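(* Let $A:=(V,m_2,\omega)$ be a strictly graded commutative Frobenius algebra and let $m$ and $m'$ be two minimal symplectic $C_{n+1}$-structures on $V$ whose underlying Frobenius algebra is $A$. Let $\phi\in\mathcal{SM}_n(\bar m;\bar m')$ be an extendable symplectic $C_n$-morphism. Then $HC^{n,|\omega|-1}_{\mathrm{Harr}}(A)$ acts freely and transitively on $\mathcal{SEM}_n(\phi:m,m')$ by $$HC^{n,|\omega|-1}_{\mathrm{Harr}}(A)\times\mathcal{SEM}_n(\phi:m,m')\to\mathcal{SEM}_n(\phi:m,m'),\qquad(\alpha,\gamma)\mapsto\gamma+\Upsilon_{\mathrm{Lie}}(\alpha).$$
   Context: Conventions. $\mathbb K$ is an evenly graded commutative ring containing $\mathbb Q$; modules are graded $\mathbb K$-modules, cohomologically graded, with the Koszul sign rule. $(\Sigma V)^i=V^{i+1}$, $(\Sigma^{-1}V)^i=V^{i-1}$; $\Sigma V^*$ means $\mathrm{Hom}_{\mathbb K}(\Sigma V,\mathbb K)$. Profinite modules are inverse limits of free modules of finite rank. For $W$ profinite, $\widehat TW=\prod_{i\ge0}W^{\hat\otimes i}$ and $\widehat LW\subset\widehat TW$ is the Lie subalgebra of convergent (possibly infinite) linear combinations of Lie monomials. Vector field = continuous derivation; diffeomorphism = invertible continuous homomorphism; $\mathrm{Der}(X)$, $\mathrm{Aut}(X)$ are the Lie algebra and group of these. Elements of $W^{\hat\otimes n}$ have order $n$; an endomorphism of $\widehat LW$ has order $n$ if it takes elements of order $i$ to elements of order $i+n-1$. $(n)$ denotes the module of continuous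 endomorphisms of $\widehat L\Sigma V^*$ of order $\ge n$. A diffeomorphism is pointed if it is of the form $\mathrm{id}+\phi_2+\phi_3+\cdots$ with $\phi_i$ an endomorphism of order $i$. Lie de Rham complex. For $g=\widehat LW$ with $\widehat{\mathcal U}(g)=\widehat TW$: $\Omega^1_{\mathrm{Lie}}(g)$ is the quotient of $\widehat{\mathcal U}(g)\hat\otimes g$ (elements written $x\otimes dy$) by $x\otimes d[y,z]=xy\otimes dz-(-1)^{|z||y|}xz\otimes dy$, with $g$ acting by left multiplication. $\Omega^\bullet_{\mathrm{Lie}}(g)=g\ltimes\widehat L(\Sigma^{-1}\Omega^1_{\mathrm{Lie}}(g))$ with the unique differential $d$ extending $y\mapsto dy=1\otimes dy$ to a differential graded Lie algebra structure. $DR^\bullet_{\mathrm{Lie}}(g)$ is the quotient of $\Omega^\bullet_{\mathrm{Lie}}(g)\hat\otimes\Omega^\bullet_{\mathrm{Lie}}(g)$ by $x\otimes y=(-1)^{|x||y|}y\otimes x$ and $x\otimes[y,z]=[x,y]\otimes z$, with $d(x\otimes y)=dx\otimes y+(-1)^{|x|}x\otimes dy$. $i$-forms $DR^i$ are the $i$-fold suspension of the part of form-degree $i$ (so the degree of $dx\otimes dy\in DR^2$ is $|x|+|y|$). The order of a form is its tensor degree in $W$ minus its form degree. For a vector field $\xi$, $L_\xi$ and $i_\xi$ are the derivations of $\Omega^\bullet_{\mathrm{Lie}}(g)$ with $L_\xi(x)=\xi(x)$, $L_\xi(dx)=(-1)^{|\xi|}d(\xi(x))$, $i_\xi(x)=0$,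 $i_\xi(dx)=\xi(x)$; they induce operators on $DR^\bullet_{\mathrm{Lie}}(g)$ by the Leibniz rule. A diffeomorphism $\phi$ induces $\phi^*$ on forms. A homogeneous 2-form $\omega$ is symplectic if $d\omega=0$ and $\Phi:\mathrm{Der}(g)\to DR^1_{\mathrm{Lie}}(g)$, $\Phi(\xi)=i_\xi(\omega)$, is bijective. $\xi$ is symplectic if $L_\xi\omega=0$; $\phi$ is a symplectomorphism if $\phi^*\omega=\omega$. Frobenius algebras and cyclic Harrison cohomology. A strictly graded commutative Frobenius algebra $A=(V,m_2,\omega)$ consists of a free graded module $V$ of finite rank, a symplectic form $\omega\in DR^2_{\mathrm{Lie}}(\widehat L\Sigma V^* )$ of order zero and a symplectic vector field $m_2$ on $\widehat L\Sigma V^*$ of order 2 and degree one with $m_2^2=0$. $CC^\bullet_{\mathrm{Harr}}(A)=\Sigma DR^0_{\mathrm{Lie}}(\widehat L\Sigma V^* )$ with differential $L_{m_2}$; a 0-form has bidegree $(i,j)$ if it has order $i$ and degree $j$ in $\Sigma DR^0_{\mathrm{Lie}}$ (i.e. degree $j+1$ as a 0-form); $HC^{ij}_{\mathrm{Harr}}(A)$ is the bigraded cohomology. $\Upsilon_{\mathrm{Lie}}(\alpha):=(-1)^{|\alpha|}\Phi^{-1}(d\alpha)$ is an isomorphism from $CC^\bullet_{\mathrm{Harr}}(A)$ (suitably shifted by $|\omega|-2$) onto the complex of symplectic vector fields (with differential $[m_2,-]$, inside $\Sigma^{-1}\mathrm{Der}(\widehat L\Sigma V^* )$). Minimal symplectic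 $C_n$-structures ($n\ge3$). With $V$ free of finite rank and $\omega$ symplectic of order zero, these are symplectic vector fields $m=m_2+\dots+m_{n-1}$ on $\widehat L\Sigma V^*$ of degree one, $m_i$ of order $i$, with $m^2=0\mod(n+1)$; the underlying Frobenius algebra is $(V,m_2,\omega)$. For a symplectic $C_{n+1}$-structure $m=m_2+\dots+m_n$, $\bar m:=m_2+\dots+m_{n-1}$. Morphisms. A minimal symplectic $C_n$-morphism from $m$ to $m'$ is a symplectomorphism $\phi$ of $\widehat L\Sigma V^*$ of degree zero with $\phi\circ m=m'\circ\phi\mod(n)$; two such, $\phi,\phi'$, are homotopic if $\phi=\phi'\circ\exp([m,\eta])\mod(n-1)$ for a symplectic vector field $\eta$ of degree $-1$. $\mathcal{SM}_n(m;m')$ (for $m,m'$ with the same underlying Frobenius algebra) is the set of pointed minimal symplectic $C_n$-morphisms modulo homotopy. For minimal symplectic $C_{n+1}$-structures $m,m'$ with the same underlying Frobenius algebra, a pointed symplectic $C_n$-morphism $\phi$ from $\bar m$ to $\bar m'$ is extendable if there is a symplectic vector field $\gamma$ of order $n-1$ and degree zero such that $\exp(\gamma)\circ\phi$ is a symplectic $C_{n+1}$-morphism from $m$ to $m'$; $\gamma$ is an extension of $\phi$. Extensions $\gamma,\gamma'$ are equivalent if $\exp(\gamma)\circ\phi=\exp(\gamma')\circ\phi\circ\exp([m,\eta])\mod(n)$ for some symplectic vector field $\eta$ of order $n-2$ and degree $-1$. $\mathcal{SEM}_n(\phi:m,m')$ is the set of extensions of $\phi$ modulo equivalence. *)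

(* Defs.v *)
From HB Require Import structures.
From mathcomp Require Import all_boot all_order all_algebra.
From mathcomp Require Import boolp classical_sets functions.
Set Implicit Arguments.
Unset Strict Implicit.
Unset Printing Implicit Defensive.
Import GRing.Theory.
Local Open Scope classical_set_scope.
Local Open Scope ring_scope.

(* An internal grading of K, concentrated in even degrees.  As K is a
   (non-trivial) rat-algebra, it contains the rational numbers; as all degrees
   are even, graded commutative means commutative. *)
Record even_grading (K : comAlgType rat) := EvenGrading {
  hcomp :> int -> set K;
  hcomp0 : forall i, hcomp i 0;
  hcompB : forall i x y, hcomp i x -> hcomp i y -> hcomp i (x - y);
  hcomp1 : hcomp 0 1;
  hcompM : forall i j x y, hcomp i x -> hcomp j y -> hcomp (i + j) (x * y);
  hcomp_sum : forall x, exists s : seq int, exists c : int -> K,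
    [/\ uniq s, forall i, hcomp i (c i) & x = \sum_(i <- s) c i];
  hcomp_direct : forall (s : seq int) (c : int -> K), uniq s ->
    (forall i, hcomp i (c i)) -> \sum_(i <- s) c i = 0 ->
    forall i, i \in s -> c i = 0;
  hcomp_odd : forall i x, odd `|i|%N -> hcomp i x -> x = 0 }.

(* A free graded module of finite rank, given by a homogeneous basis. *)
Record free_module := FreeModule { bas : finType; bdeg : bas -> int }.

Definition ksgn (i : int) : rat := (-1) ^+ `|i|%N.

(* The set of equivalence classes of elements of D under E. *)
Definition quotient (T : Type) (D : set T) (E : T -> T -> Prop) : Type :=
  {C : set T | exists2 x, D x & C = [set y | D y /\ E x y]}.

Definition cls (T : Type) (D : set T) (E : T -> T -> Prop) (x : T) (Dx : D x) :
    quotient D E :=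
  exist _ [set y | D y /\ E x y] (ex_intro2 _ _ x Dx erefl).

Section Theory.
Variables (K : comAlgType rat) (gr : even_grading K).

(* A profinite module with topological basis B is the product B -> K of copies
   of the discrete module K; all the profinite modules below are closed
   submodules of such products, or quotients of these by closed submodules.
   Since K is even, the parity of a homogeneous element is that of the basis
   elements in its support, so that Koszul signs are computed on the basis. *)

Definition homogeneous (B : Type) (deg : B -> int) (d : int) (f : B -> K) :=
  forall b, gr (d - deg b) (f b).

(* Closure, in the product topology, of the span of S. *)
Definition closed_span (B : eqType) (S : set (B -> K)) : set (B -> K) :=
  [set f | forall F : seq B, exists m, exists c : 'I_m -> K,
     exists s : 'I_m -> B -> K, (forall i, S (s i)) /\
     {in F, forall b, f b = \sum_(i < m) c i * s i b}].

Definition tens (B C : Type) (f : B -> K) (g : C -> K) : B * C -> K :=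
  fun bc => f bc.1 * g bc.2.

Definition wdeg (X : Type) (deg : X -> int) (w : seq X) : int :=
  \sum_(a <- w) deg a.

Definition tone (X : Type) : seq X -> K := fun w => (nilp w)%:R.

Definition letter (X : Type) (x : X -> K) : seq X -> K :=
  fun w => if w is [:: a] then x a else 0.

Definition tmul (X : Type) (f g : seq X -> K) : seq X -> K :=
  fun w => \sum_(i < (size w).+1) f (take i w) * g (drop i w).

(* The graded commutator: u and v have bracket uv - (-1)^(|u||v|) vu. *)
Definition tbrk (X : Type) (deg : X -> int) (f g : seq X -> K) : seq X -> K :=
  fun w => \sum_(i < (size w).+1)
    (f (take i w) * g (drop i w)
     - ksgn (wdeg deg (take i w) * wdeg deg (drop i w)) *:
         (g (take i w) * f (drop i w))).

Definition tensor_alg (X : eqType) (M : set (X -> K)) : set (seq X -> K) :=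
  closed_span [set f | exists m, exists s : 'I_m -> X -> K,
    (forall i, M (s i)) /\ f = \big[@tmul X/@tone X]_(i < m) letter (s i)].

Inductive lie_monomial (X : Type) (deg : X -> int) (M : set (X -> K)) :
    (seq X -> K) -> Prop :=
| LieLetter x : M x -> lie_monomial deg M (letter x)
| LieBracket f g : lie_monomial deg M f -> lie_monomial deg M g ->
    lie_monomial deg M (tbrk deg f g).

Definition free_lie (X : eqType) (deg : X -> int) (M : set (X -> K)) :
    set (seq X -> K) :=
  closed_span [set f | lie_monomial deg M f].

(* A profinite graded Lie algebra, presented as the quotient of lcar by lrel. *)
Record lie_alg := LieAlg {
  ix : eqType;
  ideg : ix -> int;
  lcar : set (ix -> K);
  lrel : set (ix -> K);
  lbrk : (ix -> K) -> (ix -> K) -> ix -> K }.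

Definition endo (L : lie_alg) : Type := (ix L -> K) -> ix L -> K.

Definition cont_endo (L : lie_alg) (D : endo L) :=
  [/\ forall x, lcar x -> lcar (D x),
      forall x, lrel x -> lrel (D x),
      forall (c : K) x y, lcar x -> lcar y ->
        D ((c \*o x) + y) = (c \*o D x) + D y
    & forall F : seq (ix L), exists G : seq (ix L), forall x, lcar x ->
        {in G, forall b, x b = 0} -> {in F, forall b, D x b = 0}].

Definition of_degree (L : lie_alg) (e : int) (D : endo L) :=
  forall d x, lcar x -> homogeneous (@ideg L) d x ->
    homogeneous (@ideg L) (d + e) (D x).

Definition derivation (L : lie_alg) (e : int) (D : endo L) :=
  [/\ cont_endo D, of_degree e D &
      forall a x y, lcar x -> lcar y -> homogeneous (@ideg L) a x ->
        lrel (D (lbrk x y) - (lbrk (D x) y + ksgn (e * a) *: lbrk x (D y)))].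

(* Homomorphisms of degree zero. *)
Definition morphism (L : lie_alg) (F : endo L) :=
  [/\ cont_endo F, of_degree 0 F &
      forall x y, lcar x -> lcar y -> lrel (F (lbrk x y) - lbrk (F x) (F y))].

Definition eq_car (L : lie_alg) (D D' : endo L) := forall x, lcar x -> D x = D' x.

Definition automorphism (L : lie_alg) (F : endo L) :=
  morphism F /\ exists2 G : endo L, morphism G &
    eq_car (F \o G) id /\ eq_car (G \o F) id.

Section DeRham.
Variable V : free_module.

(* W = Hom (Sigma V, K), with the basis dual to that of Sigma V: the latter
   sits in degrees bdeg - 1. *)
Definition degW (i : bas V) : int := 1 - bdeg i.

Definition word : eqType := seq (bas V).
Definition degT : word -> int := wdeg degW.

(* The completed free Lie algebra on W, in the completed tensor algebra. *)
Definition LW : lie_alg :=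
  @LieAlg word degT (free_lie degW setT) [set 0] (tbrk degW).

(* The pair (u, v) stands for u (x) dv; its degree is taken in the
   desuspension of the module of 1-forms. *)
Definition pair_ix : eqType := (seq (bas V) * seq (bas V))%type.
Definition degA (a : pair_ix) : int := degT a.1 + degT a.2 + 1.

Definition Ug_g : set (pair_ix -> K) :=
  closed_span [set f | exists x, exists2 y, lcar (l := LW) y & f = tens x y].

Definition Omega1_rel : set (pair_ix -> K) :=
  closed_span [set f | exists x y z p q,
    [/\ lcar (l := LW) y, lcar (l := LW) z, homogeneous degT p y,
        homogeneous degT q z &
        f = tens x (tbrk degW y z) - tens (tmul x y) z
            + ksgn (q * p) *: tens (tmul x z) y]].

Definition LOmega1 : set (seq pair_ix -> K) := free_lie degA Ug_g.

(* The kernel of the map induced on tensor algebras by the projection of Ug_g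
   onto the module of 1-forms. *)
Definition LOmega1_rel : set (seq pair_ix -> K) :=
  closed_span [set f | exists a r b,
    [/\ tensor_alg Ug_g a, Omega1_rel r, tensor_alg Ug_g b &
        f = tmul (tmul a (letter r)) b]].

(* The action by derivations of x in LW on a.  A word p of x sends the letter
   (u, v) of a to (-1)^|p| (pu, v), the sign coming from the desuspension, and
   p moves past the letters that precede (u, v).  With tw, there is a further
   sign (-1)^(|x||a|), as needed for the bracket of a with x. *)
Definition act (tw : bool) (x : word -> K) (a : seq pair_ix -> K) :
    seq pair_ix -> K :=
  fun s => \sum_(k < size s) let l := nth ([::], [::]) s k in
    \sum_(i < (size l.1).+1)
      let p := take i l.1 in
      let t := take k s ++ (drop i l.1, l.2) :: drop k.+1 s in
      ksgn (degT p * (1 + wdeg degA (take k s))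
            + (if tw then degT p * wdeg degA t else 0))
      *: (x p * a t).

Definition form_ix : eqType := (seq (bas V) + seq pair_ix)%type.

Definition opair (x : word -> K) (a : seq pair_ix -> K) : form_ix -> K :=
  fun j => match j with inl u => x u | inr s => a s end.

Definition odeg (j : form_ix) : int :=
  match j with inl u => degT u | inr s => wdeg degA s end.

Definition ocar : set (form_ix -> K) :=
  [set f : form_ix -> K | lcar (l := LW) (f \o inl) /\ LOmega1 (f \o inr)].

Definition orel : set (form_ix -> K) :=
  [set f : form_ix -> K | [/\ ocar f, f \o inl = 0 & LOmega1_rel (f \o inr)]].

Definition obrk (f h : form_ix -> K) : form_ix -> K :=
  opair (tbrk degW (f \o inl) (h \o inl))
    (act false (f \o inl) (h \o inr) - act true (h \o inl) (f \o inr)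
     + tbrk degA (f \o inr) (h \o inr)).

(* The semidirect product of LW and the free Lie algebra LOmega1 / LOmega1_rel. *)
Definition Omega : lie_alg := @LieAlg form_ix odeg ocar orel obrk.

Definition of_g (x : word -> K) : form_ix -> K := opair x 0.
Definition d_of (y : word -> K) : form_ix -> K :=
  opair 0 (letter (tens (@tone (bas V)) y)).

(* In the following definitions xget picks the unique (modulo orel) operator
   with the given properties. *)

Definition derham : endo Omega :=
  xget 0 [set D : endo Omega | [/\ derivation 1 D,
    forall y, lcar (l := LW) y -> orel (D (of_g y) - d_of y) &
    forall f, ocar f -> orel (D (D f))]].

Definition lie_op (e : int) (xi : endo LW) : endo Omega :=
  xget 0 [set D : endo Omega | derivation e D /\
    forall x, lcar (l := LW) x -> orel (D (of_g x) - of_g (xi x)) /\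
      orel (D (d_of x) - ksgn e *: derham (of_g (xi x)))].

Definition contr_op (e : int) (xi : endo LW) : endo Omega :=
  xget 0 [set D : endo Omega | derivation (e - 1) D /\
    forall x, lcar (l := LW) x -> orel (D (of_g x)) /\
      orel (D (d_of x) - of_g (xi x))].

Definition pull_op (phi : endo LW) : endo Omega :=
  xget 0 [set F : endo Omega | morphism F /\
    forall x, lcar (l := LW) x -> orel (F (of_g x) - of_g (phi x)) /\
      orel (F (d_of x) - derham (of_g (phi x)))].

Definition fdeg (j : form_ix) : nat :=
  match j with inl _ => 0 | inr s => size s end.
Definition tdeg (j : form_ix) : nat :=
  match j with
  | inl u => size u
  | inr s => \sum_(a <- s) (size a.1 + size a.2)
  end%N.

Definition form2_ix : eqType := (form_ix * form_ix)%type.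

Definition form (p : nat) : set (form2_ix -> K) :=
  [set f | closed_span [set h | exists x y, [/\ ocar x, ocar y & h = tens x y]] f
    /\ forall j, f j <> 0 -> (fdeg j.1 + fdeg j.2)%N = p].

Definition form_rel : set (form2_ix -> K) :=
  closed_span ([set f | exists r x, [/\ orel r, ocar x & f = tens r x]]
    `|` [set f | exists r x, [/\ orel r, ocar x & f = tens x r]]
    `|` [set f | exists x y p q, [/\ ocar x, ocar y, homogeneous odeg p x,
           homogeneous odeg q y & f = tens x y - ksgn (p * q) *: tens y x]]
    `|` [set f | exists x y z, [/\ ocar x, ocar y, ocar z &
           f = tens x (obrk y z) - tens (obrk x y) z]]).

Definition form_eq (f h : form2_ix -> K) := form_rel (f - h).

(* Degrees of p-forms are shifted down by p. *)
Definition form_degree (p : nat) (d : int) (f : form2_ix -> K) :=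
  homogeneous (fun j : form2_ix => odeg j.1 + odeg j.2) (d + p%:Z) f.

Definition form_order (p k : nat) (f : form2_ix -> K) :=
  forall j, f j <> 0 -> (tdeg j.1 + tdeg j.2 = k + p)%N.

(* The operator D (x) 1 + 1 (x) D, for D of degree e. *)
Definition leibniz (e : int) (D : endo Omega) (f : form2_ix -> K) :
    form2_ix -> K :=
  fun j => D (fun k => f (k, j.2)) j.1
           + ksgn (e * odeg j.1) *: D (fun k => f (j.1, k)) j.2.

Definition dDR : (form2_ix -> K) -> form2_ix -> K := leibniz 1 derham.
Definition lieDR (e : int) (xi : endo LW) := leibniz e (lie_op e xi).
Definition contrDR (e : int) (xi : endo LW) := leibniz (e - 1) (contr_op e xi).

(* F (x) F, where F is induced by phi. *)
Definition pullDR (phi : endo LW) (f : form2_ix -> K) : form2_ix -> K :=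
  fun j => pull_op phi (fun k => pull_op phi (fun l => f (k, l)) j.2) j.1.

Definition vector_field (e : int) (xi : endo LW) := derivation e xi.

Definition has_order (n : nat) (E : endo LW) :=
  forall i x, lcar (l := LW) x -> (forall u, x u <> 0 -> size u = i) ->
    forall u, E x u <> 0 -> (size u).+1 = (i + n)%N.

Definition order_ge (n : nat) (E : endo LW) :=
  forall i x, lcar (l := LW) x -> (forall u, x u <> 0 -> size u = i) ->
    forall u, E x u <> 0 -> (i + n <= (size u).+1)%N.

Definition eq_mod (n : nat) (E E' : endo LW) := order_ge n (E - E').

Definition Phi (om : form2_ix -> K) (e : int) (xi : endo LW) : form2_ix -> K :=
  contrDR e xi om.

(* w is the degree of om. *)
Definition symplectic_form (w : int) (om : form2_ix -> K) :=
  [/\ form 2 om, form_degree 2 w om, form_rel (dDR om),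
      forall e xi xi', vector_field e xi -> vector_field e xi' ->
        form_eq (Phi om e xi) (Phi om e xi') -> eq_car xi xi' &
      forall e th, form 1 th -> form_degree 1 (w + e) th ->
        exists2 xi, vector_field e xi & form_eq (Phi om e xi) th].

Definition symplectic_field (om : form2_ix -> K) (e : int) (xi : endo LW) :=
  vector_field e xi /\ form_rel (lieDR e xi om).

(* Symplectomorphisms of degree zero. *)
Definition symplectomorphism (om : form2_ix -> K) (phi : endo LW) :=
  automorphism phi /\ form_eq (pullDR phi om) om.

Definition pointed (phi : endo LW) := eq_mod 2 phi id.

(* The commutator of vector fields of degrees e and e'. *)
Definition comm (e e' : int) (xi eta : endo LW) : endo LW :=
  (xi \o eta) - ksgn (e * e') *: (eta \o xi).

(* The exponential of a vector field of order at least 2: the k-th power of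
   xi maps LW into words of length at least k + 1, so that the terms with
   k > size u vanish on u. *)
Definition expv (xi : endo LW) : endo LW :=
  fun x u => \sum_(k < (size u).+1) (k`!%:R^-1 : rat) *: iter k xi x u.

Definition frobenius (w : int) (m2 : endo LW) (om : form2_ix -> K) :=
  [/\ symplectic_form w om, form_order 2 0 om, symplectic_field om 1 m2,
      has_order 2 m2 & eq_car (m2 \o m2) 0].

Definition cochain (i : nat) (j : int) (al : form2_ix -> K) :=
  [/\ form 0 al, form_order 0 i al & form_degree 0 (j + 1) al].

Definition cocycle (m2 : endo LW) (i : nat) (j : int) : set (form2_ix -> K) :=
  [set al | cochain i j al /\ form_rel (lieDR 1 m2 al)].

Definition cohomologous (m2 : endo LW) (i : nat) (j : int)
    (al al' : form2_ix -> K) :=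
  exists2 be, cochain i.-1 (j - 1) be & form_eq (al - al') (lieDR 1 m2 be).

Definition HC (m2 : endo LW) (i : nat) (j : int) : Type :=
  quotient (cocycle m2 i j) (cohomologous m2 i j).

(* Upsilon on cochains of degree j in the suspension of DR^0. *)
Definition Upsilon (w : int) (om : form2_ix -> K) (j : int)
    (al : form2_ix -> K) : endo LW :=
  ksgn j *: xget 0 [set xi : endo LW | vector_field (j + 1 - w) xi /\
    form_eq (Phi om (j + 1 - w) xi) (dDR al)].

(* The sum of the components m_2, ..., m_(n-1) of a C_n-structure. *)
Definition mc_sum (n : nat) (ms : nat -> endo LW) : endo LW :=
  \sum_(2 <= i < n) ms i.

Definition C_structure (om : form2_ix -> K) (n : nat) (ms : nat -> endo LW) :=
  [/\ forall i, (2 <= i < n)%N -> vector_field 1 (ms i) /\ has_order i (ms i),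
      symplectic_field om 1 (mc_sum n ms) &
      order_ge n.+1 (mc_sum n ms \o mc_sum n ms)].

Definition C_morphism (om : form2_ix -> K) (n : nat) (m m' phi : endo LW) :=
  symplectomorphism om phi /\ eq_mod n (phi \o m) (m' \o phi).

Definition homotopic (om : form2_ix -> K) (n : nat) (m phi phi' : endo LW) :=
  exists2 eta, symplectic_field om (-1) eta &
    eq_mod n.-1 phi (phi' \o expv (comm 1 (-1) m eta)).

Definition SM (om : form2_ix -> K) (n : nat) (m m' : endo LW) : Type :=
  quotient [set phi | C_morphism om n m m' phi /\ pointed phi]
    (homotopic om n m).

(* For C_(n+1)-structures m, m' and a C_n-morphism phi between their
   truncations. *)
Definition extension (om : form2_ix -> K) (n : nat) (m m' phi : endo LW) :
    set (endo LW) :=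
  [set ga | [/\ symplectic_field om 0 ga, has_order n.-1 ga &
    C_morphism om n.+1 m m' (expv ga \o phi)]].

Definition extendable (om : form2_ix -> K) (n : nat) (m m' phi : endo LW) :=
  exists ga, extension om n m m' phi ga.

Definition ext_equiv (om : form2_ix -> K) (n : nat) (m phi ga ga' : endo LW) :=
  exists eta, [/\ symplectic_field om (-1) eta, has_order n.-2 eta &
    eq_mod n (expv ga \o phi) (expv ga' \o phi \o expv (comm 1 (-1) m eta))].

Definition SEM (om : form2_ix -> K) (n : nat) (m m' phi : endo LW) : Type :=
  quotient (extension om n m m' phi) (ext_equiv om n m phi).

End DeRham.
End Theory.

Arguments LW {K} V.
Arguments SM {K} gr {V} om n m m'.
Arguments SEM {K} gr {V} om n m m' phi.
Arguments HC {K} gr {V} m2 i j.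
Arguments Upsilon {K} gr {V} w om j al.
Arguments frobenius {K} gr {V} w m2 om.
Arguments C_structure {K} gr {V} om n ms.
Arguments extendable {K} gr {V} om n m m' phi.
Arguments extension {K} gr {V} om n m m' phi.
Arguments cocycle {K} gr {V} m2 i j.
Arguments cohomologous {K} gr {V} m2 i j al al'.
Arguments ext_equiv {K} gr {V} om n m phi ga ga'.
Arguments cls {T D E x} Dx.

(* Submission.v *)
Require Import Defs.
From HB Require Import structures.
From mathcomp Require Import all_boot all_order all_algebra.
From mathcomp Require Import boolp classical_sets functions.
From mathcomp Require Import ring zify.
Set Implicit Arguments.
Unset Strict Implicit.
Unset Printing Implicit Defensive.
Import GRing.Theory.
Local Open Scope classical_set_scope.
Local Open Scope ring_scope.

(* Write n = p + 3, so that an extension ga has order p + 2.  For a symplectic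
   field xi of order p + 2 and degree zero, exp(ga + xi) = exp(ga) + xi modulo
   terms of order n; since phi = id modulo order 2 and both structures are m2
   modulo order 3, replacing ga by ga + xi changes the obstruction to being a
   C_(n+1)-morphism by -[m2, xi] modulo order n + 1, a term homogeneous of order
   n.  Hence the extensions form a torsor under the symplectic fields of order
   p + 2 that commute with m2.  In the same way two extensions are equivalent
   iff they differ by [m2, eta] for a symplectic field eta of order p + 1.

   Non-degeneracy of om, Cartan's formula and the Poincare lemma (contraction
   with the Euler field, which multiplies by the order) identify, through
   Upsilon, the fields commuting with m2 with the cocycles and the brackets
   [m2, eta] with the coboundaries.  That exp of a symplectic field is a
   symplectomorphism follows by exponentiating the Lie derivative on forms.

   The existence of the de Rham differential is the laborious point.  A 1-form
   has a unique normal form, a combination of u (x) db with b a letter, so that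
   the tensor algebra on 1-forms modulo its relations embeds in the tensor
   algebra on the letters (u, b), where d can be written down.  *)

(** * Koszul signs as scalars of the ground ring *)

Section Signs.
Variable K : comAlgType rat.
Implicit Types (i j : int) (x : K).

(** The operators of the calculus are picked by [xget] among maps that are determined only modulo
    [orel], with value 0 if there is none. So each of them is handled through existence, its
    specification and uniqueness modulo relations, and its actual values need not sit in the
    expected form degree or tensor degree. The cure is [component]: the part of an operator of a
    fixed weight satisfies the corresponding specification, and it yields representatives with exact
    support, without which orders of forms and fields could not be tracked.

    Elements of a product are infinite sums of homogeneous ones, so a Koszul sign depending on the
    degree of an argument is expressed by the sign twist [tau]. Rules with signs then hold for all
    elements and pass to closures, and it is enough to verify them on basis words or Lie monomials.

    Operators on tensor algebras are given by their coefficients, that is, as transposes: the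
    coefficient of D f at a word is a finite combination of coefficients of f. Recursions therefore
    strip letters from the output word instead of multiplying inputs. *)

Definition sg i : K := if odd `|i|%N then -1 else 1.

Lemma oddzD i j : odd `|(i + j)%R|%N = odd `|i|%N (+) odd `|j|%N.
Proof. lia. Qed.

Lemma oddzM i j : odd `|(i * j)%R|%N = odd `|i|%N && odd `|j|%N.
Proof. by rewrite abszM oddM. Qed.

Lemma oddzN i : odd `|(- i)%R|%N = odd `|i|%N.
Proof. by rewrite abszN. Qed.

Definition oddE := (oddzD, oddzM, oddzN).

Lemma ksgnE i x : ksgn i *: x = sg i * x.
Proof.
rewrite /ksgn /sg -signr_odd; case: (odd _) => /=.
  by rewrite expr1 scaleN1r mulN1r.
by rewrite expr0 scale1r mul1r.
Qed.

Lemma sgD i j : sg (i + j) = sg i * sg j.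
Proof. by rewrite /sg oddE; do 2!case: (odd _) => /=; ring. Qed.

Lemma sg0 : sg 0 = 1. Proof. by []. Qed.

Lemma sgsq i : sg i * sg i = 1.
Proof. by rewrite /sg; case: (odd _) => /=; ring. Qed.

End Signs.
Arguments sg {K} i.

(** * Closed submodules and continuous operators *)
Section Pointwise.
Variables (K : comAlgType rat) (B : Type).
Implicit Types (f g : B -> K) (b : B).

Lemma faddE f g b : (f + g) b = f b + g b. Proof. by []. Qed.
Lemma foppE f b : (- f) b = - f b. Proof. by []. Qed.
Lemma fmulE (c : K) f b : (c \*o f) b = c * f b. Proof. by []. Qed.
Lemma fscaleE (q : rat) f b : (q *: f) b = q *: f b. Proof. by []. Qed.
Lemma fzeroE b : (0 : B -> K) b = 0. Proof. by []. Qed.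
Lemma fsumE (I : Type) (r : seq I) (P : pred I) (F : I -> B -> K) b :
  (\sum_(i <- r | P i) F i) b = \sum_(i <- r | P i) F i b.
Proof. by rewrite fct_sumE. Qed.
Definition fE := (faddE, foppE, fmulE, fscaleE, fzeroE, fsumE).

Lemma fsg i f : ksgn i *: f = (sg i : K) \*o f.
Proof. by apply: funext => b; rewrite !fE ksgnE. Qed.

Lemma fmulA (c d : K) f : c \*o (d \*o f) = (c * d) \*o f.
Proof. by apply: funext => b; rewrite !fE mulrA. Qed.
Lemma fmul1 f : 1 \*o f = f.
Proof. by apply: funext => b; rewrite !fE mul1r. Qed.
Lemma fmulN1 f : (-1) \*o f = - f.
Proof. by apply: funext => b; rewrite !fE mulN1r. Qed.
Lemma fscale_alg (q : rat) f : q *: f = (q%:A : K) \*o f.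
Proof. by apply: funext => b; rewrite !fE mulr_algl. Qed.
End Pointwise.

Section Closed.
Variable K : comAlgType rat.
Implicit Types B C : eqType.

(** One inclusion encodes both requirements on a closed submodule: stability under finite
    K-combinations and under limits in the product topology. *)
Definition csubmod B (T : set (B -> K)) := closed_span T `<=` T.

Definition agree B (F : seq B) (f g : B -> K) := {in F, forall b, f b = g b}.

Lemma closed_span_sub B (S : set (B -> K)) : S `<=` closed_span S.
Proof.
move=> f Sf F; exists 1, (fun=> 1), (fun=> f); split => // b _.
by rewrite big_ord1 mul1r.
Qed.

Lemma closed_span_mono B (S T : set (B -> K)) :
  S `<=` T -> closed_span S `<=` closed_span T.
Proof.
move=> ST f Sf F; have [m [c [s [Ss fE]]]] := Sf F.
by exists m, c, s; split => // i; apply: ST.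
Qed.

Lemma closed_lim B (T : set (B -> K)) f : csubmod T ->
  (forall F, exists2 g, T g & agree F f g) -> T f.
Proof.
move=> cT lim; apply: cT => F; have [g Tg fg] := lim F.
exists 1, (fun=> 1), (fun=> g); split => // b bF.
by rewrite big_ord1 mul1r fg.
Qed.

Lemma closed_comb B (T : set (B -> K)) m (c : 'I_m -> K) s : csubmod T ->
  (forall i, T (s i)) -> T (\sum_(i < m) c i \*o s i).
Proof.
move=> cT Ts; apply: cT => F; exists m, c, s; split => // b _.
by rewrite fE; apply: eq_bigr => i _.
Qed.

Section Submodule.
Variables (B : eqType) (T : set (B -> K)) (cT : csubmod T).

Lemma closed0 : T 0.
Proof.
have := @closed_comb B T 0 (fun=> 0) (fun=> 0) cT.
by rewrite big_ord0; apply; case.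
Qed.

Lemma closedZD c f g : T f -> T g -> T ((c \*o f) + g).
Proof.
move=> Tf Tg.
have := @closed_comb B T 2 (fun i => if i == 0 then c else 1)
  (fun i => if i == 0 then f else g) cT.
rewrite big_ord_recl big_ord1 /= fmul1; apply.
by move=> i; case: ifP.
Qed.

Lemma closedD f g : T f -> T g -> T (f + g).
Proof. by move=> Tf Tg; have := closedZD 1 Tf Tg; rewrite fmul1. Qed.

Lemma closedZ c f : T f -> T (c \*o f).
Proof. by move=> Tf; have := closedZD c Tf closed0; rewrite addr0. Qed.

Lemma closedN f : T f -> T (- f).
Proof. by move=> Tf; rewrite -fmulN1; apply: closedZ. Qed.

Lemma closedB f g : T f -> T g -> T (f - g).
Proof. by move=> Tf Tg; apply: closedD => //; apply: closedN. Qed.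

Lemma closedQ (q : rat) f : T f -> T (q *: f).
Proof. by move=> Tf; rewrite fscale_alg; apply: closedZ. Qed.

Lemma closed_sum I (r : seq I) (P : pred I) (F : I -> B -> K) :
  (forall i, P i -> T (F i)) -> T (\sum_(i <- r | P i) F i).
Proof. by move=> TF; apply: (big_ind T) => //; [exact: closed0 | exact: closedD]. Qed.

End Submodule.

(** On a fixed finite window, each of the finitely many vectors that approximate f is itself a
    finite combination of elements of S; the resulting double sum is reindexed by a type of
    dependent pairs. *)
Lemma closed_closed_span B (S : set (B -> K)) : csubmod (closed_span S).
Proof.
move=> f Sf F; have [m [c [s [Ss fE]]]] := Sf F.
have {Ss} /choice[t tP] : forall i, exists t : {M & (('I_M -> K) * ('I_M -> B -> K))%type},
    (forall j, S ((tagged t).2 j)) /\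
    {in F, forall b, s i b = \sum_(j < tag t) (tagged t).1 j * (tagged t).2 j b}.
  by move=> i; have [M [d [u [Su uE]]]] := Ss i F; exists (existT _ M (d, u)).
pose J : finType := {i : 'I_m & 'I_(tag (t i))}.
exists #|J|, (fun k => let x := enum_val k : J in c (tag x) * (tagged (t (tag x))).1 (tagged x)),
  (fun k => let x := enum_val k : J in (tagged (t (tag x))).2 (tagged x)); split.
  by move=> k; case: (tP (tag (enum_val k : J))).
move=> b bF; rewrite fE //.
rewrite -(big_enum_val (A := J) (fun x : J => c (tag x) * (tagged (t (tag x))).1 (tagged x)
  * (tagged (t (tag x))).2 (tagged x) b)) /=.
under eq_bigr => i _ do rewrite (tP i).2 // mulr_sumr.
rewrite sig_big_dep /=.
by apply: eq_big => [x|x _]; rewrite ?inE //= mulrA.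
Qed.

Lemma closed_spanT B (S T : set (B -> K)) : csubmod T -> S `<=` T -> closed_span S `<=` T.
Proof. by move=> cT ST; apply: subset_trans cT; apply: closed_span_mono. Qed.

Lemma closedT B : csubmod (@setT (B -> K)). Proof. by []. Qed.

Lemma closed_eq0 B : csubmod ([set 0] : set (B -> K)).
Proof.
move=> f Sf; apply: funext => b; have [m [c [s [Ss fE]]]] := Sf [:: b].
rewrite fE ?inE // big1 // => i _.
by have := Ss i; rewrite /= => ->; rewrite mulr0.
Qed.

Lemma closedI B (S T : set (B -> K)) : csubmod S -> csubmod T -> csubmod (S `&` T).
Proof.
move=> cS cT f STf; split; [apply: cS | apply: cT];
  by apply: closed_span_mono STf => ? [].
Qed.

(** Linearity and continuity are asked on S only: operators chosen by [xget] are controlled on the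
    carrier of a Lie algebra and nowhere else. *)
Definition clin B C (S : set (B -> K)) (A : (B -> K) -> C -> K) :=
  (forall (c : K) x y, S x -> S y -> A ((c \*o x) + y) = (c \*o A x) + A y) /\
  (forall F : seq C, exists G : seq B, forall x, S x ->
     {in G, forall b, x b = 0} -> {in F, forall b, A x b = 0}).

Section Clin.
Variables (B C : eqType) (S : set (B -> K)) (cS : csubmod S).
Variables (A : (B -> K) -> C -> K) (lA : clin S A).

Lemma clin0 : A 0 = 0.
Proof.
have S0 := closed0 cS; have := lA.1 (-1) _ _ S0 S0.
by rewrite !fmulN1 oppr0 addr0 addNr.
Qed.

Lemma clinD x y : S x -> S y -> A (x + y) = A x + A y.
Proof. by move=> Sx Sy; have := lA.1 1 _ _ Sx Sy; rewrite !fmul1. Qed.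

Lemma clinZ c x : S x -> A (c \*o x) = c \*o A x.
Proof.
by move=> Sx; have := lA.1 c _ _ Sx (closed0 cS); rewrite clin0 !addr0.
Qed.

Lemma clinN x : S x -> A (- x) = - A x.
Proof. by move=> Sx; rewrite -!fmulN1 clinZ. Qed.

Lemma clinB x y : S x -> S y -> A (x - y) = A x - A y.
Proof. by move=> Sx Sy; rewrite clinD ?clinN //; apply: closedN. Qed.

Lemma clinQ (q : rat) x : S x -> A (q *: x) = q *: A x.
Proof. by move=> Sx; rewrite !fscale_alg clinZ. Qed.

Lemma clin_sum I (r : seq I) (P : pred I) (F : I -> B -> K) :
  (forall i, P i -> S (F i)) ->
  A (\sum_(i <- r | P i) F i) = \sum_(i <- r | P i) A (F i).
Proof.
move=> SF; elim: r => [|i r IH]; first by rewrite !big_nil clin0.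
rewrite !big_cons; case: ifP => // Pi; rewrite clinD ?IH //; first exact: SF.
by apply: closed_sum.
Qed.

Lemma clin_cont (F : seq C) : exists G : seq B, forall x y, S x -> S y ->
  agree G x y -> agree F (A x) (A y).
Proof.
have [G GP] := lA.2 F; exists G => x y Sx Sy xy b bF.
apply/eqP; rewrite -subr_eq0; apply/eqP.
have := GP (x - y) (closedB cS Sx Sy) _ b bF; rewrite clinB //; apply.
by move=> g gG; rewrite !fE xy ?subrr.
Qed.

Lemma closed_preim (T : set (C -> K)) : csubmod T ->
  csubmod [set x | S x /\ T (A x)].
Proof.
move=> cT f cf.
have Sf : S f by apply: cS; apply: closed_span_mono cf => ? [].
split => //; apply: closed_lim => // F.
have [G GP] := clin_cont F; have [m [c [s [ss fE]]]] := cf G.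
have Ss i : S (s i) by case: (ss i).
have Sg : S (\sum_(i < m) c i \*o s i) by apply: closed_comb.
exists (A (\sum_(i < m) c i \*o s i)).
  rewrite clin_sum => [|i _]; last exact: closedZ.
  apply: closed_sum => // i _; rewrite clinZ //; apply: closedZ => //.
  by case: (ss i).
by apply: GP => // b bG; rewrite fE // fsumE.
Qed.

(** The induction principle behind most density arguments below: the preimage of a closed submodule
    under a continuous linear map is closed, so membership need only be tested on topological
    generators. *)
Lemma clin_span (G : set (B -> K)) (T : set (C -> K)) : csubmod T -> G `<=` S ->
  (forall g, G g -> T (A g)) -> forall f, closed_span G f -> T (A f).
Proof.
move=> cT GS GT f Gf.
by case: (closed_spanT (closed_preim cT) (S := G) _ Gf) => // g Gg; split; auto.
Qed.
End Clin.

Lemma clin_comp B C (D : eqType) (S : set (B -> K)) (T : set (C -> K)) (A : (B -> K) -> C -> K) (A' : (C -> K) -> D -> K)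
    : (forall x, S x -> T (A x)) -> clin S A -> clin T A' -> clin S (A' \o A).
Proof.
move=> ST [lA kA] [lA' kA']; split => [c x y Sx Sy /=|F].
  by rewrite lA // lA' //; apply: ST.
have [G GP] := kA' F; have [H HP] := kA G; exists H => x Sx x0.
by apply: GP; [exact: ST | exact: HP].
Qed.

Lemma clinZD_op B C (S : set (B -> K)) (A A' : (B -> K) -> C -> K) c :
  clin S A -> clin S A' -> clin S (fun x => (c \*o A x) + A' x).
Proof.
move=> [lA kA] [lA' kA']; split => [d x y Sx Sy|F].
  by rewrite lA // lA' //; apply: funext => b; rewrite !fE; ring.
have [G GP] := kA F; have [H HP] := kA' F; exists (G ++ H) => x Sx x0 b bF.
rewrite !fE GP ?HP ?mulr0 ?addr0 // => g gG; apply: x0; rewrite mem_cat gG ?orbT //.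
Qed.

Lemma clin_ext B C (S : set (B -> K)) (A A' : (B -> K) -> C -> K) :
  A =1 A' -> clin S A' -> clin S A.
Proof. by move=> /funext ->. Qed.

Lemma clin_zero B C (S : set (B -> K)) : clin S (fun=> 0 : C -> K).
Proof.
split => [c x y _ _|F]; last by exists [::].
by apply: funext => b; rewrite !fE mulr0 addr0.
Qed.

Lemma clin_id B (S : set (B -> K)) : clin S id.
Proof. by split => // F; exists F. Qed.

Lemma clinD_op B C (S : set (B -> K)) (A A' : (B -> K) -> C -> K) :
  clin S A -> clin S A' -> clin S (fun x => A x + A' x).
Proof. by move=> h h'; have := clinZD_op 1 h h'; under eq_fun do rewrite fmul1. Qed.

Lemma clinZ_op B C (S : set (B -> K)) (A : (B -> K) -> C -> K) c :
  clin S A -> clin S (fun x => c \*o A x).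
Proof.
by move=> h; have := clinZD_op c h (clin_zero _ _); under eq_fun do rewrite addr0.
Qed.

Lemma clinB_op B C (S : set (B -> K)) (A A' : (B -> K) -> C -> K) :
  clin S A -> clin S A' -> clin S (fun x => A x - A' x).
Proof.
move=> h /(clinZ_op (-1)) h'; have := clinD_op h h'.
by under eq_fun do rewrite fmulN1.
Qed.

Lemma clin_sum_op B C (S : set (B -> K)) I (r : seq I) (P : pred I) (A : I -> (B -> K) -> C -> K) :
  (forall i, P i -> clin S (A i)) -> clin S (fun x => \sum_(i <- r | P i) A i x).
Proof.
move=> h; elim: r => [|i r IH].
  by apply: clin_ext (clin_zero _ _) => x; rewrite big_nil.
case Pi: (P i); last by apply: clin_ext IH => x; rewrite big_cons Pi.
by apply: clin_ext (clinD_op (h _ Pi) IH) => x; rewrite big_cons Pi.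
Qed.

(* Finite combinations of coordinates, that is, the linear functionals that are
   continuous for the product topology. *)
Definition func B (phi : (B -> K) -> K) :=
  exists l : seq (K * B), forall x, phi x = \sum_(p <- l) p.1 * x p.2.

Definition flin B C (A : (B -> K) -> C -> K) := forall c, func (fun x => A x c).

Lemma func_ext B (phi psi : (B -> K) -> K) : phi =1 psi -> func psi -> func phi.
Proof. by move=> e [l lP]; exists l => x; rewrite e. Qed.

Lemma func_at B (b : B) : func (fun x => x b).
Proof. by exists [:: (1, b)] => x; rewrite big_seq1 mul1r. Qed.

Lemma func0 B : func (fun _ : B -> K => 0).
Proof. by exists [::] => x; rewrite big_nil. Qed.

Lemma funcD B (phi psi : (B -> K) -> K) :
  func phi -> func psi -> func (fun x => phi x + psi x).
Proof. by move=> [l lP] [l' lP']; exists (l ++ l') => x; rewrite big_cat lP lP'. Qed.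

Lemma funcZ B c (phi : (B -> K) -> K) : func phi -> func (fun x => c * phi x).
Proof.
move=> [l lP]; exists [seq (c * p.1, p.2) | p <- l] => x.
by rewrite big_map lP mulr_sumr; apply: eq_bigr => p _; rewrite mulrA.
Qed.

Lemma funcZr B c (phi : (B -> K) -> K) : func phi -> func (fun x => phi x * c).
Proof. by move=> /(funcZ c); apply: func_ext => x; rewrite mulrC. Qed.

Lemma funcN B (phi : (B -> K) -> K) : func phi -> func (fun x => - phi x).
Proof. by move=> /(funcZ (-1)); apply: func_ext => x; rewrite mulN1r. Qed.

Lemma funcQ B (q : rat) (phi : (B -> K) -> K) : func phi -> func (fun x => q *: phi x).
Proof. by move=> /(funcZ q%:A); apply: func_ext => x; rewrite mulr_algl. Qed.

Lemma func_sum B I (r : seq I) (P : pred I) (phi : I -> (B -> K) -> K) :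
  (forall i, P i -> func (phi i)) -> func (fun x => \sum_(i <- r | P i) phi i x).
Proof.
move=> h; elim: r => [|i r IH].
  by apply: func_ext (func0 _) => x; rewrite big_nil.
case Pi: (P i); last by apply: func_ext IH => x; rewrite big_cons Pi.
by apply: func_ext (funcD (h _ Pi) IH) => x; rewrite big_cons Pi.
Qed.

Lemma func_comp B C (A : (B -> K) -> C -> K) (phi : (C -> K) -> K) :
  flin A -> func phi -> func (fun x => phi (A x)).
Proof.
move=> fA [l lP]; apply: (func_ext (fun x => lP (A x))).
by apply: func_sum => p _; exact: (funcZ p.1 (fA p.2)).
Qed.

Lemma flin_comp B C (D : eqType) (A : (B -> K) -> C -> K) (A' : (C -> K) -> D -> K) :
  flin A -> flin A' -> flin (fun x => A' (A x)).
Proof. by move=> fA fA' d; exact: (func_comp fA (fA' d)). Qed.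

Lemma flin_clin B C (S : set (B -> K)) (A : (B -> K) -> C -> K) : flin A -> clin S A.
Proof.
move=> fA; split.
  move=> c x y _ _; apply: funext => d; have [l lP] := fA d.
  rewrite !fE !lP mulr_sumr -big_split; apply: eq_bigr => p _ /=.
  by rewrite !fE; ring.
elim=> [|d F [G GP]]; first by exists [::].
have [l lP] := fA d; exists (map snd l ++ G) => x Sx x0 b.
rewrite inE => /predU1P[->|bF].
  rewrite lP big_seq big1 // => p pl; rewrite x0 ?mulr0 // mem_cat.
  by rewrite (map_f snd pl).
by apply: (GP x) bF => // g gG; apply: x0; rewrite mem_cat gG orbT.
Qed.

Lemma flin_id B : flin (@id (B -> K)). Proof. by move=> b; apply: func_at. Qed.

Lemma flinD B C (A A' : (B -> K) -> C -> K) :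
  flin A -> flin A' -> flin (fun x => A x + A' x).
Proof. by move=> fA fA' c; apply: (funcD (fA c) (fA' c)). Qed.

Lemma flinZ B C c (A : (B -> K) -> C -> K) : flin A -> flin (fun x => c \*o A x).
Proof. by move=> fA d; apply: (funcZ c (fA d)). Qed.

Lemma flinN B C (A : (B -> K) -> C -> K) : flin A -> flin (fun x => - A x).
Proof. by move=> fA d; apply: (funcN (fA d)). Qed.

Lemma flinB B C (A A' : (B -> K) -> C -> K) :
  flin A -> flin A' -> flin (fun x => A x - A' x).
Proof. by move=> fA fA'; apply: flinD => //; apply: flinN. Qed.

Definition delta B (b : B) : B -> K := fun b' => (b' == b)%:R.

(** Only finitely many coordinates of x enter a given coordinate of A x, so x may be replaced by a
    finite combination of the [delta] functions. Identities between globally defined operators thus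
    reduce to basis elements. *)
Lemma flin_eq B C (A A' : (B -> K) -> C -> K) : flin A -> flin A' ->
  (forall b, A (delta b) = A' (delta b)) -> A = A'.
Proof.
move=> fA fA' e; apply: funext => x; apply: funext => c.
have [l lP] := flinB fA fA' c; apply/eqP; rewrite -subr_eq0.
have -> : A x c - A' x c = \sum_(p <- l) p.1 * x p.2 by rewrite -lP.
pose r := undup (map snd l).
rewrite (eq_big_seq (fun p => \sum_(b <- r) x b * (p.1 * delta b p.2))); last first.
  move=> p pl; rewrite (bigD1_seq p.2) ?undup_uniq ?mem_undup ?map_f //=.
  rewrite big1 => [|b bp]; last by rewrite /delta eq_sym (negPf bp) !mulr0.
  by rewrite /delta eqxx /= addr0; ring.
rewrite exchange_big big1 //= => b _; rewrite -mulr_sumr -lP !fE e subrr.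
by rewrite mulr0.
Qed.

Section Flin.
Variables (B C : eqType) (A : (B -> K) -> C -> K) (fA : flin A).
Let lA := flin_clin setT fA.
Lemma flD x y : A (x + y) = A x + A y.
Proof. by apply: (clinD lA). Qed.
Lemma flZ c x : A (c \*o x) = c \*o A x.
Proof. by apply: (clinZ (@closedT B) lA). Qed.
Lemma flN x : A (- x) = - A x.
Proof. by apply: (clinN (@closedT B) lA). Qed.
Lemma flB x y : A (x - y) = A x - A y.
Proof. by rewrite flD flN. Qed.
Lemma fl0 : A 0 = 0.
Proof. exact: (clin0 (@closedT B) lA). Qed.
Lemma flQ (q : rat) x : A (q *: x) = q *: A x.
Proof. by apply: (clinQ (@closedT B) lA). Qed.
Lemma fl_sum I (r : seq I) (P : pred I) (F : I -> B -> K) :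
  A (\sum_(i <- r | P i) F i) = \sum_(i <- r | P i) A (F i).
Proof. by apply: (clin_sum (@closedT B) lA). Qed.
End Flin.
End Closed.

Arguments delta {K B} b.

(** * Parity of elements and the sign twist *)

Section Parity.
Variables (K : comAlgType rat) (B : eqType) (deg : B -> int).
Implicit Types (x : B -> K).

(** On an element of pure degree p this is multiplication by (-1)^(ep); as an operator it makes
    sense, with its Koszul sign, on inhomogeneous elements too. *)
Definition tau (e : int) x : B -> K := fun b => sg (e * deg b) * x b.

(** Signs see only the parity of the support, so this weaker form of homogeneity is enough for all
    sign computations. *)
Definition par (p : int) x := forall b, x b = 0 \/ odd `|deg b|%N = odd `|p|%N.

Lemma sg_odd (i j : int) : odd `|i|%N = odd `|j|%N -> sg i = sg j :> K.
Proof. by rewrite /sg => ->. Qed.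

Lemma par_sg p x k b : par p x -> sg (k * deg b) * x b = sg (k * p) * x b.
Proof.
move=> px; case: (px b) => [->|e]; first by rewrite !mulr0.
by congr (_ * _); apply: sg_odd; rewrite !oddE e.
Qed.

Lemma tau_par p x k : par p x -> tau k x = sg (k * p) \*o x.
Proof. by move=> px; apply: funext => b; rewrite fE -(par_sg _ _ px). Qed.

Lemma par_tau p x k : par p x -> par p (tau k x).
Proof. by move=> px b; rewrite /tau; case: (px b) => [->|]; [left; rewrite mulr0 | right]. Qed.

Lemma flin_tau k : flin (tau k).
Proof. by move=> b; apply: funcZ; apply: func_at. Qed.

Lemma tauD i j x : tau (i + j) x = tau i (tau j x).
Proof. by apply: funext => b; rewrite /tau mulrDl sgD mulrA. Qed.

Lemma tauK i x : tau i (tau i x) = x.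
Proof. by apply: funext => b; rewrite /tau mulrA sgsq mul1r. Qed.

Lemma tau0 x : tau 0 x = x.
Proof. by apply: funext => b; rewrite /tau mul0r mul1r. Qed.

Lemma par_delta b : par (deg b) (delta b : B -> K).
Proof. by move=> b'; rewrite /delta; case: eqP => [->|_]; [right | left]. Qed.

Lemma double_eq0 (x : K) : x + x = 0 -> x = 0.
Proof.
move=> xx; have := congr1 (fun y => (2^-1 : rat) *: y) xx.
by rewrite scaler0 -mulr2n -scaler_nat scalerA mulVf // scale1r.
Qed.

(** A coordinate of the wrong parity equals its own opposite, and 2 is invertible. *)
Lemma tau1_par p x : tau 1 x = sg p \*o x -> par p x.
Proof.
move=> h b; have := congr1 (fun F => F b) h; rewrite fE /tau mul1r /sg.
case: (odd `|deg b|%N); case: (odd `|p|%N); rewrite ?mul1r ?mulN1r; auto => e; left.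
  by apply: double_eq0; rewrite -{1}e addNr.
by apply: double_eq0; rewrite {1}e addNr.
Qed.

(** A nonzero coordinate at b is an element of K of degree d - deg b, which has to be even because K
    vanishes in odd degrees. *)
Lemma homogeneous_par (gr : even_grading K) d x : homogeneous gr deg d x -> par d x.
Proof.
move=> hx b; case o : (odd `|(d - deg b)%R|%N); first by left; apply: (hcomp_odd o).
by right; move: o; rewrite !oddE; case: (odd `|d|%N); case: (odd _).
Qed.
End Parity.

Lemma delta_at (K : comAlgType rat) (B : eqType) (b : B) : delta b b = 1 :> K.
Proof. by rewrite /delta eqxx. Qed.

(** * Tensor algebras and their derivations *)
Section TensorAlgebra.
Variables (K : comAlgType rat) (A : eqType) (deg : A -> int).
Local Notation T := (seq A -> K).
Local Notation wd := (wdeg deg).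
Local Notation tone := (@tone K A).
Local Notation tau := (tau wd).
Local Notation par := (par wd).
Implicit Types (f g h : T) (l : A) (s : seq A).

(** Left division by the letter l, the transpose of left multiplication by it; it drives the
    recursions on words. *)
Definition sh l f : T := fun s => f (l :: s).

Lemma wdeg_nil : wd [::] = 0. Proof. by rewrite /wdeg big_nil. Qed.
Lemma wdeg_cons l s : wd (l :: s) = deg l + wd s.
Proof. by rewrite /wdeg big_cons. Qed.
Lemma wdeg_cat s t : wd (s ++ t) = wd s + wd t.
Proof. by rewrite /wdeg big_cat. Qed.
Lemma wdeg_take_drop i s : wd (take i s) + wd (drop i s) = wd s.
Proof. by rewrite -wdeg_cat cat_take_drop. Qed.

Lemma tmul_nil f g : tmul f g [::] = f [::] * g [::].
Proof. by rewrite /tmul big_ord1. Qed.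

Lemma tmul_cons f g l s : tmul f g (l :: s) = f [::] * g (l :: s) + tmul (sh l f) g s.
Proof. by rewrite /tmul big_ord_recl take0 drop0. Qed.

Lemma sh_tmul f g l : sh l (tmul f g) = (f [::] \*o sh l g) + tmul (sh l f) g.
Proof. by apply: funext => s; rewrite /sh tmul_cons. Qed.

Lemma flin_sh l : flin (sh l).
Proof. by move=> s; apply: func_at. Qed.

Lemma flin_tmull g : flin (fun f => tmul f g).
Proof. by move=> s; apply: func_sum => i _; apply: funcZr; apply: func_at. Qed.

Lemma flin_tmulr f : flin (tmul f).
Proof. by move=> s; apply: func_sum => i _; apply: funcZ; apply: func_at. Qed.

Lemma tmulDl f g h : tmul (f + g) h = tmul f h + tmul g h.
Proof. by rewrite (flD (flin_tmull h)). Qed.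
Lemma tmulBl f g h : tmul (f - g) h = tmul f h - tmul g h.
Proof. by rewrite (flB (flin_tmull h)). Qed.
Lemma tmulBr f g h : tmul h (f - g) = tmul h f - tmul h g.
Proof. by rewrite (flB (flin_tmulr h)). Qed.
Lemma tmulZl c f h : tmul (c \*o f) h = c \*o tmul f h.
Proof. by rewrite (flZ (flin_tmull h)). Qed.
Lemma tmulZr c f h : tmul h (c \*o f) = c \*o tmul h f.
Proof. by rewrite (flZ (flin_tmulr h)). Qed.
Lemma tmul0l h : tmul 0 h = 0 :> T.
Proof. by rewrite (fl0 (flin_tmull h)). Qed.
Lemma tmul0r h : tmul h 0 = 0 :> T.
Proof. by rewrite (fl0 (flin_tmulr h)). Qed.

Lemma tmulA f g h : tmul f (tmul g h) = tmul (tmul f g) h.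
Proof.
apply: funext => s; elim: s f => [|l s IH] f; first by rewrite !tmul_nil mulrA.
rewrite !tmul_cons sh_tmul tmulDl tmulZl !fE IH tmul_nil mulrDr mulrA.
by rewrite addrA.
Qed.

Lemma sh_tone l : sh l tone = 0. Proof. by []. Qed.

Lemma tmul1l f : tmul tone f = f.
Proof.
apply: funext => -[|l s]; first by rewrite tmul_nil mul1r.
by rewrite tmul_cons sh_tone tmul0l mul1r addr0.
Qed.

Lemma tmul1r f : tmul f tone = f.
Proof.
apply: funext => s; elim: s f => [|l s IH] f; first by rewrite tmul_nil mulr1.
by rewrite tmul_cons IH mulr0 add0r.
Qed.

Lemma delta_nil : delta [::] = tone.
Proof. by apply: funext => -[]. Qed.

Lemma tmul_letter (x : A -> K) f l s : tmul (letter x) f (l :: s) = x l * f s.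
Proof.
rewrite tmul_cons /= mul0r add0r.
have -> : sh l (letter x) = x l \*o tone.
  by apply: funext => -[|? ?]; rewrite fE /sh /= /tone ?mulr1 ?mulr0.
by rewrite tmulZl tmul1l.
Qed.

Lemma delta_cons l s : delta (l :: s) = tmul (letter (delta l)) (delta s) :> T.
Proof.
apply: funext => -[|l' s']; first by rewrite tmul_nil /= mul0r.
by rewrite tmul_letter /delta eqseq_cons; case: (l' == l) => /=; rewrite ?mul1r ?mul0r.
Qed.

Lemma letter_delta l : letter (delta l) = delta [:: l] :> T.
Proof. by rewrite delta_cons delta_nil tmul1r. Qed.

Lemma flin_letter : flin (@letter K A).
Proof. by move=> [|a [|b s]]; [exact: func0 | exact: func_at | exact: func0]. Qed.

Lemma tau_nil k f : tau k f [::] = f [::].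
Proof. by rewrite /tau wdeg_nil mulr0 mul1r. Qed.

Lemma sh_tau k l f : sh l (tau k f) = sg (k * deg l) \*o tau k (sh l f).
Proof.
by apply: funext => s; rewrite !fE /tau /sh wdeg_cons mulrDr sgD mulrA.
Qed.

Lemma tau_tmul k f g : tau k (tmul f g) = tmul (tau k f) (tau k g).
Proof.
apply: funext => s; rewrite /tau /tmul mulr_sumr; apply: eq_bigr => i _.
by rewrite -(wdeg_take_drop i s) mulrDr sgD; ring.
Qed.

Lemma tau_tone k : tau k tone = tone.
Proof. by apply: funext => -[|l s]; rewrite /tau ?wdeg_nil ?mulr0 ?mul1r. Qed.

Lemma par_tmul p q f g : par p f -> par q g -> par (p + q) (tmul f g).
Proof.
move=> pf qg s; have [o|o] := boolP (odd `|wd s|%N == odd `|(p + q)%R|%N).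
  by right; apply/eqP.
left; rewrite /tmul big1 // => i _.
case: (pf (take i s)) => [->|e]; first by rewrite mul0r.
case: (qg (drop i s)) => [->|e']; first by rewrite mulr0.
by move: o; rewrite -(wdeg_take_drop i s) !oddE e e' eqxx.
Qed.

Lemma tbrkE p f g : par p f -> tbrk deg f g = tmul f g - tmul (tau p g) f.
Proof.
move=> pf; apply: funext => s; rewrite /tbrk big_split sumrN; congr (_ - _).
apply: eq_bigr => i _; rewrite ksgnE /tau.
have := par_sg (wd (take i s)) (drop i s) pf => e.
by rewrite mulrCA e (mulrC p); ring.
Qed.

Lemma tbrk_par p q f g : par p f -> par q g ->
  tbrk deg f g = tmul f g - sg (p * q) \*o tmul g f.
Proof. by move=> pf qg; rewrite (tbrkE _ pf) (tau_par _ qg) tmulZl. Qed.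

Lemma flin_tbrkr f : flin (tbrk deg f).
Proof.
move=> s; apply: func_sum => i _; apply: funcD; first by apply: funcZ; apply: func_at.
by apply: funcN; apply: funcQ; apply: funcZr; apply: func_at.
Qed.

Lemma flin_tbrkl g : flin (fun f => tbrk deg f g).
Proof.
move=> s; apply: func_sum => i _; apply: funcD; first by apply: funcZr; apply: func_at.
by apply: funcN; apply: funcQ; apply: funcZ; apply: func_at.
Qed.

Lemma tau_tbrk k f g : tau k (tbrk deg f g) = tbrk deg (tau k f) (tau k g).
Proof.
apply: funext => s; rewrite /tau /tbrk mulr_sumr; apply: eq_bigr => i _.
by rewrite !ksgnE -(wdeg_take_drop i s) (mulrDr k) sgD; ring.
Qed.

Lemma par_sub p f g : par p f -> par p g -> par p (f - g).
Proof.
by move=> pf pg s; case: (pf s); case: (pg s); auto => e e'; left; rewrite !fE e e' subrr.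
Qed.

Lemma par_scale c p f : par p f -> par p (c \*o f).
Proof. by move=> pf s; case: (pf s); auto => e; left; rewrite fE e mulr0. Qed.

Lemma par_tbrk p q f g : par p f -> par q g -> par (p + q) (tbrk deg f g).
Proof.
move=> pf qg; rewrite (tbrk_par pf qg); apply: par_sub; first exact: par_tmul.
by apply: par_scale; rewrite addrC; apply: par_tmul.
Qed.

Lemma par_letter p (x : A -> K) :
  (forall a, x a = 0 \/ odd `|deg a|%N = odd `|p|%N) -> par p (letter x).
Proof.
move=> px [|a [|b s]]; [by left | | by left].
by case: (px a) => [e|e]; [left | right; rewrite /wdeg big_seq1].
Qed.

(** Derivations along a homomorphism M. Besides M = [id], the case M = [norm] occurs when an
    operator applied before and after taking normal forms is compared. *)
Definition nder (M : T -> T) (e : int) (D : T -> T) :=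
  flin D /\ forall f g, D (tmul f g) = tmul (D f) (M g) + tmul (M (tau e f)) (D g).

Definition nmor (M : T -> T) :=
  [/\ flin M, M tone = tone & forall f g, M (tmul f g) = tmul (M f) (M g)].

(** Says that D has parity e, without mentioning homogeneous elements. *)
Definition parop (e : int) (D : T -> T) :=
  forall k f, D (tau k f) = sg (k * e) \*o tau k (D f).

Lemma nder1 M e D : nmor M -> nder M e D -> D tone = 0.
Proof.
move=> [_ M1 _] [_ mD]; have := mD tone tone.
rewrite tau_tone M1 tmul1l tmul1r tmul1l => /eqP.
by rewrite -subr_eq0 opprD addrA subrr add0r oppr_eq0 => /eqP.
Qed.

Lemma nder_eq M e D D' : nmor M -> nder M e D -> nder M e D' ->
  (forall l, D (letter (delta l)) = D' (letter (delta l))) -> D = D'.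
Proof.
move=> hM hD hD' e'; apply: flin_eq; [exact: hD.1 | exact: hD'.1 |].
elim=> [|l s IH]; first by rewrite delta_nil (nder1 hM hD) (nder1 hM hD').
by rewrite delta_cons hD.2 hD'.2 e' IH.
Qed.

Lemma nmor_id : nmor id.
Proof. by split => //; apply: flin_id. Qed.

Lemma nder_comm e e' D D' : nder id e D -> nder id e' D' -> parop e D -> parop e' D' ->
  nder id (e + e') (fun f => D (D' f) - sg (e * e') \*o D' (D f)).
Proof.
move=> [fD mD] [fD' mD'] pD pD'; split.
  by apply: flinB; [exact: (flin_comp fD' fD) | apply: flinZ; exact: (flin_comp fD fD')].
move=> f g; rewrite mD mD' (flD fD) (flD fD') !mD !mD'.
rewrite (pD e') (pD' e) tmulBl tmulBr !tmulZl !tmulZr tauD.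
rewrite -!tauD (addrC e') tauD.
apply: funext => s; rewrite !fE (mulrC e'); move: (sgsq K (e * e')) => q.
set c := sg _ in q *.
by rewrite !mulrDr !mulrA q; ring.
Qed.

Lemma nder_tbrk e D : nder id e D -> parop e D -> forall f g,
  D (tbrk deg f g) = tbrk deg (D f) g + tbrk deg (tau e f) (D g).
Proof.
move=> [fD mD] pD f g; move: f.
suff: (fun f => D (tbrk deg f g)) = (fun f => tbrk deg (D f) g + tbrk deg (tau e f) (D g)).
  by move=> /(congr1 (fun F => F _)) h f; rewrite (h f).
apply: flin_eq => [||u].
- exact: (flin_comp (flin_tbrkl g) fD).
- apply: flinD; first exact: (flin_comp fD (flin_tbrkl g)).
  exact: (flin_comp (@flin_tau K _ wd e) (flin_tbrkl (D g))).
have pu := @par_delta K _ wd u.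
(* Commutation with the total twist forces the image of a word to have pure parity, as needed to
   expand its bracket. *)
have pDu : par (e + wd u) (D (delta u)).
  apply: tau1_par; have := pD 1 (delta u); rewrite (tau_par _ pu) (flZ fD).
  move=> /(congr1 (fun x => sg (1 * e) \*o x)); rewrite !fmulA sgsq fmul1 => <-.
  by rewrite -sgD -mulrDr mul1r.
rewrite (tau_par _ pu) (flZ (flin_tbrkl _)).
rewrite (tbrkE _ pu) (tbrkE _ pDu) (tbrkE (D g) pu) (flB fD) !mD.
rewrite (tau_par _ pu) pD !tmulZl !tauD.
apply: funext => s; rewrite !fE.
by rewrite (mulrC (wd u)); ring.
Qed.
End TensorAlgebra.

(** * Derivations built from their effect on the first letter *)

Section DerivationFromHead.
Variables (K : comAlgType rat) (A : eqType) (deg : A -> int).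
Local Notation T := (seq A -> K).
Local Notation tau := (tau (wdeg deg)).
Variables (H : A -> T -> T) (e : int).
Hypothesis fH : forall l, flin (H l).
Hypothesis mH : forall l f g, H l (tmul f g) = (f [::] \*o H l g) + tmul (H l f) g.
Hypothesis pH : forall l k f, H l (tau k f) = sg (k * (e + deg l)) \*o tau k (H l f).

(** The Leibniz rule read on coefficients: the coefficient at l :: s comes either from the
    derivation acting on the first letter of an input word, which is recorded by H, or from its
    acting further right, after the letter l has been passed at the cost of the sign (-1)^(deg l *
    e). *)
Fixpoint der_at (s : seq A) (f : T) : K :=
  if s is l :: s' then H l f s' + sg (deg l * e) * der_at s' (sh l f) else 0.

Definition der (f : T) : T := der_at^~ f.

Lemma sh_der l f : sh l (der f) = H l f + sg (deg l * e) \*o der (sh l f).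
Proof. by []. Qed.

Lemma flin_der : flin der.
Proof.
elim=> [|l s IH]; first exact: func0.
apply: funcD; first exact: fH.
by apply: funcZ; apply: (func_comp (@flin_sh K A l) IH).
Qed.

Lemma nder_der : nder deg id e der.
Proof.
split; first exact: flin_der.
move=> f g; apply: funext => s; elim: s f => [|l s IH] f.
  by rewrite fE !tmul_nil !mul0r mulr0 addr0.
rewrite fE 2!tmul_cons sh_der sh_tau tmulDl !tmulZl tau_nil !fE mul0r add0r.
rewrite {1}/der /= mH sh_tmul (_ : der_at s _ = der ((f [::] \*o sh l g) + tmul (sh l f) g) s) //.
rewrite (flD flin_der) (flZ flin_der) !fE IH fE {2}/der /= -/(der (sh l g) s).
by rewrite (mulrC (deg l) e); ring.
Qed.

Lemma parop_der : parop deg e der.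
Proof.
move=> k f; apply: funext => s; elim: s f => [|l s IH] f.
  by rewrite !fE /tau wdeg_nil !mulr0.
rewrite fE /tau {1 2}/der /= wdeg_cons -!/(der _ s) pH sh_tau (flZ flin_der) !fE IH !fE.
by rewrite /tau !(mulrDr k) !sgD; ring.
Qed.

Lemma der_letter t l s : der (letter t) (l :: s) = H l (letter t) s.
Proof.
have -> : der (letter t) (l :: s) = sh l (der (letter t)) s by [].
rewrite sh_der faddE fmulE.
have -> : sh l (letter t) = t l \*o (@tone K A).
  by apply: funext => -[|? ?]; rewrite fE /sh /= /tone ?mulr1 ?mulr0.
by rewrite (flZ flin_der) (nder1 (@nmor_id K A) nder_der) !fE !mulr0 addr0.
Qed.
End DerivationFromHead.

Section NmorEq.
Variables (K : comAlgType rat) (A : eqType).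
Local Notation T := (seq A -> K).

Lemma nmor_eq (M M' : T -> T) : nmor M -> nmor M' ->
  (forall l, M (letter (delta l)) = M' (letter (delta l))) -> M = M'.
Proof.
move=> [fM M1 mM] [fM' M1' mM'] e; apply: flin_eq => //.
elim=> [|l s IH]; first by rewrite delta_nil M1 M1'.
by rewrite delta_cons mM mM' e IH.
Qed.

Lemma delta_pair (B C : eqType) (b : B) (c : C) :
  delta (b, c) = tens (delta b) (delta c) :> (B * C -> K).
Proof.
apply: funext => -[b' c']; rewrite /delta /tens /= xpair_eqE.
by case: (b' == b); case: (c' == c); rewrite ?mulr1 ?mulr0.
Qed.

Lemma flin_tensl (B C : eqType) (g : C -> K) : flin (fun f : B -> K => tens f g).
Proof. by move=> b; apply: funcZr; apply: func_at. Qed.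
Lemma flin_tensr (B C : eqType) (f : B -> K) : flin (fun g : C -> K => tens f g).
Proof. by move=> b; apply: funcZ; apply: func_at. Qed.
End NmorEq.

(** * The action of Lie elements on words of 1-forms *)

Section FormLetters.
Variables (K : comAlgType rat) (V : free_module).
Local Notation X := (seq (bas V) -> K).
Local Notation L1 := (pair_ix V -> K).
Local Notation T := (seq (pair_ix V) -> K).
Local Notation dW := (@degW V).
Local Notation dA := (@degA V).
Local Notation tauT := (tau (wdeg dA)).
Local Notation parX := (par (wdeg dW)).
Implicit Types (x y : X) (t : L1) (f g : T).

Definition lmulL x t : L1 := fun a => tmul x (fun u => t (u, a.2)) a.1.

Lemma flin_lmulL x : flin (lmulL x).
Proof. by move=> a; apply: func_sum => i _; apply: funcZ; apply: func_at. Qed.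

Lemma lmulL_tens x y z : lmulL x (tens y z) = tens (tmul x y) z.
Proof.
apply: funext => -[u v]; rewrite /lmulL /tens /= /tmul mulr_suml.
by apply: eq_bigr => i _; rewrite mulrA.
Qed.

Lemma lmulL_tmul x y t : lmulL (tmul x y) t = lmulL x (lmulL y t).
Proof. by apply: funext => -[u v]; rewrite /lmulL /= tmulA. Qed.

Lemma lmulLD x y t : lmulL (x + y) t = lmulL x t + lmulL y t.
Proof. by apply: funext => -[u v]; rewrite /lmulL tmulDl. Qed.
Lemma lmulLZ c x t : lmulL (c \*o x) t = c \*o lmulL x t.
Proof. by apply: funext => -[u v]; rewrite /lmulL tmulZl. Qed.

Definition act_head x (l : pair_ix V) f : T := fun s =>
  \sum_(i < (size l.1).+1) sg (degT (take i l.1)) *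
     (x (take i l.1) * f ((drop i l.1, l.2) :: s)).

(** The explicit sum defining [act] takes its signs from the prefix split off from x, the recursion
    takes them from the parity p of x; on the support of x these agree. *)
Lemma act_der p x : parX p x -> act false x = der dA (act_head x) p.
Proof.
move=> px; apply: funext => f; apply: funext => s; elim: s f => [|l s IH] f.
  by rewrite /act big_ord0.
rewrite /act big_ord_recl /der /= -/(der _ _ _ (sh l f) s) -IH; congr (_ + _).
  apply: eq_bigr => i _; rewrite ksgnE /= drop0 wdeg_nil !addr0 mulr1.
  by [].
rewrite /act mulr_sumr; apply: eq_bigr => k _; rewrite mulr_sumr.
apply: eq_bigr => i _; rewrite !ksgnE !addr0 /= wdeg_cons /sh.
set w := take i _; have := par_sg (dA l) w px; rewrite -/(degT w) => h.
set S := wdeg dA _.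
have -> : degT w * (1 + (dA l + S)) = dA l * degT w + degT w * (1 + S) by ring.
by rewrite sgD [LHS]mulrACA h; ring.
Qed.

Section ActPar.
Variables (p : int) (x : X) (px : parX p x).

Lemma flin_act_head l : flin (act_head x l).
Proof.
by move=> s; apply: func_sum => i _; apply: funcZ; apply: funcZ; apply: func_at.
Qed.

Lemma act_head_tmul l f g :
  act_head x l (tmul f g) = (f [::] \*o act_head x l g) + tmul (act_head x l f) g.
Proof.
apply: funext => s; rewrite !fE {1}/act_head.
under eq_bigr => i _ do rewrite tmul_cons !mulrDr.
rewrite big_split mulr_sumr; congr (_ + _); first by apply: eq_bigr => i _ /=; ring.
rewrite [in RHS]/tmul; under [RHS]eq_bigr => j _ do rewrite /act_head mulr_suml.
rewrite exchange_big; apply: eq_bigr => i _ /=; rewrite /tmul !mulr_sumr.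
by apply: eq_bigr => j _; rewrite /sh !mulrA.
Qed.

Lemma dA_cut i l : degT (take i l.1) + dA (drop i l.1, l.2) = dA l.
Proof. by rewrite /degA /= /degT -(wdeg_take_drop dW i l.1); ring. Qed.

Lemma act_head_tau l k f :
  act_head x l (tauT k f) = sg (k * (p + dA l)) \*o tauT k (act_head x l f).
Proof.
apply: funext => s; rewrite fE /tau /act_head.
under [LHS]eq_bigr do rewrite wdeg_cons; move: (wdeg dA s) => S.
rewrite !mulr_sumr; apply: eq_bigr => i _; set w := take i _.
have h := par_sg k w px; rewrite -(dA_cut i l) -/w.
set d := dA _; clearbody d; rewrite /degT; move: h; set ww := wdeg dW w => h.
rewrite !(mulrDr k) !sgD; move: h; set a := sg (k * ww); set b := sg (k * p) => h.
set F := f _. transitivity (sg ww * (sg (k * d) * (sg (k * S) * F)) * x w); first by ring.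
have e : a * (b * x w) = x w by rewrite -h mulrA sgsq mul1r.
by rewrite -[in LHS]e; ring.
Qed.

Lemma nder_act : nder dA id p (act false x).
Proof.
rewrite (act_der px).
by apply: nder_der; [exact: flin_act_head | exact: act_head_tmul].
Qed.

Lemma parop_act : parop dA p (act false x).
Proof.
rewrite (act_der px).
apply: parop_der; [exact: flin_act_head | exact: act_head_tau].
Qed.

Lemma act_letter t : act false x (letter t) = letter (sg p \*o lmulL x t).
Proof.
rewrite (act_der px); apply: funext => -[|l s]; first by [].
rewrite der_letter; [|exact: flin_act_head | exact: act_head_tmul].
case: s => [|l' s] /=; last by rewrite /act_head big1 // => i _ /=; rewrite !mulr0.
rewrite /act_head /= /lmulL /tmul mulr_sumr; apply: eq_bigr => i _ /=.
have := par_sg 1 (take i l.1) px; rewrite !mul1r => h.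
by rewrite mulrA h mulrA.
Qed.

End ActPar.

(** Both sides are derivations of the tensor algebra, so letters suffice, and there the claim is
    associativity of left multiplication on the first factor. *)
Lemma act_tbrk p q x y : parX p x -> parX q y ->
  act false (tbrk dW x y) =
  (fun f => act false x (act false y f) - sg (p * q) \*o act false y (act false x f)).
Proof.
move=> px qy; have pxy := par_tbrk px qy.
have [nx ny nxy] := And3 (nder_act px) (nder_act qy) (nder_act pxy).
apply: (nder_eq (@nmor_id K _) nxy).
  exact: (nder_comm nx ny (parop_act px) (parop_act qy)).
move=> l; rewrite (act_letter pxy) !(act_letter px) !(act_letter qy) (act_letter px).
rewrite (tbrk_par px qy) -fmulN1 lmulLD !lmulLZ !lmulL_tmul.
rewrite -!(flZ (@flin_letter K _)) -(flB (@flin_letter K _)); congr letter.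
rewrite !(flZ (flin_lmulL _)).
by apply: funext => a; rewrite !fE sgD; ring.
Qed.

Lemma flin_act tw x : flin (@act K V tw x).
Proof.
move=> s; apply: func_sum => k _; apply: func_sum => i _; apply: funcQ; apply: funcZ.
exact: func_at.
Qed.

Lemma flin_actl tw f : flin (fun x => act tw x f).
Proof.
move=> s; apply: func_sum => k _; apply: func_sum => i _; apply: funcQ; apply: funcZr.
exact: func_at.
Qed.

Lemma act_size tw x f n : (forall s, size s = n -> f s = 0) ->
  forall s, size s = n -> act tw x f s = 0.
Proof.
move=> f0 s sn; rewrite /act big1 // => k _; rewrite big1 // => i _.
rewrite f0 ?mulr0 ?scaler0 // size_cat /= size_drop size_take ltn_ord.
by rewrite -subSn ?ltn_ord // subSS subnKC // ltnW // ltn_ord.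
Qed.
End FormLetters.

(** * Normal forms of 1-forms and the de Rham differential *)
Section NormalForm.
Variables (K : comAlgType rat) (V : free_module).
Local Notation X := (seq (bas V) -> K).
Local Notation L1 := (pair_ix V -> K).
Local Notation T := (seq (pair_ix V) -> K).
Local Notation dW := (@degW V).
Local Notation dA := (@degA V).
Local Notation tauT := (tau (wdeg dA)).
Local Notation parX := (par (wdeg dW)).
Local Notation parT := (par (wdeg dA)).
Implicit Types (x y z : X) (t : L1) (f g : T).

(** Since u' (x) d(va) has normal form u'v (x) da, the letters contributing to the coefficient at
    (u, [:: a]) are obtained by cutting the word ua anywhere before its last letter. A letter whose
    second word is not of length 1 never occurs in a normal form. *)
Definition pre (l : pair_ix V) : seq (pair_ix V) :=
  if l.2 is [:: a] then
    [seq (take i l.1, rcons (drop i l.1) a) | i <- iota 0 (size l.1).+1]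
  else [::].

Fixpoint Pre (s : seq (pair_ix V)) : seq (seq (pair_ix V)) :=
  if s is l :: s' then [seq l' :: r | l' <- pre l, r <- Pre s'] else [:: [::]].

Definition norm1 t : L1 := fun l => \sum_(l' <- pre l) t l'.

(* The Fox calculus normal form: the relations of 1-forms give
   u (x) d(va) = uv (x) da for a letter a, extended multiplicatively. *)
Definition norm f : T := fun s => \sum_(s' <- Pre s) f s'.

Lemma flin_norm1 : flin norm1.
Proof. by move=> l; apply: func_sum => i _; apply: func_at. Qed.

Lemma flin_norm : flin norm.
Proof. by move=> l; apply: func_sum => i _; apply: func_at. Qed.

Lemma norm_nil f : norm f [::] = f [::].
Proof. by rewrite /norm big_seq1. Qed.

Lemma norm_cons f l s : norm f (l :: s) = \sum_(l' <- pre l) norm (sh l' f) s.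
Proof. by rewrite /norm /= big_allpairs_dep. Qed.

Lemma nmor_norm : nmor norm.
Proof.
have e1 : norm (@tone K _) = @tone K _.
  apply: funext => -[|l s]; first by rewrite norm_nil.
  by rewrite norm_cons big1 // => l' _; rewrite sh_tone (fl0 flin_norm).
split => //; first exact: flin_norm.
move=> f g; apply: funext => s; elim: s f => [|l s IH] f.
  by rewrite !(norm_nil, tmul_nil).
rewrite norm_cons tmul_cons norm_nil norm_cons mulr_sumr.
have -> : sh l (norm f) = \sum_(l' <- pre l) norm (sh l' f).
  by apply: funext => r; rewrite /sh norm_cons !fE.
rewrite (fl_sum (flin_tmull _)) !fE -big_split; apply: eq_bigr => l' _ /=.
by rewrite sh_tmul (flD flin_norm) (flZ flin_norm) !fE IH.
Qed.

Lemma norm_letter t : norm (letter t) = letter (norm1 t).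
Proof.
apply: funext => -[|l [|l' s]]; first by rewrite norm_nil.
  by rewrite norm_cons; apply: eq_bigr => r _; rewrite norm_nil.
rewrite norm_cons big1 // => r _; rewrite norm_cons big1 // => r' _.
by rewrite /norm big1.
Qed.

Lemma norm1_tens x y u v : norm1 (tens x y) (u, v) =
  if v is [:: a] then tmul x (fun w => y (rcons w a)) u else 0.
Proof.
rewrite /norm1 /pre [(u, v).2]/= [(u, v).1]/=; case: v => [|a [|? ?]]; rewrite ?big_nil //.
by rewrite big_map -[iota _ _]/(index_iota 0 (size u).+1) big_mkord.
Qed.

Lemma norm1_lmulL x t : norm1 (lmulL x t) = lmulL x (norm1 t).
Proof.
suff /(congr1 (fun F => F t)) : (fun t => norm1 (lmulL x t)) = (fun t => lmulL x (norm1 t)).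
  by [].
apply: flin_eq => [||-[b1 b2]].
- exact: (flin_comp (flin_lmulL x) flin_norm1).
- exact: (flin_comp flin_norm1 (flin_lmulL x)).
rewrite delta_pair lmulL_tens; apply: funext => -[u v].
rewrite norm1_tens /lmulL /=; case: v => [|a [|? ?]]; first 1 last.
- by rewrite -tmulA; congr tmul; apply: funext => w; rewrite norm1_tens.
- by rewrite /tmul big1 // => i _; rewrite norm1_tens mulr0.
- by rewrite /tmul big1 // => i _; rewrite norm1_tens mulr0.
Qed.

Lemma norm1K t : norm1 (norm1 t) = norm1 t.
Proof.
suff /(congr1 (fun F => F t)) : (fun t => norm1 (norm1 t)) = norm1 by [].
apply: flin_eq => [||-[b1 b2]]; [exact: (flin_comp flin_norm1 flin_norm1) | exact: flin_norm1 |].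
rewrite delta_pair; apply: funext => -[u v].
have E1 t' w : norm1 t' w = \sum_(l' <- pre w) t' l' by [].
rewrite [LHS]E1; case: v => [|a [|? ?]]; rewrite ?norm1_tens /pre [(u, _).2]/= [(u, _).1]/= ?big_nil // big_map.
(* Only the cut i = [size u] leaves a single letter on the right. Earlier cuts leave a second word
   of length at least 2, at which [norm1] vanishes. *)
rewrite -[iota _ _]/(index_iota 0 (size u).+1) big_mkord big_ord_recr.
rewrite [nat_of_ord _]/= take_size drop_size norm1_tens big1 => [|i _]; first exact: add0r.
rewrite norm1_tens /=.
case E: (drop i u) => [|b r]; last by case: r {E}.
by move: E => /(congr1 size)/eqP; rewrite size_drop subn_eq0 leqNgt ltn_ord.
Qed.

Lemma normK f : norm (norm f) = norm f.
Proof.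
suff /(congr1 (fun F => F f)) : (fun f => norm (norm f)) = norm by [].
have [fN N1 mN] := nmor_norm.
apply: nmor_eq => //; last by move=> l; rewrite !norm_letter norm1K.
by split; [exact: (flin_comp fN fN) | rewrite !N1 | move=> ? ?; rewrite !mN].
Qed.

Lemma preP l l' : l' \in pre l -> exists a i, [/\ l.2 = [:: a], (i <= size l.1)%N &
  l' = (take i l.1, rcons (drop i l.1) a)].
Proof.
case: l => u [|a [|? ?]]; rewrite /pre ?in_nil // => /mapP[i].
by rewrite mem_iota => /andP[_ iu] ->; exists a, i.
Qed.

Lemma pre_dA l l' : l' \in pre l -> dA l' = dA l.
Proof.
case: l => u v /preP[a [i [/= -> _ ->]]].
rewrite /degA /= -cats1 /degT wdeg_cat -(wdeg_take_drop dW i u); ring.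
Qed.

Lemma Pre_wdeg s s' : s' \in Pre s -> wdeg dA s' = wdeg dA s.
Proof.
elim: s s' => [|l s IH] s'; first by rewrite inE => /eqP ->.
by move=> /allpairsP[[l' r] /= [/pre_dA e /IH e' ->]]; rewrite !wdeg_cons e e'.
Qed.

Lemma Pre_size s s' : s' \in Pre s -> size s' = size s.
Proof.
elim: s s' => [|l s IH] s'; first by rewrite inE => /eqP ->.
by move=> /allpairsP[[l' r] /= [_ /IH e' ->]] /=; rewrite e'.
Qed.

Lemma Pre_tdeg s s' : s' \in Pre s ->
  (\sum_(a <- s') (size a.1 + size a.2))%N = (\sum_(a <- s) (size a.1 + size a.2))%N.
Proof.
elim: s s' => [|l s IH] s'; first by rewrite inE => /eqP ->.
move=> /allpairsP[[l' r] /= [pl /IH e' ->]] /=; rewrite !big_cons e'; congr addn.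
case: l pl => u v /preP[a [i [/= -> iu ->]]] /=.
rewrite size_rcons size_take size_drop; case: ltnP; lia.
Qed.

(** Cutting and regrouping preserves degree, length and tensor degree of a word, so functions of
    these can be pulled out of a normal form. This serves for sign twists and for projections to a
    weight. *)
Lemma norm_char (chi : seq (pair_ix V) -> K) f :
  (forall s s', s' \in Pre s -> chi s' = chi s) ->
  norm (fun s => chi s * f s) = (fun s => chi s * norm f s).
Proof.
move=> h; apply: funext => s; rewrite /norm mulr_sumr.
by apply: eq_big_seq => s' /h ->.
Qed.

Lemma norm_tau k f : norm (tauT k f) = tauT k (norm f).
Proof. by apply: norm_char => s s' /Pre_wdeg ->. Qed.

(** Both composites are derivations along [norm]; on letters they agree because left multiplication
    commutes with the Fox rule. *)
Lemma norm_act p x f : parX p x -> norm (act false x f) = act false x (norm f).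
Proof.
move=> px.
suff /(congr1 (fun F => F f)) : (fun f => norm (act false x f)) = (fun f => act false x (norm f)) by [].
have [fN N1 mN] := nmor_norm; have [fD mD] := nder_act px.
apply: (nder_eq (deg := dA) (e := p) nmor_norm) => [||l].
- split; first exact: (flin_comp fD fN).
  by move=> g h; rewrite mD (flD fN) !mN.
- split; first exact: (flin_comp fN fD).
  by move=> g h; rewrite mN mD norm_tau.
rewrite norm_letter (act_letter px) norm_letter (act_letter px).
by rewrite (flZ flin_norm1) norm1_lmulL.
Qed.

Lemma norm_tbrk f g : norm (tbrk dA f g) = tbrk dA (norm f) (norm g).
Proof.
suff /(congr1 (fun F => F f)) : (fun f => norm (tbrk dA f g)) = (fun f => tbrk dA (norm f) (norm g)) by [].
have [fN N1 mN] := nmor_norm.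
apply: flin_eq => [||s].
- exact: (flin_comp (flin_tbrkl _ g) fN).
- exact: (flin_comp fN (flin_tbrkl _ (norm g))).
have ps := @par_delta K _ (wdeg dA) s.
have pns : parT (wdeg dA s) (norm (delta s)).
  by apply: tau1_par; rewrite -norm_tau (tau_par _ ps) (flZ fN) mul1r.
by rewrite (tbrkE _ ps) (tbrkE _ pns) (flB fN) !mN norm_tau.
Qed.

Definition dbas (b : bas V) : T := letter (delta ([::], [:: b])).

Definition lsh (b : bas V) t : L1 := fun a => t (b :: a.1, a.2).

(* The transpose of the map D0 with D0 (1 (x) dv) = 0 and
   D0 (bu (x) dv) = (-1)^|b| [db, u (x) dv] + b . D0 (u (x) dv); the first
   argument bounds the recursion. *)
Fixpoint D0 (n : nat) t (l1 l2 : pair_ix V) : K :=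
  if n is n'.+1 then
    \sum_b sg (dW b) * tbrk dA (dbas b) (letter (lsh b t)) [:: l1; l2]
    + (if l1.1 is b :: u then sg (dW b) * D0 n' (lsh b t) (u, l1.2) l2 else 0)
    + (if l2.1 is b :: u then sg (dW b * (1 + dA l1)) * D0 n' (lsh b t) l1 (u, l2.2)
       else 0)
  else 0.

(** Each recursive call strips a letter from one of the two first words, so this bound is never
    exhausted and the recursion holds without it, as [dpairE] records. *)
Definition dpair t l1 l2 := D0 (size l1.1 + size l2.1).+1 t l1 l2.

Lemma func_D0 n l1 l2 : func (fun t => D0 n t l1 l2).
Proof.
have flsh b : flin (lsh b) by move=> a; apply: func_at.
elim: n l1 l2 => [|n IH] l1 l2; first exact: func0.
apply: funcD; first apply: funcD.
- apply: func_sum => b _; apply: funcZ.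
  exact: (func_comp (flsh b) (flin_comp (@flin_letter K _) (flin_tbrkr dA (dbas b)) [:: l1; l2])).
- case: l1.1 => [|b u]; first exact: func0.
  by apply: funcZ; apply: (func_comp (flsh b) (IH _ _)).
- case: l2.1 => [|b u]; first exact: func0.
  by apply: funcZ; apply: (func_comp (flsh b) (IH _ _)).
Qed.

Lemma dA_lcons b l : dA (b :: l.1, l.2) = dW b + dA l.
Proof. by rewrite /degA /= /degT wdeg_cons; ring. Qed.

Lemma lsh_tau k b t : lsh b (tau dA k t) = sg (k * dW b) \*o tau dA k (lsh b t).
Proof. by apply: funext => l; rewrite fE /lsh /tau dA_lcons mulrDr sgD mulrA. Qed.

Lemma letter_tau k t : letter (tau dA k t) = tauT k (letter t).
Proof.
apply: funext => -[|l [|l' s]]; rewrite /tau /= ?mulr0 //.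
by rewrite wdeg_cons wdeg_nil addr0.
Qed.

Lemma par_dbas b : parT (1 + dW b) (dbas b).
Proof.
apply: par_letter => a; rewrite /delta; case: eqP => [->|_]; [right | by left].
by rewrite /degA /= /degT wdeg_cons !wdeg_nil !addr0 add0r addrC.
Qed.

Lemma tbrk_dbas_tau k b g : tbrk dA (dbas b) (tauT k g) =
  sg (k * (1 + dW b)) \*o tauT k (tbrk dA (dbas b) g).
Proof.
rewrite tau_tbrk (tau_par _ (par_dbas b)) (flZ (flin_tbrkl _ _)).
by rewrite fmulA sgsq fmul1.
Qed.

Lemma D0_tau n k t l1 l2 :
  D0 n (tau dA k t) l1 l2 = sg (k * (1 + dA l1 + dA l2)) * D0 n t l1 l2.
Proof.
elim: n t l1 l2 => [|n IH] t l1 l2 /=; first by rewrite mulr0.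
set S := sg (k * (1 + _ + _)); rewrite !mulrDr mulr_sumr; congr (_ + _ + _); rewrite /S {S}.
- apply: eq_bigr => b _; rewrite lsh_tau (flZ (@flin_letter K _)) (flZ (flin_tbrkr _ _)).
  rewrite letter_tau fE.
  rewrite tbrk_dbas_tau !fE /tau 2!wdeg_cons wdeg_nil addr0.
  set w := tbrk _ _ _ _; move: (dA l1) (dA l2) (dW b) w => a1 a2 bb w.
  rewrite !(mulrDr k) !sgD.
  have := sgsq K (k * bb); set c := sg (k * bb) => cc; set s := sg bb.
  rewrite [LHS](_ : _ = (c * c) * s * (sg (k * 1) * sg (k * a1) * sg (k * a2)) * w); last by ring.
  by rewrite cc; ring.
- case: l1 => -[|b u] v /=; rewrite ?mulr0 // lsh_tau.
  (* A scalar functional is regarded as an operator into functions on [bool], so that the linearity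
     lemmas for [flin] apply to it. *)
  have /(flZ (B := pair_ix V) (C := bool)) : flin (fun t (_ : bool) => D0 n t (u, v) l2).
    by move=> _; apply: func_D0.
  move=> /(_ (sg (k * dW b)) (tau dA k (lsh b t))) /(congr1 (fun F => F true)) ->.
  rewrite fE IH (dA_lcons b (u, v)).
  move: (dA (u, v)) (dA l2) (dW b) => a1 a2 bb; rewrite !(mulrDr k) !sgD; ring.
- case: l2 => -[|b u] v /=; rewrite ?mulr0 // lsh_tau.
  have /(flZ (B := pair_ix V) (C := bool)) : flin (fun t (_ : bool) => D0 n t l1 (u, v)).
    by move=> _; apply: func_D0.
  move=> /(_ (sg (k * dW b)) (tau dA k (lsh b t))) /(congr1 (fun F => F true)) ->.
  rewrite fE IH (dA_lcons b (u, v)).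
  move: (dA (u, v)) (dA l1) (dW b) => a1 a2 bb; rewrite !(mulrDr k) !sgD; ring.
Qed.

(** The differential turns one letter into two: the coefficient at l, l2 followed by s' comes from
    words consisting of a single letter followed by s'. *)
Definition dhead (l : pair_ix V) f : T := fun s =>
  if s is l2 :: s' then dpair (fun a : pair_ix V => f (a :: s')) l l2 else 0.

Lemma flin_dhead l : flin (dhead l).
Proof.
move=> [|l2 s]; first exact: func0.
by apply: (func_comp (A := fun (f : T) (a : pair_ix V) => f (a :: s)) _ (func_D0 _ _ _)) => a; apply: func_at.
Qed.

Lemma dhead_tmul l f g :
  dhead l (tmul f g) = (f [::] \*o dhead l g) + tmul (dhead l f) g.
Proof.
apply: funext => -[|l2 s]; first by rewrite !fE tmul_nil /= mul0r mulr0 addr0.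
rewrite !fE tmul_cons /= mul0r add0r.
have fd : flin (fun t (_ : bool) => dpair t l l2) by move=> _; apply: func_D0.
have -> : (fun a : pair_ix V => tmul f g (a :: s)) = (f [::] \*o (fun a : pair_ix V => g (a :: s))) +
    \sum_(i < (size s).+1) g (drop i s) \*o (fun a : pair_ix V => f (a :: take i s)).
  apply: funext => a; rewrite !fE tmul_cons; congr (_ + _).
  by apply: eq_bigr => i _; rewrite fE mulrC.
have := congr1 (fun F => F true) (flD fd _ _) => /= ->; congr (_ + _).
  by have := congr1 (fun F => F true) (flZ fd _ _) => /= ->.
have := congr1 (fun F => F true) (fl_sum fd _ _ _) => /= ->; rewrite fE.
apply: eq_bigr => i _; have := congr1 (fun F => F true) (flZ fd _ _) => /= ->.
exact: mulrC.
Qed.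

Lemma dhead_tau l k f :
  dhead l (tauT k f) = sg (k * (1 + dA l)) \*o tauT k (dhead l f).
Proof.
apply: funext => -[|l2 s]; rewrite fE /tau /=; first by rewrite !mulr0.
have -> : (fun a : pair_ix V => sg (k * wdeg dA (a :: s)) * f (a :: s)) =
    sg (k * wdeg dA s) \*o tau dA k (fun a : pair_ix V => f (a :: s)).
  by apply: funext => a; rewrite fE /tau wdeg_cons mulrDr sgD; ring.
have fd : flin (fun t (_ : bool) => dpair t l l2) by move=> _; apply: func_D0.
have := congr1 (fun F => F true) (flZ fd _ _) => /= ->.
by rewrite /dpair D0_tau wdeg_cons !(mulrDr k) !sgD; ring.
Qed.

Definition dform : T -> T := der dA dhead 1.

Lemma nder_dform : nder dA id 1 dform.
Proof. by apply: nder_der; [exact: flin_dhead | exact: dhead_tmul]. Qed.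

Lemma parop_dform : parop dA 1 dform.
Proof. by apply: parop_der; [exact: flin_dhead | exact: dhead_tau]. Qed.

Lemma dform_letter t s : dform (letter t) s =
  if s is [:: l1; l2] then dpair t l1 l2 else 0.
Proof.
case: s => [|l [|l2 [|l3 s]]] //; rewrite /dform der_letter //=;
  do ?[exact: flin_dhead | exact: dhead_tmul].
have -> : (fun a : pair_ix V => letter t [:: a, l3 & s]) = 0 by [].
have fd : flin (fun t (_ : bool) => dpair t l l2) by move=> _; apply: func_D0.
by have := congr1 (fun F => F true) (fl0 fd).
Qed.
End NormalForm.
Arguments dform {K V} f _ : simpl never.
Arguments norm {K V} f _ : simpl never.
Arguments norm1 {K V} t _ : simpl never.
Arguments dpair {K V} t l1 l2 : simpl never.

(** * Compatibility of the differential with the action *)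

Section Identities.
Variables (K : comAlgType rat) (V : free_module).
Local Notation X := (seq (bas V) -> K).
Local Notation L1 := (pair_ix V -> K).
Local Notation T := (seq (pair_ix V) -> K).
Local Notation dW := (@degW V).
Local Notation dA := (@degA V).
Local Notation tauX := (tau (wdeg dW)).
Local Notation tauT := (tau (wdeg dA)).
Local Notation parX := (par (wdeg dW)).
Local Notation parT := (par (wdeg dA)).
Local Notation dbas := (@dbas K V).
Local Notation dform := (@dform K V).
Implicit Types (x y z : X) (t : L1) (f g : T).

Lemma dpairE t l1 l2 : dpair t l1 l2 =
  \sum_b sg (dW b) * tbrk dA (dbas b) (letter (lsh b t)) [:: l1; l2]
  + (if l1.1 is b :: u then sg (dW b) * dpair (lsh b t) (u, l1.2) l2 else 0)
  + (if l2.1 is b :: u then sg (dW b * (1 + dA l1)) * dpair (lsh b t) l1 (u, l2.2)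
     else 0).
Proof.
rewrite {1}/dpair; case: l1 l2 => u1 v1 [u2 v2].
rewrite [D0 _ _ _ _]/=; congr (_ + _ + _); first by case: u1.
by case: u2 => [|b u] //; rewrite /dpair /= addnS.
Qed.

Lemma act_head_letter b l f s : act_head (letter (delta b)) l f s =
  if l.1 is b' :: u then sg (dW b') * ((b' == b)%:R * f ((u, l.2) :: s)) else 0.
Proof.
case: l => -[|b' u] v; rewrite /act_head /=.
  by rewrite big_ord1 /= mul0r mulr0.
rewrite big_ord_recl big_ord_recl big1 /=.
  by rewrite mul0r mulr0 add0r addr0 take0 drop0 /degT wdeg_cons wdeg_nil addr0.
move=> i _ /=; case: u i => [|c u] i; first by case: i.
by rewrite /= mul0r mulr0.
Qed.

Lemma tbrk_letters0 (t t' : L1) s : size s != 2 ->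
  tbrk dA (letter t) (letter t') s = 0.
Proof.
move=> s2; rewrite /tbrk big1 // => i _; have : (i <= size s)%N by rewrite -ltnS.
have e (h h' : L1) : letter h (take i s) * letter h' (drop i s) = 0.
  case: (take i s) (drop i s) (cat_take_drop i s) => [|a [|? ?]] [|c [|? ?]] //= E;
  rewrite ?mul0r ?mulr0 //.
  by move: s2; rewrite -E.
by rewrite !e scaler0 subr0.
Qed.

Lemma par_basis b : parX (dW b) (letter (delta b : bas V -> K)).
Proof.
by apply: par_letter => a; rewrite /delta; case: eqP => [->|_]; [right | left].
Qed.

Lemma lsh_lmulL b b' t : lsh b' (lmulL (letter (delta b)) t) = (b' == b)%:R \*o t.
Proof. by apply: funext => -[u v]; rewrite /lsh /lmulL tmul_letter. Qed.

Lemma flin_dpair l1 l2 : flin (fun t (_ : bool) => dpair t l1 l2 : K).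
Proof. by move=> _; apply: func_D0. Qed.

Lemma dpairZ c t l1 l2 : dpair (c \*o t) l1 l2 = c * dpair t l1 l2 :> K.
Proof. exact: (congr1 (fun F => F true) (flZ (flin_dpair l1 l2) c t)). Qed.

(** The recursion for [D0] transposed back: after multiplication by the letter b, [lsh] annihilates
    every summand but that of b. Both sides are supported on words of length 2. *)
Lemma dform_act_letter b t :
  dform (act false (letter (delta b)) (letter t)) =
  tbrk dA (dbas b) (letter t) +
    (sg (dW b) \*o act false (letter (delta b)) (dform (letter t))).
Proof.
have pb := par_basis b.
rewrite (act_letter pb); apply: funext => s; rewrite !fE dform_letter.
have [|s2] := eqVneq (size s) 2; last first.
  rewrite tbrk_letters0 // add0r (@act_size K V _ _ _ (size s)) ?mulr0.
  - by case: s s2 => [|? [|? [|? ?]]].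
  - by move=> r; rewrite dform_letter; case: r s2 => [|? [|? [|? ?]]] //= s2 e; rewrite -e in s2.
  - by [].
case: s => [|l1 [|l2 [|? ?]]] // _.
rewrite dpairZ dpairE (act_der pb) /der /= !act_head_letter mulr0 addr0.
rewrite (bigD1 b) //= big1 => [|b' b'b]; last first.
  by rewrite lsh_lmulL (negPf b'b) (flZ (@flin_letter K _)) (flZ (flin_tbrkr _ _)) fE mul0r mulr0.
rewrite lsh_lmulL eqxx fmul1 addr0 2!mulrDr mulrA sgsq mul1r -addrA; congr (_ + _).
rewrite [RHS]mulrDr; congr (_ + _).
  case: l1 => -[|b' u] v /=; rewrite ?mulr0 // lsh_lmulL dpairZ.
  by rewrite dform_letter.
case: l2 => -[|b' u] v /=; rewrite ?mulr0 // lsh_lmulL dpairZ.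
rewrite /sh dform_letter; have [->|_] := eqVneq b' b; last by rewrite !mul0r !mulr0.
move: (dA l1) (dW b) => a1 bb; rewrite mulrDr mulr1 sgD (mulrC a1); ring.
Qed.

(** The 1-form dx in normal form. Its coefficient at u (x) da is the coefficient of the word ua in
    x, a Fox derivative. *)
Definition dvec x : T := letter (norm1 (tens (@tone K (bas V)) x)).

Lemma flin_dvec : flin dvec.
Proof.
exact: (flin_comp (flin_comp (flin_tensr _) (@flin_norm1 K V)) (@flin_letter K _)).
Qed.

Lemma norm_dvec x : norm (dvec x) = dvec x.
Proof. by rewrite /dvec norm_letter norm1K. Qed.

Lemma norm1_tone x u v : norm1 (tens (@tone K (bas V)) x) (u, v) =
  if v is [:: a] then x (rcons u a) else 0.
Proof. by rewrite norm1_tens; case: v => [|a [|? ?]] //; rewrite tmul1l. Qed.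

Lemma dvec_letter b : dvec (letter (delta b)) = dbas b.
Proof.
rewrite /dvec /dbas; congr letter; apply: funext => -[u v]; rewrite norm1_tone /delta xpair_eqE.
case: v => [|a [|a' v]]; rewrite ?eqseq_cons ?andbF //.
by case: u => [|c [|c' u]]; rewrite //= andbT.
Qed.

Lemma dvec_par p x : parX p x -> parT (1 + p) (dvec x).
Proof.
move=> px; apply: par_letter => -[u v]; rewrite norm1_tone.
case: v => [|a [|? ?]]; auto; case: (px (rcons u a)) => [->|e]; [by left | right].
rewrite /degA /= /degT !oddE; move: e; rewrite -cats1 wdeg_cat oddzD.
by case: (odd _); case: (odd _); case: (odd `|p|%N).
Qed.

Lemma dvec_tau k x : dvec (tauX k x) = sg k \*o tauT k (dvec x).
Proof.
rewrite /dvec -letter_tau -(flZ (@flin_letter K _)); congr letter.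
apply: funext => -[u v]; rewrite fE /tau !norm1_tone; case: v => [|a [|? ?]]; rewrite ?mulr0 //.
rewrite /degA /= /degT -cats1 wdeg_cat !(mulrDr k) !sgD mulr1 !mulrA.
by rewrite mulrC -!mulrA; have := sgsq K k; set c := sg k => cc;
  rewrite [RHS](_ : _ = (c * c) * (sg (k * wdeg dW u) * (sg (k * wdeg dW [:: a]) * x (u ++ [:: a]))));
  [rewrite cc mul1r; ring | ring].
Qed.

(** The Fox rule differentiates the last letter of each word, and in a product this letter belongs
    to y as soon as y has no constant term; hence d(xy) = x dy. *)
Lemma dvec_tmul x y : y [::] = 0 ->
  dvec (tmul x y) = letter (lmulL x (norm1 (tens (@tone K _) y))).
Proof.
move=> y0; congr letter; apply: funext => -[u v]; rewrite norm1_tone /lmulL /=.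
case: v => [|a [|? ?]].
- by rewrite /tmul big1 // => i _; rewrite norm1_tone mulr0.
- rewrite /tmul size_rcons big_ord_recr /= drop_oversize ?size_rcons // y0 mulr0 addr0.
  apply: eq_bigr => i _; rewrite norm1_tone.
  have iu : (i <= size u)%N by rewrite -ltnS.
  by rewrite drop_rcons // -cats1 takel_cat.
- by rewrite /tmul big1 // => i _; rewrite norm1_tone mulr0.
Qed.

Lemma act_letterT x t : act false x (letter t) = letter (lmulL (tauX 1 x) t).
Proof.
suff /(congr1 (fun F => F x)) : (fun x => act false x (letter t)) =
  (fun x => letter (lmulL (tauX 1 x) t)) by [].
apply: flin_eq => [||u].
- exact: flin_actl.
- have fl : flin (fun x => lmulL x t).
    by move=> l; apply: func_sum => i _; apply: funcZr; apply: func_at.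
  exact: (flin_comp (flin_comp (@flin_tau K _ (wdeg dW) 1) fl) (@flin_letter K _)).
have pu := @par_delta K _ (wdeg dW) u.
by rewrite (act_letter pu) (tau_par _ pu) mul1r lmulLZ.
Qed.

Lemma norm_actT x f : norm (act false x f) = act false x (norm f).
Proof.
suff /(congr1 (fun F => F x)) : (fun x => norm (act false x f)) =
  (fun x => act false x (norm f)) by [].
apply: flin_eq => [||u].
- exact: (flin_comp (flin_actl false f) (@flin_norm K V)).
- exact: flin_actl.
- exact: (norm_act _ (@par_delta K _ (wdeg dW) u)).
Qed.

Lemma act_twist_par p x f : parT p f -> act true x f = act false (tauX p x) f.
Proof.
move=> pf; apply: funext => s; apply: eq_bigr => k _; apply: eq_bigr => i _.
rewrite /= !ksgnE /tau; set w := take i _; set r := _ ++ _.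
have := par_sg (degT w) r pf => h.
rewrite addr0 sgD (mulrC p) -/(degT w).
by rewrite [LHS]mulrACA [LHS]mulrC h; ring.
Qed.

(* The derivation d of the free Lie algebra on 1-forms satisfies
   [d, act x] = [dx, -] as soon as x is a Lie element. *)
Definition dcompat x := [/\ x [::] = 0, exists p, parX p x &
  forall f, dform (act false x f) =
    tbrk dA (dvec x) f + act false (tauX 1 x) (dform f)].

Lemma nder_tbrkl p g : parT p g -> nder dA id p (tbrk dA g).
Proof.
move=> pg; split; first exact: flin_tbrkr.
move=> h h'; rewrite !(tbrkE _ pg) tau_tmul tmulBl tmulBr !tmulA.
by rewrite addrA subrK.
Qed.

(** The commutator of [dform] with the action of b and the bracket with db are derivations of the
    same degree, and [dform_act_letter] compares them on letters. *)
Lemma dcompat_letter b : dcompat (letter (delta b)).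
Proof.
split => //; first by exists (dW b); exact: par_basis.
have pb := par_basis b; have [nb nd] := (nder_act pb, @nder_dform K V).
have := nder_eq (@nmor_id K _)
  (nder_comm nd nb (@parop_dform K V) (parop_act pb)) (nder_tbrkl (@par_dbas K V b)).
move=> h f; rewrite dvec_letter (tau_par _ pb) mul1r (flZ (flin_actl _ _)).
rewrite -h => [|l]; rewrite /= mul1r ?subrK //.
by rewrite dform_act_letter addrK.
Qed.

(** The action of a bracket is the graded commutator of the actions. Moving [dform] through both
    composites leaves brackets with x.dy and y.dx, which assemble to the bracket with d[x,y]; the
    remaining terms cancel. *)
Lemma dcompat_tbrk x y : dcompat x -> dcompat y -> dcompat (tbrk dW x y).
Proof.
move=> [x0 [p px] hx] [y0 [q qy] hy].
have pxy := par_tbrk px qy.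
split; first by rewrite (tbrk_par px qy) !fE !tmul_nil x0 mul0r !mulr0 subrr.
  by exists (p + q).
move=> f; have [fd _] := @nder_dform K V.
rewrite (tau_par _ pxy) mul1r (flZ (flin_actl _ _)) (act_tbrk px qy).
rewrite (flB fd) (flZ fd) (hx (act false y f)) (hy (act false x f)) (hx f) (hy f).
have [fx _] := nder_act px; have [fy _] := nder_act qy.
rewrite !(tau_par _ px) !(tau_par _ qy) !mul1r !(flZ (flin_actl _ _)).
rewrite (flD fx) (flD fy) (flZ fx) (flZ fy).
rewrite (nder_tbrk (nder_act px) (parop_act px)) (nder_tbrk (nder_act qy) (parop_act qy)).
rewrite (tau_par _ (dvec_par px)) (tau_par _ (dvec_par qy)).
rewrite !(flZ (flin_tbrkl _ _)).
(* The Fox rule on the two products in [x,y]; the signs sg p and sg q undo those of [act_letter]. *)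
have -> : dvec (tbrk dW x y) = (sg p \*o act false x (dvec y)) -
    ((sg (p * q) * sg q) \*o act false y (dvec x)).
  rewrite (tbrk_par px qy) (flB flin_dvec) (flZ flin_dvec) !dvec_tmul //.
  rewrite /dvec (act_letter px) (act_letter qy) -!(flZ (@flin_letter K _)) !fmulA.
  by rewrite sgsq fmul1 -mulrA sgsq mulr1.
rewrite (flB (flin_tbrkl _ _)) !(flZ (flin_tbrkl _ _)) sgD.
apply: funext => s; rewrite !fE !mulrDr !mulr1 !sgD (mulrC q p).
have := sgsq K p; have := sgsq K q; have := sgsq K (p * q).
set a := sg (p * q); set b := sg p; set c := sg q => aa cc bb.
set u1 := tbrk _ (dvec x) _ _; set u2 := tbrk _ (dvec y) _ _.
have -> : b * (b * a * u2) = a * u2 by rewrite !mulrA bb mul1r.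
have -> : a * (c * (c * a * u1)) = u1.
  have -> : a * (c * (c * a * u1)) = (a * a) * (c * c) * u1 by ring.
  by rewrite aa cc !mul1r.
ring.
Qed.
End Identities.

(** * Free Lie algebras as closed spans of Lie monomials *)

Section FreeLie.
Variables (K : comAlgType rat) (A : eqType) (deg : A -> int).
Local Notation T := (seq A -> K).
Implicit Types (M : set (A -> K)).

Lemma closed_span_delta (B : eqType) (P : set B) (x : B -> K) :
  (forall b, x b <> 0 -> P b) ->
  closed_span [set f | exists2 b, P b & f = delta b] x.
Proof.
move=> xP; apply: closed_lim; first exact: closed_closed_span.
move=> F; exists (\sum_(b <- undup F) x b \*o delta b).
  apply: (closed_sum (@closed_closed_span _ _ _)) => b _; have [->|/eqP xb] := eqVneq (x b) 0.
    have -> : 0 \*o delta b = 0 :> (B -> K) by apply: funext => c; rewrite fE mul0r.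
    exact: (closed0 (@closed_closed_span _ _ _)).
  apply: (closedZ (@closed_closed_span _ _ _)).
  by apply: closed_span_sub; exists b => //; apply: xP.
move=> b bF; rewrite fsumE (bigD1_seq b) ?mem_undup ?undup_uniq //= delta_at mulr1.
by rewrite big1 ?addr0 // => c cb; rewrite /delta /= eq_sym (negPf cb) mulr0.
Qed.

Lemma closed_free_lie M : csubmod (free_lie deg M).
Proof. exact: closed_closed_span. Qed.

Lemma free_lie_monomial M f : lie_monomial deg M f -> free_lie deg M f.
Proof. by move=> mf; apply: closed_span_sub. Qed.

Lemma free_lie_tbrk M f g : free_lie deg M f -> free_lie deg M g ->
  free_lie deg M (tbrk deg f g).
Proof.
have cM := @closed_free_lie M.
move=> Mf Mg; move: f Mf.
apply: (clin_span (closedT (B := _)) (flin_clin setT (flin_tbrkl deg g)) cM) => // f mf.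
move: g Mg; apply: (clin_span (closedT (B := _)) (flin_clin setT (flin_tbrkr deg f)) cM) => // g mg.
by apply: free_lie_monomial; apply: LieBracket.
Qed.

Lemma free_lie_sub M M' : (forall x, M x -> free_lie deg M' (letter x)) ->
  free_lie deg M `<=` free_lie deg M'.
Proof.
move=> MM; apply: closed_spanT; first exact: closed_free_lie.
by move=> f; elim=> [x /MM //|g h _ Mg _ Mh]; apply: free_lie_tbrk.
Qed.

Lemma free_lie_letter M x : closed_span M x -> free_lie deg M (letter x).
Proof.
move: x; apply: (clin_span (closedT (B := _)) (flin_clin setT (@flin_letter K A))) => //.
  exact: closed_free_lie.
by move=> x Mx; apply: free_lie_monomial; apply: LieLetter.
Qed.

Lemma free_lie_span M M' : M `<=` closed_span M' -> free_lie deg M `<=` free_lie deg M'.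
Proof. by move=> MM; apply: free_lie_sub => x /MM; apply: free_lie_letter. Qed.

Lemma free_lie_ind M (C : eqType) (D : T -> C -> K) (P : set (C -> K)) :
  csubmod P -> flin D -> (forall f, lie_monomial deg M f -> P (D f)) ->
  forall f, free_lie deg M f -> P (D f).
Proof.
move=> cP fD h; apply: (clin_span (closedT (B := _)) (flin_clin setT fD)) => //.
Qed.

Lemma free_lie_nil M f : free_lie deg M f -> f [::] = 0.
Proof.
move=> Mf.
suff : [set 0] (fun _ : bool => f [::]) by move=> /(congr1 (fun F => F true)).
move: f Mf; apply: (free_lie_ind (D := fun f (_ : bool) => f [::])).
- exact: closed_eq0.
- by move=> _; apply: func_at.
move=> f; elim=> [x _|g h _ g0 _ h0] //; apply: funext => b; rewrite fzeroE.
have := congr1 (fun F => F true) g0; have := congr1 (fun F => F true) h0 => /= e e'.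
by rewrite /tbrk big_ord1 /= e e' !mulr0 scaler0 subr0.
Qed.

Lemma free_lie_tau M k f :
  (forall x, M x -> closed_span M (tau deg k x)) ->
  free_lie deg M f -> free_lie deg M (tau (wdeg deg) k f).
Proof.
move=> Mt; move: f; apply: free_lie_ind; [exact: closed_free_lie | exact: flin_tau |].
move=> f; elim=> [x /Mt/free_lie_letter h|g h _ Mg _ Mh]; last first.
  by rewrite tau_tbrk; apply: free_lie_tbrk.
suff -> : tau (wdeg deg) k (letter x) = letter (tau deg k x) by [].
apply: funext => -[|l [|l' s]]; rewrite /tau /= ?mulr0 //.
by rewrite wdeg_cons wdeg_nil addr0.
Qed.
End FreeLie.

(** * Topological generators of the Lie algebra and of its 1-forms *)

Section Carriers.
Variables (K : comAlgType rat) (gr : even_grading K) (V : free_module).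
Local Notation X := (seq (bas V) -> K).
Local Notation L1 := (pair_ix V -> K).
Local Notation T := (seq (pair_ix V) -> K).
Local Notation dW := (@degW V).
Local Notation dA := (@degA V).
Local Notation tauX := (tau (wdeg dW)).
Local Notation tauT := (tau (wdeg dA)).
Local Notation parX := (par (wdeg dW)).
Local Notation parT := (par (wdeg dA)).
Local Notation LW := (@LW K V).
Local Notation lcW := (lcar (l := LW)).
Implicit Types (x y z : X) (t : L1) (f g : T).

Definition basis : set (bas V -> K) := [set f | exists2 b, setT b & f = delta b].
(** Monomials in basis letters, as opposed to arbitrary letters, are homogeneous, and they still
    span topologically; signs and bracket relations are always checked on them. *)
Definition bmon : set X := [set x | lie_monomial dW basis x].

Lemma lcW_span : lcW = closed_span bmon.
Proof.
apply/seteqP; split; last first.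
  apply: closed_span_mono => x; elim=> [t _|y z _ my _ mz]; first exact: LieLetter.
  exact: LieBracket.
by apply: free_lie_span => x _; apply: closed_span_delta.
Qed.

Lemma closed_lcW : csubmod lcW. Proof. exact: closed_free_lie. Qed.

Lemma lcW_letter (t : bas V -> K) : lcW (letter t).
Proof. by apply: free_lie_monomial; apply: LieLetter. Qed.

Lemma lcW_tbrk x y : lcW x -> lcW y -> lcW (tbrk dW x y).
Proof. exact: free_lie_tbrk. Qed.

Lemma lcW_nil x : lcW x -> x [::] = 0.
Proof. exact: free_lie_nil. Qed.

Lemma lcW_bmon x : bmon x -> lcW x.
Proof. by rewrite lcW_span; apply: closed_span_sub. Qed.

Lemma bmon_par x : bmon x -> exists p, parX p x.
Proof.
elim=> [_ [b _ ->]|y z _ [p py] _ [q qz]]; first by exists (dW b); apply: par_basis.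
by exists (p + q); apply: par_tbrk.
Qed.

Lemma lcW_tau k x : lcW x -> lcW (tauX k x).
Proof. by apply: free_lie_tau => t _; apply: closed_span_sub. Qed.

Lemma lcW_ind (C : eqType) (D : X -> C -> K) (P : set (C -> K)) :
  csubmod P -> flin D -> (forall x, bmon x -> P (D x)) -> forall x, lcW x -> P (D x).
Proof. move=> cP fD h x; rewrite lcW_span => lx; exact: (free_lie_ind cP fD h lx). Qed.

(** With the sign carried by [tau] both sides are continuous and linear in x, so the compatibility
    spreads from monomials to all Lie elements. *)
Lemma lcW_dform x f : lcW x -> dform (act false x f) =
  tbrk dA (dvec x) f + act false (tauX 1 x) (dform f).
Proof.
move=> lx; apply/eqP; rewrite -subr_eq0; apply/eqP; move: x lx.
have [fd _] := @nder_dform K V.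
apply: (lcW_ind (P := [set 0]) (D := fun x => dform (act false x f) -
  (tbrk dA (dvec x) f + act false (tauX 1 x) (dform f)))).
- exact: closed_eq0.
- apply: flinB; first exact: (flin_comp (flin_actl false f) fd).
  apply: flinD; first exact: (flin_comp (@flin_dvec K V) (flin_tbrkl dA f)).
  exact: (flin_comp (@flin_tau K _ (wdeg dW) 1) (flin_actl false (dform f))).
move=> x mx; suff [_ _ ->] : dcompat x by rewrite subrr.
elim: mx => [_ [b _ ->]|y z _ hy _ hz]; [exact: dcompat_letter | exact: dcompat_tbrk].
Qed.

Lemma closed_Ug_g : csubmod (@Ug_g K V). Proof. exact: closed_closed_span. Qed.

Lemma Ug_g_tens x y : lcW y -> Ug_g (tens x y).
Proof. by move=> ly; apply: closed_span_sub; exists x, y. Qed.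

Lemma Ug_g_ind (C : eqType) (D : L1 -> C -> K) (P : set (C -> K)) :
  csubmod P -> flin D -> (forall x y, lcW y -> P (D (tens x y))) ->
  forall t, Ug_g t -> P (D t).
Proof.
move=> cP fD h; apply: (clin_span (closedT (B := _)) (flin_clin setT fD)) => //.
by move=> _ [x [y ly ->]]; apply: h.
Qed.

Definition upair : set L1 := [set t | exists u, exists2 m, bmon m & t = tens (delta u) m].

Lemma Ug_g_upair t : Ug_g t -> closed_span upair t.
Proof.
move: t; apply: (Ug_g_ind (D := id)); [exact: closed_closed_span | exact: flin_id |].
move=> x y; move: y; apply: (lcW_ind (P := closed_span upair)); [exact: closed_closed_span | exact: flin_tensr |].
move=> y my.
have := @closed_span_delta K _ setT x (fun _ _ => I); move: x.
apply: (clin_span (closedT (B := _)) (flin_clin setT (flin_tensl y))) => //.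
  exact: closed_closed_span.
by move=> _ [u _ ->]; apply: closed_span_sub; exists u, y.
Qed.

Lemma Ug_g_lmulL x t : Ug_g t -> Ug_g (lmulL x t).
Proof.
move: t; apply: Ug_g_ind; [exact: closed_Ug_g | exact: flin_lmulL |].
by move=> y z lz; rewrite lmulL_tens; apply: Ug_g_tens.
Qed.

Lemma tau_tens k x y :
  tau dA k (tens x y) = sg k \*o tens (tauX k x) (tauX k y).
Proof.
apply: funext => -[u v]; rewrite fE /tau /tens /degA /= /degT.
by rewrite !(mulrDr k) !sgD mulr1; ring.
Qed.

Lemma Ug_g_tau k t : Ug_g t -> Ug_g (tau dA k t).
Proof.
move: t; apply: Ug_g_ind; [exact: closed_Ug_g | exact: flin_tau |].
move=> y z lz; rewrite tau_tens; apply: (closedZ closed_Ug_g).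
by apply: Ug_g_tens; apply: lcW_tau.
Qed.

Definition fmon : set T := [set f | lie_monomial dA upair f].

Lemma closed_LOmega1 : csubmod (@LOmega1 K V). Proof. exact: closed_free_lie. Qed.

Lemma upair_Ug_g t : upair t -> Ug_g t.
Proof. by move=> [u [m mm ->]]; apply: Ug_g_tens; apply: lcW_bmon. Qed.

Lemma LOmega1_span : @LOmega1 K V = closed_span fmon.
Proof.
apply/seteqP; split; first by apply: free_lie_span => t; apply: Ug_g_upair.
by apply: free_lie_span => t /upair_Ug_g tU; apply: closed_span_sub.
Qed.

Lemma LOmega1_ind (C : eqType) (D : T -> C -> K) (P : set (C -> K)) :
  csubmod P -> flin D -> (forall f, fmon f -> P (D f)) -> forall f, LOmega1 f -> P (D f).
Proof. move=> cP fD h f; rewrite LOmega1_span => lx; exact: (free_lie_ind cP fD h lx). Qed.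

Lemma LOmega1_letter t : Ug_g t -> LOmega1 (letter t).
Proof. by move=> Ut; apply: free_lie_monomial; apply: LieLetter. Qed.

Lemma LOmega1_tbrk f g : LOmega1 f -> LOmega1 g -> LOmega1 (tbrk dA f g).
Proof. exact: free_lie_tbrk. Qed.

Lemma LOmega1_tau k f : LOmega1 f -> LOmega1 (tauT k f).
Proof. by apply: free_lie_tau => t /(Ug_g_tau k); apply: closed_span_sub. Qed.

Lemma fmon_LOmega1 f : fmon f -> LOmega1 f.
Proof. by rewrite LOmega1_span; apply: closed_span_sub. Qed.

Lemma fmon_par f : fmon f -> exists p, parT p f.
Proof.
elim=> [_ [u [m /bmon_par[p pm] ->]]|y z _ [p py] _ [q qz]]; last first.
  by exists (p + q); apply: par_tbrk.
exists (degT u + p + 1); apply: par_letter => -[u' v]; rewrite /tens /delta /=.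
case: eqP => [->|_]; last by left; rewrite mul0r.
case: (pm v) => [->|e]; first by left; rewrite mulr0.
by right; rewrite /degA /= !oddE -e.
Qed.

Lemma LOmega1_act x f : lcW x -> LOmega1 f -> LOmega1 (act false x f).
Proof.
move=> lx Lf; move: x lx; apply: lcW_ind; [exact: closed_LOmega1 | exact: flin_actl |].
move=> x /bmon_par[p px]; move: f Lf.
apply: LOmega1_ind; [exact: closed_LOmega1 | exact: flin_act |].
move=> f; elim=> [t /upair_Ug_g Ut|g h mg Lg mh Lh].
  rewrite act_letterT; apply: LOmega1_letter; exact: Ug_g_lmulL.
rewrite (nder_tbrk (nder_act px) (parop_act px)).
have [Lg' Lh'] := (fmon_LOmega1 mg, fmon_LOmega1 mh).
apply: (closedD closed_LOmega1); apply: LOmega1_tbrk => //.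
exact: LOmega1_tau.
Qed.

Lemma LOmega1_act_true x f : lcW x -> LOmega1 f -> LOmega1 (act true x f).
Proof.
move=> lx; move: f; apply: LOmega1_ind; [exact: closed_LOmega1 | exact: flin_act |].
move=> f mf; have [p pf] := fmon_par mf; rewrite (act_twist_par _ pf).
by apply: LOmega1_act; [exact: lcW_tau | exact: fmon_LOmega1].
Qed.

(* The letters u (x) db with b a basis element: the normal forms of 1-forms. *)
Definition npair : set L1 :=
  [set t | exists2 l : pair_ix V, size l.2 = 1 & t = delta l].

Lemma npair_Ug_g t : npair t -> Ug_g t.
Proof.
move=> [[u [|a [|? ?]]] //= _ ->]; rewrite delta_pair; apply: Ug_g_tens.
by rewrite -letter_delta; apply: lcW_letter.
Qed.

Lemma norm1_npair t : closed_span npair (norm1 t).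
Proof.
apply: closed_span_delta => -[u [|a [|? ?]]] //=;
by rewrite /norm1 /pre big_nil.
Qed.

Lemma norm1_Ug_g t : Ug_g (norm1 t).
Proof.
have := norm1_npair t; apply: closed_spanT; first exact: closed_Ug_g.
exact: npair_Ug_g.
Qed.

Lemma norm_LOmega1 f : LOmega1 f -> free_lie dA npair (norm f).
Proof.
move: f; apply: LOmega1_ind; [exact: closed_free_lie | exact: flin_norm |].
move=> f; elim=> [t _|g h _ Lg _ Lh].
  by rewrite norm_letter; apply: free_lie_letter; apply: norm1_npair.
by rewrite norm_tbrk; apply: free_lie_tbrk.
Qed.

Lemma npair_LOmega1 f : free_lie dA npair f -> LOmega1 f.
Proof. by move: f; apply: free_lie_sub => t /npair_Ug_g/LOmega1_letter. Qed.

(** This is d(dv) = 0: no letter can be stripped from an empty first word, so every term of the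
    recursion vanishes. *)
Lemma dform_letter_nil v : dform (letter (delta ([::], v) : L1)) = 0.
Proof.
have e b : lsh b (delta ([::], v)) = 0 :> L1.
  by apply: funext => -[u w]; rewrite /lsh /delta xpair_eqE.
apply: funext => s; rewrite dform_letter; case: s => [|l1 [|l2 [|? ?]]] //.
have d0 l l' : dpair 0 l l' = 0 :> K by exact: (congr1 (fun F => F true) (fl0 (flin_dpair K l l'))).
rewrite dpairE big1 => [|b _]; last first.
  by rewrite e (fl0 (@flin_letter K _)) (fl0 (flin_tbrkr _ _)) fE mulr0.
by case: l1.1 => [|? ?]; case: l2.1 => [|? ?]; rewrite ?e ?d0 ?mulr0 ?addr0.
Qed.

Lemma lmulL_delta b u v :
  lmulL (letter (delta b)) (delta (u, v)) = delta (b :: u, v) :> L1.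
Proof. by rewrite !delta_pair lmulL_tens delta_cons. Qed.

Lemma LOmega1_dbas b : @LOmega1 K V (dbas K b).
Proof. by apply: LOmega1_letter; apply: npair_Ug_g; exists ([::], [:: b]). Qed.

(** For a normal letter u (x) db the induction is on u: its first letter acts on the shorter 1-form,
    and [dform_act_letter] expresses the result by a bracket and the action on an earlier value. *)
Lemma dform_LOmega1 f : free_lie dA npair f -> LOmega1 (dform f).
Proof.
move: f; have [fd _] := @nder_dform K V.
apply: free_lie_ind; [exact: closed_LOmega1 | exact: fd |].
move=> f; elim=> [_ [[u v] /= v1 ->]|g h mg Lg mh Lh]; last first.
  rewrite (nder_tbrk (@nder_dform K V) (@parop_dform K V)).
  have [Lg' Lh'] := (npair_LOmega1 (free_lie_monomial mg), npair_LOmega1 (free_lie_monomial mh)).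
  apply: (closedD closed_LOmega1); apply: LOmega1_tbrk => //.
  exact: LOmega1_tau.
elim: u => [|b u IH].
  rewrite dform_letter_nil; exact: (closed0 closed_LOmega1).
have pb := @par_basis K V b.
have e : letter (delta (b :: u, v)) = sg (dW b) \*o act false (letter (delta b)) (letter (delta (u, v))) :> T.
  by rewrite (act_letter pb) -(flZ (@flin_letter K _)) fmulA sgsq fmul1 lmulL_delta.
rewrite e (flZ fd) dform_act_letter; apply: (closedZ closed_LOmega1).
apply: (closedD closed_LOmega1).
  apply: LOmega1_tbrk; first exact: LOmega1_dbas.
  by apply: LOmega1_letter; apply: npair_Ug_g; exists (u, v).
apply: (closedZ closed_LOmega1); apply: LOmega1_act => //; exact: lcW_letter.
Qed.

Lemma dvec_LOmega1 x : @LOmega1 K V (dvec x).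
Proof. by apply: LOmega1_letter; apply: norm1_Ug_g. Qed.
End Carriers.

(** * The Lie de Rham algebra *)
Section OmegaStructure.
Variables (K : comAlgType rat) (gr : even_grading K) (V : free_module).
Local Notation X := (seq (bas V) -> K).
Local Notation L1 := (pair_ix V -> K).
Local Notation T := (seq (pair_ix V) -> K).
Local Notation dW := (@degW V).
Local Notation dA := (@degA V).
Local Notation parX := (par (wdeg dW)).
Local Notation parT := (par (wdeg dA)).
Local Notation LW := (@LW K V).
Local Notation lcW := (lcar (l := LW)).
Local Notation tone := (@tone K (bas V)).
Local Notation F := (form_ix V -> K).
Implicit Types (x y z : X) (t : L1) (f g : T).

Lemma hcompD i (a b : K) : gr i a -> gr i b -> gr i (a + b).
Proof.
move=> ha hb; rewrite -[b]opprK; apply: hcompB => //.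
by rewrite -sub0r; apply: hcompB => //; apply: hcomp0.
Qed.

Lemma hcomp_add_sum i I (r : seq I) (P : pred I) (G : I -> K) :
  (forall k, P k -> gr i (G k)) -> gr i (\sum_(k <- r | P k) G k).
Proof. by move=> h; apply: big_ind => //; [exact: hcomp0 | exact: hcompD]. Qed.

Lemma hcompN i (a : K) : gr i a -> gr i (- a).
Proof. by move=> ha; rewrite -sub0r; apply: hcompB => //; apply: hcomp0. Qed.

Lemma hcomp_sg i j (a : K) : gr i a -> gr i (sg j * a).
Proof. by rewrite /sg; case: ifP; rewrite ?mul1r ?mulN1r // => _; apply: hcompN. Qed.

Lemma hom0 (B : Type) (deg : B -> int) d : homogeneous gr deg d (0 : B -> K).
Proof. by move=> b; apply: hcomp0. Qed.

Lemma homD (B : Type) (deg : B -> int) d (f g : B -> K) :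
  homogeneous gr deg d f -> homogeneous gr deg d g -> homogeneous gr deg d (f + g).
Proof. by move=> hf hg b; apply: hcompD. Qed.

Lemma homN (B : Type) (deg : B -> int) d (f : B -> K) :
  homogeneous gr deg d f -> homogeneous gr deg d (- f).
Proof. by move=> hf b; apply: hcompN. Qed.

Lemma hom_sg (B : Type) (deg : B -> int) d j (f : B -> K) :
  homogeneous gr deg d f -> homogeneous gr deg d (sg j \*o f).
Proof. by move=> hf b; apply: hcomp_sg. Qed.

Lemma hom_tbrk (A : Type) (deg : A -> int) p q (f g : seq A -> K) :
  homogeneous gr (wdeg deg) p f -> homogeneous gr (wdeg deg) q g ->
  homogeneous gr (wdeg deg) (p + q) (tbrk deg f g).
Proof.
move=> hf hg w; apply: hcomp_add_sum => i _.
have e : wdeg deg w = wdeg deg (take i w) + wdeg deg (drop i w).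
  by rewrite /wdeg -big_cat cat_take_drop.
rewrite ksgnE e; apply: hcompB; last apply: hcomp_sg.
  have := hcompM (hf (take i w)) (hg (drop i w)).
  by congr (gr _ _); ring.
have := hcompM (hg (take i w)) (hf (drop i w)).
have [->|g0] := eqVneq (g (take i w) * f (drop i w)) 0; first by move=> _; apply: hcomp0.
by congr (gr _ _); ring.
Qed.

Lemma hom_delta (B : eqType) (deg : B -> int) b : homogeneous gr deg (deg b) (delta b).
Proof.
by move=> c; rewrite /delta; case: eqP => [->|_]; [rewrite subrr; apply: hcomp1 | apply: hcomp0].
Qed.

Lemma hom_letter (A : Type) (deg : A -> int) d (t : A -> K) :
  homogeneous gr deg d t -> homogeneous gr (wdeg deg) d (letter t).
Proof.
move=> ht [|a [|b s]]; [exact: hcomp0 | | exact: hcomp0].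
by rewrite /wdeg big_seq1; apply: ht.
Qed.

Lemma bmon_hom x : bmon x -> exists p, homogeneous gr (@degT V) p x.
Proof.
elim=> [_ [b _ ->]|y z _ [p hy] _ [q hz]].
  by exists (dW b); apply: hom_letter; apply: hom_delta.
by exists (p + q); apply: hom_tbrk.
Qed.

Lemma norm1_tone_tmul x y : y [::] = 0 ->
  norm1 (tens tone (tmul x y)) = lmulL x (norm1 (tens tone y)).
Proof.
move=> y0; have /(congr1 (fun f l => f [:: l])) := dvec_tmul x y0.
by move=> e; apply: funext => l; have := congr1 (fun h => h l) e.
Qed.

Lemma norm1_tensE x y : norm1 (tens x y) = lmulL x (norm1 (tens tone y)).
Proof. by rewrite -norm1_lmulL lmulL_tens tmul1r. Qed.

(** Lie elements have no constant term, so the Fox rule gives d(yz) = y dz and d(zy) = z dy, whose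
    signed difference is the defining relation. *)
Lemma norm1_rel_gen x y z p q : lcW y -> lcW z -> parX p y -> parX q z ->
  norm1 (tens x (tbrk dW y z) - tens (tmul x y) z + (sg (q * p) \*o tens (tmul x z) y)) = 0.
Proof.
move=> /lcW_nil y0 /lcW_nil z0 py qz; have fn := @flin_norm1 K V.
rewrite (flD fn) (flB fn) (flZ fn) (tbrk_par py qz).
rewrite (flB (flin_tensr x)) (flZ (flin_tensr x)) (flB fn) (flZ fn).
rewrite !(norm1_tensE x) (norm1_tensE (tmul x y)) (norm1_tensE (tmul x z)) !norm1_tone_tmul // !lmulL_tmul (mulrC q).
by apply: funext => l; rewrite !fE; ring.
Qed.

Lemma norm1_rel t : Omega1_rel gr t -> norm1 t = 0.
Proof.
move: t; apply: (clin_span (T := [set 0]) (closedT (B := _)) (flin_clin setT (@flin_norm1 K V))) => //.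
  exact: closed_eq0.
move=> _ [x [y [z [p [q [ly lz hy hz ->]]]]]]; rewrite fsg.
by apply: norm1_rel_gen; rewrite //; apply: homogeneous_par; eassumption.
Qed.

Lemma closed_Omega1_rel : csubmod (@Omega1_rel K gr V).
Proof. exact: closed_closed_span. Qed.

Lemma norm1_letter x b : norm1 (tens x (letter (delta b))) = tens x (letter (delta b)).
Proof.
rewrite norm1_tensE.
have -> : norm1 (tens tone (letter (delta b))) = tens tone (letter (delta b)).
  have /(congr1 (fun f l => f [:: l])) := dvec_letter K b => e.
  apply: funext => l; have /= -> := congr1 (fun h => h l) e.
  by rewrite delta_pair delta_nil -letter_delta.
by rewrite lmulL_tens tmul1r.
Qed.

(** The relations suffice to reach the normal form: x (x) d[y1,y2] is traded for xy1 (x) dy2 and xy2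
    (x) dy1. As the first factor changes, the induction on the monomial keeps x arbitrary. *)
Lemma sub_norm1 t : Ug_g t -> Omega1_rel gr (t - norm1 t).
Proof.
have cO := closed_Omega1_rel; have fn := @flin_norm1 K V.
have fd : flin (fun t => t - norm1 t) by apply: flinB => //; apply: flin_id.
move: t; apply: Ug_g_ind => // x y; move: y x.
suff h y : bmon y -> forall x, Omega1_rel gr (tens x y - norm1 (tens x y)).
  move=> y x; move: y; apply: (lcW_ind (P := @Omega1_rel K gr V)
    (D := fun y => tens x y - norm1 (tens x y))) => // [|y /h //].
  by apply: flinB; [exact: flin_tensr | exact: (flin_comp (flin_tensr x) fn)].
elim=> [_ [b _ ->] x|y1 y2 m1 h1 m2 h2 x].
  by rewrite norm1_letter subrr; apply: (closed0 cO).
have [p hp] := bmon_hom m1; have [q hq] := bmon_hom m2.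
have [l1 l2] := (lcW_bmon m1, lcW_bmon m2).
(* A generator of the relations; its normal form is 0, so subtracting it from the bracket term
   leaves the normal form unchanged. *)
pose r := tens x (tbrk dW y1 y2) - tens (tmul x y1) y2 + (sg (q * p) \*o tens (tmul x y2) y1).
have r0 : norm1 r = 0 by apply: norm1_rel_gen => //; apply: homogeneous_par; eassumption.
have -> : tens x (tbrk dW y1 y2) = r + tens (tmul x y1) y2 - (sg (q * p) \*o tens (tmul x y2) y1).
  by apply: funext => l; rewrite /r !fE; ring.
rewrite (flB fn) (flD fn) (flZ fn) r0 add0r.
have -> (a b c d e : L1) : a + b - c - (d - e) = a + (b - d) - (c - e).
  by apply: funext => l; rewrite !fE; ring.
apply: (closedB cO).
  apply: (closedD cO); last exact: h2.
  apply: closed_span_sub; exists x, y1, y2, p, q; split => //.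
  by rewrite fsg.
have -> (c : K) (a b : L1) : (c \*o a) - (c \*o b) = c \*o (a - b).
  by apply: funext => l; rewrite !fE mulrBr.
by apply: (closedZ cO); apply: h1.
Qed.

Definition plist (ts : seq L1) : T := \big[@tmul K (pair_ix V)/@Defs.tone K _]_(t <- ts) letter t.

Lemma plist_nil : plist [::] = @Defs.tone K _. Proof. by rewrite /plist big_nil. Qed.
Lemma plist_cons t ts : plist (t :: ts) = tmul (letter t) (plist ts).
Proof. by rewrite /plist big_cons. Qed.
Lemma plist_cat ts ts' : plist (ts ++ ts') = tmul (plist ts) (plist ts').
Proof.
elim: ts => [|t ts IH]; first by rewrite plist_nil tmul1l.
by rewrite cat_cons !plist_cons IH tmulA.
Qed.

Local Notation TA := (tensor_alg (@Ug_g K V)).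

Definition tgen : set T := [set f | exists2 ts, forall i, Ug_g (nth 0 ts i) & f = plist ts].

Lemma TA_span : TA = closed_span tgen.
Proof.
apply/seteqP; split; apply: closed_span_mono => f.
  move=> [m [s [ms ->]]]; exists [seq s i | i <- index_enum 'I_m].
    elim: (index_enum _) => [|j r IH] [|i] //=; exact: closed0 (@closed_Ug_g K V).
  by rewrite /plist big_map.
move=> [ts mts ->]; exists (size ts), (fun i => nth 0 ts i); split; first by move=> i; apply: mts.
by rewrite /plist (big_nth 0) big_mkord.
Qed.

Lemma closed_TA : csubmod TA. Proof. exact: closed_closed_span. Qed.

Lemma TA_ind (C : eqType) (D : T -> C -> K) (P : set (C -> K)) :
  csubmod P -> flin D ->
  (forall ts, (forall i, Ug_g (nth 0 ts i)) -> P (D (plist ts))) ->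
  forall f, TA f -> P (D f).
Proof.
move=> cP fD h f; rewrite TA_span; move: f.
apply: (clin_span (closedT (B := _)) (flin_clin setT fD)) => //.
by move=> _ [ts mts ->]; apply: h.
Qed.

Lemma TA_plist ts : (forall i, Ug_g (nth 0 ts i)) -> TA (plist ts).
Proof. by move=> mts; rewrite TA_span; apply: closed_span_sub; exists ts. Qed.

Lemma TA_tmul f g : TA f -> TA g -> TA (tmul f g).
Proof.
move=> Tf Tg; move: f Tf.
apply: TA_ind; [exact: closed_TA | exact: flin_tmull |] => ts mts; move: g Tg.
apply: TA_ind; [exact: closed_TA | exact: flin_tmulr |] => ts' mts'.
rewrite -plist_cat; apply: TA_plist => i; rewrite nth_cat; case: ifP => _; auto.
Qed.

Lemma TA_letter t : Ug_g t -> TA (letter t).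
Proof.
move=> Ut; have := @TA_plist [:: t]; rewrite plist_cons plist_nil tmul1r; apply.
by move=> [|[|i]] //=; exact: closed0 (@closed_Ug_g K V).
Qed.

Lemma LOmega1_TA f : LOmega1 f -> TA f.
Proof.
move: f; apply: (LOmega1_ind (D := id)); [exact: closed_TA | exact: flin_id |].
move=> f; elim=> [t /upair_Ug_g|g h mg Tg mh Th]; first exact: TA_letter.
have [p pg] := fmon_par mg; have [q qh] := fmon_par mh.
rewrite (tbrk_par pg qh); apply: (closedB closed_TA); first exact: TA_tmul.
by apply: (closedZ closed_TA); apply: TA_tmul.
Qed.

Lemma closed_LOmega1_rel : csubmod (@LOmega1_rel K gr V).
Proof. exact: closed_closed_span. Qed.

Lemma norm_LOmega1_rel f : LOmega1_rel gr f -> norm f = 0.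
Proof.
move: f; apply: (clin_span (T := [set 0]) (closedT (B := _)) (flin_clin setT (@flin_norm K V))) => //.
  exact: closed_eq0.
move=> _ [a [r [b [_ /norm1_rel r0 _ ->]]]]; have [fN _ mN] := @nmor_norm K V.
by rewrite !mN norm_letter r0 (fl0 (@flin_letter K _)) tmul0r tmul0l.
Qed.

Lemma LOmega1_rel_tmul a f : TA a -> LOmega1_rel gr f -> LOmega1_rel gr (tmul a f).
Proof.
move=> Ta; move: f; apply: (clin_span (closedT (B := _)) (flin_clin setT (flin_tmulr a))) => //.
  exact: closed_LOmega1_rel.
move=> _ [b [r [c [Tb Or Tc ->]]]]; apply: closed_span_sub.
by exists (tmul a b), r, c; split => //; [exact: TA_tmul | rewrite !tmulA].
Qed.

(** Letters are replaced by their normal forms one at a time, and each replacement changes the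
    product by an element of the two-sided ideal generated by the relations of 1-forms. *)
Lemma sub_norm f : LOmega1 f -> LOmega1_rel gr (f - norm f).
Proof.
move=> /LOmega1_TA; have [fN N1 mN] := @nmor_norm K V.
have cR := closed_LOmega1_rel.
move: f; apply: (TA_ind (D := fun f => f - norm f)) => //.
  by apply: flinB => //; apply: flin_id.
elim=> [_|t ts IH mts].
  by rewrite plist_nil N1 subrr; apply: (closed0 cR).
have Ut : Ug_g t := mts 0%N.
have mts' i : Ug_g (nth 0 ts i) := mts i.+1.
rewrite plist_cons mN norm_letter.
have -> : tmul (letter t) (plist ts) - tmul (letter (norm1 t)) (norm (plist ts)) =
    tmul (tmul (@Defs.tone K _) (letter (t - norm1 t))) (plist ts) +
    tmul (letter (norm1 t)) (plist ts - norm (plist ts)).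
  rewrite tmul1l (flB (@flin_letter K _)) tmulBl tmulBr.
  by rewrite addrA subrK.
apply: (closedD cR).
  apply: closed_span_sub; exists (@Defs.tone K _), (t - norm1 t), (plist ts); split => //.
  - by rewrite -plist_nil; apply: TA_plist => i; rewrite nth_nil; exact: closed0 (@closed_Ug_g K V).
  - exact: sub_norm1.
  - exact: TA_plist.
by apply: LOmega1_rel_tmul; [apply: TA_letter; apply: norm1_Ug_g | apply: IH].
Qed.

Implicit Types (h : F).
Local Notation Om := (@Omega K gr V).
Local Notation ocar := (lcar (l := Om)).
Local Notation orel := (lrel (l := Om)).
Local Notation obrk := (lbrk (l := Om)).

(** Turns membership in a closed ideal into the vanishing of an explicit normal form; all relations
    in the Lie de Rham algebra are verified in this way. *)
Lemma orelP (f : F) : orel f <-> [/\ ocar f, f \o inl = 0 & norm (f \o inr) = 0].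
Proof.
split=> [[cf f0 /norm_LOmega1_rel]|[[lf Lf] f0 n0]] //; split => //.
by have := sub_norm Lf; rewrite n0 subr0.
Qed.

Lemma flin_inl : flin (fun f : F => f \o inl : X).
Proof. by move=> u; apply: func_at. Qed.
Lemma flin_inr : flin (fun f : F => f \o inr : T).
Proof. by move=> u; apply: func_at. Qed.

Lemma flin_opair (B : eqType) (A : (B -> K) -> X) (A' : (B -> K) -> T) :
  flin A -> flin A' -> flin (fun b => opair (A b) (A' b)).
Proof. by move=> fA fA' [u|s]; [exact: fA | exact: fA']. Qed.

Lemma opair_eta (f : F) : f = opair (f \o inl) (f \o inr).
Proof. by apply: funext => -[]. Qed.

Lemma opairD (x x' : X) (a a' : T) : opair (x + x') (a + a') = opair x a + opair x' a' :> F.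
Proof. by apply: funext => -[]. Qed.

Lemma csub_preim (B C : eqType) (A : (B -> K) -> C -> K) (P : set (C -> K)) :
  flin A -> csubmod P -> csubmod [set b | P (A b)].
Proof.
move=> fA cP f cf; have := closed_preim (closedT (B := _)) (flin_clin setT fA) cP.
by move=> /(_ f) [|//]; apply: closed_span_mono cf => x Px; split.
Qed.

Lemma closed_ocar : csubmod ocar.
Proof.
apply: closedI.
  exact: (csub_preim flin_inl (@closed_lcW K V)).
exact: (csub_preim flin_inr (@closed_LOmega1 K V)).
Qed.

Lemma closed_orel : csubmod orel.
Proof.
have -> : orel = ocar `&` ([set f : F | [set 0] (f \o inl)] `&` [set f : F | [set 0] (norm (f \o inr))]).
  apply/seteqP; split=> f; first by move=> /orelP[? ? ?].
  by move=> [? [? ?]]; apply/orelP; split.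
apply: closedI; first exact: closed_ocar.
apply: closedI; first exact: (csub_preim flin_inl (@closed_eq0 _ _)).
exact: (csub_preim (flin_comp flin_inr (@flin_norm K V)) (@closed_eq0 _ _)).
Qed.

Lemma flin_obrkr (f : F) : flin (obrk f).
Proof.
apply: flin_opair; first exact: (flin_comp flin_inl (flin_tbrkr dW _)).
apply: flinD; last exact: (flin_comp flin_inr (flin_tbrkr dA _)).
apply: flinB; first exact: (flin_comp flin_inr (flin_act false _)).
exact: (flin_comp flin_inl (flin_actl true _)).
Qed.

Lemma flin_obrkl h : flin (fun f : F => obrk f h).
Proof.
apply: flin_opair; first exact: (flin_comp flin_inl (flin_tbrkl dW _)).
apply: flinD; last exact: (flin_comp flin_inr (flin_tbrkl dA _)).
apply: flinB; first exact: (flin_comp flin_inl (flin_actl false _)).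
exact: (flin_comp flin_inr (flin_act true _)).
Qed.

Lemma ocar_obrk (f h : F) : ocar f -> ocar h -> ocar (obrk f h).
Proof.
move=> [lf Lf] [lh Lh]; split; first exact: lcW_tbrk.
apply: (closedD (@closed_LOmega1 K V)); last exact: LOmega1_tbrk.
apply: (closedB (@closed_LOmega1 K V)); first exact: LOmega1_act.
exact: LOmega1_act_true.
Qed.

Lemma norm_act_true x f : norm (act true x f) = act true x (norm f).
Proof.
suff /(congr1 (fun G => G f)) : (fun f => norm (act true x f)) = (fun f => act true x (norm f)) by [].
have fN := @flin_norm K V.
apply: flin_eq; [exact: (flin_comp (flin_act true x) fN) | exact: (flin_comp fN (flin_act true x)) |].
move=> s; have ps := @par_delta K _ (wdeg dA) s.
have pns : parT (wdeg dA s) (norm (delta s : T)).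
  by apply: tau1_par; rewrite -norm_tau (tau_par _ ps) (flZ fN) mul1r.
by rewrite (act_twist_par _ ps) (act_twist_par _ pns) norm_actT.
Qed.

Lemma norm_obrk (f h : F) : norm (obrk f h \o inr) =
  act false (f \o inl) (norm (h \o inr)) - act true (h \o inl) (norm (f \o inr))
  + tbrk dA (norm (f \o inr)) (norm (h \o inr)).
Proof.
have fN := @flin_norm K V.
by rewrite -norm_tbrk -norm_act_true -norm_actT -(flB fN) -(flD fN).
Qed.

Lemma orel_ocar (f : F) : orel f -> ocar f. Proof. by case/orelP. Qed.

Lemma orel_obrkl (f h : F) : orel f -> ocar h -> orel (obrk f h).
Proof.
move=> /orelP[cf f0 n0] ch; apply/orelP; split; first exact: ocar_obrk.
  by rewrite -[_ \o inl]/(tbrk dW (f \o inl) (h \o inl)) f0 (fl0 (flin_tbrkl _ _)).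
rewrite norm_obrk n0 f0 (fl0 (flin_tbrkl _ _)) (fl0 (flin_actl _ _)) (fl0 (flin_act _ _)).
by rewrite subrr addr0.
Qed.

Lemma orel_obrkr (f h : F) : ocar f -> orel h -> orel (obrk f h).
Proof.
move=> cf /orelP[ch h0 n0]; apply/orelP; split; first exact: ocar_obrk.
  by rewrite -[_ \o inl]/(tbrk dW (f \o inl) (h \o inl)) h0 (fl0 (flin_tbrkr _ _)).
rewrite norm_obrk n0 h0 (fl0 (flin_tbrkr _ _)) (fl0 (flin_actl _ _)) (fl0 (flin_act _ _)).
by rewrite subrr addr0.
Qed.

Definition omon : set F := [set f : F | (exists2 x, bmon x & f = opair x 0) \/
  (exists2 g, fmon g & f = opair 0 g)].

Lemma omon_ocar (f : F) : omon f -> ocar f.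
Proof.
move=> [[x mx ->]|[g mg ->]]; split.
- exact: lcW_bmon. - exact: (closed0 (@closed_LOmega1 K V)).
- exact: (closed0 (@closed_lcW K V)). - exact: fmon_LOmega1.
Qed.

Lemma flin_opairl : flin (fun x : X => opair x 0 : F).
Proof. by apply: flin_opair; [exact: flin_id | move=> c; exact: func0]. Qed.
Lemma flin_opairr : flin (fun g : T => opair 0 g : F).
Proof. by apply: flin_opair; [move=> c; exact: func0 | exact: flin_id]. Qed.

Lemma ocar_ind (P : set F) : csubmod P -> (forall x, bmon x -> P (opair x 0)) ->
  (forall g, fmon g -> P (opair 0 g)) -> forall f : F, ocar f -> P f.
Proof.
move=> cP hx hg f [lf Lf]; rewrite (opair_eta f).
have -> : opair (f \o inl) (f \o inr) = opair (f \o inl) 0 + opair 0 (f \o inr) :> F.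
  by rewrite -opairD addr0 add0r.
apply: (closedD cP); first exact: (lcW_ind cP flin_opairl hx lf).
exact: (LOmega1_ind cP flin_opairr hg Lf).
Qed.

Lemma ocar_span (f : F) : ocar f -> closed_span omon f.
Proof.
apply: (ocar_ind (P := closed_span omon)); first exact: closed_closed_span.
  by move=> x mx; apply: closed_span_sub; left; exists x.
by move=> g mg; apply: closed_span_sub; right; exists g.
Qed.

(** In the quotient, d[y,z] is a signed combination of [y,dz] and [z,dy]. So differentials of
    monomials are generated by letters and differentials of letters. *)
Lemma tens_tbrk_rel y z p q : lcW y -> lcW z -> parX p y -> parX q z ->
  orel (opair 0 (letter (tens tone (tbrk dW y z))) -
    ((sg p \*o obrk (opair y 0) (d_of z)) - ((sg (p * q) * sg q) \*o obrk (opair z 0) (d_of y)))).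
Proof.
move=> ly lz py qz.
have cO := closed_ocar.
have c0 x : lcW x -> ocar (opair x 0) by split => //; exact: (closed0 (@closed_LOmega1 K V)).
have cd x : lcW x -> ocar (d_of x : F).
  by split; [exact: (closed0 (@closed_lcW K V)) | apply: LOmega1_letter; apply: Ug_g_tens].
apply/orelP; split.
- apply: (closedB cO); first by apply: cd; apply: lcW_tbrk.
  by apply: (closedB cO); apply: (closedZ cO); apply: ocar_obrk; auto.
- apply: funext => u; rewrite /= !fE /= /lbrk /=.
  have e x : tbrk dW x 0 u = 0 by rewrite (fl0 (flin_tbrkr _ _)).
  rewrite -[(opair y 0 \o inl)]/y -[(opair z 0 \o inl)]/z.
  by rewrite !e !mulr0 !subr0.
have fN := @flin_norm K V.
have e x x' : obrk (opair x 0) (d_of x') \o inr = act false x (letter (tens tone x')).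
  rewrite -[obrk _ _ \o inr]/(act false x (letter (tens tone x')) - act true 0 0 + tbrk dA 0 (letter (tens tone x'))).
  by rewrite (fl0 (flin_actl _ _)) (fl0 (flin_tbrkl _ _)) subr0 addr0.
have -> : (opair 0 (letter (tens tone (tbrk dW y z))) -
    ((sg p \*o obrk (opair y 0) (d_of z)) - ((sg (p * q) * sg q) \*o obrk (opair z 0) (d_of y)))) \o inr
  = letter (tens tone (tbrk dW y z)) - ((sg p \*o (obrk (opair y 0) (d_of z) \o inr))
    - ((sg (p * q) * sg q) \*o (obrk (opair z 0) (d_of y) \o inr))).
  by apply: funext => s.
rewrite !e (act_letter py) (act_letter qz) -!(flZ (@flin_letter K _)) -!(flB (@flin_letter K _)).
rewrite norm_letter !fmulA sgsq fmul1 -mulrA sgsq mulr1 !lmulL_tens !tmul1r.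
have := norm1_rel_gen tone ly lz py qz; rewrite !tmul1l => h.
rewrite -[RHS](fl0 (@flin_letter K _)) -h; congr letter; congr norm1.
by apply: funext => l; rewrite !fE (mulrC q); ring.
Qed.

(** Modulo relations the algebra is topologically generated by the letters b and db: differentials
    of monomials reduce to these by [tens_tbrk_rel], and u (x) dm arises from dm by letting the
    letters of u act one after the other. Uniqueness of derivations and morphisms rests on this. *)
Lemma ocar_gen (P : set F) : csubmod P -> orel `<=` P ->
  (forall f h : F, ocar f -> ocar h -> P f -> P h -> P (obrk f h)) ->
  (forall b, P (of_g (letter (delta b)))) -> (forall b, P (d_of (letter (delta b)))) ->
  ocar `<=` P.
Proof.
move=> cP rP bP gP dP.
have c0 x : lcW x -> ocar (opair x 0) by split => //; exact: (closed0 (@closed_LOmega1 K V)).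
have cd x : lcW x -> ocar (d_of x : F).
  by split; [exact: (closed0 (@closed_lcW K V)) | apply: LOmega1_letter; apply: Ug_g_tens].
have cr g : LOmega1 g -> ocar (opair 0 g) by split => //; exact: (closed0 (@closed_lcW K V)).
have gmon x : bmon x -> P (opair x 0).
  elim=> [_ [b _ ->]|y z my Py mz Pz]; first exact: gP.
  have := bP _ _ (c0 _ (lcW_bmon my)) (c0 _ (lcW_bmon mz)) Py Pz.
  congr P; apply: funext => -[u|s] //=.
  by rewrite !fE -[opair _ _ \o inr]/(0 : T) (fl0 (flin_act _ _)) (fl0 (flin_act _ _)) (fl0 (flin_tbrkl _ _)) subrr addr0.
have dmon x : bmon x -> P (d_of x).
  elim=> [_ [b _ ->]|y z my Py mz Pz]; first exact: dP.
  have [ly lz] := (lcW_bmon my, lcW_bmon mz).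
  have [[p py] [q qz]] := (bmon_par my, bmon_par mz).
  have /rP h := tens_tbrk_rel ly lz py qz.
  have := closedD cP h.
  set A := (_ - _ in X in X -> _) => hA.
  rewrite /d_of; set B := opair 0 _.
  set C := (sg p \*o _ - _) in h.
  have -> : B = (B - C) + C by rewrite subrK.
  apply: (closedD cP) => //.
  by apply: (closedB cP); apply: (closedZ cP); apply: bP; auto.
have brk_r x g : obrk (opair x 0) (opair 0 g) = opair 0 (act false x g).
  apply: funext => -[u|s].
    by rewrite /= -[opair 0 g \o inl]/(0 : X) (fl0 (flin_tbrkr _ _)).
  rewrite /= -[opair x 0 \o inr]/(0 : T) -[opair 0 g \o inl]/(0 : X).
  by rewrite !fE (fl0 (flin_actl _ _)) (fl0 (flin_tbrkl _ _)) subr0 addr0.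
apply: ocar_ind => // g; elim=> [_ [u [m mm ->]]|g1 g2 m1 P1 m2 P2]; last first.
  have := bP _ _ (cr _ (fmon_LOmega1 m1)) (cr _ (fmon_LOmega1 m2)) P1 P2.
  congr P; apply: funext => -[u|s] /=.
    by rewrite -[opair 0 g1 \o inl]/(0 : X) (fl0 (flin_tbrkl _ _)).
  rewrite -[opair 0 g1 \o inl]/(0 : X) -[opair 0 g2 \o inl]/(0 : X).
  by rewrite !fE !(fl0 (flin_actl _ _)) subrr add0r.
elim: u => [|b u IH].
  by rewrite delta_nil; apply: dmon.
have pb := @par_basis K V b.
have -> : letter (tens (delta (b :: u)) m) = sg (dW b) \*o act false (letter (delta b)) (letter (tens (delta u) m)) :> T.
  by rewrite (act_letter pb) -(flZ (@flin_letter K _)) fmulA sgsq fmul1 lmulL_tens delta_cons.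
rewrite (flZ flin_opairr) -brk_r; apply: (closedZ cP); apply: bP => //.
- by apply: c0; apply: lcW_letter.
- by apply: cr; apply: LOmega1_letter; apply: Ug_g_tens; apply: lcW_bmon.
- exact: gP.
Qed.
End OmegaStructure.

(** * Projections to the components of a weight *)

Section Grading.
Variables (K : comAlgType rat).

(** The index is an integer so that differences of weights are allowed; components of negative index
    are 0. *)
Definition Pi (B : eqType) (ga : B -> nat) (n : int) (f : B -> K) : B -> K :=
  fun b => if (ga b)%:Z == n then f b else 0.

Lemma flin_Pi (B : eqType) (ga : B -> nat) n : flin (Pi ga n).
Proof. by move=> b; rewrite /Pi; case: (_ == _); [exact: func_at | exact: func0]. Qed.

Lemma Pi_delta (B : eqType) (ga : B -> nat) n b :
  Pi ga n (delta b) = if (ga b)%:Z == n then delta b else 0.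
Proof.
apply: funext => c; rewrite /Pi; have [->|cb] := eqVneq c b; first by case: ifP.
have d0 : delta b c = 0 :> K by rewrite /delta (negPf cb).
by rewrite d0 if_same; case: ifP.
Qed.

Lemma Pi_Pi (B : eqType) (ga : B -> nat) n m f :
  Pi ga n (Pi ga m f) = if n == m then Pi ga n f else 0.
Proof.
apply: funext => c; have [->|/eqP nm] := eqVneq n m; rewrite /Pi; case: eqP => // e.
by case: eqP => // e'; case: nm; rewrite -e e'.
Qed.

Definition supp (B : eqType) (ga : B -> nat) (n : int) (f : B -> K) :=
  forall b, f b <> 0 -> (ga b)%:Z = n.

Lemma suppP (B : eqType) (ga : B -> nat) n f : supp ga n f <-> Pi ga n f = f.
Proof.
split=> [h|<- b].
  apply: funext => b; rewrite /Pi; case: eqP => // nb.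
  by have [//|/eqP/h] := eqVneq (f b) 0.
by rewrite /Pi; case: eqP.
Qed.

Lemma Pi_supp (B : eqType) (ga : B -> nat) n m f : supp ga m f ->
  Pi ga n f = if n == m then f else 0.
Proof. by move=> /suppP <-; rewrite Pi_Pi; case: eqP => // ->. Qed.

Lemma supp_Pi (B : eqType) (ga : B -> nat) n f : supp ga n (Pi ga n f).
Proof. by apply/suppP; rewrite Pi_Pi eqxx. Qed.

(** On a finite window an element agrees with the sum of finitely many of its components. *)
Lemma closed_Pi (B : eqType) (ga : B -> nat) (T : set (B -> K)) f : csubmod T ->
  (forall n, T (Pi ga n f)) -> T f.
Proof.
move=> cT h; apply: closed_lim => // F.
exists (\sum_(i < (\max_(b <- F) ga b).+1) Pi ga i%:Z f).
  by apply: (closed_sum cT).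
move=> b bF; rewrite fsumE.
have ib : (ga b < (\max_(b <- F) ga b).+1)%N by rewrite ltnS leq_bigmax_seq.
rewrite (bigD1 (Ordinal ib)) //= big1 ?addr0 => [|i ib']; rewrite /Pi ?eqxx //.
by case: eqP => // -[e]; case/eqP: ib'; apply: val_inj.
Qed.

Lemma tau_Pi (B : eqType) (ga : B -> nat) (deg : B -> int) k n (f : B -> K) :
  tau deg k (Pi ga n f) = Pi ga n (tau deg k f).
Proof. by apply: funext => b; rewrite /tau /Pi; case: ifP; rewrite ?mulr0. Qed.
End Grading.

(** * Derivations of profinite graded Lie algebras *)

Section LieTheory.
Variables (K : comAlgType rat) (gr : even_grading K) (L : lie_alg K).
Local Notation F := (ix L -> K).
Local Notation lcar := (@lcar K L).
Local Notation lrel := (@lrel K L).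
Local Notation lbrk := (@lbrk K L).
Local Notation tau := (tau (@ideg K L)).
Local Notation hom := (homogeneous gr (@ideg K L)).
Local Notation of_degree := (@of_degree K gr L).
Local Notation derivation := (@derivation K gr L).
Implicit Types (x y : F) (D : endo L).

(** The interface common to [LW] and [Omega]. The field [g_hom] reduces statements about signs to
    homogeneous elements, and [g_taurel] lets the sign twist descend to the quotient. *)
Record good := Good {
  g_car : csubmod lcar;
  g_rel : csubmod lrel;
  g_sub : lrel `<=` lcar;
  g_brk : forall x y, lcar x -> lcar y -> lcar (lbrk x y);
  g_idl : forall x y, lrel x -> lcar y -> lrel (lbrk x y);
  g_idr : forall x y, lcar x -> lrel y -> lrel (lbrk x y);
  g_fll : forall y, flin (fun x => lbrk x y);
  g_flr : forall x, flin (lbrk x);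
  g_hom : lcar `<=` closed_span [set x | lcar x /\ exists d, hom d x];
  g_tau : forall k x y, tau k (lbrk x y) = lbrk (tau k x) (tau k y);
  g_taurel : forall k x, lrel x -> lrel (tau k x) }.

Hypothesis gL : good.

Lemma lcar_tau k x : lcar x -> lcar (tau k x).
Proof.
move=> /(g_hom gL); move: x.
apply: (clin_span (closedT (B := _)) (flin_clin setT (@flin_tau K _ (@ideg K L) k)) (g_car gL)) => //.
move=> x [lx [d hx]]; rewrite (tau_par _ (homogeneous_par hx)).
by apply: (closedZ (g_car gL)).
Qed.

Lemma cont_clin D : cont_endo D -> clin lcar D.
Proof. by case=> _ _ lD kD; split. Qed.

Lemma cont_car D x : cont_endo D -> lcar x -> lcar (D x).
Proof. by case=> h _ _ _; apply: h. Qed.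

Lemma cont_rel D x : cont_endo D -> lrel x -> lrel (D x).
Proof. by case=> _ h _ _; apply: h. Qed.

Definition defect (e : int) D x y := D (lbrk x y) - (lbrk (D x) y + lbrk (tau e x) (D y)).

Lemma clin_lbrkl (S : set F) (A : F -> F) y : clin S A -> clin S (fun x => lbrk (A x) y).
Proof. by move=> cA; apply: (clin_comp (T := setT) (A' := fun x => lbrk x y) _ cA (flin_clin setT (g_fll gL y))). Qed.

Lemma clin_lbrkr (S : set F) (A : F -> F) x : clin S A -> clin S (fun y => lbrk x (A y)).
Proof. by move=> cA; apply: (clin_comp (T := setT) (A' := lbrk x) _ cA (flin_clin setT (g_flr gL x))). Qed.

Lemma clin_defectl e D y : cont_endo D -> lcar y -> clin lcar (fun x => defect e D x y).
Proof.
move=> cD ly; have kD := cont_clin cD.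
apply: clinB_op; first apply: (clin_comp (T := lcar) _ (flin_clin lcar (g_fll gL y)) kD).
  by move=> x lx; apply: g_brk.
apply: clinD_op; first exact: clin_lbrkl.
apply: clin_lbrkl; apply: flin_clin; exact: flin_tau.
Qed.

Lemma clin_defectr e D x : cont_endo D -> lcar x -> clin lcar (defect e D x).
Proof.
move=> cD lx; have kD := cont_clin cD.
apply: clinB_op; first apply: (clin_comp (T := lcar) _ (flin_clin lcar (g_flr gL x)) kD).
  by move=> y ly; apply: g_brk.
apply: clinD_op; last exact: clin_lbrkr.
apply: flin_clin; exact: g_flr.
Qed.

(** Homogeneous elements are topologically dense, so the rule stated for homogeneous x is equivalent
    to the twisted rule for all x. *)
Lemma derivationP e D : derivation e D <->
  [/\ cont_endo D, of_degree e D & forall x y, lcar x -> lcar y -> lrel (defect e D x y)].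
Proof.
split=> -[cD dD h]; split => //.
  move=> x y lx ly; have := g_hom gL lx; move: x {lx}.
  apply: (clin_span (g_car gL) (clin_defectl e cD ly) (g_rel gL)) => [x []|x [lx [d hx]]] //.
  have := h d x y lx ly hx; rewrite fsg /defect (tau_par _ (homogeneous_par hx)).
  by rewrite (flZ (g_fll gL _)).
move=> a x y lx ly hx; have := h x y lx ly; rewrite fsg /defect (tau_par _ (homogeneous_par hx)).
by rewrite (flZ (g_fll gL _)).
Qed.

Lemma of_degree_tau e D k x : of_degree e D -> cont_endo D -> lcar x ->
  D (tau k x) = sg (k * e) \*o tau k (D x).
Proof.
move=> dD cD lx; apply/eqP; rewrite -subr_eq0; apply/eqP.
have := g_hom gL lx; move: x {lx}.
have kD := cont_clin cD.
apply: (@clin_span K _ _ lcar (g_car gL) (fun x => D (tau k x) - (sg (k * e) \*o tau k (D x))) _ _ [set 0]).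
- apply: clinB_op; first by apply: (clin_comp (T := lcar) _ (flin_clin _ (@flin_tau K _ _ k)) kD) => x; apply: lcar_tau.
  apply: clinZ_op; apply: (clin_comp (T := setT) (A' := tau k) _ kD) => //.
  apply: flin_clin; exact: flin_tau.
- exact: closed_eq0.
- by move=> x [].
move=> x [lx [d hx]]; rewrite (tau_par _ (homogeneous_par hx)) (clinZ (g_car gL) kD) //.
rewrite (tau_par _ (homogeneous_par (dD _ _ lx hx))) fmulA mulrDr sgD mulrCA sgsq mulr1.
by rewrite /= subrr.
Qed.

Lemma eaddE D D' x : (D + D') x = D x + D' x. Proof. by []. Qed.
Lemma eoppE D x : (- D) x = - D x. Proof. by []. Qed.
Lemma escaleE (q : rat) D x : (q *: D) x = q *: D x. Proof. by []. Qed.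
Definition eE := (eaddE, eoppE, escaleE).

Lemma cont0 : cont_endo (0 : endo L).
Proof.
split=> [x _|x _|c x y _ _|G]; [exact: (closed0 (g_car gL)) | exact: (closed0 (g_rel gL)) | |].
  by apply: funext => b; rewrite -[LHS]/(0 : K) -[RHS]/(c * 0 + 0) mulr0 addr0.
by exists [::].
Qed.

Lemma contD D D' : cont_endo D -> cont_endo D' -> cont_endo (D + D').
Proof.
move=> cD cD'; have [h1 h2] := clinD_op (cont_clin cD) (cont_clin cD').
split=> // x lx; first by apply: (closedD (g_car gL)); apply: cont_car.
by apply: (closedD (g_rel gL)); apply: cont_rel.
Qed.

Lemma contQ (q : rat) D : cont_endo D -> cont_endo (q *: D).
Proof.
move=> cD; have e : (q *: D : endo L) = fun x => q%:A \*o D x.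
  by apply: funext => x; rewrite eE fscale_alg.
have [h1 h2] := clinZ_op q%:A (cont_clin cD); rewrite e.
split=> // x lx; first by apply: (closedZ (g_car gL)); apply: cont_car.
by apply: (closedZ (g_rel gL)); apply: cont_rel.
Qed.

Lemma cont_comp D D' : cont_endo D -> cont_endo D' -> cont_endo (D \o D').
Proof.
move=> cD cD'.
have [h1 h2] : clin lcar (D \o D').
  by apply: (clin_comp (T := lcar) _ (cont_clin cD') (cont_clin cD)) => x; apply: cont_car.
split=> // x lx; first exact: (cont_car cD (cont_car cD' lx)).
exact: (cont_rel cD (cont_rel cD' lx)).
Qed.

Lemma cont_id : cont_endo (id : endo L).
Proof. by split=> // G; exists G. Qed.

Lemma flin_cont (D : endo L) : flin D -> (forall x, lcar x -> lcar (D x)) ->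
  (forall x, lrel x -> lrel (D x)) -> cont_endo D.
Proof. by move=> fD h1 h2; have [? ?] := flin_clin lcar fD; split. Qed.

Lemma der0 e : derivation e (0 : endo L).
Proof.
apply/derivationP; split; first exact: cont0.
  by move=> d x _ _; apply: hom0.
move=> x y _ _; rewrite /defect /= (fl0 (g_fll gL y)) (fl0 (g_flr gL _)) addr0 subrr.
exact: (closed0 (g_rel gL)).
Qed.

Lemma derD e D D' : derivation e D -> derivation e D' -> derivation e (D + D').
Proof.
move=> /derivationP[cD dD mD] /derivationP[cD' dD' mD']; apply/derivationP; split.
- exact: contD.
- by move=> d x lx hx; apply: homD; [apply: dD | apply: dD'].
move=> x y lx ly.
have -> : defect e (D + D') x y = defect e D x y + defect e D' x y.
  rewrite /defect !eE (flD (g_fll gL _)) (flD (g_flr gL _)).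
  by apply: funext => b; rewrite !fE; ring.
by apply: (closedD (g_rel gL)); [apply: mD | apply: mD'].
Qed.

Lemma der_sg e j D : derivation e D -> derivation e (ksgn j *: D).
Proof.
move=> /derivationP[cD dD mD]; apply/derivationP; split.
- exact: contQ.
- by move=> d x lx hx; rewrite eE fsg; apply: hom_sg; apply: dD.
move=> x y lx ly.
have -> : defect e (ksgn j *: D) x y = sg j \*o defect e D x y.
  rewrite /defect !eE !fsg (flZ (g_fll gL _)) (flZ (g_flr gL _)).
  by apply: funext => b; rewrite !fE; ring.
by apply: (closedZ (g_rel gL)); apply: mD.
Qed.

Lemma derB e D D' : derivation e D -> derivation e D' -> derivation e (D - D').
Proof.
move=> hD /(der_sg 1) hD'; rewrite (_ : - D' = ksgn 1 *: D'); first exact: derD.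
by rewrite /ksgn scaleN1r.
Qed.

Definition gcomm (e e' : int) D D' : endo L := (D \o D') - ksgn (e * e') *: (D' \o D).

Lemma der_comm e e' D D' : derivation e D -> derivation e' D' ->
  derivation (e + e') (gcomm e e' D D').
Proof.
move=> /derivationP[cD dD mD] /derivationP[cD' dD' mD']; apply/derivationP.
have [kD kD'] := (cont_clin cD, cont_clin cD').
split.
- rewrite /gcomm -scaleNr; apply: contD; first exact: cont_comp.
  by apply: contQ; apply: cont_comp.
- move=> d x lx hx; rewrite /gcomm !eE fsg.
  have [h1 h2] := (dD' _ _ lx hx, dD _ _ lx hx).
  apply: homD.
    have := dD _ _ (cont_car cD' lx) h1; congr homogeneous; ring.
  apply: homN; apply: hom_sg.
  have := dD' _ _ (cont_car cD lx) h2; congr homogeneous; ring.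
move=> x y lx ly.
have [c1 c2 c3 c4] := And4 (cont_car cD lx) (cont_car cD ly) (cont_car cD' lx) (cont_car cD' ly).
have tx k := lcar_tau k lx.
(* The second-order Leibniz rule modulo relations: E is applied to the defect of E', and the defects
   of E on the two resulting terms are added. The mixed terms cancel in the graded commutator. *)
have key E E' i i' (cE : cont_endo E) (cE' : cont_endo E') (dE' : of_degree i' E')
    (mE : forall x y, lcar x -> lcar y -> lrel (defect i E x y))
    (mE' : forall x y, lcar x -> lcar y -> lrel (defect i' E' x y)) :
  lrel (E (E' (lbrk x y)) - (lbrk (E (E' x)) y + (sg (i * i') \*o lbrk (E' (tau i x)) (E y))
    + lbrk (E (tau i' x)) (E' y) + lbrk (tau i (tau i' x)) (E (E' y)))).
  have [l1 l2] := (cont_car cE' lx, cont_car cE' ly).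
  have := closedD (g_rel gL) (closedD (g_rel gL) (cont_rel cE (mE' x y lx ly)) (mE _ _ l1 ly))
    (mE _ _ (tx i') l2).
  have kE := cont_clin cE; congr lrel; rewrite /defect.
  rewrite (clinB (g_car gL) kE) ?(clinD kE) //.
  + rewrite (of_degree_tau _ dE' cE' lx) (flZ (g_fll gL _)) fmulA sgsq fmul1.
    by apply: funext => b; rewrite !fE; ring.
  + exact: g_brk. + by apply: g_brk. + by apply: cont_car => //; apply: g_brk.
  + by apply: (closedD (g_car gL)); apply: g_brk.
have h1 := key _ _ _ _ cD cD' dD' mD mD'.
have h2 := key _ _ _ _ cD' cD dD mD' mD.
have := closedB (g_rel gL) h1 (closedZ (g_rel gL) (sg (e * e')) h2).
congr lrel; rewrite /defect /gcomm !eE !fsg /=.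
rewrite (flB (g_fll gL _)) (flB (g_flr gL _)) (flZ (g_fll gL _)) (flZ (g_flr gL _)).
rewrite -!tauD (addrC e' e).
apply: funext => b; rewrite !fE (mulrC e' e); have := sgsq K (e * e').
set c := sg (e * e') => cc.
set u1 := lbrk (D' (tau e x)) (D y) b; set u2 := lbrk (D (tau e' x)) (D' y) b.
rewrite !(mulrBr, mulrDr, opprD, opprB, mulrA, cc, mul1r).
ring.
Qed.

Section Component.
Variable ga : ix L -> nat.
Record graded := Graded {
  gd_car : forall n x, lcar x -> lcar (Pi ga n x);
  gd_rel : forall n x, lrel x -> lrel (Pi ga n x);
  gd_brk : forall a b, supp ga ((ga a)%:Z + (ga b)%:Z) (lbrk (delta a) (delta b)) }.
Hypothesis gg : graded.

Lemma supp_lbrkl a n y : supp ga n y -> supp ga ((ga a)%:Z + n) (lbrk (delta a) y).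
Proof.
move=> /suppP sy; apply/suppP; rewrite -sy.
suff /(congr1 (fun G => G y)) : (fun y => Pi ga ((ga a)%:Z + n) (lbrk (delta a) (Pi ga n y))) =
  (fun y => lbrk (delta a) (Pi ga n y)) by [].
apply: flin_eq.
- exact: (flin_comp (flin_comp (@flin_Pi K _ ga n) (g_flr gL _)) (@flin_Pi K _ ga _)).
- exact: (flin_comp (@flin_Pi K _ ga n) (g_flr gL _)).
move=> b; rewrite Pi_delta; case: eqP => [<-|_].
  by apply/suppP; apply: gd_brk.
by rewrite (fl0 (g_flr gL _)) (fl0 (@flin_Pi K _ ga _)).
Qed.

Lemma Pi_lbrkl n m x y : supp ga m y -> Pi ga (n + m) (lbrk x y) = lbrk (Pi ga n x) y.
Proof.
move=> sy.
suff /(congr1 (fun G => G x)) : (fun x => Pi ga (n + m) (lbrk x y)) = (fun x => lbrk (Pi ga n x) y) by [].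
apply: flin_eq.
- exact: (flin_comp (g_fll gL y) (@flin_Pi K _ ga _)).
- exact: (flin_comp (@flin_Pi K _ ga n) (g_fll gL y)).
move=> a; rewrite (Pi_supp _ (@supp_lbrkl a _ _ sy)) Pi_delta.
rewrite (inj_eq (addIr m)) eq_sym; case: ifP => // _.
by rewrite (fl0 (g_fll gL y)).
Qed.

Lemma supp_lbrk n m x y : supp ga n x -> supp ga m y -> supp ga (n + m) (lbrk x y).
Proof. by move=> /suppP sx sy; apply/suppP; rewrite (Pi_lbrkl _ _ sy) sx. Qed.

Lemma Pi_lbrkr n m x y : supp ga m x -> Pi ga (m + n) (lbrk x y) = lbrk x (Pi ga n y).
Proof.
move=> sx.
suff /(congr1 (fun G => G y)) : (fun y => Pi ga (m + n) (lbrk x y)) = (fun y => lbrk x (Pi ga n y)) by [].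
apply: flin_eq.
- exact: (flin_comp (g_flr gL x) (@flin_Pi K _ ga _)).
- exact: (flin_comp (@flin_Pi K _ ga n) (g_flr gL x)).
move=> b; have sb : supp ga (ga b)%:Z (delta b : F).
  by apply/suppP; rewrite Pi_delta eqxx.
rewrite (Pi_supp _ (supp_lbrk sx sb)) Pi_delta (inj_eq (addrI m)) eq_sym; case: ifP => // _.
by rewrite (fl0 (g_flr gL x)).
Qed.

(** The part of D that shifts the weight by s. Being defined coordinate by coordinate, it needs no
    infinite sum: the value at j sees only the part of x of weight [ga j] - s. *)
Definition component (s : int) (D : endo L) : endo L :=
  fun x j => D (Pi ga ((ga j)%:Z - s) x) j.

Lemma Pi_component n s D x : Pi ga n (component s D x) = Pi ga n (D (Pi ga (n - s) x)).
Proof. by apply: funext => j; rewrite /Pi; case: eqP => // <-. Qed.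

Lemma component_supp n s D x : cont_endo D -> supp ga n x ->
  component s D x = Pi ga (n + s) (D x).
Proof.
move=> cD sx; apply: funext => j; rewrite /component (Pi_supp _ sx) /Pi.
rewrite subr_eq; case: eqP => // _.
by rewrite (clin0 (g_car gL) (cont_clin cD)).
Qed.

Lemma cont_component s D : cont_endo D -> cont_endo (component s D).
Proof.
move=> cD; have kD := cont_clin cD; split.
- move=> x lx; apply: (closed_Pi (ga := ga) (g_car gL)) => n; rewrite Pi_component.
  by apply: (gd_car gg); apply: cont_car => //; apply: (gd_car gg).
- move=> x lx; apply: (closed_Pi (ga := ga) (g_rel gL)) => n; rewrite Pi_component.
  by apply: (gd_rel gg); apply: cont_rel => //; apply: (gd_rel gg).
- move=> c x y lx ly; apply: funext => j; rewrite !fE /component /=.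
  rewrite (flD (@flin_Pi K _ ga _)) (flZ (@flin_Pi K _ ga _)) kD.1 //; exact: (gd_car gg).
move=> G; have [H HP] := kD.2 G; exists H => x lx x0 b bG.
apply: (HP _ _ _ b bG); first exact: (gd_car gg).
by move=> c cH; rewrite /Pi x0 //; case: ifP.
Qed.

(** By continuity x and y may be taken of pure weight, and then the Leibniz defect of the component
    is a projection of the defect of D. *)
Lemma der_component e s D : derivation e D -> derivation e (component s D).
Proof.
move=> /derivationP[cD dD mD]; have cD' := cont_component s cD.
have [kD kD'] := (cont_clin cD, cont_clin cD').
apply/derivationP; split => //.
  move=> d x lx hx j; apply: dD; first exact: (gd_car gg).
  by move=> b; rewrite /Pi; case: ifP => _; [exact: hx | exact: hcomp0].
suff h n m x y : lcar x -> lcar y -> supp ga n x -> supp ga m y ->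
    lrel (defect e (component s D) x y).
  move=> x y lx ly.
  suff [//] : [set x | lcar x /\ lrel (defect e (component s D) x y)] x.
  apply: (closed_Pi (ga := ga)); first exact: (closed_preim (g_car gL) (clin_defectl e cD' ly) (g_rel gL)).
  move=> n; have lnx := gd_car gg n lx; split => //.
  suff [//] : [set y | lcar y /\ lrel (defect e (component s D) (Pi ga n x) y)] y.
  apply: (closed_Pi (ga := ga)); first exact: (closed_preim (g_car gL) (clin_defectr e cD' lnx) (g_rel gL)).
  move=> m; have lmy := gd_car gg m ly; split => //.
  by apply: (h n m) => //; apply: supp_Pi.
move=> lx ly sx sy.
have -> : defect e (component s D) x y = Pi ga (n + m + s) (defect e D x y).
  have fP := @flin_Pi K _ ga (n + m + s).
  rewrite /defect (component_supp _ cD (supp_lbrk sx sy)) (component_supp _ cD sx) (component_supp _ cD sy).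
  rewrite (flB fP) (flD fP); congr (_ - (_ + _)).
    by rewrite -(Pi_lbrkl _ _ sy); congr Pi; ring.
  have stx : supp ga n (tau e x).
    by apply/suppP; rewrite -tau_Pi; congr (tau e _); apply/suppP.
  by rewrite -(Pi_lbrkr _ _ stx); congr Pi; ring.
by apply: (gd_rel gg); apply: mD.
Qed.
End Component.
End LieTheory.

(** * The two Lie algebras as graded instances, and uniqueness of operators *)

Section Instances.
Variables (K : comAlgType rat) (gr : even_grading K) (V : free_module).
Local Notation X := (seq (bas V) -> K).
Local Notation L1 := (pair_ix V -> K).
Local Notation T := (seq (pair_ix V) -> K).
Local Notation dW := (@degW V).
Local Notation dA := (@degA V).
Local Notation tauX := (tau (wdeg dW)).
Local Notation tauT := (tau (wdeg dA)).
Local Notation LW := (@LW K V).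
Local Notation lcW := (lcar (l := LW)).
Local Notation F := (form_ix V -> K).
Local Notation Om := (@Omega K gr V).
Local Notation ocar := (lcar (l := Om)).
Local Notation orel := (lrel (l := Om)).
Local Notation obrk := (lbrk (l := Om)).
Implicit Types (x y z : X) (t : L1) (g : T) (f h : F).

Lemma good_LW : good gr LW.
Proof.
have c0 := @closed_eq0 K (word V).
split.
- exact: closed_lcW.
- exact: c0.
- by move=> x ->; exact: (closed0 (@closed_lcW K V)).
- exact: lcW_tbrk.
- by move=> x y -> _; apply: (fl0 (flin_tbrkl _ _)).
- by move=> x y _ ->; apply: (fl0 (flin_tbrkr _ _)).
- exact: flin_tbrkl.
- exact: flin_tbrkr.
- move=> x lx; have : closed_span (@bmon K V) x by rewrite -lcW_span.
  apply: closed_span_mono => y my.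
  by split; [exact: lcW_bmon | exact: bmon_hom].
- exact: tau_tbrk.
- by move=> k x ->; apply: (fl0 (@flin_tau K _ _ k)).
Qed.

Lemma hom_fmon g : fmon g -> exists d, homogeneous gr (wdeg dA) d g.
Proof.
elim=> [_ [u [m /(bmon_hom gr)[p pm] ->]]|y z _ [p py] _ [q qz]]; last first.
  by exists (p + q); apply: hom_tbrk.
exists (degT u + p + 1); apply: hom_letter => -[u' v]; rewrite /tens /delta /=.
case: eqP => [->|_]; last by rewrite mul0r; apply: hcomp0.
rewrite mul1r; have := pm v; congr (gr _ _).
by rewrite /degA /=; ring.
Qed.

Lemma hom_opair d x g : homogeneous gr (wdeg dW) d x -> homogeneous gr (wdeg dA) d g ->
  homogeneous gr (@odeg V) d (opair x g).
Proof. by move=> hx hg [u|s]; [exact: hx | exact: hg]. Qed.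

Lemma tau_act k x g : tauT k (act false x g) = act false (tauX k x) (tauT k g).
Proof.
suff /(congr1 (fun G => G x)) : (fun x => tauT k (act false x g)) =
  (fun x => act false (tauX k x) (tauT k g)) by [].
apply: flin_eq => [||u].
- exact: (flin_comp (flin_actl false g) (@flin_tau K _ _ k)).
- exact: (flin_comp (@flin_tau K _ _ k) (flin_actl false (tauT k g))).
have pu := @par_delta K _ (wdeg dW) u.
by rewrite (tau_par _ pu) (flZ (flin_actl _ _)) (parop_act pu) fmulA sgsq fmul1.
Qed.

Lemma tau_act_true k x g : tauT k (act true x g) = act true (tauX k x) (tauT k g).
Proof.
suff /(congr1 (fun G => G g)) : (fun g => tauT k (act true x g)) =
  (fun g => act true (tauX k x) (tauT k g)) by [].
apply: flin_eq => [||s].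
- exact: (flin_comp (flin_act true x) (@flin_tau K _ _ k)).
- exact: (flin_comp (@flin_tau K _ _ k) (flin_act true (tauX k x))).
have ps := @par_delta K _ (wdeg dA) s.
rewrite (act_twist_par _ ps) (act_twist_par _ (par_tau _ ps)) tau_act.
by rewrite -!tauD addrC.
Qed.

Lemma tau_opair k f : tau (@odeg V) k f = opair (tauX k (f \o inl)) (tauT k (f \o inr)).
Proof. by apply: funext => -[]. Qed.

Lemma good_Omega : good gr Om.
Proof.
split.
- exact: closed_ocar.
- exact: closed_orel.
- exact: orel_ocar.
- exact: ocar_obrk.
- exact: orel_obrkl.
- exact: orel_obrkr.
- exact: flin_obrkl.
- exact: flin_obrkr.
- move=> f /ocar_span; apply: closed_span_mono => h mh; split; first exact: omon_ocar.
  case: mh => [[x /(bmon_hom gr)[d hx] ->]|[g /hom_fmon[d hg] ->]]; exists d; apply: hom_opair => //;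
    exact: hom0.
- move=> k f h; rewrite !tau_opair /= /obrk tau_tbrk.
  congr opair; rewrite -tau_act -tau_act_true -tau_tbrk.
  by rewrite (flD (@flin_tau K _ _ k)) (flB (@flin_tau K _ _ k)).
move=> k f /orelP[[lf Lf] f0 n0]; apply/orelP; split.
- by split; [exact: lcW_tau | exact: LOmega1_tau].
- by rewrite -[_ \o inl]/(tauX k (f \o inl)) f0 (fl0 (@flin_tau K _ _ k)).
by rewrite -[_ \o inr]/(tauT k (f \o inr)) norm_tau n0 (fl0 (@flin_tau K _ _ k)).
Qed.

Lemma graded_span (L : lie_alg K) (ga : ix L -> nat) (M : set (ix L -> K)) :
  csubmod (lcar (l := L)) -> (forall a, lcar (l := L) a -> closed_span M a) -> M `<=` lcar (l := L) ->
  (forall m, M m -> exists k, supp ga k m) ->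
  forall n a, lcar (l := L) a -> lcar (l := L) (Pi ga n a).
Proof.
move=> cL sM ML hM n a /sM; move: a.
apply: (clin_span (closedT (B := _)) (flin_clin setT (@flin_Pi K _ ga n))) => //.
move=> m Mm; have [k sm] := hM m Mm; rewrite (Pi_supp _ sm); case: ifP => _; first exact: ML.
exact: (closed0 cL).
Qed.

Lemma tbrk_supp (A : eqType) (deg : A -> int) (a b : seq A -> K) w : tbrk deg a b w <> 0 ->
  exists u v, [/\ perm_eq (u ++ v) w, a u <> 0 & b v <> 0].
Proof.
move=> w0; apply: contrapT => h; apply: w0; rewrite /tbrk big1 // => i _.
have e u v : perm_eq (u ++ v) w -> a u * b v = 0.
  move=> pw; have [->|/eqP au] := eqVneq (a u) 0; first by rewrite mul0r.
  have [->|/eqP bv] := eqVneq (b v) 0; first by rewrite mulr0.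
  by case: h; exists u, v.
rewrite e ?cat_take_drop // [b _ * _]mulrC e ?scaler0 ?subr0 //.
by rewrite perm_catC cat_take_drop.
Qed.

Definition tsize (s : seq (pair_ix V)) := (\sum_(a <- s) (size a.1 + size a.2))%N.

Lemma act_supp tw x g s : act tw x g s <> 0 ->
  exists p r, [/\ x p <> 0, g r <> 0, size r = size s & tsize s = (size p + tsize r)%N].
Proof.
move=> s0; apply: contrapT => h; apply: s0; rewrite /act big1 // => k _.
rewrite big1 // => i _; set l := nth _ s k; set p := take i _; set r := _ ++ _.
suff -> : x p * g r = 0 by rewrite scaler0.
have [->|/eqP xp] := eqVneq (x p) 0; first by rewrite mul0r.
have [->|/eqP gr0] := eqVneq (g r) 0; first by rewrite mulr0.
case: h; exists p, r; split => //.
  rewrite /r size_cat /= size_drop size_take ltn_ord.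
  by rewrite -subSn ?ltn_ord // subSS subnKC // ltnW // ltn_ord.
have {1}-> : s = take k s ++ l :: drop k.+1 s.
  by rewrite -drop_nth ?ltn_ord // cat_take_drop.
rewrite /tsize /r !big_cat !big_cons /= -{1}(cat_take_drop i l.1) -/p size_cat.
by rewrite [RHS]addnCA !addnA.
Qed.

Lemma supp_delta (B : eqType) (ga : B -> nat) b : supp ga (ga b)%:Z (delta b : B -> K).
Proof. by apply/suppP; rewrite Pi_delta eqxx. Qed.

Lemma delta_supp (B : eqType) (b c : B) : delta b c <> 0 :> K -> c = b.
Proof. by rewrite /delta; case: eqP. Qed.

Lemma supp_tbrk (A : eqType) (deg : A -> int) (ga : seq A -> nat) (a b : seq A -> K) n m :
  (forall u v, ga (u ++ v) = (ga u + ga v)%N) -> (forall u v, perm_eq u v -> ga u = ga v) ->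
  supp ga n a -> supp ga m b -> supp ga (n + m) (tbrk deg a b).
Proof.
move=> gD gP sa sb w /tbrk_supp[u [v [puv au bv]]].
by rewrite -(gP _ _ puv) gD PoszD (sa _ au) (sb _ bv).
Qed.

Lemma supp_bmon x : bmon x -> exists k, supp (@size (bas V)) k x.
Proof.
elim=> [_ [b _ ->]|y z _ [p py] _ [q qz]].
  by exists 1 => -[|c [|? ?]].
exists (p + q); apply: supp_tbrk => //; first exact: size_cat.
by move=> u v; apply: perm_size.
Qed.

Lemma graded_LW : graded (L := LW) (@size (bas V)).
Proof.
split.
- apply: (@graded_span LW (@size (bas V)) (@bmon K V)); first exact: closed_lcW.
  + by move=> x; rewrite lcW_span.
  + exact: lcW_bmon.
  + exact: supp_bmon.
- by move=> n x ->; apply: (fl0 (@flin_Pi K _ _ n)).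
move=> a b; apply: supp_tbrk; [exact: size_cat | by move=> u v; apply: perm_size | |]; exact: supp_delta.
Qed.

Lemma tsize_cat s s' : tsize (s ++ s') = (tsize s + tsize s')%N.
Proof. by rewrite /tsize big_cat. Qed.
Lemma tsize_perm s s' : perm_eq s s' -> tsize s = tsize s'.
Proof. by move=> h; rewrite /tsize (perm_big _ h). Qed.

Lemma supp_fmon_t g : fmon g -> exists k, supp tsize k g.
Proof.
elim=> [_ [u [m /supp_bmon[p pm] ->]]|y z _ [p py] _ [q qz]]; last first.
  by exists (p + q); apply: supp_tbrk => //; [exact: tsize_cat | exact: tsize_perm].
exists ((size u)%:Z + p) => -[|[u' v] [|? ?]] //=.
rewrite /tens /delta /=; case: eqP => [->|_]; last by rewrite mul0r.
by rewrite mul1r => /pm <-; rewrite /tsize big_seq1.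
Qed.

Lemma supp_fmon_s g : fmon g -> exists k, supp (@size (pair_ix V)) k g.
Proof.
elim=> [t _|y z _ [p py] _ [q qz]].
  by exists 1 => -[|c [|? ?]].
exists (p + q); apply: supp_tbrk => //; first exact: size_cat.
by move=> u v; apply: perm_size.
Qed.

(** Used for the tensor degree and for the form degree. Constancy along [Pre] makes the projections
    commute with normal forms, hence preserve the relations. *)
Lemma graded_Omega (ga : form_ix V -> nat) :
  (forall x, bmon x -> exists k, supp (ga \o inl) k x) ->
  (forall g, fmon g -> exists k, supp (ga \o inr) k g) ->
  (forall s s', s' \in Pre s -> ga (inr s') = ga (inr s)) ->
  (forall a b, supp (ga \o inl) ((ga (inl a))%:Z + (ga (inl b))%:Z) (tbrk dW (delta a) (delta b) : X)) ->
  (forall a b, supp (ga \o inr) ((ga (inr a))%:Z + (ga (inr b))%:Z) (tbrk dA (delta a) (delta b) : T)) ->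
  (forall tw a b, supp (ga \o inr) ((ga (inl a))%:Z + (ga (inr b))%:Z) (act tw (delta a) (delta b) : T)) ->
  graded (L := Om) ga.
Proof.
move=> h1 h2 h3 h4 h5 h6; split.
- apply: (@graded_span Om ga (@omon K V)); first exact: closed_ocar.
  + exact: ocar_span.
  + by move=> f; apply: omon_ocar.
  + move=> f [[x /h1[k sx] ->]|[g /h2[k sg] ->]]; exists k => -[u|s] //=; [exact: sx | exact: sg].
- move=> n f /orelP[cf f0 n0]; apply/orelP; split.
  + apply: (@graded_span Om ga (@omon K V)) => //; first exact: closed_ocar.
    * exact: ocar_span.
    * by move=> h; apply: omon_ocar.
    * move=> h [[x /h1[k sx] ->]|[g /h2[k sg] ->]]; exists k => -[u|s] //=; [exact: sx | exact: sg].
  + apply: funext => u; have := congr1 (fun G => G u) f0 => /= e.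
    by rewrite /Pi /= e; case: ifP.
  + have -> : Pi ga n f \o inr = (fun s => (if (ga (inr s))%:Z == n then 1 else 0) * (f \o inr) s).
      by apply: funext => s; rewrite /Pi /=; case: ifP; rewrite ?mul1r ?mul0r.
    rewrite norm_char => [|s s' /h3 -> //].
    by rewrite n0; apply: funext => s; rewrite mulr0.
have dl u : (delta (inl u) : F) \o inl = delta u by apply: funext => v.
have dr u : (delta (inr u) : F) \o inr = delta u by apply: funext => v.
have dlr u : (delta (inl u) : F) \o inr = 0 by apply: funext => v.
have drl u : (delta (inr u) : F) \o inl = 0 by apply: funext => v.
move=> [a|a] [b|b] [w|s]; rewrite /lbrk /= /Defs.obrk /= ?dl ?dr ?dlr ?drl.
- exact: h4.
- by rewrite !(fl0 (flin_act _ _)) (fl0 (flin_tbrkl _ _)) subr0 addr0 fE.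
- by rewrite (fl0 (flin_tbrkr _ _)).
- rewrite (fl0 (flin_actl _ _)) (fl0 (flin_tbrkl _ _)) subr0 addr0.
  exact: (h6 false a b s).
- by rewrite (fl0 (flin_tbrkl _ _)).
- rewrite (fl0 (flin_actl _ _)) (fl0 (flin_tbrkr _ _)) sub0r addr0 fE => e.
  by rewrite addrC; apply: (h6 true b a s) => e'; apply: e; rewrite e' oppr0.
- by rewrite (fl0 (flin_tbrkl _ _)).
- rewrite !(fl0 (flin_actl _ _)) subr0 add0r; exact: h5.
Qed.

Lemma graded_tdeg : graded (L := Om) (@tdeg V).
Proof.
apply: graded_Omega.
- exact: supp_bmon.
- exact: supp_fmon_t.
- exact: Pre_tdeg.
- by move=> a b; apply: supp_tbrk; [exact: size_cat | by move=> u v; apply: perm_size | |]; exact: supp_delta.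
- by move=> a b; apply: supp_tbrk; [exact: tsize_cat | exact: tsize_perm | |]; exact: supp_delta.
move=> tw a b s /act_supp[p [r [xp xr _ e]]].
have [pa rb] := (delta_supp xp, delta_supp xr).
by rewrite /= -/(tsize s) e pa rb PoszD.
Qed.

Lemma graded_fdeg : graded (L := Om) (@fdeg V).
Proof.
apply: graded_Omega.
- by move=> x _; exists 0.
- exact: supp_fmon_s.
- exact: Pre_size.
- by [].
- by move=> a b; apply: supp_tbrk; [exact: size_cat | by move=> u v; apply: perm_size | |]; exact: supp_delta.
by move=> tw a b s /act_supp[p [r [_ xr e _]]]; have rb := delta_supp xr; rewrite /= -e rb.
Qed.

Local Notation derivation := (@derivation K gr Om).

Lemma of_g_ocar x : lcW x -> ocar (of_g x).
Proof. by split => //; exact: (closed0 (@closed_LOmega1 K V)). Qed.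

Lemma d_of_ocar x : lcW x -> ocar (d_of x : F).
Proof.
by split; [exact: (closed0 (@closed_lcW K V)) | apply: LOmega1_letter; apply: Ug_g_tens].
Qed.

Lemma der_unique e (D D' : endo Om) : derivation e D -> derivation e D' ->
  (forall b, orel (D (of_g (letter (delta b))) - D' (of_g (letter (delta b))))) ->
  (forall b, orel (D (d_of (letter (delta b))) - D' (d_of (letter (delta b))))) ->
  forall f, ocar f -> orel (D f - D' f).
Proof.
move=> hD hD' hg hd; have gO := good_Omega.
have /(derivationP gO)[cE dE mE] := derB gO hD hD'.
suff h : ocar `<=` [set f | ocar f /\ orel ((D - D') f)] by move=> f /h[].
apply: (@ocar_gen K gr V).
- exact: (closed_preim (g_car gO) (cont_clin cE) (g_rel gO)).
- by move=> f rf; split; [exact: orel_ocar | exact: (cont_rel cE)].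
- move=> f h cf ch [_ rf] [_ rh]; split; first exact: ocar_obrk.
  have := closedD (g_rel gO) (mE _ _ cf ch) (closedD (g_rel gO) (g_idl gO rf ch)
    (g_idr gO (lcar_tau gO e cf) rh)).
  by rewrite /defect subrK.
- by move=> b; split; [apply: of_g_ocar; exact: lcW_letter | exact: hg].
- by move=> b; split; [apply: d_of_ocar; exact: lcW_letter | exact: hd].
Qed.

Lemma mor_unique (G G' : endo Om) : morphism gr G -> morphism gr G' ->
  (forall b, orel (G (of_g (letter (delta b))) - G' (of_g (letter (delta b))))) ->
  (forall b, orel (G (d_of (letter (delta b))) - G' (d_of (letter (delta b))))) ->
  forall f, ocar f -> orel (G f - G' f).
Proof.
move=> [cG _ mG] [cG' _ mG'] hg hd; have gO := good_Omega.
suff h : ocar `<=` [set f | ocar f /\ orel (G f - G' f)] by move=> f /h[].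
apply: (@ocar_gen K gr V).
- apply: (closed_preim (g_car gO) _ (g_rel gO)).
  exact: (clinB_op (cont_clin cG) (cont_clin cG')).
- move=> f rf; split; first exact: orel_ocar.
  by apply: (closedB (g_rel gO)); apply: cont_rel.
- move=> f h cf ch [_ rf] [_ rh]; split; first exact: ocar_obrk.
  have c1 := cont_car cG cf; have c2 := cont_car cG' ch.
  have := closedD (g_rel gO) (closedB (g_rel gO) (mG _ _ cf ch) (mG' _ _ cf ch))
    (closedD (g_rel gO) (g_idl gO rf (cont_car cG ch)) (g_idr gO (cont_car cG' cf) rh)).
  congr orel; rewrite (flB (g_fll gO _)) (flB (g_flr gO _)).
  by apply: funext => j; rewrite !fE; ring.
- by move=> b; split; [apply: of_g_ocar; exact: lcW_letter | exact: hg].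
- by move=> b; split; [apply: d_of_ocar; exact: lcW_letter | exact: hd].
Qed.
End Instances.

(** * Existence of the de Rham differential *)

Section DeRhamExists.
Variables (K : comAlgType rat) (gr : even_grading K) (V : free_module).
Local Notation X := (seq (bas V) -> K).
Local Notation L1 := (pair_ix V -> K).
Local Notation T := (seq (pair_ix V) -> K).
Local Notation dW := (@degW V).
Local Notation dA := (@degA V).
Local Notation tauX := (tau (wdeg dW)).
Local Notation tauT := (tau (wdeg dA)).
Local Notation parX := (par (wdeg dW)).
Local Notation parT := (par (wdeg dA)).
Local Notation LW := (@LW K V).
Local Notation lcW := (lcar (l := LW)).
Local Notation tone := (@tone K (bas V)).
Local Notation F := (form_ix V -> K).
Local Notation Om := (@Omega K gr V).
Local Notation ocar := (lcar (l := Om)).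
Local Notation orel := (lrel (l := Om)).
Local Notation obrk := (lbrk (l := Om)).
Local Notation dform := (@dform K V).
Local Notation derivation := (@derivation K gr Om).
Implicit Types (x y z : X) (t : L1) (g : T) (f h : F).

(** Taking the normal form before applying [dform] sends relations to 0 on the nose, so that the map
    descends to the quotient. *)
Definition dOmega : endo Om :=
  fun f : F => opair 0 (dvec (f \o inl) + dform (norm (f \o inr))) : F.

Lemma flin_dOmega : flin dOmega.
Proof.
apply: flin_opair; first by move=> c; exact: func0.
apply: flinD; first exact: (flin_comp (@flin_inl K V) (@flin_dvec K V)).
have [fd _] := @nder_dform K V.
exact: (flin_comp (flin_comp (@flin_inr K V) (@flin_norm K V)) fd).
Qed.

Lemma ocar_dOmega f : ocar f -> ocar (dOmega f).
Proof.
move=> [lf Lf]; split; first exact: (closed0 (@closed_lcW K V)).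
apply: (closedD (@closed_LOmega1 K V)); first exact: dvec_LOmega1.
by apply: dform_LOmega1; apply: norm_LOmega1.
Qed.

Lemma cont_dOmega : cont_endo dOmega.
Proof.
apply: (flin_cont flin_dOmega) ocar_dOmega _ => f /orelP[cf f0 n0].
suff -> : dOmega f = 0 by exact: (closed0 (@closed_orel K gr V)).
have [fd _] := @nder_dform K V.
rewrite /dOmega f0 n0 (fl0 (@flin_dvec K V)) (fl0 fd) addr0.
by apply: funext => -[].
Qed.

Lemma hom_dbas b : homogeneous gr (wdeg dA) (1 + dW b) (dbas K b).
Proof.
have -> : 1 + dW b = dA ([::], [:: b]).
  by rewrite /degA /degT /= wdeg_cons !wdeg_nil; ring.
by apply: hom_letter; apply: hom_delta.
Qed.

Lemma hom_D0 n d t l1 l2 : homogeneous gr dA d t ->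
  gr (d + 1 - (dA l1 + dA l2)) (D0 n t l1 l2).
Proof.
have hl b d' t' : homogeneous gr dA d' t' -> homogeneous gr dA (d' - dW b) (lsh b t').
  move=> ht a; have := ht (b :: a.1, a.2); rewrite dA_lcons.
  by congr (gr _ _); case: a => ? ? /=; ring.
elim: n t d l1 l2 => [|n IH] t d l1 l2 ht /=; first exact: hcomp0.
apply: hcompD; first apply: hcompD.
- apply: hcomp_add_sum => b _; apply: hcomp_sg.
  have := hom_tbrk (hom_dbas b) (hom_letter (hl b _ _ ht)) [:: l1; l2].
  by congr (gr _ _); rewrite 2!wdeg_cons wdeg_nil; move: (dA l1) (dA l2) (dW b) => *; ring.
- case: l1 => -[|b u] v /=; first exact: hcomp0.
  apply: hcomp_sg; have := IH _ _ (u, v) l2 (hl b _ _ ht).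
  congr (gr _ _); rewrite (dA_lcons b (u, v)).
  by move: (dA (u, v)) (dA l2) (dW b) => *; ring.
- case: l2 => -[|b u] v /=; first exact: hcomp0.
  apply: hcomp_sg; have := IH _ _ l1 (u, v) (hl b _ _ ht).
  congr (gr _ _); rewrite (dA_lcons b (u, v)).
  by move: (dA (u, v)) (dA l1) (dW b) => *; ring.
Qed.

Lemma hom_dform d g : homogeneous gr (wdeg dA) d g -> homogeneous gr (wdeg dA) (d + 1) (dform g).
Proof.
move=> hg s; elim: s d g hg => [|l s IH] d g hg; first exact: hcomp0.
have -> : dform g (l :: s) = dhead l g s + sg (dA l * 1) * dform (sh l g) s by [].
apply: hcompD.
  case: s {IH} => [|l2 s] /=; first exact: hcomp0.
  have ht : homogeneous gr dA (d - wdeg dA s) (fun a => g (a :: s)).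
    by move=> a; have := hg (a :: s); congr (gr _ _); rewrite wdeg_cons; ring.
  have := hom_D0 (size l.1 + size l2.1).+1 l l2 ht.
  by congr (gr _ _); rewrite !wdeg_cons; ring.
apply: hcomp_sg; have hs : homogeneous gr (wdeg dA) (d - dA l) (sh l g).
  by move=> r; have := hg (l :: r); congr (gr _ _); rewrite wdeg_cons; ring.
by have := IH _ _ hs; congr (gr _ _); rewrite wdeg_cons; ring.
Qed.

Lemma hom_norm d g : homogeneous gr (wdeg dA) d g -> homogeneous gr (wdeg dA) d (norm g).
Proof.
move=> hg s; rewrite /norm big_seq; apply: hcomp_add_sum => s' /Pre_wdeg <-.
exact: hg.
Qed.

Lemma hom_dvec d x : homogeneous gr (wdeg dW) d x -> homogeneous gr (wdeg dA) (d + 1) (dvec x).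
Proof.
move=> hx; apply: hom_letter => -[u v]; rewrite norm1_tone.
case: v => [|a [|? ?]]; try exact: hcomp0.
have := hx (rcons u a); congr (gr _ _).
by rewrite /degA /degT /= -cats1 wdeg_cat; ring.
Qed.

Lemma hom_dOmega : of_degree gr 1 dOmega.
Proof.
move=> d f _ hf; apply: hom_opair; first exact: hom0.
apply: homD; first by apply: hom_dvec => u; exact: (hf (inl u)).
by apply: hom_dform; apply: hom_norm => s; exact: (hf (inr s)).
Qed.

Lemma tbrk_anti p (f g : T) : parT p f ->
  tbrk dA (tauT p g) f = - tbrk dA f g.
Proof.
move=> pf.
suff /(congr1 (fun G => G g)) : (fun g => tbrk dA (tauT p g) f) = (fun g => - tbrk dA f g) by [].
apply: flin_eq => [||s].
- exact: (flin_comp (@flin_tau K _ (wdeg dA) p) (flin_tbrkl dA f)).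
- by apply: flinN; exact: flin_tbrkr.
have ps := @par_delta K _ (wdeg dA) s.
rewrite (tau_par _ ps) (flZ (flin_tbrkl _ _)) (tbrk_par ps pf) (tbrk_par pf ps).
by apply: funext => r; rewrite !fE mulrBr mulrA (mulrC p) sgsq mul1r opprB.
Qed.

Lemma dvec_tbrk d x y : lcW x -> lcW y -> parX d x ->
  dvec (tbrk dW x y) = (sg d \*o act false x (dvec y)) - act false (tauX (d + 1) y) (dvec x).
Proof.
move=> /lcW_nil x0 /lcW_nil y0 px.
rewrite (tbrkE _ px) (flB (@flin_dvec K V)) !dvec_tmul //.
rewrite /dvec !act_letterT (tau_par _ px) mul1r lmulLZ (flZ (@flin_letter K _)) fmulA sgsq fmul1.
by rewrite -tauD (_ : 1 + (d + 1) = d + (1 + 1)) ?tauD ?tauK //; ring.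
Qed.

(** The identity is checked on normal forms. Two Lie elements are covered by the Fox formula for
    d[x,y], a Lie element and a form by [lcW_dform], two forms by the derivation property of
    [dform]. *)
Lemma der_dOmega : derivation 1 dOmega.
Proof.
split; [exact: cont_dOmega | exact: hom_dOmega |].
move=> d f h cf ch hf; have [lf Lf] := cf; have [lh Lh] := ch.
have cD := cont_dOmega.
set x := f \o inl; set a := f \o inr; set y := h \o inl; set b := h \o inr.
have hx : homogeneous gr (wdeg dW) d x by move=> u; exact: (hf (inl u)).
have ha : homogeneous gr (wdeg dA) d a by move=> u; exact: (hf (inr u)).
have [px pa] := (homogeneous_par hx, homogeneous_par ha).
have pna := homogeneous_par (hom_norm ha).
have [fN N1 mN] := @nmor_norm K V; have fd := (@nder_dform K V).1.
have cO := @closed_ocar K gr V.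
apply/orelP; split.
- apply: (closedB cO); first by apply: (cont_car cD); apply: ocar_obrk.
  apply: (closedD cO); first by apply: ocar_obrk => //; exact: (cont_car cD).
  by apply: (closedQ cO); apply: ocar_obrk => //; exact: (cont_car cD).
- rewrite fsg; apply: funext => u; rewrite /= !fE /= /lbrk /= /Defs.obrk /=.
  by rewrite -[dOmega f \o inl]/(0 : X) -[dOmega h \o inl]/(0 : X)
     (fl0 (flin_tbrkl _ _)) (fl0 (flin_tbrkr _ _)) !fE mulr0 addr0 subrr.
rewrite mul1r fsg.
have -> : (dOmega (obrk f h) - (obrk (dOmega f) h + (sg d \*o obrk f (dOmega h)))) \o inr =
  (dOmega (obrk f h) \o inr) - ((obrk (dOmega f) h \o inr) + (sg d \*o (obrk f (dOmega h) \o inr))).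
  by apply: funext.
rewrite (flB fN) (flD fN) (flZ fN) !norm_obrk -/x -/a -/y -/b.
rewrite -[dOmega f \o inl]/(0 : X) -[dOmega h \o inl]/(0 : X).
rewrite -[dOmega f \o inr]/(dvec x + dform (norm a)) -[dOmega h \o inr]/(dvec y + dform (norm b)).
rewrite -[dOmega (obrk f h) \o inr]/(dvec (tbrk dW x y) + dform (norm (obrk f h \o inr))).
rewrite norm_obrk -/x -/a -/y -/b (fl0 (flin_actl _ _)).
rewrite (fl0 (flin_actl true (norm a))) sub0r subr0.
rewrite (act_twist_par _ pna) !(flD fN) !norm_dvec.
(* The parity of the form part of d f is needed to rewrite the action in the twisted position as an
   untwisted one. *)
have hdn : parT (d + 1) (norm (dvec x) + norm (dform (norm a))).
  apply: (homogeneous_par (gr := gr)); apply: homD; apply: hom_norm; first exact: hom_dvec.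
  by apply: hom_dform; apply: hom_norm.
rewrite norm_dvec in hdn; rewrite (act_twist_par _ hdn).
rewrite (flD fd) (flB fd) (lcW_dform _ lf) (lcW_dform _ (lcW_tau d lh)).
rewrite (nder_tbrk (@nder_dform K V) (@parop_dform K V)).
rewrite (tau_par _ px) (tau_par _ pna) !mul1r !(flZ (flin_actl _ _)) !(flZ (flin_tbrkl _ _)).
rewrite -tauD (addrC 1 d) dvec_tau (flZ (flin_tbrkl _ _)) (tbrk_anti _ pna).
rewrite (dvec_tbrk lf lh px).
rewrite !(flD (flin_act _ _), flD (flin_tbrkl _ _), flD (flin_tbrkr _ _)).
rewrite !(flD fN, flB fN, flZ fN, flN fN) !(norm_actT, norm_tbrk, norm_dvec, normK).
apply: funext => s; rewrite !fE; ring.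
Qed.

Lemma dOmega_of_g x : lcW x -> orel (dOmega (of_g x) - d_of x).
Proof.
move=> lx; have cO := @closed_ocar K gr V; have fN := @flin_norm K V.
apply/orelP; split.
- apply: (closedB cO); last exact: d_of_ocar.
  by apply: (cont_car cont_dOmega); apply: of_g_ocar.
- by apply: funext => u; rewrite /= !fE /= subrr.
have -> : (dOmega (of_g x) - d_of x) \o inr = (dOmega (of_g x) \o inr) - (d_of x \o inr).
  by apply: funext.
rewrite (flB fN) -[dOmega _ \o inr]/(dvec x + dform (norm 0)) -[d_of x \o inr]/(letter (tens tone x)).
by rewrite (fl0 fN) (fl0 (@nder_dform K V).1) addr0 norm_dvec norm_letter subrr.
Qed.

Lemma dOmega_d_of b : dOmega (d_of (letter (delta b))) = 0.
Proof.
rewrite /dOmega -[d_of _ \o inl]/(0 : X) -[d_of _ \o inr]/(letter (tens tone (letter (delta b)))).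
rewrite norm_letter norm1_letter (fl0 (@flin_dvec K V)) add0r -delta_nil letter_delta -delta_pair.
by rewrite dform_letter_nil; apply: funext => -[].
Qed.

(** The square is half of the graded commutator of d with itself, a derivation which vanishes on the
    generators b and db. *)
Lemma dOmega2 f : ocar f -> orel (dOmega (dOmega f)).
Proof.
move=> cf; have gO := good_Omega gr V.
have d2 := der_comm gO der_dOmega der_dOmega.
have e : gcomm 1 1 dOmega dOmega = (2%:R : rat) *: (dOmega \o dOmega).
  rewrite /gcomm mul1r (_ : ksgn 1 = -1); last by rewrite /ksgn.
  by rewrite scaleN1r opprK scaler_nat mulr2n.
have h0 b : orel (gcomm 1 1 dOmega dOmega (of_g (letter (delta b)))).
  rewrite e escaleE; apply: (closedQ (g_rel gO)) => /=.
  have := cont_rel cont_dOmega (dOmega_of_g (@lcW_letter K V (delta b))).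
  rewrite (clinB (g_car gO) (cont_clin cont_dOmega)) ?dOmega_d_of ?subr0 //.
    by apply: ocar_dOmega; apply: of_g_ocar; apply: lcW_letter.
  by apply: d_of_ocar; apply: lcW_letter.
have h1 b : orel (gcomm 1 1 dOmega dOmega (d_of (letter (delta b)))).
  by rewrite e escaleE /= dOmega_d_of (fl0 flin_dOmega) scaler0; exact: (closed0 (g_rel gO)).
have h0' b : orel (gcomm 1 1 dOmega dOmega (of_g (letter (delta b))) - (0 : endo Om) (of_g (letter (delta b)))).
  by rewrite -[(0 : endo Om) _]/(0 : F) subr0.
have h1' b : orel (gcomm 1 1 dOmega dOmega (d_of (letter (delta b))) - (0 : endo Om) (d_of (letter (delta b)))).
  by rewrite -[(0 : endo Om) _]/(0 : F) subr0.
have := der_unique d2 (der0 gO _) h0' h1' cf.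
rewrite -[(0 : endo Om) f]/(0 : F) subr0 e escaleE => /(closedQ (g_rel gO) (2%:R^-1)).
by rewrite scalerA mulVf // scale1r.
Qed.

Lemma derhamP : [/\ derivation 1 (@derham K gr V),
    forall y, lcW y -> orel (@derham K gr V (of_g y) - d_of y) &
    forall f, ocar f -> orel (@derham K gr V (@derham K gr V f))].
Proof.
rewrite /derham; case: xgetP => [D _ //|/(_ dOmega) []]; split.
- exact: der_dOmega. - exact: dOmega_of_g. - exact: dOmega2.
Qed.
End DeRhamExists.

(** * Operators on forms, Cartan calculus and the Poincare lemma *)
Section Forms.
Variables (K : comAlgType rat) (gr : even_grading K) (V : free_module).
Local Notation F := (form_ix V -> K).
Local Notation F2 := (form2_ix V -> K).
Local Notation Om := (@Omega K gr V).
Local Notation ocar := (lcar (l := Om)).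
Local Notation orel := (lrel (l := Om)).
Local Notation obrk := (lbrk (l := Om)).
Local Notation derivation := (@derivation K gr Om).
Local Notation tau := (tau (@odeg V)).
Local Notation form_rel := (@form_rel K gr V).
Local Notation form_eq := (@form_eq K gr V).
Local Notation leibniz := (@leibniz K gr V).
Implicit Types (x y z : F) (f h : F2) (A B D : endo Om).
Let gO := good_Omega gr V.

Definition forms : set F2 :=
  closed_span [set h | exists x y, [/\ ocar x, ocar y & h = tens x y]].

Lemma closed_forms : csubmod forms. Proof. exact: closed_closed_span. Qed.
Lemma closed_form_rel : csubmod form_rel. Proof. exact: closed_closed_span. Qed.

Lemma forms_tens x y : ocar x -> ocar y -> forms (tens x y).
Proof. by move=> cx cy; apply: closed_span_sub; exists x, y. Qed.

Lemma form_forms p f : Defs.form p f -> forms f. Proof. by case. Qed.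

Lemma forms_ind (C : eqType) (G : F2 -> C -> K) (P : set (C -> K)) :
  csubmod P -> clin forms G -> (forall x y, ocar x -> ocar y -> P (G (tens x y))) ->
  forall f, forms f -> P (G f).
Proof.
move=> cP kG h; apply: (clin_span closed_forms kG cP).
  by move=> _ [x [y [cx cy ->]]]; apply: forms_tens.
by move=> _ [x [y [cx cy ->]]]; apply: h.
Qed.

Lemma form_relP (P : set F2) : csubmod P ->
  (forall r x, orel r -> ocar x -> P (tens r x)) ->
  (forall r x, orel r -> ocar x -> P (tens x r)) ->
  (forall x y p q, ocar x -> ocar y -> homogeneous gr (@odeg V) p x ->
    homogeneous gr (@odeg V) q y -> P (tens x y - (sg (p * q) \*o tens y x))) ->
  (forall x y z, ocar x -> ocar y -> ocar z -> P (tens x (obrk y z) - tens (obrk x y) z)) ->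
  form_rel `<=` P.
Proof.
move=> cP h1 h2 h3 h4; apply: closed_spanT => // f [[[|]|]|].
- by move=> [r [x [rr cx ->]]]; apply: h1.
- by move=> [r [x [rr cx ->]]]; apply: h2.
- by move=> [x [y [p [q [cx cy hx hy ->]]]]]; rewrite fsg; apply: h3.
- by move=> [x [y [z [cx cy cz ->]]]]; apply: h4.
Qed.

Lemma rel_l r x : orel r -> ocar x -> form_rel (tens r x).
Proof. by move=> rr cx; apply: closed_span_sub; left; left; left; exists r, x. Qed.
Lemma rel_r r x : orel r -> ocar x -> form_rel (tens x r).
Proof. by move=> rr cx; apply: closed_span_sub; left; left; right; exists r, x. Qed.
Lemma rel_sym x y p q : ocar x -> ocar y -> homogeneous gr (@odeg V) p x ->
  homogeneous gr (@odeg V) q y -> form_rel (tens x y - (sg (p * q) \*o tens y x)).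
Proof.
move=> cx cy hx hy; apply: closed_span_sub; left; right; exists x, y, p, q.
by split=> //; rewrite fsg.
Qed.
Lemma rel_brk x y z : ocar x -> ocar y -> ocar z ->
  form_rel (tens x (obrk y z) - tens (obrk x y) z).
Proof. by move=> cx cy cz; apply: closed_span_sub; right; exists x, y, z. Qed.

Lemma form_rel_forms f : form_rel f -> forms f.
Proof.
have cF := closed_forms; have sub := g_sub gO.
move: f; apply: form_relP => // [r x rr cx|r x rr cx|x y p q cx cy _ _|x y z cx cy cz].
- by apply: forms_tens => //; apply: sub.
- by apply: forms_tens => //; apply: sub.
- by apply: (closedB cF); [|apply: (closedZ cF)]; apply: forms_tens.
- by apply: (closedB cF); apply: forms_tens => //; apply: (g_brk gO).
Qed.

Lemma form_eq_refl f : form_eq f f.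
Proof. by rewrite /form_eq /Defs.form_eq subrr; apply: (closed0 closed_form_rel). Qed.
Lemma form_eq_sym f h : form_eq f h -> form_eq h f.
Proof. by move=> /(closedN closed_form_rel); rewrite opprB. Qed.
Lemma form_eq_trans f h k : form_eq f h -> form_eq h k -> form_eq f k.
Proof.
move=> e1 e2; have := closedD closed_form_rel e1 e2.
by rewrite addrA subrK.
Qed.
Lemma form_eq_rel f h : form_eq f h -> form_rel h -> form_rel f.
Proof. by move=> e r; have := closedD closed_form_rel e r; rewrite subrK. Qed.
Lemma form_eqD f f' h h' : form_eq f h -> form_eq f' h' -> form_eq (f + f') (h + h').
Proof.
move=> e1 e2; have := closedD closed_form_rel e1 e2; congr form_rel.
by apply: funext => j; rewrite !fE; ring.
Qed.
Lemma form_eqZ c f h : form_eq f h -> form_eq (c \*o f) (c \*o h).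
Proof.
move=> /(closedZ closed_form_rel c); congr form_rel.
by apply: funext => j; rewrite !fE mulrBr.
Qed.
Lemma form_eqB f f' h h' : form_eq f h -> form_eq f' h' -> form_eq (f - f') (h - h').
Proof. by move=> e1 /(form_eqZ (-1)); rewrite !fmulN1; apply: form_eqD. Qed.
Lemma form_eq0 f : form_eq f 0 <-> form_rel f.
Proof. by rewrite /form_eq /Defs.form_eq subr0. Qed.

Lemma flin_slicel l : flin (fun f k => f (k, l)) .
Proof. by move=> k; apply: func_at. Qed.
Lemma flin_slicer k : flin (fun f l => f (k, l)).
Proof. by move=> l; apply: func_at. Qed.

Lemma slicel f l : forms f -> ocar (fun k => f (k, l)).
Proof.
move: f; apply: (forms_ind (g_car gO) (flin_clin forms (flin_slicel l))) => x y cx cy.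
have -> : (fun k => tens x y (k, l)) = y l \*o x by apply: funext => k; rewrite fE mulrC.
exact: (closedZ (g_car gO)).
Qed.

Lemma slicer f k : forms f -> ocar (fun l => f (k, l)).
Proof.
move: f; apply: (forms_ind (g_car gO) (flin_clin forms (flin_slicer k))) => x y cx cy.
have -> : (fun l => tens x y (k, l)) = x k \*o y by apply: funext => l; rewrite fE.
exact: (closedZ (g_car gO)).
Qed.

Definition stable A := (forall x, ocar x -> ocar (A x)) /\ clin ocar A.

Lemma stable_cont A : cont_endo A -> stable A.
Proof. by move=> cA; split; [move=> x; apply: cont_car | exact: cont_clin]. Qed.

Lemma stable_id : stable id. Proof. by split=> //; apply: clin_id. Qed.

Lemma stable_tau e : stable (tau e).
Proof.
by split; [move=> x; exact: (lcar_tau gO) | exact: (flin_clin _ (@flin_tau K _ _ e))].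
Qed.

Lemma stable_comp A B : stable A -> stable B -> stable (A \o B).
Proof.
move=> [sA kA] [sB kB]; split; first by move=> x cx; apply: sA; apply: sB.
exact: (clin_comp sB kB kA).
Qed.

(** The tensor product of A and B, computed slice by slice: B in the second variable, then A in the
    first. It is meaningful on [forms], whose slices lie in the carrier. *)
Definition op2 A B f : F2 := fun j => A (fun k => B (fun l => f (k, l)) j.2) j.1.

Section Op2.
Variables (A B : endo Om) (sA : stable A) (sB : stable B).

Lemma clin_inner l : clin forms (fun f k => B (fun l => f (k, l)) l).
Proof.
split=> [c f h ff fh|G].
  apply: funext => k; rewrite !fE.
  by have := congr1 (fun g => g l) (sB.2.1 c _ _ (slicer k ff) (slicer k fh)).
have [H HP] := sB.2.2 [:: l]; exists [seq (k, j) | k <- G, j <- H] => f ff f0 k kG.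
apply: (HP (fun j => f (k, j)) (slicer k ff)) => [j jH|]; last by rewrite inE.
by apply: f0; apply/allpairsP; exists (k, j).
Qed.

Lemma inner_tens l x y : ocar y -> (fun k => B (fun l => tens x y (k, l)) l) = B y l \*o x.
Proof.
move=> cy; apply: funext => k; rewrite fE mulrC.
exact: (congr1 (fun g => g l) (clinZ (g_car gO) sB.2 (x k) cy)).
Qed.

Lemma inner_ocar l f : forms f -> ocar (fun k => B (fun l => f (k, l)) l).
Proof.
move: f; apply: (forms_ind (g_car gO) (clin_inner l)) => x y cx cy.
by rewrite inner_tens //; apply: (closedZ (g_car gO)).
Qed.

Lemma op2_tens x y : ocar x -> ocar y -> op2 A B (tens x y) = tens (A x) (B y).
Proof.
move=> cx cy; apply: funext => -[k l]; rewrite /op2 /= inner_tens //.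
rewrite (clinZ (g_car gO) sA.2) // fE mulrC //.
Qed.

Lemma clin_op2 : clin forms (op2 A B).
Proof.
split=> [c f h ff fh|G].
  apply: funext => -[k l]; rewrite !fE /op2 /=.
  have -> : (fun k => B (fun l => ((c \*o f) + h) (k, l)) l) =
      (c \*o (fun k => B (fun l => f (k, l)) l)) + (fun k => B (fun l => h (k, l)) l).
    exact: (clin_inner l).1.
  by rewrite sA.2.1 //; apply: inner_ocar.
elim: G => [|[k l] G [H HP]]; first by exists [::].
have [H1 HP1] := sA.2.2 [:: k]; have [H2 HP2] := (clin_inner l).2 H1.
exists (H ++ H2) => f ff f0 j; rewrite inE => /predU1P[->|jG].
  apply: (HP1 _ (inner_ocar l ff)); last by rewrite inE.
  by apply: HP2 => // b bH; apply: f0; rewrite mem_cat bH orbT.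
by apply: (HP f) => // b bH; apply: f0; rewrite mem_cat bH.
Qed.

Lemma op2_forms f : forms f -> forms (op2 A B f).
Proof.
move: f; apply: (forms_ind closed_forms clin_op2) => x y cx cy.
by rewrite op2_tens //; apply: forms_tens; [apply: sA.1 | apply: sB.1].
Qed.
End Op2.

Lemma forms_eq (G G' : F2 -> F2) : clin forms G -> clin forms G' ->
  (forall x y, ocar x -> ocar y -> G (tens x y) = G' (tens x y)) ->
  forall f, forms f -> G f = G' f.
Proof.
move=> kG kG' e f ff; apply/eqP; rewrite -subr_eq0; apply/eqP; move: f ff.
apply: (forms_ind (P := [set 0]) (G := fun f => G f - G' f)) => [||x y cx cy].
- exact: closed_eq0. - exact: clinB_op.
by rewrite /= e ?subrr.
Qed.

Lemma leibnizE e D f : leibniz e D f = op2 D id f + op2 (tau e) D f.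
Proof. by apply: funext => j; rewrite !fE /leibniz /Defs.leibniz ksgnE. Qed.

Section Leibniz.
Variables (e : int) (D : endo Om) (sD : stable D).

Lemma clin_leibniz : clin forms (leibniz e D).
Proof.
apply: (clin_ext (leibnizE e D)); apply: clinD_op; apply: clin_op2 => //.
exact: stable_id. exact: stable_tau.
Qed.

Lemma leibniz_tens x y : ocar x -> ocar y ->
  leibniz e D (tens x y) = tens (D x) y + tens (tau e x) (D y).
Proof.
move=> cx cy; rewrite leibnizE !op2_tens //; [exact: stable_tau | exact: stable_id].
Qed.

Lemma leibniz_forms f : forms f -> forms (leibniz e D f).
Proof.
move=> ff; rewrite leibnizE; apply: (closedD closed_forms); apply: op2_forms => //.
exact: stable_id. exact: stable_tau.
Qed.
End Leibniz.

Lemma der_stable e D : derivation e D -> stable D.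
Proof. by case=> cD _ _; apply: stable_cont. Qed.

(** Each kind of generating relation is sent to a combination of relations; this is what makes the
    induced operator act on forms modulo relations. *)
Lemma leibniz_rel e D f : derivation e D -> form_rel f -> form_rel (leibniz e D f).
Proof.
move=> hD; have [cD dD mD] := hD; have /(derivationP gO)[_ _ mD'] := hD.
have sD := der_stable hD; have kL := clin_leibniz e sD.
have cR := closed_form_rel; have sub := g_sub gO; have tc k := @lcar_tau K gr Om gO k.
have Dc := sD.1; have bc := g_brk gO.
suff h : form_rel `<=` [set f | forms f /\ form_rel (leibniz e D f)] by move=> /h[].
apply: form_relP => [|r x rr cx|r x rr cx|x y p q cx cy hx hy|x y z cx cy cz].
- exact: (closed_preim closed_forms kL cR).
- have cr := sub _ rr; split; first exact: forms_tens.
  rewrite (leibniz_tens _ sD) //; apply: (closedD cR); apply: rel_l => //.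
  + exact: (cont_rel cD). + exact: (g_taurel gO). + exact: Dc.
- have cr := sub _ rr; split; first exact: forms_tens.
  rewrite (leibniz_tens _ sD) //; apply: (closedD cR); apply: rel_r => //.
  + exact: Dc. + exact: (cont_rel cD). + exact: tc.
- split; first by apply: form_rel_forms; apply: rel_sym.
  rewrite (clinB closed_forms kL) ?(clinZ closed_forms kL) ?(leibniz_tens _ sD) //;
    try by [apply: forms_tens | apply: (closedZ closed_forms); apply: forms_tens].
  have [hDx hDy] := (dD _ _ cx hx, dD _ _ cy hy).
  have := closedD cR (rel_sym (Dc _ cx) cy hDx hy)
    (closedZ cR (sg (e * p)) (rel_sym cx (Dc _ cy) hx hDy)).
  congr form_rel.
  rewrite (tau_par _ (homogeneous_par hx)) (tau_par _ (homogeneous_par hy)).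
  rewrite !(flZ (flin_tensl _)).
  apply: funext => j; rewrite !fE (mulrDl p e q) (mulrDr p q e) !sgD (mulrC p e).
  have := sgsq K (e * p); set c := sg (e * p) => cc.
  set u := tens y (D x) j; set v := tens (D y) x j; set w := tens x (D y) j.
  have -> : c * (w - sg (p * q) * c * v) = c * w - (c * c) * (sg (p * q) * v) by ring.
  by rewrite cc; ring.
split; first by apply: form_rel_forms; apply: rel_brk.
rewrite (clinB closed_forms kL) ?(leibniz_tens _ sD) //;
  try by [apply: forms_tens; auto | auto].
have dx := mD' _ _ cx cy; have dy := mD' _ _ cy cz.
(* The image of x (x) [y,z] - [x,y] (x) z consists of three relations of the same shape, with D on
   x, on y and on z, corrected by the Leibniz defects of D on [y,z] and on [x,y]. *)
have := closedD cR (closedD cR (closedB cR (rel_r dy (tc e _ cx)) (rel_l dx cz)) (rel_brk (Dc _ cx) cy cz))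
  (closedD cR (rel_brk (tc e _ cx) (Dc _ cy) cz) (rel_brk (tc e _ cx) (tc e _ cy) (Dc _ cz))).
congr form_rel; rewrite /defect (g_tau gO).
rewrite !(flB (flin_tensr _)) !(flD (flin_tensr _)) !(flB (flin_tensl _)) !(flD (flin_tensl _)).
by apply: funext => j; rewrite !fE; ring.
Qed.

Lemma leibniz_eq e D f h : derivation e D -> form_eq f h -> forms f -> forms h ->
  form_eq (leibniz e D f) (leibniz e D h).
Proof.
move=> hD fh ff fh'; have := leibniz_rel hD fh.
by rewrite (clinB closed_forms (clin_leibniz e (der_stable hD))).
Qed.

Lemma leibniz_cong e D D' f : stable D -> stable D' ->
  (forall x, ocar x -> orel (D x - D' x)) -> forms f ->
  form_eq (leibniz e D f) (leibniz e D' f).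
Proof.
move=> sD sD' DD; move: f.
apply: (forms_ind (G := fun f => leibniz e D f - leibniz e D' f) closed_form_rel).
  by apply: clinB_op; apply: clin_leibniz.
move=> x y cx cy; rewrite !leibniz_tens //.
have := closedD closed_form_rel (rel_l (DD _ cx) cy) (rel_r (DD _ cy) (lcar_tau gO e cx)).
rewrite (flB (flin_tensr _)) (flB (flin_tensl _)); congr form_rel.
by apply: funext => j; rewrite !fE; ring.
Qed.

Lemma leibniz_sg e k D f : leibniz e (ksgn k *: D) f = sg k \*o leibniz e D f.
Proof.
apply: funext => j; rewrite fE /leibniz /Defs.leibniz !eE !fE.
by rewrite !ksgnE; ring.
Qed.

Lemma leibniz_comm e e' D D' f : derivation e D -> derivation e' D' -> forms f ->
  leibniz (e + e') (gcomm e e' D D') f =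
  leibniz e D (leibniz e' D' f) - (sg (e * e') \*o leibniz e' D' (leibniz e D f)).
Proof.
move=> hD hD'; have [sD sD'] := (der_stable hD, der_stable hD').
have hC := der_comm gO hD hD'; have sC := der_stable hC.
have [cD dD _] := hD; have [cD' dD' _] := hD'.
have k1 := clin_leibniz e sD; have k2 := clin_leibniz e' sD'.
have f1 f' := @leibniz_forms e D sD f'; have f2 f' := @leibniz_forms e' D' sD' f'.
move: f; apply: forms_eq.
- exact: clin_leibniz.
- apply: clinB_op; first exact: (clin_comp f2 k2 k1).
  apply: clinZ_op; exact: (clin_comp f1 k1 k2).
move=> x y cx cy; have tc k := lcar_tau gO k cx.
have tcD k z : ocar z -> ocar (tau k z) by apply: (lcar_tau gO).
rewrite !leibniz_tens //.
rewrite (clinD k1) ?(clinD k2); try by apply: forms_tens; auto; [apply: sD.1 | apply: sD'.1].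
- rewrite !leibniz_tens //; try by [apply: sD.1 | apply: sD'.1 | auto].
  rewrite /gcomm !eE !fsg /= !(of_degree_tau gO _ dD cD cx) !(of_degree_tau gO _ dD' cD' cx).
  rewrite (flB (flin_tensl _)) (flB (flin_tensr _)) !(flZ (flin_tensl _)) (flZ (flin_tensr _)).
  rewrite -!tauD (addrC e' e).
  apply: funext => j; rewrite !fE (mulrC e' e); have := sgsq K (e * e').
  set c := sg (e * e') => cc.
  set u1 := tens (tau e (D' x)) (D y) j; set u2 := tens (tau e' (D x)) (D' y) j.
  rewrite (mulrDr c _ (c * u1 + _)) (mulrDr c (c * u1)) mulrA cc mul1r.
  by ring.
all: by apply: forms_tens; rewrite ?/id; auto; try apply: sD.1; try apply: sD'.1; auto.
Qed.

Lemma hom_leibniz e D d f : derivation e D -> forms f ->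
  homogeneous gr (fun j : form2_ix V => odeg j.1 + odeg j.2) d f ->
  homogeneous gr (fun j : form2_ix V => odeg j.1 + odeg j.2) (d + e) (leibniz e D f).
Proof.
move=> [cD dD _] ff hf [k l]; rewrite /leibniz /Defs.leibniz ksgnE /=.
apply: hcompD; last apply: hcomp_sg.
  have := dD (d - odeg l) _ (slicel l ff) _ k.
  rewrite (_ : d - odeg l + e - _ = d + e - (odeg k + odeg l)); last by ring.
  by apply=> j; have := hf (j, l); congr (gr _ _) => /=; ring.
have := dD (d - odeg k) _ (slicer k ff) _ l.
rewrite (_ : d - odeg k + e - _ = d + e - (odeg k + odeg l)); last by ring.
by apply=> j; have := hf (k, j); congr (gr _ _) => /=; ring.
Qed.

Section Weight.
Variables (ga : form_ix V -> nat) (gg : graded (L := Om) ga).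
Definition ga2 (j : form2_ix V) := (ga j.1 + ga j.2)%N.

Lemma supp_leibniz e s D n f : cont_endo D -> forms f -> supp ga2 n f ->
  supp ga2 (n + s) (leibniz e (component (L := Om) ga s D) f).
Proof.
move=> cD ff sf [k l] /= h.
have : component (L := Om) ga s D (fun k => f (k, l)) k <> 0 \/ component (L := Om) ga s D (fun l => f (k, l)) l <> 0.
  apply: contrapT => /not_orP[/contrapT e1 /contrapT e2]; apply: h.
  by rewrite /leibniz /Defs.leibniz /= e1 e2 scaler0 addr0.
have s1 : supp ga (n - (ga l)%:Z) (fun k => f (k, l)).
  by move=> j /sf /= <-; rewrite PoszD addrK.
have s2 : supp ga (n - (ga k)%:Z) (fun l => f (k, l)).
  by move=> j /sf /= <-; rewrite PoszD addrC addKr.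
rewrite (component_supp gO s cD s1) (component_supp gO s cD s2) /ga2 /= PoszD.
by case=> h'; rewrite (supp_Pi h'); ring.
Qed.

Lemma supp_tens n m x y : supp ga n x -> supp ga m y -> supp ga2 (n + m) (tens x y).
Proof.
move=> sx sy [k l]; rewrite /tens /ga2 /= PoszD => h.
have [xk|/eqP/sx ->] := eqVneq (x k) 0; first by case: h; rewrite xk mul0r.
by have [yl|/eqP/sy ->] := eqVneq (y l) 0; first by case: h; rewrite yl mulr0.
Qed.

(** By continuity in each argument, the generating relations may be taken between elements of pure
    weight, and on those the projection is the identity or 0. *)
Lemma Pi_rel n f : form_rel f -> form_rel (Pi ga2 n f).
Proof.
have cR := closed_form_rel; have fP := @flin_Pi K _ ga2 n.
have r0 : form_rel 0 := closed0 cR.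
have crel f' m : supp ga2 m f' -> form_rel f' -> form_rel (Pi ga2 n f').
  by move=> sf rf; rewrite (Pi_supp _ sf); case: ifP.
have red (G : F -> F2) x : flin G -> (forall k, form_rel (G (Pi ga k x))) -> form_rel (G x).
  by move=> fG h; apply: (closed_Pi (ga := ga) (T := [set x | form_rel (G x)])) => //; apply: csub_preim.
move: f; apply: form_relP => [|r x rr cx|r x rr cx|x y p q cx cy hx hy|x y z cx cy cz].
- exact: csub_preim.
- apply: (red (fun r => Pi ga2 n (tens r x))) => [|k]; first exact: (flin_comp (flin_tensl _) fP).
  apply: (red (fun x => Pi ga2 n (tens _ x))) => [|m]; first exact: (flin_comp (flin_tensr _) fP).
  apply: (crel _ (k + m)); first by apply: supp_tens; apply: supp_Pi.
  by apply: rel_l; [exact: (gd_rel gg) | exact: (gd_car gg)].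
- apply: (red (fun r => Pi ga2 n (tens x r))) => [|k]; first exact: (flin_comp (flin_tensr _) fP).
  apply: (red (fun x => Pi ga2 n (tens x _))) => [|m]; first exact: (flin_comp (flin_tensl _) fP).
  apply: (crel _ (m + k)); first by apply: supp_tens; apply: supp_Pi.
  by apply: rel_r; [exact: (gd_rel gg) | exact: (gd_car gg)].
- have hPi k d (z : F) : homogeneous gr (@odeg V) d z -> homogeneous gr (@odeg V) d (Pi ga k z).
    by move=> hz j; rewrite /Pi; case: ifP => _; [exact: hz | exact: hcomp0].
  apply: (red (fun x => Pi ga2 n (tens x y - (sg (p * q) \*o tens y x)))) => [|k].
    apply: (flin_comp _ fP); apply: flinB; first exact: flin_tensl.
    by apply: flinZ; apply: flin_tensr.
  apply: (red (fun y => Pi ga2 n (tens (Pi ga k x) y - (sg (p * q) \*o tens y _)))) => [|m].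
    apply: (flin_comp _ fP); apply: flinB; first exact: flin_tensr.
    by apply: flinZ; apply: flin_tensl.
  apply: (crel _ (k + m)); last first.
    by apply: rel_sym; [exact: (gd_car gg) | exact: (gd_car gg) | exact: hPi | exact: hPi].
  have sx := @supp_Pi K _ ga k x; have sy := @supp_Pi K _ ga m y.
  apply/suppP; rewrite (flB (@flin_Pi K _ _ _)) (flZ (@flin_Pi K _ _ _)).
  have /suppP -> := supp_tens sx sy.
  by have := supp_tens sy sx; rewrite addrC => /suppP ->.
apply: (red (fun x => Pi ga2 n (tens x (obrk y z) - tens (obrk x y) z))) => [|k].
  apply: (flin_comp _ fP); apply: flinB; first exact: flin_tensl.
  exact: (flin_comp (g_fll gO y) (flin_tensl z)).
apply: (red (fun y => Pi ga2 n (tens (Pi ga k x) (obrk y z) - tens (obrk (Pi ga k x) y) z))) => [|m].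
  apply: (flin_comp _ fP); apply: flinB.
    exact: (flin_comp (g_fll gO z) (flin_tensr _)).
  exact: (flin_comp (g_flr gO _) (flin_tensl z)).
apply: (red (fun z => Pi ga2 n (tens (Pi ga k x) (obrk (Pi ga m y) z) - tens (obrk (Pi ga k x) (Pi ga m y)) z))) => [|l].
  apply: (flin_comp _ fP); apply: flinB; last exact: flin_tensr.
  exact: (flin_comp (g_flr gO _) (flin_tensr _)).
have [sx sy sz] := And3 (@supp_Pi K _ ga k x) (@supp_Pi K _ ga m y) (@supp_Pi K _ ga l z).
apply: (crel _ (k + m + l)); last by apply: rel_brk; apply: (gd_car gg).
apply/suppP; rewrite (flB (@flin_Pi K _ _ _)).
have := supp_tens sx (supp_lbrk gO gg sy sz); rewrite addrA => /suppP ->.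
by have /suppP -> := supp_tens (supp_lbrk gO gg sx sy) sz.
Qed.

Lemma leibniz_component e s D n f : cont_endo D -> forms f -> supp ga2 n f ->
  leibniz e (component (L := Om) ga s D) f = Pi ga2 (n + s) (leibniz e D f).
Proof.
move=> cD ff sf; apply: funext => -[k l]; rewrite /leibniz /Defs.leibniz /=.
have s1 : supp ga (n - (ga l)%:Z) (fun k => f (k, l)).
  by move=> j /sf /= <-; rewrite PoszD addrK.
have s2 : supp ga (n - (ga k)%:Z) (fun l => f (k, l)).
  by move=> j /sf /= <-; rewrite PoszD addrC addKr.
rewrite (component_supp gO s cD s1) (component_supp gO s cD s2) /Pi /ga2 /= PoszD.
have -> : ((ga k)%:Z == n - (ga l)%:Z + s) = ((ga k)%:Z + (ga l)%:Z == n + s).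
  by apply/eqP/eqP; lia.
have -> : ((ga l)%:Z == n - (ga k)%:Z + s) = ((ga k)%:Z + (ga l)%:Z == n + s).
  by apply/eqP/eqP; lia.
by case: (_ == _); rewrite ?scaler0 ?addr0.
Qed.
End Weight.
End Forms.

(** * Multiplication by the weight as a derivation *)

Section WeightOperator.
Variables (K : comAlgType rat) (gr : even_grading K) (L : lie_alg K).
Hypothesis gL : good gr L.
Variables (ga : ix L -> nat) (gg : graded (L := L) ga).

Lemma hcomp_nat i (n : nat) (a : K) : gr i a -> gr i (n%:R * a).
Proof.
move=> ha; rewrite mulr_natl; elim: n => [|n IH]; first by rewrite mulr0n; apply: hcomp0.
by rewrite mulrS; apply: hcompD.
Qed.

Definition weight_op : endo L := fun x b => (ga b)%:R * x b.

Lemma flin_weight : flin weight_op.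
Proof. by move=> b; apply: funcZ; apply: func_at. Qed.

Lemma weight_supp (n : nat) x : supp ga n x -> weight_op x = n%:R \*o x.
Proof.
move=> sx; apply: funext => b; rewrite /weight_op fE.
by have [->|/eqP/sx[->]] := eqVneq (x b) 0; rewrite ?mulr0.
Qed.

Lemma der_weight : derivation gr 0 weight_op.
Proof.
have PiT (T : set (ix L -> K)) x : csubmod T -> (forall n, T (Pi ga n x)) -> T (weight_op x).
  move=> cT h; apply: (closed_Pi (ga := ga) cT) => n.
  case: n => n.
    have -> : Pi ga n (weight_op x) = n%:R \*o Pi ga n x.
      by apply: funext => b; rewrite fE /Pi /weight_op; case: eqP => [[->]|_]; rewrite ?mulr0.
    exact: (closedZ cT).
  have -> : Pi ga (Negz n) (weight_op x) = 0 by apply: funext => b; rewrite /Pi.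
  exact: (closed0 cT).
apply/(derivationP gL); split.
- apply: (flin_cont flin_weight) => x rx; apply: PiT.
  + exact: (g_car gL). + by move=> n; apply: (gd_car gg).
  + exact: (g_rel gL). + by move=> n; apply: (gd_rel gg).
- by move=> d x _ hx b; rewrite addr0; apply: hcomp_nat; apply: hx.
move=> x y _ _; suff -> : defect 0 weight_op x y = 0 by exact: (closed0 (g_rel gL)).
have fW := flin_weight.
suff /(congr1 (fun G => G x)) : (fun x => defect 0 weight_op x y) = (fun=> 0) by [].
rewrite /defect; have t0 (z : ix L -> K) : tau (@ideg K L) 0 z = z := tau0 _ z.
apply: flin_eq => [||a].
- apply: flinB; first exact: (flin_comp (g_fll gL y) fW).
  apply: flinD; first exact: (flin_comp fW (g_fll gL y)).
  exact: (flin_comp (@flin_tau K _ _ 0) (g_fll gL _)).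
- by move=> b; exact: func0.
suff /(congr1 (fun G => G y)) : (fun y => weight_op (lbrk (delta a) y) -
    (lbrk (weight_op (delta a)) y + lbrk (tau (@ideg K L) 0 (delta a)) (weight_op y))) = (fun=> 0) by [].
apply: flin_eq => [||b].
- apply: flinB; first exact: (flin_comp (g_flr gL _) fW).
  apply: flinD; first exact: (g_flr gL).
  exact: (flin_comp fW (g_flr gL _)).
- by move=> c; exact: func0.
rewrite t0 (weight_supp (n := (ga a + ga b)%N)); last exact: gd_brk.
rewrite !(weight_supp (@supp_delta K _ ga _)) (flZ (g_fll gL _)) (flZ (g_flr gL _)).
by apply: funext => c; rewrite !fE natrD; ring.
Qed.
End WeightOperator.

(** * Contractions, Lie derivatives and Cartan's formula *)

Section Cartan.
Variables (K : comAlgType rat) (gr : even_grading K) (V : free_module).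
Local Notation X := (seq (bas V) -> K).
Local Notation LW := (@LW K V).
Local Notation lcW := (lcar (l := LW)).
Local Notation F := (form_ix V -> K).
Local Notation F2 := (form2_ix V -> K).
Local Notation Om := (@Omega K gr V).
Local Notation ocar := (lcar (l := Om)).
Local Notation orel := (lrel (l := Om)).
Local Notation derivation := (@derivation K gr Om).
Local Notation form_rel := (@form_rel K gr V).
Local Notation form_eq := (@form_eq K gr V).
Local Notation leibniz := (@leibniz K gr V).
Local Notation forms := (@forms K gr V).
Local Notation dR := (@derham K gr V).
Local Notation dDR := (@dDR K gr V).
Local Notation lieDR := (@lieDR K gr V).
Local Notation contrDR := (@contrDR K gr V).
Local Notation lie_op := (@lie_op K gr V).
Local Notation contr_op := (@contr_op K gr V).
Local Notation vfield := (@vector_field K gr V).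
Local Notation Phi := (@Phi K gr V).
Local Notation dl b := (letter (delta b)).
Implicit Types (x y z : F) (u v : X) (f h : F2) (D : endo Om) (xi eta : endo LW).
Let gO := good_Omega gr V.
Let gW := good_LW gr V.

Definition eqr x y := orel (x - y).

Lemma eqr_refl x : eqr x x.
Proof. by rewrite /eqr subrr; apply: (closed0 (g_rel gO)). Qed.
Lemma eqr_sym x y : eqr x y -> eqr y x.
Proof. by move=> /(closedN (g_rel gO)); rewrite opprB. Qed.
Lemma eqr_trans x y z : eqr x y -> eqr y z -> eqr x z.
Proof. by move=> e1 e2; have := closedD (g_rel gO) e1 e2; rewrite addrA subrK. Qed.
Lemma eqrD x x' y y' : eqr x y -> eqr x' y' -> eqr (x + x') (y + y').
Proof.
move=> e1 e2; have := closedD (g_rel gO) e1 e2; congr orel.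
by apply: funext => j; rewrite !fE; ring.
Qed.
Lemma eqrZ c x y : eqr x y -> eqr (c \*o x) (c \*o y).
Proof.
move=> /(closedZ (g_rel gO) c); congr orel.
by apply: funext => j; rewrite !fE mulrBr.
Qed.
Lemma eqrB x x' y y' : eqr x y -> eqr x' y' -> eqr (x - x') (y - y').
Proof. by move=> e1 /(eqrZ (-1)); rewrite !fmulN1; apply: eqrD. Qed.
Lemma eqr0 x : eqr x 0 <-> orel x. Proof. by rewrite /eqr subr0. Qed.
Lemma eqr_cont D x y : cont_endo D -> ocar x -> ocar y -> eqr x y -> eqr (D x) (D y).
Proof.
move=> cD cx cy e; have := cont_rel cD e.
by rewrite (clinB (g_car gO) (cont_clin cD)).
Qed.
Lemma eqr_rel x y : eqr x y -> orel y -> orel x.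
Proof. by move=> e r; have := closedD (g_rel gO) e r; rewrite subrK. Qed.

Lemma of_g0 : of_g 0 = 0 :> F. Proof. by apply: funext => -[]. Qed.
Lemma flin_of_g : flin (fun u : X => of_g u : F). Proof. exact: flin_opairl. Qed.
Lemma flin_d_of : flin (fun u : X => d_of u : F).
Proof.
exact: (flin_comp (flin_comp (flin_tensr _) (@flin_letter K _)) (@flin_opairr K V)).
Qed.

Lemma der_cont (L : lie_alg K) e (D : endo L) : Defs.derivation gr e D -> cont_endo D.
Proof. by case. Qed.

Lemma dR_der : derivation 1 dR. Proof. by case: (derhamP gr V). Qed.
Lemma dR_of_g u : lcW u -> eqr (dR (of_g u)) (d_of u).
Proof. by case: (derhamP gr V) => _ h _; apply: h. Qed.
Lemma dRdR x : ocar x -> orel (dR (dR x)).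
Proof. by case: (derhamP gr V) => _ _ h; apply: h. Qed.
Lemma dR_d_of u : lcW u -> orel (dR (d_of u)).
Proof.
move=> lu; have cd := der_cont dR_der; have cg := @of_g_ocar K gr V _ lu.
apply: (eqr_rel _ (dRdR cg)); apply: eqr_cont => //; first exact: d_of_ocar.
  exact: (cont_car cd).
by apply: eqr_sym; apply: dR_of_g.
Qed.

Definition contr_spec e xi D := derivation (e - 1) D /\
  forall u, lcW u -> orel (D (of_g u)) /\ eqr (D (d_of u)) (of_g (xi u)).

Definition lie_spec e xi D := derivation e D /\
  forall u, lcW u -> eqr (D (of_g u)) (of_g (xi u)) /\
    eqr (D (d_of u)) (ksgn e *: dR (of_g (xi u))).

Lemma contr_unique e xi xi' D D' : contr_spec e xi D -> contr_spec e xi' D' ->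
  eq_car xi xi' -> forall x, ocar x -> eqr (D x) (D' x).
Proof.
move=> [hD sD] [hD' sD'] E; apply: (der_unique hD hD') => b; have lb := @lcW_letter K V (delta b).
  by apply: (closedB (g_rel gO)); [case: (sD _ lb) | case: (sD' _ lb)].
apply: eqr_trans (proj2 (sD _ lb)) _; rewrite E //.
by apply: eqr_sym; case: (sD' _ lb).
Qed.

Lemma lie_unique e xi D D' : lie_spec e xi D -> lie_spec e xi D' ->
  forall x, ocar x -> eqr (D x) (D' x).
Proof.
move=> [hD sD] [hD' sD']; apply: (der_unique hD hD') => b; have lb := @lcW_letter K V (delta b).
  by apply: eqr_trans (proj1 (sD _ lb)) _; apply: eqr_sym; case: (sD' _ lb).
by apply: eqr_trans (proj2 (sD _ lb)) _; apply: eqr_sym; case: (sD' _ lb).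
Qed.

Lemma contr_spec0 e : contr_spec e 0 0.
Proof.
split; first exact: (der0 gO).
move=> u lu; split; first exact: (closed0 (g_rel gO)).
by rewrite -[(0 : endo LW) u]/(0 : X) of_g0; apply: eqr_refl.
Qed.

Lemma contr_xget e xi : (exists D, contr_spec e xi D) -> contr_spec e xi (contr_op e xi).
Proof. by move=> h; have := xgetPex (0 : endo Om) h. Qed.

Lemma contr_xgetN e xi : ~ (exists D, contr_spec e xi D) -> contr_op e xi = 0.
Proof. by move=> h; apply: xgetPN => D hD; apply: h; exists D. Qed.

Lemma leibniz0 e f : leibniz e 0 f = 0.
Proof.
apply: funext => j; rewrite /Defs.leibniz.
by rewrite -[(0 : endo Om) _ _]/(0 : K) -[(0 : endo Om) _ _]/(0 : K) scaler0 addr0.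
Qed.

Lemma stable0 : stable (0 : endo Om).
Proof. by apply: stable_cont; apply: (cont0 gO). Qed.

(* If no contraction by xi existed, then [Phi xi = 0] by the convention on
   [contr_op], whence [xi = 0] by non-degeneracy, and 0 is a contraction. *)
Lemma contr_ex w om e xi : @symplectic_form K gr V w om -> vfield e xi ->
  contr_spec e xi (contr_op e xi).
Proof.
move=> [fom _ _ inj _] hxi; apply: contr_xget; apply: contrapT => h.
have h0 : contr_spec e 0 (contr_op e 0) by apply: contr_xget; exists 0; apply: contr_spec0.
have E : eq_car xi 0.
  apply: inj hxi (der0 gW e) _; rewrite /Defs.Phi /Defs.contrDR (contr_xgetN h) leibniz0.
  apply: form_eq_sym; have := leibniz_cong (e - 1) (der_stable h0.1) stable0 _ (form_forms gr fom).
  rewrite leibniz0; apply; exact: (contr_unique h0 (contr_spec0 e)).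
apply: h; exists 0; split; first exact: (der0 gO).
move=> u lu; split; first exact: (closed0 (g_rel gO)).
by rewrite E // -[(0 : endo LW) u]/(0 : X) of_g0; apply: eqr_refl.
Qed.

(** The graded commutator is d i + (-1)^e i d, which sends x to (-1)^e xi(x); the prefactor restores
    L(x) = xi(x), and then L(dx) = (-1)^e d(xi(x)) as prescribed. *)
Definition cartan e (D : endo Om) : endo Om := ksgn e *: gcomm 1 (e - 1) dR D.

Lemma sgB1 (e : int) : sg (e - 1) = - sg e :> K.
Proof. by rewrite sgD {2}/sg mulrN1. Qed.

Lemma cartan_spec e xi D : vfield e xi -> contr_spec e xi D -> lie_spec e xi (cartan e D).
Proof.
move=> hxi [hD sD]; have [cD cd] := (der_cont hD, der_cont dR_der).
have lxi u : lcW u -> lcW (xi u) by move=> lu; apply: (cont_car _ lu); case: hxi.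
have og u := @of_g_ocar K gr V u; have od u := @d_of_ocar K gr V u.
split.
  have := der_sg gO e (der_comm gO dR_der hD).
  by rewrite (_ : 1 + (e - 1) = e) //; ring.
move=> u lu; have [s1 s2] := sD u lu.
rewrite /cartan /gcomm !eE !fsg mul1r /= sgB1; split.
  have h : eqr (D (dR (of_g u))) (of_g (xi u)).
    apply: eqr_trans s2; apply: eqr_cont => //; [|exact: od|exact: dR_of_g].
    by apply: (cont_car cd); apply: og.
  have := eqrZ (sg e) (eqrB (proj2 (eqr0 _) (cont_rel cd s1)) (eqrZ (- sg e) h)).
  by congr eqr; apply: funext => j; rewrite !fE sub0r mulNr opprK mulrA sgsq mul1r.
have h : eqr (dR (D (d_of u))) (dR (of_g (xi u))).
  by apply: eqr_cont => //; [apply: (cont_car cD); apply: od | apply: og; apply: lxi].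
have := eqrZ (sg e) (eqrB h (eqrZ (- sg e) (proj2 (eqr0 _) (cont_rel cD (dR_d_of lu))))).
by congr eqr; apply: funext => j; rewrite !fE mulr0 subr0.
Qed.

Lemma lie_xget e xi : (exists D, lie_spec e xi D) -> lie_spec e xi (lie_op e xi).
Proof. by move=> h; have := xgetPex (0 : endo Om) h. Qed.

(** The graded commutator is a derivation, and it vanishes on the generators x and dx because d
    squares to 0. *)
Lemma lie_dR e xi D : vfield e xi -> lie_spec e xi D ->
  forall x, ocar x -> eqr (gcomm e 1 D dR x) ((0 : endo Om) x).
Proof.
move=> hxi [hL sL]; have [cL cd] := (der_cont hL, der_cont dR_der).
have lxi u : lcW u -> lcW (xi u) by move=> lu; apply: (cont_car _ lu); case: hxi.
have og u := @of_g_ocar K gr V u; have od u := @d_of_ocar K gr V u.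
have hC := der_comm gO hL dR_der.
move=> x cx; move: x cx.
apply: (der_unique hC (der0 gO _)) => b; rewrite -[(0 : endo Om) _]/(0 : F) subr0;
have lb := @lcW_letter K V (delta b); rewrite /gcomm !eE fsg mulr1 /=.
  have h1 : eqr (D (dR (of_g (dl b)))) (sg e \*o dR (of_g (xi (dl b)))).
    rewrite -fsg; apply: eqr_trans (proj2 (sL _ lb)); apply: eqr_cont => //.
    - by apply: (cont_car cd); apply: og. - exact: od. - exact: dR_of_g.
  have h2 : eqr (dR (D (of_g (dl b)))) (dR (of_g (xi (dl b)))).
    apply: eqr_cont => //; [by apply: (cont_car cL); apply: og | by apply: og; apply: lxi |].
    by case: (sL _ lb).
  by have := eqrB h1 (eqrZ (sg e) h2); rewrite subrr => /eqr0.
apply: (closedB (g_rel gO)); first by apply: (cont_rel cL); apply: dR_d_of.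
apply: (closedZ (g_rel gO)).
have h1 : eqr (dR (D (d_of (dl b)))) (dR (sg e \*o dR (of_g (xi (dl b))))).
  apply: eqr_cont => //.
  - by apply: (cont_car cL); apply: od.
  - by apply: (closedZ (g_car gO)); apply: (cont_car cd); apply: og; apply: lxi.
  - by rewrite -fsg; case: (sL _ lb).
apply: eqr_rel h1 _; rewrite (clinZ (g_car gO) (cont_clin cd)).
  by apply: (closedZ (g_rel gO)); apply: dRdR; apply: og; apply: lxi.
by apply: (cont_car cd); apply: og; apply: lxi.
Qed.

Section Symplectic.
Variables (w : int) (om : F2) (Hom : @symplectic_form K gr V w om).

Lemma om_forms : forms om.
Proof. by case: Hom => /(form_forms gr). Qed.

Lemma contrP e xi : vfield e xi -> contr_spec e xi (contr_op e xi).
Proof. exact: contr_ex Hom. Qed.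

Lemma lieP e xi : vfield e xi -> lie_spec e xi (lie_op e xi).
Proof.
by move=> hxi; apply: lie_xget; exists (cartan e (contr_op e xi)); apply: cartan_spec (contrP hxi).
Qed.

Lemma contr_der e xi : vfield e xi -> derivation (e - 1) (contr_op e xi).
Proof. by move=> /contrP[]. Qed.
Lemma lie_der e xi : vfield e xi -> derivation e (lie_op e xi).
Proof. by move=> /lieP[]. Qed.

Lemma dDR_forms f : forms f -> forms (dDR f).
Proof. by apply: leibniz_forms; exact: (der_stable dR_der). Qed.
Lemma contrDR_forms e xi f : vfield e xi -> forms f -> forms (contrDR e xi f).
Proof. by move=> hxi; apply: leibniz_forms; exact: (der_stable (contr_der hxi)). Qed.
Lemma lieDR_forms e xi f : vfield e xi -> forms f -> forms (lieDR e xi f).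
Proof. by move=> hxi; apply: leibniz_forms; exact: (der_stable (lie_der hxi)). Qed.
Lemma Phi_forms e xi : vfield e xi -> forms (Phi om e xi).
Proof. by move=> hxi; apply: contrDR_forms => //; apply: om_forms. Qed.

Lemma dDR_rel f : form_rel f -> form_rel (dDR f).
Proof. exact: (leibniz_rel dR_der). Qed.
Lemma contrDR_rel e xi f : vfield e xi -> form_rel f -> form_rel (contrDR e xi f).
Proof. by move=> hxi; apply: leibniz_rel; apply: contr_der. Qed.

Lemma dDR_eq f h : forms f -> forms h -> form_eq f h -> form_eq (dDR f) (dDR h).
Proof. by move=> ff fh e; apply: (leibniz_eq dR_der). Qed.
Lemma lieDR_eq e xi f h : vfield e xi -> forms f -> forms h -> form_eq f h ->
  form_eq (lieDR e xi f) (lieDR e xi h).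
Proof. by move=> hxi ff fh; move=> E; apply: (leibniz_eq (lie_der hxi)). Qed.

Lemma dDR2 f : forms f -> form_rel (dDR (dDR f)).
Proof.
move=> ff; have d2 := der_comm gO dR_der dR_der.
have h x : ocar x -> eqr (gcomm 1 1 dR dR x) ((0 : endo Om) x).
  move=> cx; rewrite -[(0 : endo Om) x]/(0 : F); apply/eqr0.
  rewrite /gcomm !eE fsg /=; apply: (closedB (g_rel gO)); first exact: dRdR.
  by apply: (closedZ (g_rel gO)); apply: dRdR.
have := leibniz_cong (1 + 1) (der_stable d2) stable0 h ff.
rewrite leibniz0 (leibniz_comm dR_der dR_der ff) => /form_eq0.
rewrite mul1r (_ : sg 1 = -1 :> K) // fmulN1 opprK => /(closedQ (@closed_form_rel K gr V) (2%:R^-1)).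
by rewrite -mulr2n -scaler_nat scalerA mulVf // scale1r.
Qed.

Lemma cartanDR e xi f : vfield e xi -> forms f ->
  form_eq (lieDR e xi f) ((sg e \*o dDR (contrDR e xi f)) + contrDR e xi (dDR f)).
Proof.
move=> hxi ff; have hc := cartan_spec hxi (contrP hxi).
have := leibniz_cong e (der_stable (lie_der hxi)) (der_stable hc.1)
  (lie_unique (lieP hxi) hc) ff.
rewrite /cartan leibniz_sg.
have := leibniz_comm dR_der (contr_der hxi) ff.
rewrite (_ : 1 + (e - 1) = e); last by ring.
move=> ->; congr form_eq; apply: funext => j; rewrite !fE mul1r sgB1 mulNr opprK mulrDr mulrA sgsq mul1r.
by [].
Qed.

(** Since d om = 0, Cartan's formula reduces the Lie derivative of om to (-1)^e d(i om). *)
Lemma sympl_closed e xi : vfield e xi ->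
  form_rel (lieDR e xi om) <-> form_rel (dDR (Phi om e xi)).
Proof.
move=> hxi; have cR := @closed_form_rel K gr V; have [_ _ dom _ _] := Hom.
have E := cartanDR hxi om_forms; have r := contrDR_rel hxi dom; split=> h.
  have := form_eq_rel (form_eq_sym E) h; move=> /(closedB cR)/(_ r).
  by rewrite addrK => /(closedZ cR (sg e)); rewrite fmulA sgsq fmul1.
by apply: form_eq_rel E _; apply: (closedD cR) => //; apply: (closedZ cR).
Qed.

(** The identity i_[xi,eta] = [L_xi, i_eta], obtained by evaluating the right-hand side on x and
    dx. *)
Lemma comm_contr e e' xi eta : vfield e xi -> vfield e' eta ->
  contr_spec (e + e') (comm e e' xi eta) (gcomm e (e' - 1) (lie_op e xi) (contr_op e' eta)).
Proof.
move=> hxi heta; have [hL sL] := lieP hxi; have [hI sI] := contrP heta.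
have [cL cI] := (der_cont hL, der_cont hI).
have lxi u : lcW u -> lcW (xi u) by move=> lu; apply: (cont_car _ lu); case: hxi.
have leta u : lcW u -> lcW (eta u) by move=> lu; apply: (cont_car _ lu); case: heta.
have og u := @of_g_ocar K gr V u; have od u := @d_of_ocar K gr V u.
have cd := der_cont dR_der.
split; first by have := der_comm gO hL hI; rewrite addrA.
move=> u lu; rewrite /gcomm !eE !fsg /=; split.
  apply: (closedB (g_rel gO)); first by apply: (cont_rel cL); case: (sI _ lu).
  apply: (closedZ (g_rel gO)).
  have h : eqr (contr_op e' eta (lie_op e xi (of_g u))) (contr_op e' eta (of_g (xi u))).
    apply: eqr_cont => //; [by apply: (cont_car cL); apply: og | by apply: og; apply: lxi |].
    by case: (sL _ lu).
  by apply: eqr_rel h _; case: (sI _ (lxi _ lu)).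
have h1 : eqr (lie_op e xi (contr_op e' eta (d_of u))) (of_g (xi (eta u))).
  apply: eqr_trans (proj1 (sL _ (leta _ lu))); apply: eqr_cont => //.
  - by apply: (cont_car cI); apply: od.
  - by apply: og; apply: leta.
  - by case: (sI _ lu).
have h2 : eqr (contr_op e' eta (lie_op e xi (d_of u))) (sg e \*o of_g (eta (xi u))).
  have : eqr (contr_op e' eta (lie_op e xi (d_of u))) (contr_op e' eta (sg e \*o d_of (xi u))).
    apply: eqr_cont => //.
    - by apply: (cont_car cL); apply: od.
    - by apply: (closedZ (g_car gO)); apply: od; apply: lxi.
    - apply: eqr_trans (proj2 (sL _ lu)) _; rewrite fsg; apply: eqrZ.
      by apply: dR_of_g; apply: lxi.
  rewrite (clinZ (g_car gO) (cont_clin cI)); last by apply: od; apply: lxi.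
  move=> /eqr_trans; apply; apply: eqrZ.
  by case: (sI _ (lxi _ lu)).
have := eqrB h1 (eqrZ (sg (e * (e' - 1))) h2); congr eqr.
rewrite /comm -[(_ - _) u]/((xi (eta u)) - ksgn (e * e') *: (eta (xi u))) fsg.
rewrite (flB flin_of_g) (flZ flin_of_g) fmulA; congr (_ - (_ \*o _)).
by rewrite mulrBr mulr1 sgD /sg oddzN; case: (odd `|e|%N); rewrite ?mulr1 // -mulrA mulrN1 opprK mulr1.
Qed.

Lemma Phi_eq e xi D : vfield e xi -> contr_spec e xi D ->
  form_eq (Phi om e xi) (leibniz (e - 1) D om).
Proof.
move=> hxi hD; apply: leibniz_cong; [exact: (der_stable (contr_der hxi)) | exact: (der_stable hD.1) | |].
  exact: (contr_unique (contrP hxi) hD).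
exact: om_forms.
Qed.

Lemma Phi_eq_car e xi xi' : vfield e xi -> vfield e xi' -> eq_car xi xi' ->
  form_eq (Phi om e xi) (Phi om e xi').
Proof.
move=> hxi hxi' E; apply: leibniz_cong; [exact: (der_stable (contr_der hxi)) |
  exact: (der_stable (contr_der hxi')) | | exact: om_forms].
exact: (contr_unique (contrP hxi) (contrP hxi')).
Qed.

(** In [L_xi, i_eta] om the term containing L_xi om vanishes, because xi is symplectic. *)
Lemma Phi_comm e e' xi eta : symplectic_field gr om e xi -> vfield e' eta ->
  form_eq (Phi om (e + e') (comm e e' xi eta)) (lieDR e xi (Phi om e' eta)).
Proof.
move=> [hxi sxi] heta; have hc := der_comm gW hxi heta.
apply: form_eq_trans (Phi_eq hc (comm_contr hxi heta)) _.
have := leibniz_comm (lie_der hxi) (contr_der heta) om_forms; rewrite addrA => ->.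
rewrite /Defs.form_eq addrAC subrr add0r.
apply: (closedN (@closed_form_rel K gr V)); apply: (closedZ (@closed_form_rel K gr V)).
exact: (contrDR_rel heta).
Qed.

Lemma lie_d e xi f : vfield e xi -> forms f ->
  form_eq (lieDR e xi (dDR f)) (sg e \*o dDR (lieDR e xi f)).
Proof.
move=> hxi ff; have hL := lieP hxi; have hC := der_comm gO hL.1 dR_der.
have := leibniz_cong (e + 1) (der_stable hC) stable0 (lie_dR hxi hL) ff.
by rewrite leibniz0 (leibniz_comm hL.1 dR_der ff) mulr1 => /form_eq0.
Qed.

Lemma Phi_inj e xi xi' : vfield e xi -> vfield e xi' ->
  form_eq (Phi om e xi) (Phi om e xi') -> eq_car xi xi'.
Proof. by case: Hom => _ _ _ inj _; apply: inj. Qed.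
End Symplectic.
End Cartan.

(** * The Poincare lemma, potentials and the map Upsilon *)

Section Poincare.
Variables (K : comAlgType rat) (gr : even_grading K) (V : free_module).
Local Notation X := (seq (bas V) -> K).
Local Notation LW := (@LW K V).
Local Notation lcW := (lcar (l := LW)).
Local Notation F := (form_ix V -> K).
Local Notation F2 := (form2_ix V -> K).
Local Notation Om := (@Omega K gr V).
Local Notation ocar := (lcar (l := Om)).
Local Notation orel := (lrel (l := Om)).
Local Notation derivation := (@derivation K gr Om).
Local Notation form_rel := (@form_rel K gr V).
Local Notation form_eq := (@form_eq K gr V).
Local Notation leibniz := (@leibniz K gr V).
Local Notation forms := (@forms K gr V).
Local Notation eqr := (@eqr K gr V).
Local Notation dR := (@derham K gr V).
Local Notation dDR := (@dDR K gr V).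
Local Notation contrDR := (@contrDR K gr V).
Local Notation contr_op := (@contr_op K gr V).
Local Notation vfield := (@vector_field K gr V).
Local Notation Phi := (@Phi K gr V).
Local Notation dl b := (letter (delta b)).
Local Notation sz := (@size (bas V)).
Local Notation td := (@tdeg V).
Local Notation fd := (@fdeg V).
Implicit Types (x y z : F) (u v : X) (f h : F2) (D : endo Om) (xi eta : endo LW).
Let gO := good_Omega gr V.
Let gW := good_LW gr V.
Let gS := graded_LW K V.
Let gT := graded_tdeg gr V.
Let gF := graded_fdeg gr V.

Lemma lcW_Pi_ind (C : eqType) (A : X -> C -> K) (P : set (C -> K)) : csubmod P ->
  clin lcW A -> (forall n u, lcW u -> supp sz n u -> P (A u)) -> forall u, lcW u -> P (A u).
Proof.
move=> cP kA h u lu.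
suff [] : [set u | lcW u /\ P (A u)] u by [].
apply: (closed_Pi (ga := sz)); first exact: (closed_preim (g_car gW) kA cP).
move=> n; have ln := gd_car gS n lu; split => //.
by apply: (h n) => //; apply: supp_Pi.
Qed.

Lemma has_order_supp n xi (i : int) u : has_order n.+1 xi -> lcW u -> supp sz i u ->
  supp sz (i + n) (xi u).
Proof.
move=> h lu; case: i => i su r hr.
  have /(_ i u lu) := h; move=> /(_ _ r hr) H.
  have : (size r).+1 = (i + n.+1)%N by apply: H => t /su[].
  by rewrite addnS => -[->].
(* A negative length forces u = 0, which meets the hypothesis of [has_order] for every i; the values
   i = 0 and i = 1 then give contradictory lengths for r. *)
have u0 : u = 0 by apply: funext => t; have [//|/eqP/su] := eqVneq (u t) 0.
have /(_ 0%N u lu) := h; move=> /(_ _ r hr) H.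
have H1 : (size r).+1 = (0 + n.+1)%N by apply: H => t; rewrite u0.
have /(_ 1%N u lu) := h; move=> /(_ _ r hr) H'.
have H2 : (size r).+1 = (1 + n.+1)%N by apply: H' => t; rewrite u0.
by move: H1; rewrite H2; lia.
Qed.

Lemma supp_has_order n xi : (forall (i : nat) u, lcW u -> supp sz i u -> supp sz (i + n) (xi u)) ->
  has_order n.+1 xi.
Proof.
move=> h i u lu su r hr; have su' : supp sz i u by move=> t /su ->.
by have [->] := h i u lu su' r hr; rewrite addnS.
Qed.

(** Order n + 1 means raising the word length by n, whence the shift between [has_order] and
    [component]. *)
Lemma order_component (n : nat) e xi : vfield e xi -> has_order n.+1 xi ->
  eq_car xi (component (L := LW) sz n xi).
Proof.
move=> hxi ho u lu; have cxi := der_cont hxi.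
apply/eqP; rewrite -subr_eq0; apply/eqP; move: u lu.
apply: (lcW_Pi_ind (A := fun u => xi u - component (L := LW) sz n xi u) (P := [set 0])).
- exact: closed_eq0.
- by apply: clinB_op; apply: cont_clin => //; apply: (cont_component gW gS).
move=> i u lu su; rewrite (component_supp gW n cxi su).
by have /suppP -> := has_order_supp ho lu su; rewrite /= subrr.
Qed.

Lemma component_order (n : nat) e xi : vfield e xi -> eq_car xi (component (L := LW) sz n xi) ->
  has_order n.+1 xi.
Proof.
move=> hxi E; apply: supp_has_order => i u lu su.
rewrite E // (component_supp gW n (der_cont hxi) su); exact: supp_Pi.
Qed.

Lemma supp_of_g n u : supp sz n u -> supp td n (of_g u : F).
Proof. by move=> su [t|s] //= /su. Qed.

Lemma supp_d_of n u : supp sz n u -> supp td n (d_of u : F).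
Proof.
move=> su [t|[|[a b] [|? ?]]] //=; rewrite /tens /tone /= => h.
case: a h => [|? ?] /=; rewrite ?mul0r // mul1r => /su <-.
by rewrite big_seq1.
Qed.

Lemma supp_of_g_fd u : supp fd 0 (of_g u : F). Proof. by case. Qed.
Lemma supp_d_of_fd u : supp fd 1 (d_of u : F). Proof. by case=> // -[|? [|? ?]]. Qed.

Lemma eqr_Pi ga n x y : graded (L := Om) ga -> eqr x y -> eqr (Pi ga n x) (Pi ga n y).
Proof.
move=> gg e; rewrite /Submission.eqr -(flB (@flin_Pi K _ ga n)).
exact: (gd_rel gg).
Qed.

Lemma clin_of_g D : cont_endo D -> clin lcW (fun u : X => D (of_g u)).
Proof.
move=> cD; apply: (clin_comp (T := ocar) _ (flin_clin _ (@flin_of_g K V)) (cont_clin cD)) => u.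
exact: of_g_ocar.
Qed.

Lemma clin_d_of D : cont_endo D -> clin lcW (fun u : X => D (d_of u)).
Proof.
move=> cD; apply: (clin_comp (T := ocar) _ (flin_clin _ (@flin_d_of K V)) (cont_clin cD)) => u.
exact: d_of_ocar.
Qed.

Lemma clin_gxi xi : cont_endo xi -> clin lcW (fun u : X => of_g (xi u) : F).
Proof.
move=> cxi; apply: (clin_comp (T := setT) (A' := fun u : X => of_g u : F) _ (cont_clin cxi)) => //.
by apply: flin_clin; apply: flin_of_g.
Qed.

Lemma of_g_Pi n u : of_g (Pi sz n u) = Pi td n (of_g u) :> F.
Proof. by apply: funext => -[t|s]; rewrite /Pi //=; case: ifP. Qed.

Lemma d_of_Pi n u : d_of (Pi sz n u) = Pi td n (d_of u) :> F.
Proof.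
apply: funext => -[t|[|[a b] [|? ?]]]; rewrite /Pi /=; try by case: ifP.
rewrite big_seq1 /tens /tone /=; case: a => [|? ?] /=; first by case: ifP => //; rewrite mulr0.
by rewrite !mul0r; case: ifP.
Qed.

(** Both x and dx have the length of x as tensor degree, so the two sides of the specification can
    be projected together. *)
Lemma contr_component e s xi D : vfield e xi -> contr_spec (gr := gr) e xi D ->
  contr_spec (gr := gr) e (component (L := LW) sz s xi) (component (L := Om) td s D).
Proof.
move=> hxi [hD sD]; have [cD cxi] := (der_cont hD, der_cont hxi).
have cD' := cont_component gO gT s cD; have cxi' := cont_component gW gS s cxi.
split; first exact: (der_component gO gT).
suff h u : lcW u -> orel (component (L := Om) td s D (of_g u)) /\
    orel (component (L := Om) td s D (d_of u) - of_g (component (L := LW) sz s xi u)).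
  by move=> u /h.
move=> lu; split.
  move: u lu; apply: (lcW_Pi_ind (A := fun u => component (L := Om) td s D (of_g u)) (g_rel gO) (clin_of_g cD')).
  move=> n u lu su; rewrite (component_supp gO s cD (supp_of_g su)).
  by apply: (gd_rel gT); case: (sD _ lu).
move: u lu; apply: (lcW_Pi_ind (A := fun u => component (L := Om) td s D (d_of u) -
  of_g (component (L := LW) sz s xi u)) (g_rel gO)).
  by apply: clinB_op; [exact: clin_d_of | exact: clin_gxi].
move=> n u lu su; rewrite (component_supp gO s cD (supp_d_of su)).
rewrite (component_supp gW s cxi su) of_g_Pi; apply: (eqr_Pi _ gT).
by case: (sD _ lu).
Qed.

Lemma contr_component_fd e xi D : contr_spec (gr := gr) e xi D ->
  contr_spec (gr := gr) e xi (component (L := Om) fd (-1) D).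
Proof.
move=> [hD sD]; have cD := der_cont hD; split; first exact: (der_component gO gF).
move=> u lu; have [s1 s2] := sD u lu; split.
  by rewrite (component_supp gO _ cD (@supp_of_g_fd u)); apply: (gd_rel gF).
rewrite (component_supp gO _ cD (@supp_d_of_fd u)).
have /suppP <- := @supp_of_g_fd (xi u).
exact: (eqr_Pi _ gF).
Qed.

Lemma dR_of_g_Pi n u : lcW u -> eqr (Pi td n (dR (of_g u))) (dR (of_g (Pi sz n u))).
Proof.
move=> lu; apply: (eqr_trans (eqr_Pi n gT (dR_of_g gr lu))).
rewrite -d_of_Pi; apply: eqr_sym; apply: dR_of_g; exact: (gd_car gS).
Qed.

Lemma lie_component e s xi D : vfield e xi -> lie_spec (gr := gr) e xi D ->
  lie_spec (gr := gr) e (component (L := LW) sz s xi) (component (L := Om) td s D).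
Proof.
move=> hxi [hD sD]; have [cD cxi] := (der_cont hD, der_cont hxi).
have cD' := cont_component gO gT s cD; have cxi' := cont_component gW gS s cxi.
split; first exact: (der_component gO gT).
suff h u : lcW u -> orel (component (L := Om) td s D (of_g u) - of_g (component (L := LW) sz s xi u)) /\
    orel (component (L := Om) td s D (d_of u) - ksgn e *: dR (of_g (component (L := LW) sz s xi u))).
  by move=> u /h.
move=> lu; split; move: u lu.
  apply: (lcW_Pi_ind (A := fun u => component (L := Om) td s D (of_g u) -
    of_g (component (L := LW) sz s xi u)) (g_rel gO)).
    by apply: clinB_op; [exact: clin_of_g | exact: clin_gxi].
  move=> n u lu su; rewrite (component_supp gO s cD (supp_of_g su)).
  rewrite (component_supp gW s cxi su) of_g_Pi; apply: (eqr_Pi _ gT).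
  by case: (sD _ lu).
apply: (lcW_Pi_ind (A := fun u => component (L := Om) td s D (d_of u) -
    ksgn e *: dR (of_g (component (L := LW) sz s xi u))) (g_rel gO)).
  apply: clinB_op; first exact: clin_d_of.
  apply: (clin_ext (fun u => fsg _ _)); apply: clinZ_op.
  apply: (clin_comp (T := lcW) (A' := fun u : X => dR (of_g u)) _ (cont_clin cxi')).
    by move=> u; apply: cont_car.
  by apply: clin_of_g; apply: der_cont; apply: dR_der.
move=> n u lu su; rewrite (component_supp gO s cD (supp_d_of su)).
rewrite (component_supp gW s cxi su) fsg.
have lx : lcW (xi u) by apply: (cont_car cxi).
apply: (eqr_trans (eqr_Pi _ gT (proj2 (sD _ lu)))).
rewrite fsg (flZ (@flin_Pi K _ td _)); apply: eqrZ.
exact: dR_of_g_Pi.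
Qed.

(** The chosen [derham] may have stray terms among the relations. Its part raising the form degree
    by 1 and preserving the tensor degree agrees with it modulo relations and has exact degrees. *)
Definition dn : endo Om := component (L := Om) td 0 (component (L := Om) fd 1 dR).

Lemma dn_der : derivation 1 dn.
Proof. by apply: (der_component gO gT); apply: (der_component gO gF); apply: dR_der. Qed.

Lemma dnE x : ocar x -> eqr (dR x) (dn x).
Proof.
have h1 := der_component gO gF 1 (dR_der gr V); have cd := der_cont (dR_der gr V).
have c1 := der_cont h1.
apply: (der_unique (dR_der gr V) dn_der) => b; have lb := @lcW_letter K V (delta b);
  have sb : supp sz 1 (dl b : X) by case=> [|? [|? ?]].
  rewrite /dn (component_supp gO 0 c1 (supp_of_g sb)) (component_supp gO 1 cd (@supp_of_g_fd _)).
  apply: (eqr_trans (dR_of_g gr lb)); apply: eqr_sym.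
  have /suppP <- := supp_d_of sb; rewrite addr0; apply: (eqr_Pi _ gT).
  have /suppP <- := @supp_d_of_fd (dl b); rewrite add0r; apply: (eqr_Pi _ gF).
  exact: dR_of_g.
rewrite /dn (component_supp gO 0 c1 (supp_d_of sb)) (component_supp gO 1 cd (@supp_d_of_fd _)).
have rd := dR_d_of gr lb.
by apply: (closedB (g_rel gO)) => //; apply: (gd_rel gT); apply: (gd_rel gF).
Qed.

Definition euler : endo LW := weight_op (L := LW) sz.

Lemma euler_der : vfield 0 euler. Proof. exact: (der_weight gW gS). Qed.

(** The Lie derivative along the Euler field multiplies x and dx by the length of x, which is their
    common tensor degree. *)
Lemma euler_lie : lie_spec (gr := gr) 0 euler (weight_op (L := Om) td).
Proof.
split; first exact: (der_weight gO gT).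
move=> u lu; split.
  have -> : weight_op (L := Om) td (of_g u) = of_g (euler u).
    by apply: funext => -[t|s] //; rewrite /weight_op /= mulr0.
  exact: eqr_refl.
have -> : weight_op (L := Om) td (d_of u) = d_of (euler u).
  apply: funext => -[t|[|[a b] [|? ?]]]; rewrite /weight_op /= ?mulr0 //.
  rewrite big_seq1 /tens /tone /=; case: a => [|? ?] /=; rewrite ?mul0r ?mulr0 // !mul1r //.
rewrite fsg sg0 fmul1.
apply: eqr_sym; apply: dR_of_g; exact: (cont_car (der_cont euler_der)).
Qed.

Lemma natK (m : nat) (b : K) : (m.+1%:R^-1 : rat) *: (m.+1%:R * b) = b.
Proof. by rewrite mulr_natl -scaler_nat scalerA mulVf ?scale1r // Num.Theory.pnatr_eq0. Qed.

(** The components of b in degrees other than i are killed by m + 1, which is invertible, so they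
    vanish. Consequently division by integers preserves degrees. *)
Lemma hcomp_div i (m : nat) (b : K) : gr i (m.+1%:R * b) -> gr i b.
Proof.
move=> hb; have [s [c [us cg e]]] := hcomp_sum gr b.
pose s' := if i \in s then s else i :: s.
pose c' j := if j \in s then c j else 0.
have is' : i \in s' by rewrite /s'; case: ifP => // _; rewrite inE eqxx.
have us' : uniq s' by rewrite /s'; case: ifP => //= ->.
have e' : b = \sum_(j <- s') c' j.
  rewrite e /s'; case: ifP => h; first by apply: eq_big_seq => j js; rewrite /c' js.
  by rewrite big_cons /c' h add0r; apply: eq_big_seq => j js; rewrite js.
have c'g j : gr j (c' j) by rewrite /c'; case: ifP => _; [exact: cg | exact: hcomp0].
have z j : j \in s' -> j != i -> c' j = 0.
  move=> js ji.
  have := @hcomp_direct K gr s' (fun j => m.+1%:R * c' j - (if j == i then m.+1%:R * b else 0)) us' _ _ j js.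
  rewrite (negPf ji) subr0 => h; rewrite -(natK m (c' j)) h ?scaler0 // => [k|].
    by apply: hcompB; [exact: hcomp_nat | case: eqP => [->|_] //; exact: hcomp0].
  rewrite sumrB -mulr_sumr -e' (bigD1_seq i) //= eqxx big1 ?addr0 ?subrr // => k ki.
  by rewrite (negPf ki).
by rewrite e' (bigD1_seq i) //= big_seq_cond big1 ?addr0 // => j /andP[]; exact: z.
Qed.

Lemma hcompVn i (m : nat) (a : K) : gr i a -> gr i ((m.+1%:R^-1 : rat) *: a).
Proof.
move=> ha; apply: (hcomp_div (m := m)).
by rewrite mulr_natl -scaler_nat scalerA mulfV ?scale1r // Num.Theory.pnatr_eq0.
Qed.

Section Symplectic.
Variables (w : int) (om : F2) (Hom : @symplectic_form K gr V w om).
Hypothesis om2 : form_order 2 0 om.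

Let cR := @closed_form_rel K gr V.

Lemma form_orderP p k f : form_order p k f <-> supp (ga2 td) (k + p)%N f.
Proof. by split=> h j /h; [move=> e; rewrite /ga2 e | case]. Qed.

Lemma formP p f : Defs.form p f <-> forms f /\ supp (ga2 fd) p f.
Proof. by split=> -[ff h]; split=> // j /h; [move=> e; rewrite /ga2 e | case]. Qed.

Lemma weight_DR n f : supp (ga2 td) (Posz n) f ->
  leibniz 0 (weight_op (L := Om) td) f = n%:R \*o f.
Proof.
move=> sf; apply: funext => -[j k]; rewrite /Defs.leibniz /weight_op /= mul0r ksgnE sg0 mul1r.
rewrite -mulrDl -natrD.
by have [->|/eqP/sf[<-]] := eqVneq (f (j, k)) 0; rewrite /= ?mulr0.
Qed.

(** Cartan's formula for the Euler field, whose Lie derivative is multiplication by n in tensor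
    degree n. *)
Lemma eulerDR n f : forms f -> supp (ga2 td) (Posz n) f ->
  form_eq (n%:R \*o f) (dDR (contrDR 0 euler f) + contrDR 0 euler (dDR f)).
Proof.
move=> ff sf; rewrite -(weight_DR sf).
have := cartanDR Hom euler_der ff; rewrite sg0 fmul1.
apply: form_eq_trans; apply: leibniz_cong => //.
- exact: (der_stable euler_lie.1).
- exact: (der_stable (lie_der Hom euler_der)).
- exact: (lie_unique euler_lie (lieP Hom euler_der)).
Qed.

(** Contractions kill [LW]. A form of form degree 0 lives on pairs of words of [LW]: the only other
    index of form degree 0 is the empty word of 1-forms, where Lie elements have coefficient 0. *)
Lemma contr_form0 e xi f : vfield e xi -> Defs.form 0 f -> form_rel (contrDR e xi f).
Proof.
move=> hxi /formP[ff sf]; have [hD sD] := contrP Hom hxi.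
pose p : endo Om := fun x : F => opair (x \o inl) 0 : F.
have sp : stable p.
  split; first by move=> x [lx Lx]; apply: of_g_ocar.
  by apply: flin_clin; exact: (flin_comp (@flin_inl K V) (@flin_of_g K V)).
have -> : f = op2 p p f.
  apply: funext => -[[t|s] [t'|s']] //.
  - apply: contrapT => h; have /sf : f (inl t, inr s') <> 0 by [].
    rewrite /ga2 /= => -[]; case: s' h => // h _.
    by case: (slicer (inl t) ff) => _ /free_lie_nil.
  - apply: contrapT => h; have /sf : f (inr s, inl t') <> 0 by [].
    rewrite /ga2 /= => -[]; case: s h => // h _.
    by case: (slicel (inl t') ff) => _ /free_lie_nil.
  apply: contrapT => h; have /sf : f (inr s, inr s') <> 0 by [].
  rewrite /ga2 /= => -[]; case: s h => // h _.
  by case: (slicel (inr s') ff) => _ /free_lie_nil.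
have sc := der_stable hD; have kL := clin_leibniz (e - 1) sc.
move: f ff {sf}; apply: (forms_ind (G := fun f => contrDR e xi (op2 p p f)) cR).
  exact: (clin_comp (op2_forms sp sp) (clin_op2 sp sp) kL).
move=> x y cx cy; rewrite op2_tens // [contrDR _ _ _]leibniz_tens //; [|exact: sp.1|exact: sp.1].
apply: (closedD cR).
  by apply: rel_l; [case: (sD _ cx.1) | exact: sp.1].
apply: rel_r; first by case: (sD _ cy.1).
by apply: (lcar_tau gO); apply: sp.1.
Qed.

Lemma form_rel_div (n : nat) f : form_rel (n.+1%:R \*o f) -> form_rel f.
Proof.
move=> /(closedQ cR (n.+1%:R^-1)); congr form_rel.
by apply: funext => j; rewrite !fE natK.
Qed.

(** In the Euler formula the contraction of f and that of df are both trivial, and the factor n + 1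
    can be divided out. *)
Lemma poincare0 n f : Defs.form 0 f -> form_order 0 n.+1 f -> form_rel (dDR f) -> form_rel f.
Proof.
move=> f0 /form_orderP; rewrite addn0 => fn df; have ff := form_forms gr f0.
apply: (@form_rel_div n); apply: form_eq_rel (eulerDR ff fn) _.
apply: (closedD cR); first by apply: dDR_rel; apply: (contr_form0 euler_der).
exact: (contrDR_rel Hom euler_der).
Qed.

(** A 1-form of order n has tensor degree n + 1, so the Euler formula exhibits its contraction with
    the Euler field, divided by n + 1, as a potential. *)
Lemma poincare1 n d f : Defs.form 1 f -> form_order 1 n f -> form_degree gr 1 d f ->
  form_rel (dDR f) ->
  exists al, [/\ Defs.form 0 al, form_order 0 n.+1 al, form_degree gr 0 d al &
    form_eq (dDR al) f].
Proof.
move=> /formP[ff sf] /form_orderP; rewrite addn1 => fn df rf.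
have hE := contr_component 0 euler_der (contr_component_fd (contrP Hom euler_der)).
have cE0 := der_cont (contr_der Hom euler_der).
have cE1 := der_cont (contr_component_fd (contrP Hom euler_der)).1.
set D1 := component (L := Om) fd (-1) (contr_op 0 euler) in hE cE1.
set D2 := component (L := Om) td 0 D1 in hE.
have E0 : eq_car euler (component (L := LW) sz 0 euler).
  apply: (order_component (n := 0) euler_der); apply: supp_has_order => i u lu su r.
  by rewrite addr0 => h; apply: su => e; apply: h; rewrite /euler /weight_op e mulr0.
(* The contraction is replaced by its part lowering the form degree by 1 and preserving the tensor
   degree, so that the potential has exact support. *)
pose be := leibniz (0 - 1) D2 f.
have fbe : forms be by apply: leibniz_forms => //; exact: (der_stable hE.1).
have ebe : form_eq (contrDR 0 euler f) be.
  apply: leibniz_cong => //; [exact: (der_stable (contr_der Hom euler_der)) | exact: (der_stable hE.1) |].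
  exact: (contr_unique (contrP Hom euler_der) hE E0).
have sbe : supp (ga2 td) (Posz n.+1) be.
  by have := @supp_leibniz K gr V td (0 - 1) 0 _ _ _ cE1 ff fn; rewrite addr0.
have bbe : supp (ga2 fd) 0 be.
  rewrite /be /D2 (@leibniz_component K gr V td _ 0 _ _ _ cE1 ff fn).
  have := @supp_leibniz K gr V fd (0 - 1) (-1) _ _ _ cE0 ff sf => /= h j.
  by rewrite /Pi; case: ifP => // _ /h.
exists (((n.+1%:R^-1 : rat)) *: be); split.
- apply/formP; split; first exact: (closedQ (@closed_forms K gr V)).
  by move=> j hj; apply: bbe => h; apply: hj; rewrite fE h scaler0.
- apply/form_orderP; rewrite addn0 => j hj; apply: sbe => h; apply: hj; rewrite fE h scaler0 //.
- move=> j; rewrite fE; apply: hcompVn.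
  have := hom_leibniz hE.1 ff df j; congr (gr _ _); ring.
have fE1 := dDR_forms fbe.
have kd := clin_leibniz 1 (der_stable (dR_der gr V)).
rewrite [dDR _](clinQ (@closed_forms K gr V) kd) //.
have h : form_eq (n.+1%:R \*o f) (dDR be).
  apply: form_eq_trans (eulerDR ff fn) _.
  have := form_eqD (dDR_eq (contrDR_forms Hom euler_der ff) fbe ebe)
    (proj2 (form_eq0 gr _) (contrDR_rel Hom euler_der rf)).
  by rewrite addr0.
have := closedQ cR (n.+1%:R^-1) (form_eq_sym h); congr form_rel.
by apply: funext => j; rewrite !fE scalerBr natK.
Qed.

(** A representative with exact degrees: om has tensor degree 2, and the part of the contraction
    that shifts by n gives n + 2, the tensor degree of a 1-form of order n + 1. *)
Lemma Phi_nice e xi (n : nat) : vfield e xi -> has_order n.+1 xi ->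
  exists th, [/\ Defs.form 1 th, form_order 1 n.+1 th, form_degree gr 1 (w + e) th &
    form_eq (Phi om e xi) th].
Proof.
move=> hxi ho; have [/formP[fo so] hom _ _ _] := Hom; move/form_orderP: om2 => o2.
have hE := contr_component n hxi (contr_component_fd (contrP Hom hxi)).
have cE0 := der_cont (contr_der Hom hxi).
have cE1 := der_cont (contr_component_fd (contrP Hom hxi)).1.
set D1 := component (L := Om) fd (-1) (contr_op e xi) in hE cE1.
set D2 := component (L := Om) td n D1 in hE.
have E0 := order_component hxi ho.
exists (leibniz (e - 1) D2 om); split.
- apply/formP; split; first by apply: leibniz_forms; first exact: (der_stable hE.1).
  rewrite /D2 (@leibniz_component K gr V td _ n _ _ _ cE1 fo o2).
  have := @supp_leibniz K gr V fd (e - 1) (-1) _ _ _ cE0 fo so => /= h j.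
  by rewrite /Pi; case: ifP => // _ /h.
- apply/form_orderP; have := @supp_leibniz K gr V td (e - 1) n _ _ _ cE1 fo o2.
  by rewrite (_ : (0 + 2)%N%:Z + n%:Z = (n.+1 + 1)%N%:Z) //; lia.
- move=> j; have := hom_leibniz hE.1 fo hom j; congr (gr _ _); ring.
apply: leibniz_cong => //; [exact: (der_stable (contr_der Hom hxi)) | exact: (der_stable hE.1) |].
exact: (contr_unique (contrP Hom hxi) hE E0).
Qed.

(** Hamiltonians exist: the contraction of om with a symplectic field is closed, and integrating it
    keeps the tensor degree n + 2, which for a 0-form is the order. *)
Lemma potential e xi (n : nat) : symplectic_field gr om e xi -> has_order n.+1 xi ->
  exists al, [/\ Defs.form 0 al, form_order 0 n.+2 al, form_degree gr 0 (w + e) al &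
    form_eq (dDR al) (Phi om e xi)].
Proof.
move=> [hxi sxi] ho; have [th [th1 tho thd E]] := Phi_nice hxi ho.
have fP := Phi_forms Hom hxi; have ft := form_forms gr th1.
have rth : form_rel (dDR th).
  apply: form_eq_rel (dDR_eq ft fP (form_eq_sym E)) _.
  by apply/(sympl_closed Hom hxi).
have [al [a0 ao ad Ea]] := poincare1 th1 tho thd rth.
by exists al; split=> //; apply: form_eq_trans Ea (form_eq_sym E).
Qed.

(** Non-degeneracy is applied to a representative of d al with exact degrees. The order of the field
    follows from uniqueness: om and d al have pure tensor degrees 2 and i + 2, so the component of
    the field of shift i has the same contraction with om. *)
Lemma UpsilonP i j al : cochain gr i.+2 j al ->
  [/\ vfield (j + 1 - w) (Upsilon gr w om j al), has_order i.+1 (Upsilon gr w om j al),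
    form_eq (Phi om (j + 1 - w) (Upsilon gr w om j al)) (sg j \*o dDR al) &
    symplectic_field gr om (j + 1 - w) (Upsilon gr w om j al)].
Proof.
move=> [/formP[fa sa] /form_orderP oa da]; rewrite addn0 in oa.
set e := j + 1 - w.
have cd := der_cont (dR_der gr V); have c1 := der_cont (der_component gO gF 1 (dR_der gr V)).
pose th := leibniz 1 dn al.
have Eth : form_eq (dDR al) th.
  apply: leibniz_cong => //; [exact: (der_stable (dR_der gr V)) | exact: (der_stable dn_der) |].
  exact: dnE.
have fth : forms th by apply: leibniz_forms; first exact: (der_stable dn_der).
have oth : supp (ga2 td) i.+2 th.
  by have := @supp_leibniz K gr V td 1 0 _ _ _ c1 fa oa; rewrite addr0.
have th1 : Defs.form 1 th.
  apply/formP; split => //; rewrite /th /dn (@leibniz_component K gr V td _ 0 _ _ _ c1 fa oa).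
  have := @supp_leibniz K gr V fd 1 1 _ _ _ cd fa sa => /= h k.
  by rewrite /Pi; case: ifP => // _ /h.
have dth : form_degree gr 1 (w + e) th.
  by move=> k; have := hom_leibniz dn_der fa da k; congr (gr _ _); rewrite /e; ring.
set P := [set xi : endo LW | vfield e xi /\ form_eq (Phi om e xi) (dDR al)].
have [hxi Exi] : P (xget 0 P).
  apply: xgetPex; have [_ _ _ _ /(_ e th th1 dth)[xi hxi Exi]] := Hom.
  by exists xi; split=> //; apply: form_eq_trans Exi (form_eq_sym Eth).
have -> : Upsilon gr w om j al = ksgn j *: xget 0 P by [].
set xi := xget 0 P in hxi Exi *.
have fda := dDR_forms fa.
have hU : vfield e (ksgn j *: xi) by apply: (der_sg gW).
have hc := der_component gW gS i hxi.
have lo : has_order i.+1 xi.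
  apply: (component_order hxi); apply: (Phi_inj Hom hxi hc).
  have := Phi_eq Hom hc (contr_component i hxi (contrP Hom hxi)).
  have fo := om_forms Hom; move/form_orderP: om2 => o2.
  rewrite (@leibniz_component K gr V td _ i _ _ _ (der_cont (contr_der Hom hxi)) fo o2) => E.
  apply: form_eq_trans _ (form_eq_sym E).
  have := Pi_rel gT (i.+2) (form_eq_trans Exi Eth).
  rewrite (flB (@flin_Pi K _ _ _)); have /suppP -> := oth.
  rewrite (_ : (0 + 2)%N%:Z + i%:Z = i.+2%:Z); last by lia.
  move=> E'; apply: form_eq_trans (form_eq_trans Exi Eth) _.
  exact: form_eq_sym.
have EU : form_eq (Phi om e (ksgn j *: xi)) (sg j \*o dDR al).
  have hs : contr_spec (gr := gr) e (ksgn j *: xi) (ksgn j *: contr_op e xi).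
    have [hD sD] := contrP Hom hxi; split; first exact: (der_sg gO).
    move=> u lu; rewrite !eE !fsg; split; first by apply: (closedZ (g_rel gO)); case: (sD _ lu).
    rewrite (flZ (@flin_of_g K V)).
    by apply: eqrZ; case: (sD _ lu).
  apply: form_eq_trans (Phi_eq Hom hU hs) _; rewrite leibniz_sg.
  exact: form_eqZ.
split => //.
  move=> a u lu su r hr; apply: (lo a u lu su).
  by move=> h; apply: hr; rewrite -[(ksgn j *: xi) u]/(ksgn j *: (xi u)) fsg fE h mulr0.
split => //; apply/(sympl_closed Hom hU).
apply: form_eq_rel (dDR_eq (Phi_forms Hom hU) _ EU) _; first exact: (closedZ (@closed_forms K gr V)).
rewrite [dDR (_ \*o _)](clinZ (@closed_forms K gr V) (clin_leibniz 1 (der_stable (dR_der gr V)))) //.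
by apply: (closedZ cR); apply: dDR2.
Qed.
End Symplectic.
End Poincare.

(** * Exponentials of vector fields *)
Section ExpSums.
Variables (K : comAlgType rat).

Lemma sum_triangle (M : zmodType) (f : nat -> nat -> M) N :
  \sum_(k < N) \sum_(i < k.+1) f i (k - i)%N =
  \sum_(i < N) \sum_(j < N) (if (i + j < N)%N then f i j else 0).
Proof.
elim: N => [|N IH]; first by rewrite !big_ord0.
rewrite big_ord_recr /= IH.
have e (i j : nat) : (i <= N)%N -> (j <= N)%N -> (if (i + j < N.+1)%N then f i j else 0) =
    (if (i + j < N)%N then f i j else 0) + (if (i + j == N)%N then f i j else 0).
  by move=> _ _; rewrite ltnS leq_eqVlt; case: eqP => [->|_] /=; rewrite ?ltnn ?add0r ?addr0.
under [RHS]eq_bigr => i _ do under eq_bigr => j _ do rewrite (e _ _ (ltn_ord i) (ltn_ord j)).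
under [RHS]eq_bigr => i _ do rewrite big_split.
rewrite big_split /=; congr (_ + _).
  rewrite big_ord_recr /= [X in _ = _ + X]big1 ?addr0 => [|j _]; last by case: ifP => //; lia.
  apply: eq_bigr => i _; rewrite big_ord_recr /= [X in _ = _ + X](_ : _ = 0) ?addr0 //.
  by case: ifP => //; lia.
apply: eq_bigr => i _.
have iN : (N - i < N.+1)%N by lia.
rewrite (bigD1 (Ordinal iN)) //= big1 ?addr0 => [|j /eqP jN].
  by case: eqP => //; have := ltn_ord i; lia.
case: eqP => // h; case: jN; apply: val_inj => /=; lia.
Qed.

(** Dividing the binomial formula by k! gives the coefficients 1/(i! j!) with i + j = k; truncation
    at N leaves the triangle i + j < N. *)
Lemma closed_exp_sum (B : eqType) (T : set (B -> K)) (be : nat -> nat -> B -> K) (de : nat -> B -> K) N :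
  csubmod T ->
  (forall k, T (de k - \sum_(i < k.+1) ('C(k, i)%:R : rat) *: be i (k - i)%N)) ->
  T ((\sum_(k < N) (k`!%:R^-1 : rat) *: de k) -
     \sum_(i < N) \sum_(j < N) (if (i + j < N)%N
        then (i`!%:R^-1 * j`!%:R^-1 : rat) *: be i j else 0)).
Proof.
move=> cT h.
rewrite -(sum_triangle (fun i j => (i`!%:R^-1 * j`!%:R^-1 : rat) *: be i j)) -sumrB.
apply: (closed_sum cT) => k _; have := closedQ cT (k`!%:R^-1) (h k); congr T.
rewrite scalerBr scaler_sumr; congr (_ - _); apply: eq_bigr => i _.
rewrite scalerA; congr (_ *: _).
have ik : (i <= k)%N by rewrite -ltnS.
have f0 m : (m`!%:R : rat) != 0 by rewrite Num.Theory.pnatr_eq0 -lt0n fact_gt0.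
have c0 : ('C(k, i)%:R : rat) != 0 by rewrite Num.Theory.pnatr_eq0 -lt0n bin_gt0.
have e : (k`!%:R : rat) = 'C(k, i)%:R * (i`!%:R * (k - i)`!%:R) by rewrite -!natrM bin_fact.
by rewrite e; field; rewrite c0 !f0.
Qed.
End ExpSums.

(** * Exponentials of operators that raise a weight *)

Section Exponential.
Variables (K : comAlgType rat) (B : eqType) (ga : B -> nat).
Implicit Types (x : B -> K) (b : B).

Definition low k x := forall b, (ga b < k)%N -> x b = 0.

(** For the word length this is [expv]; the same construction is used on the Lie de Rham algebra and
    on forms, with the tensor degree. If D raises the weight, its iterates beyond the cut-off vanish
    at b. *)
Definition gexp (D : (B -> K) -> B -> K) x : B -> K :=
  fun b => \sum_(k < (ga b).+1) (k`!%:R^-1 : rat) *: iter k D x b.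

Definition texp N (D : (B -> K) -> B -> K) x : B -> K :=
  \sum_(k < N) (k`!%:R^-1 : rat) *: iter k D x.

Lemma clin_lim (C : eqType) (S : set (B -> K)) (G : (B -> K) -> C -> K) :
  (forall F : seq C, exists2 A, clin S A & forall x, S x -> agree F (G x) (A x)) ->
  csubmod S -> clin S G.
Proof.
move=> h cS; split.
  move=> c x y Sx Sy; apply: funext => b; have [A kA GA] := h [:: b].
  rewrite !fE !GA ?inE //; last by apply: closedZD.
  by rewrite kA.1.
move=> F; have [A kA GA] := h F; have [H HP] := kA.2 F; exists H => x Sx x0 b bF.
by rewrite GA // HP.
Qed.

Section Fixed.
Variables (S : set (B -> K)) (cS : csubmod S).
Variables (D : (B -> K) -> B -> K).
Hypothesis (DS : forall x, S x -> S (D x)) (kD : clin S D).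
Hypothesis raise : forall k x, S x -> low k x -> low k.+1 (D x).

Lemma iter_closed k x : S x -> S (iter k D x).
Proof. by move=> Sx; elim: k => //= k; apply: DS. Qed.

Lemma iter_low k m x : S x -> low m x -> low (k + m) (iter k D x).
Proof.
move=> Sx lx; elim: k => [//|k IH]; rewrite addSn /=.
by apply: raise => //; apply: iter_closed.
Qed.

Lemma iter_low0 k x : S x -> low k (iter k D x).
Proof. by move=> Sx; rewrite -[k in low k]addn0; apply: iter_low. Qed.

Lemma gexp_trunc N x b : S x -> (ga b < N)%N -> gexp D x b = texp N D x b.
Proof.
move=> Sx; rewrite /texp fsumE => /subnK <-; elim: (N - _)%N => [//|m IH].
rewrite addSn big_ord_recr /= -IH fE.
by rewrite (iter_low0 (k := m + (ga b).+1) Sx) ?scaler0 ?addr0 // addnS ltnS leq_addl.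
Qed.

Definition bound (F : seq B) := (\max_(b <- F) ga b).+1.

Lemma bound_lt F b : b \in F -> (ga b < bound F)%N.
Proof. by move=> bF; rewrite ltnS leq_bigmax_seq. Qed.

Lemma gexp_agree F N x : S x -> (bound F <= N)%N -> agree F (gexp D x) (texp N D x).
Proof. by move=> Sx FN b bF; apply: gexp_trunc => //; apply: leq_trans FN; apply: bound_lt. Qed.

Lemma clin_iter k : clin S (iter k D).
Proof.
elim: k => [|k IH]; first exact: clin_id.
by apply: (clin_comp _ IH kD) => x; apply: iter_closed.
Qed.

Lemma clin_texp N : clin S (texp N D).
Proof.
apply: clin_sum_op => k _.
by apply: (clin_ext (fun x => fscale_alg _ _)); apply: clinZ_op; exact: clin_iter.
Qed.

Lemma clin_gexp : clin S (gexp D).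
Proof.
apply: clin_lim cS => F; exists (texp (bound F) D); first exact: clin_texp.
by move=> x Sx; apply: gexp_agree.
Qed.

Lemma texp_sub N (T : set (B -> K)) x : csubmod T -> (forall x, T x -> T (D x)) ->
  T x -> T (texp N D x).
Proof.
move=> cT TD Tx; apply: (closed_sum cT) => k _; apply: (closedQ cT).
by elim: (nat_of_ord k) => //= m; apply: TD.
Qed.

Lemma gexp_sub (T : set (B -> K)) x : csubmod T -> T `<=` S -> (forall x, T x -> T (D x)) ->
  T x -> T (gexp D x).
Proof.
move=> cT TS TD Tx; apply: closed_lim => // F.
exists (texp (bound F) D x); last by apply: gexp_agree => //; apply: TS.
exact: texp_sub.
Qed.

Lemma gexp_car x : S x -> S (gexp D x).
Proof. by apply: gexp_sub. Qed.

End Fixed.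

Lemma closed_low k : csubmod [set x | low k x].
Proof.
move=> x cx b bk; have [m [c [s [hs e]]]] := cx [:: b].
by rewrite e ?inE // big1 // => i _; rewrite (hs i) ?mulr0.
Qed.

Lemma low_agree F N x y : (bound F <= N)%N -> low N (x - y) -> agree F x y.
Proof.
move=> FN h b bF; apply/eqP; rewrite -subr_eq0; apply/eqP.
by apply: h; apply: leq_trans FN; apply: bound_lt.
Qed.

Lemma low_le k m x : (m <= k)%N -> low k x -> low m x.
Proof. by move=> mk h b bm; apply: h; apply: leq_trans mk. Qed.

Lemma supp_low (n k : nat) x : supp ga n x -> (k <= n)%N -> low k x.
Proof.
move=> sx kn b bk; have [//|/eqP/sx[e]] := eqVneq (x b) 0.
by move: bk; rewrite e ltnNge kn.
Qed.

Section Bilinear.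
Variables (S T : set (B -> K)) (cS : csubmod S) (cT : csubmod T).
Variables (D : (B -> K) -> B -> K).
Hypothesis (DS : forall x, S x -> S (D x)) (kD : clin S D).
Hypothesis (TS : T `<=` S) (DT : forall x, T x -> T (D x)).
Hypothesis raise : forall k x, S x -> low k x -> low k.+1 (D x).
Variables (be : nat -> nat -> B -> K).
Hypothesis (Sbe : forall i j, S (be i j)).
Hypothesis (Dbe : forall i j, T (D (be i j) - (be i.+1 j + be i j.+1))).
Hypothesis (lbe : forall i j, low (i + j) (be i j)).

Lemma pascal_sum k :
  \sum_(i < k.+1) ('C(k, i)%:R : rat) *: (be i.+1 (k - i) + be i (k - i).+1) =
  \sum_(i < k.+2) ('C(k.+1, i)%:R : rat) *: be i (k.+1 - i).
Proof.
rewrite [RHS]big_ord_recl /= bin0 subn0.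
under [X in _ = _ + X]eq_bigr => i _ do rewrite /bump add1n binS natrD scalerDl subSS.
rewrite big_split /=; under eq_bigr => i _ do rewrite scalerDr; rewrite big_split /=.
rewrite addrA addrC; congr (_ + _).
rewrite big_ord_recl /= bin0 subn0; congr (_ + _).
rewrite [RHS]big_ord_recr /= bin_small // scale0r addr0.
apply: eq_bigr => i _; rewrite /bump add1n; congr (_ *: be _ _).
by have := ltn_ord i; lia.
Qed.

(** The binomial Leibniz formula for D^k, with equality modulo T, by Pascal's rule. *)
Lemma iter_leibniz k :
  T (iter k D (be 0 0) - \sum_(i < k.+1) ('C(k, i)%:R : rat) *: be i (k - i)%N).
Proof.
elim: k => [|k IH].
  by rewrite big_ord1 /= bin0 scale1r subrr; apply: (closed0 cT).
rewrite -pascal_sum iterS.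
have Sb : S (\sum_(i < k.+1) ('C(k, i)%:R : rat) *: be i (k - i)%N).
  by apply: (closed_sum cS) => i _; apply: (closedQ cS).
have h := DT IH; rewrite (clinB cS kD) // in h; last by apply: iter_closed.
rewrite (clin_sum cS kD) in h => [|i _]; last exact: (closedQ cS).
have h2 : T (\sum_(i < k.+1) ('C(k, i)%:R : rat) *:
    (D (be i (k - i)%N) - (be i.+1 (k - i) + be i (k - i).+1))).
  by apply: (closed_sum cT) => i _; apply: (closedQ cT).
have := closedD cT h h2; congr T.
under [X in _ + X = _]eq_bigr => i _ do rewrite scalerBr.
rewrite sumrB addrA; congr (_ - _).
under [X in _ - X]eq_bigr => i _ do rewrite (clinQ cS kD) //.
by rewrite subrK.
Qed.

(** The principle exp(D) B(x,y) = B(exp(D) x, exp(D) y) modulo T, for a pairing B that satisfies the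
    Leibniz rule: [be i j] plays the role of B(D^i x, D^j y) and z that of the right-hand side. It
    is applied to brackets and to tensor products. *)
Lemma exp_bilinear z :
  (forall N, low N (z - \sum_(i < N) \sum_(j < N) (i`!%:R^-1 * j`!%:R^-1 : rat) *: be i j)) ->
  T (gexp D (be 0 0) - z).
Proof.
move=> hz; apply: closed_lim => // F; pose N := bound F.
exists (texp N D (be 0 0) - \sum_(i < N) \sum_(j < N)
    (if (i + j < N)%N then (i`!%:R^-1 * j`!%:R^-1 : rat) *: be i j else 0)).
  exact: (closed_exp_sum N cT iter_leibniz).
move=> b bF; rewrite !fE; congr (_ - _).
  exact: (gexp_agree DS raise (Sbe 0 0) (leqnn _) bF).
have := low_agree (leqnn _) (hz N) bF => ->.
rewrite !fsumE; apply: eq_bigr => i _; rewrite !fsumE; apply: eq_bigr => j _.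
case: ltnP => // ij; rewrite fE (lbe (leq_trans _ ij)) ?scaler0 //.
exact: bound_lt.
Qed.
End Bilinear.

(** In the product of the two series the coefficient of D^k is (1 - 1)^k / k!, which vanishes for k
    > 0. *)
Lemma gexp_neg (S : set (B -> K)) (D : (B -> K) -> B -> K) (cS : csubmod S)
  (DS : forall x, S x -> S (D x)) (kD : clin S D)
  (raise : forall k x, S x -> low k x -> low k.+1 (D x)) x :
  S x -> gexp D (gexp (fun y => - D y) x) = x.
Proof.
move=> Sx; pose D' y := - D y.
have DS' y : S y -> S (D' y) by move=> Sy; apply: (closedN cS); apply: DS.
have kD' : clin S D'.
  by apply: (clin_ext (fun y => esym (fmulN1 _))); apply: clinZ_op.
have raise' k y : S y -> low k y -> low k.+1 (D' y).
  by move=> Sy ly b bk; rewrite /D' foppE (raise _ _ Sy ly) ?oppr0.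
have iterN j : iter j D' x = (-1) ^+ j *: iter j D x.
  elim: j => [|j IH]; first by rewrite expr0 scale1r.
  by rewrite /= IH /D' (clinQ cS kD) ?exprS ?mulN1r ?scaleNr //; apply: iter_closed.
(* The total of the terms of degree k in D: only k = 0 contributes. *)
pose de (k : nat) := if k == 0%N then x else 0.
pose be (i j : nat) := (-1) ^+ j *: iter (i + j) D x : B -> K.
apply: funext => b; set N := (ga b).+1.
have Sx' : S (gexp D' x) by apply: (gexp_car cS DS' raise').
rewrite (gexp_trunc DS raise Sx' (ltnSn _)) -/N.
have kT := clin_texp DS kD N.
have low_texp y : S y -> low N y -> texp N D y b = 0.
  move=> Sy ly; rewrite /texp fsumE big1 // => k _; rewrite fE.
  rewrite (iter_low DS raise (k := k) Sy ly) ?scaler0 //.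
  by rewrite -/N leq_addl.
have Sx'' : S (texp N D' x) by exact: (texp_sub N cS DS' Sx).
have ld : low N (gexp D' x - texp N D' x).
  by move=> c cN; rewrite !fE (gexp_trunc DS' raise' Sx cN) subrr.
have -> : texp N D (gexp D' x) b = texp N D (texp N D' x) b.
  apply/eqP; rewrite -subr_eq0; apply/eqP.
  have := clinB cS kT Sx' Sx'' => /(congr1 (fun G => G b)); rewrite !fE => <-.
  by apply: low_texp => //; apply: (closedB cS).
have h k : [set 0] (de k - \sum_(i < k.+1) ('C(k, i)%:R : rat) *: be i (k - i)%N).
  apply/eqP; rewrite subr_eq0; apply/eqP.
  have -> : \sum_(i < k.+1) ('C(k, i)%:R : rat) *: be i (k - i)%N =
      (\sum_(i < k.+1) (-1) ^+ (k - i) * 1 ^+ i *+ 'C(k, i) : rat) *: iter k D x.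
    rewrite scaler_suml; apply: eq_bigr => i _.
    rewrite /be subnKC -1?ltnS // scalerA expr1n mulr1 mulr_natl //.
  rewrite -exprDn addNr expr0n /de.
  by case: k => [|k] /=; rewrite ?scale1r ?scale0r.
have := closed_exp_sum N (@closed_eq0 K B) h.
move=> /(congr1 (fun G => G b)); rewrite !fE => /eqP; rewrite subr_eq0 => /eqP.
rewrite big_ord_recl big1 => [|i _]; last by rewrite /de /= scaler0.
rewrite addr0 fact0 invr1 scale1r => e; rewrite -[x b]/(de (@ord0 (ga b)) b) e.
have Si i j : S (be i j) by apply: (closedQ cS); apply: iter_closed.
have -> : texp N D (texp N D' x) =
    \sum_(i < N) \sum_(j < N) (i`!%:R^-1 * j`!%:R^-1 : rat) *: be i j.
  apply: eq_bigr => i _; have ki := clin_iter DS kD i.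
  rewrite /texp (clin_sum cS ki) => [|j _]; last by apply: (closedQ cS); apply: iter_closed.
  rewrite scaler_sumr; apply: eq_bigr => j _.
  rewrite (clinQ cS ki); last by apply: iter_closed.
  rewrite iterN (clinQ cS ki); last by apply: iter_closed.
  by rewrite -iterD scalerA.
rewrite !fsumE; apply: eq_bigr => i _; rewrite !fsumE; apply: eq_bigr => j _.
case: ltnP => // ij; rewrite fE /be fE (iter_low0 DS raise Sx) ?scaler0 //.
Qed.
End Exponential.

(** * Exponentials of derivations are morphisms *)

Section LieExp.
Variables (K : comAlgType rat) (gr : even_grading K) (L : lie_alg K).
Hypothesis gL : good gr L.
Variables (ga : ix L -> nat) (gg : graded (L := L) ga).
Local Notation lcL := (lcar (l := L)).
Local Notation low := (low ga).
Implicit Types (x y : ix L -> K).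

Lemma low_lbrk i j x y : low i x -> low j y -> low (i + j) (lbrk x y).
Proof.
move=> lx ly.
have lPi (k : nat) (z : ix L -> K) n : low k z -> Pi ga n z = 0 \/ exists2 m : nat, n = m & (k <= m)%N.
  move=> lz; case: n => m; last by left; apply: funext => b; rewrite /Pi.
  case: (leqP k m) => km; [by right; exists m | left; apply: funext => b; rewrite /Pi].
  by case: eqP => // -[e]; apply: lz; rewrite e.
have cl := @closed_low K _ ga (i + j).
change ([set z | low (i + j) (lbrk z y)] x).
apply: (closed_Pi (ga := ga)); first exact: (csub_preim (g_fll gL y) cl).
move=> n; change ([set z | low (i + j) (lbrk (Pi ga n x) z)] y).
apply: (closed_Pi (ga := ga)); first exact: (csub_preim (g_flr gL _) cl).
move=> m /=; have [->|[a -> ia]] := lPi i x n lx; first by rewrite (fl0 (g_fll gL _)).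
have [->|[b -> jb]] := lPi j y m ly; first by rewrite (fl0 (g_flr gL _)).
have := supp_lbrk gL gg (@supp_Pi K _ ga a x) (@supp_Pi K _ ga b y).
by rewrite -PoszD => /supp_low; apply; apply: leq_add.
Qed.

Lemma component_raise (s : nat) (D : endo L) k x : (0 < s)%N -> cont_endo D -> lcL x ->
  low k x -> low k.+1 (component ga s D x).
Proof.
move=> s0 cD lx lo b bk; rewrite /component.
have -> : Pi ga ((ga b)%:Z - s%:Z) x = 0.
  apply: funext => c; rewrite /Pi; case: eqP => // e; apply: lo.
  by move: bk s0 e; lia.
by rewrite (clin0 (g_car gL) (cont_clin cD)).
Qed.

Variables (D : endo L) (hD : derivation gr 0 D).
Hypothesis raise : forall k x, lcL x -> low k x -> low k.+1 (D x).
Let cD := der_cont hD.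
Let kD := cont_clin cD.
Let DS x (lx : lcL x) : lcL (D x) := cont_car cD lx.
Let DT x (lx : lrel (l := L) x) : lrel (l := L) (D x) := cont_rel cD lx.

Lemma gexp_cont : cont_endo (gexp ga D : endo L).
Proof.
have [k1 k2] := clin_gexp (g_car gL) DS kD raise.
split=> // x lx; first exact: (gexp_car (g_car gL) DS raise lx).
exact: (gexp_sub DS raise (g_rel gL) (g_sub gL) DT lx).
Qed.

(** The instance of [exp_bilinear] with B the Lie bracket, modulo the relations; degrees are
    preserved because D has degree 0 and factorials can be divided out. *)
Lemma gexp_morphism : morphism gr (gexp ga D : endo L).
Proof.
split; first exact: gexp_cont.
  move=> d x lx hx b; rewrite addr0; apply: hcomp_add_sum => k _.
  have -> : k`! = k`!.-1.+1 by rewrite prednK // fact_gt0.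
  apply: hcompVn; move: (nat_of_ord k) => {}k; elim: k b => [|m IH] b //=.
  have [_ dD _] := hD; have := dD d (iter m D x) (iter_closed DS m lx) IH b.
  by rewrite addr0.
move=> x y lx ly.
have Sx i := iter_closed DS i lx; have Sy i := iter_closed DS i ly.
apply: (@exp_bilinear _ _ ga lcL (lrel (l := L)) _ _ D _ _ _ _ (fun i j => lbrk (iter i D x) (iter j D y))) => //.
- exact: (g_car gL).
- exact: (g_rel gL).
- by move=> i j; apply: (g_brk gL).
- move=> i j; have /(derivationP gL)[_ _ mD] := hD.
  by have := mD _ _ (Sx i) (Sy j); rewrite /defect tau0.
- by move=> i j; apply: low_lbrk; exact: (iter_low0 DS raise).
move=> N.
have -> : \sum_(i < N) \sum_(j < N) (i`!%:R^-1 * j`!%:R^-1 : rat) *: lbrk (iter i D x) (iter j D y)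
    = lbrk (texp N D x) (texp N D y).
  rewrite /texp (fl_sum (g_fll gL _)); apply: eq_bigr => i _.
  rewrite (flQ (g_fll gL _)) (fl_sum (g_flr gL _)) scaler_sumr; apply: eq_bigr => j _.
  by rewrite (flQ (g_flr gL _)) scalerA.
have lt z (lz : lcL z) : low N (gexp ga D z - texp N D z).
  by move=> b bN; rewrite !fE (gexp_trunc DS raise lz bN) subrr.
(* The error of truncating both arguments is split into two brackets, each with one argument
   starting in weight N. *)
have -> : lbrk (gexp ga D x) (gexp ga D y) - lbrk (texp N D x) (texp N D y) =
    lbrk (gexp ga D x - texp N D x) (gexp ga D y) + lbrk (texp N D x) (gexp ga D y - texp N D y).
  by rewrite (flB (g_fll gL _)) (flB (g_flr gL _)) addrA subrK.
apply: (closedD (@closed_low K _ ga N)).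
  by rewrite -[N]addn0; apply: low_lbrk; [rewrite addn0; exact: lt | ].
by rewrite -[N]add0n; apply: low_lbrk; [ | rewrite add0n; exact: lt].
Qed.
End LieExp.

(** * Exponentials of symplectic fields *)

Section SymplExp.
Variables (K : comAlgType rat) (gr : even_grading K) (V : free_module).
Local Notation X := (seq (bas V) -> K).
Local Notation LW := (@LW K V).
Local Notation lcW := (lcar (l := LW)).
Local Notation F := (form_ix V -> K).
Local Notation F2 := (form2_ix V -> K).
Local Notation Om := (@Omega K gr V).
Local Notation ocar := (lcar (l := Om)).
Local Notation orel := (lrel (l := Om)).
Local Notation form_rel := (@form_rel K gr V).
Local Notation form_eq := (@form_eq K gr V).
Local Notation leibniz := (@leibniz K gr V).
Local Notation forms := (@forms K gr V).
Local Notation eqr := (@eqr K gr V).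
Local Notation dR := (@derham K gr V).
Local Notation lie_op := (@lie_op K gr V).
Local Notation pull_op := (@pull_op K gr V).
Local Notation pullDR := (@pullDR K gr V).
Local Notation vfield := (@vector_field K gr V).
Local Notation sz := (@size (bas V)).
Local Notation td := (@tdeg V).
Implicit Types (x y z : F) (u v : X) (f h : F2) (D G : endo Om) (xi eta phi : endo LW).
Let gO := good_Omega gr V.
Let gW := good_LW gr V.
Let gS := graded_LW K V.
Let gT := graded_tdeg gr V.
Let cR := @closed_form_rel K gr V.

Lemma mor_comp (L : lie_alg K) (gL : good gr L) (G G' : endo L) :
  morphism gr G -> morphism gr G' -> morphism gr (G \o G').
Proof.
move=> [cG dG mG] [cG' dG' mG']; split; first exact: cont_comp.
  move=> d x lx hx; have h := dG' d x lx hx.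
  by have := dG (d + 0) (G' x) (cont_car cG' lx) h; rewrite !addr0.
move=> x y lx ly; have [lx' ly'] := (cont_car cG' lx, cont_car cG' ly).
have := closedD (g_rel gL) (cont_rel cG (mG' x y lx ly)) (mG _ _ lx' ly').
rewrite (clinB (g_car gL) (cont_clin cG)) ?addrA ?subrK //.
  by apply: (cont_car cG'); apply: (g_brk gL).
exact: (g_brk gL).
Qed.

Lemma mor_id (L : lie_alg K) (gL : good gr L) : morphism gr (id : endo L).
Proof.
split; first exact: cont_id.
  by move=> d x _; rewrite addr0.
by move=> x y _ _; rewrite subrr; apply: (closed0 (g_rel gL)).
Qed.

Lemma mor_stable G : morphism gr G -> stable G.
Proof. by case=> cG _ _; apply: stable_cont. Qed.

Lemma op2_comp G G' H H' f : stable G -> stable G' -> stable H -> stable H' -> forms f ->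
  op2 (G \o G') (H \o H') f = op2 G H (op2 G' H' f).
Proof.
move=> sG sG' sH sH'; move: f; apply: forms_eq.
- by apply: clin_op2; apply: stable_comp.
- exact: (clin_comp (op2_forms sG' sH') (clin_op2 sG' sH') (clin_op2 sG sH)).
move=> x y cx cy; rewrite !op2_tens //; by [apply: stable_comp | apply: sG'.1 | apply: sH'.1].
Qed.

Lemma op2_cong G G' f : stable G -> stable G' -> (forall x, ocar x -> eqr (G x) (G' x)) ->
  forms f -> form_eq (op2 G G f) (op2 G' G' f).
Proof.
move=> sG sG' E; move: f; apply: (forms_ind (G := fun f => op2 G G f - op2 G' G' f) cR).
  by apply: clinB_op; apply: clin_op2.
move=> x y cx cy; rewrite !op2_tens //.
have := closedD cR (rel_l (E _ cx) (sG.1 _ cy)) (rel_r (E _ cy) (sG'.1 _ cx)).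
by rewrite (flB (flin_tensl _)) (flB (flin_tensr _)) addrA subrK.
Qed.

Lemma op2_rel G f : morphism gr G -> form_rel f -> form_rel (op2 G G f).
Proof.
move=> hG; have [cG dG mG] := hG; have sG := mor_stable hG.
have kG := clin_op2 sG sG; have sub := g_sub gO; have Gc := sG.1; have bc := g_brk gO.
suff h : form_rel `<=` [set f | forms f /\ form_rel (op2 G G f)] by move=> /h[].
apply: form_relP => [|r x rr cx|r x rr cx|x y p q cx cy hx hy|x y z cx cy cz].
- exact: (closed_preim (@closed_forms K gr V) kG cR).
- have cr := sub _ rr; split; first exact: forms_tens.
  by rewrite op2_tens //; apply: rel_l; [exact: (cont_rel cG) | exact: Gc].
- have cr := sub _ rr; split; first exact: forms_tens.
  by rewrite op2_tens //; apply: rel_r; [exact: (cont_rel cG) | exact: Gc].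
- split; first by apply: form_rel_forms; apply: rel_sym.
  rewrite (clinB (@closed_forms K gr V) kG) ?(clinZ (@closed_forms K gr V) kG) ?op2_tens //;
    try by [apply: forms_tens | apply: (closedZ (@closed_forms K gr V)); apply: forms_tens].
  by apply: rel_sym; [exact: Gc | exact: Gc | rewrite -[p]addr0; exact: dG | rewrite -[q]addr0; exact: dG].
split; first by apply: form_rel_forms; apply: rel_brk.
rewrite (clinB (@closed_forms K gr V) kG) ?op2_tens //; try by [apply: forms_tens; auto | auto].
have := closedD cR (closedD cR (rel_brk (Gc _ cx) (Gc _ cy) (Gc _ cz)) (rel_r (mG _ _ cy cz) (Gc _ cx)))
  (closedN cR (rel_l (mG _ _ cx cy) (Gc _ cz))).
rewrite !(flB (flin_tensr _)) !(flB (flin_tensl _)); congr form_rel.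
by apply: funext => j; rewrite !fE; ring.
Qed.

Definition pull_spec phi G := morphism gr G /\
  forall u, lcW u -> orel (G (of_g u) - of_g (phi u)) /\ orel (G (d_of u) - dR (of_g (phi u))).

Lemma pull_unique phi G G' : pull_spec phi G -> pull_spec phi G' ->
  forall x, ocar x -> eqr (G x) (G' x).
Proof.
move=> [hG sG] [hG' sG']; apply: (mor_unique hG hG') => b; have lb := @lcW_letter K V (delta b).
  by apply: (eqr_trans (proj1 (sG _ lb))); apply: eqr_sym; case: (sG' _ lb).
by apply: (eqr_trans (proj2 (sG _ lb))); apply: eqr_sym; case: (sG' _ lb).
Qed.

Section Symplectic.
Variables (w : int) (om : F2) (Hom : @symplectic_form K gr V w om).

(* Otherwise [pull_op phi = 0], so that [om] vanishes, hence so do all vector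
   fields, among them the Euler field, and the Lie algebra is zero. *)
Lemma pull_ex phi : symplectomorphism gr om phi -> pull_spec phi (pull_op phi).
Proof.
move=> [[hphi _] sphi]; suff h : exists G, pull_spec phi G by have := xgetPex (0 : endo Om) h.
apply: contrapT => h.
have p0 : pull_op phi = 0 by apply: xgetPN => G hG; apply: h; exists G.
have rom : form_rel om.
  have : form_rel (pullDR phi om - om) := sphi; rewrite /Defs.pullDR p0.
  by rewrite [X in X - _](_ : _ = 0) ?sub0r => [/(closedN cR)|//]; rewrite opprK.
have hE := euler_der gr V.
have E : eq_car (@euler K V) 0.
  apply: (Phi_inj Hom hE (der0 gW 0)); apply: (closedB cR).
    exact: (contrDR_rel Hom hE).
  exact: (contrDR_rel Hom (der0 gW 0)).
have nob (b : bas V) : False.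
  have := congr1 (fun u : X => u [:: b]) (E _ (@lcW_letter K V (delta b))).
  rewrite /euler /weight_op /= /delta eqxx mulr1 -[RHS]/(0 : K) => /eqP.
  by rewrite oner_eq0.
have z u : lcW u -> u = 0.
  move: u; apply: (lcW_ind (P := [set 0]) (D := id)); [exact: closed_eq0 | exact: flin_id |].
  by move=> u; elim=> [l [b] lb|y y' _ -> _ ->]; [case: (nob b) | rewrite (fl0 (flin_tbrkl _ _))].
apply: h; exists id; split; first exact: mor_id gO.
move=> u lu; have l2 : lcW (phi u) by apply: cont_car lu; case: hphi.
rewrite (z _ l2) (z _ lu) /= of_g0 subrr; split; first exact: (closed0 (g_rel gO)).
rewrite (fl0 (@flin_d_of K V)) (clin0 (g_car gO) (cont_clin (der_cont (dR_der gr V)))).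
by rewrite subrr; exact: (closed0 (g_rel gO)).
Qed.

Section Flow.
Variables (xi : endo LW) (s : nat).
Hypotheses (hxi : symplectic_field gr om 0 xi) (oxi : has_order s.+1 xi) (s0 : (0 < s)%N).

Let vxi : vfield 0 xi := hxi.1.
Let cxi := der_cont vxi.

Lemma field_raise k u : lcW u -> low sz k u -> low sz k.+1 (xi u).
Proof.
move=> lu lo; rewrite (order_component vxi oxi) //.
exact: (component_raise gW s0).
Qed.

Lemma expv_morphism : morphism gr (expv xi).
Proof. exact: (gexp_morphism gW gS vxi field_raise). Qed.

(** Modulo relations this is the Lie derivative along xi, cut down to its component of shift s, so
    that it raises the tensor degree and can be exponentiated coordinatewise. *)
Let D : endo Om := component (L := Om) td s (lie_op 0 xi).
Let hD := lie_component s vxi (lieP Hom vxi).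

Lemma flow_lie : lie_spec (gr := gr) 0 xi D.
Proof.
have [dD sD] := hD; split => // u lu; have [s1 s2] := sD u lu.
by rewrite (order_component vxi oxi lu).
Qed.

Let dD : derivation gr 0 D := flow_lie.1.
Let cD := der_cont dD.

Lemma flow_raise k x : ocar x -> low td k x -> low td k.+1 (D x).
Proof. move=> cx lo; apply: (component_raise gO s0) => //; exact: (der_cont (lie_der Hom vxi)). Qed.

Definition flow : endo Om := gexp td D.

Lemma flow_morphism : morphism gr flow.
Proof. exact: (gexp_morphism gO gT dD flow_raise). Qed.

Let DS x (cx : ocar x) : ocar (D x) := cont_car cD cx.
Let xS u (lu : lcW u) : lcW (xi u) := cont_car cxi lu.

Lemma flow_of_g u : lcW u -> eqr (flow (of_g u)) (of_g (expv xi u)).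
Proof.
move=> lu; apply: closed_lim (g_rel gO) _ => G.
have og v := @of_g_ocar K gr V v.
have h k : eqr (iter k D (of_g u)) (of_g (iter k xi u)).
  elim: k => [|k IH] /=; first exact: eqr_refl.
  have li := iter_closed xS k lu.
  apply: (eqr_trans (eqr_cont cD _ _ IH)); [exact: (iter_closed DS k (og _ lu)) | exact: og |].
  by case: (flow_lie) => _ /(_ _ li)[].
pose N := bound td G.
exists (texp N D (of_g u) - of_g (texp N xi u)).
  rewrite /texp (fl_sum (@flin_of_g K V)) -sumrB; apply: (closed_sum (g_rel gO)) => k _.
  by rewrite (flQ (@flin_of_g K V)) -scalerBr; apply: (closedQ (g_rel gO)); apply: h.
move=> j jG; rewrite !fE /flow (gexp_agree DS flow_raise (og _ lu) (leqnn _) jG); congr (_ - _).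
case: j jG => //= t tG; apply: (gexp_trunc xS field_raise lu).
exact: (bound_lt td tG).
Qed.

(** The Lie derivative along a field of degree 0 commutes with d modulo relations, hence so do its
    powers and, in the limit, its exponential. *)
Lemma flow_dR x : ocar x -> eqr (flow (dR x)) (dR (flow x)).
Proof.
move=> cx; have cd := der_cont (dR_der gr V); have kd := cont_clin cd.
have h y : ocar y -> eqr (D (dR y)) (dR (D y)).
  move=> cy; have := lie_dR vxi flow_lie cy.
  by rewrite /gcomm !eE fsg mul0r sg0 fmul1 -[(0 : endo Om) y]/(0 : F) => /eqr0.
have hk k : eqr (iter k D (dR x)) (dR (iter k D x)).
  elim: k => [|k IH] /=; first exact: eqr_refl.
  have ci := iter_closed DS k cx.
  apply: (eqr_trans (eqr_cont cD _ _ IH)); last exact: h.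
    by apply: (iter_closed DS); apply: (cont_car cd).
  exact: (cont_car cd).
apply: closed_lim (g_rel gO) _ => G; have [H HP] := clin_cont (g_car gO) kd G.
(* The truncation has to be exact on the window G and also on the window H, which controls the
   values of d on G. *)
pose N := maxn (bound td G) (bound td H).
have [gN hN] : (bound td G <= N)%N /\ (bound td H <= N)%N by rewrite leq_maxl leq_maxr.
have ct : ocar (texp N D x) := texp_sub N (g_car gO) DS cx.
exists (texp N D (dR x) - dR (texp N D x)).
  rewrite /texp (clin_sum (g_car gO) kd) => [|k _]; last first.
    by apply: (closedQ (g_car gO)); apply: iter_closed.
  rewrite -sumrB; apply: (closed_sum (g_rel gO)) => k _.
  rewrite (clinQ (g_car gO) kd); last exact: iter_closed.
  by rewrite -scalerBr; apply: (closedQ (g_rel gO)); apply: hk.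
move=> j jG; rewrite !fE /flow (gexp_agree DS flow_raise (cont_car cd cx) gN jG); congr (_ - _).
apply: (HP _ _ _ ct) jG; first exact: (gexp_car (g_car gO) DS flow_raise cx).
exact: (gexp_agree DS flow_raise cx hN).
Qed.

(** The exponential of the Lie derivative realises the pullback along exp(xi), since it is a
    morphism commuting with d. *)
Lemma flow_pull phi G : pull_spec phi G -> (forall u, lcW u -> lcW (phi u)) ->
  pull_spec (expv xi \o phi) (flow \o G).
Proof.
move=> [hG sG] lphi; have [cG _ _] := hG; have [cE _ _] := flow_morphism.
have og v := @of_g_ocar K gr V v; have od v := @d_of_ocar K gr V v.
have cd := der_cont (dR_der gr V); have [ce _ _] := expv_morphism.
split; first by apply: (mor_comp gO) => //; exact: flow_morphism.
move=> u lu; have [s1 s2] := sG u lu; have lp := lphi _ lu; split => /=.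
  apply: (eqr_trans (eqr_cont cE _ _ s1)); [exact: (cont_car cG (og _ lu)) | exact: og | exact: flow_of_g].
apply: (eqr_trans (eqr_cont cE _ _ s2)); [exact: (cont_car cG (od _ lu)) | exact: (cont_car cd (og _ lp)) |].
apply: (eqr_trans (flow_dR (og _ lp))); apply: eqr_cont => //.
- exact: (cont_car cE (og _ lp)).
- by apply: og; exact: (cont_car ce lp).
exact: flow_of_g.
Qed.

Let sD := der_stable dD.

Lemma leibniz_raise k f : forms f -> low (ga2 td) k f -> low (ga2 td) k.+1 (leibniz 0 D f).
Proof.
move=> ff lo [a b]; rewrite /ga2 /= => ab; rewrite /Defs.leibniz /=.
rewrite (@flow_raise (k - td b) (fun c => f (c, b)) (slicel b ff)); last by lia.
  rewrite (@flow_raise (k - td a) (fun c => f (a, c)) (slicer a ff)); last by lia.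
    by rewrite scaler0 addr0.
  by move=> c ck; apply: lo; rewrite /ga2 /=; lia.
by move=> c ck; apply: lo; rewrite /ga2 /=; lia.
Qed.

Lemma low_tens i j x y : low td i x -> low td j y -> low (ga2 td) (i + j) (tens x y).
Proof.
move=> lx ly [a b]; rewrite /ga2 /tens /= => ab.
have [ai|ai] := ltnP (td a) i; first by rewrite lx ?mul0r.
by rewrite ly ?mulr0 //; lia.
Qed.

(** The second use of [exp_bilinear], with B the tensor product and equality on the nose: exp(D) (x)
    exp(D) is the exponential of the Leibniz operator of D. *)
Lemma op2_flow f : forms f -> op2 flow flow f = gexp (ga2 td) (leibniz 0 D) f.
Proof.
have sE := mor_stable flow_morphism; have kL := clin_leibniz 0 sD.
have LS g := @leibniz_forms K gr V 0 D sD g.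
move: f; apply: forms_eq; first exact: clin_op2.
  exact: (clin_gexp (@closed_forms K gr V) LS kL leibniz_raise).
move=> x y cx cy; rewrite op2_tens //.
have Sx i := iter_closed DS i cx; have Sy i := iter_closed DS i cy.
apply/eqP; rewrite eq_sym -subr_eq0; apply/eqP.
apply: (@exp_bilinear _ _ (ga2 td) forms [set 0] _ _ (leibniz 0 D) _ _ _ _ (fun i j => tens (iter i D x) (iter j D y))).
- exact: closed_forms. - exact: closed_eq0. - exact: LS. - exact: kL.
- by move=> _ ->; apply: (clin0 (@closed_forms K gr V) kL).
- exact: leibniz_raise.
- by move=> i j; apply: forms_tens.
- by move=> i j; rewrite leibniz_tens // tau0 subrr.
- by move=> i j; apply: low_tens; exact: (iter_low0 DS flow_raise).
move=> N.
have -> : \sum_(i < N) \sum_(j < N) (i`!%:R^-1 * j`!%:R^-1 : rat) *: tens (iter i D x) (iter j D y)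
    = tens (texp N D x) (texp N D y).
  rewrite /texp (fl_sum (flin_tensl _)); apply: eq_bigr => i _.
  rewrite (flQ (flin_tensl _)) (fl_sum (flin_tensr _)) scaler_sumr; apply: eq_bigr => j _.
  by rewrite (flQ (flin_tensr _)) scalerA.
have lt z (lz : ocar z) : low td N (flow z - texp N D z).
  by move=> b bN; rewrite !fE /flow (gexp_trunc DS flow_raise lz bN) subrr.
have -> : tens (flow x) (flow y) - tens (texp N D x) (texp N D y) =
    tens (flow x - texp N D x) (flow y) + tens (texp N D x) (flow y - texp N D y).
  by rewrite (flB (flin_tensl _)) (flB (flin_tensr _)) addrA subrK.
apply: (closedD (@closed_low K _ (ga2 td) N)).
  by rewrite -[N]addn0; apply: low_tens; [rewrite addn0; exact: lt | ].
by rewrite -[N]add0n; apply: low_tens; [ | rewrite add0n; exact: lt].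
Qed.

(** The term of degree 0 of the exponential is om, and all others are relations because L_xi om is
    one. *)
Lemma flow_om : form_eq (op2 flow flow om) om.
Proof.
have fo := om_forms Hom; have kL := clin_leibniz 0 sD.
have LS g := @leibniz_forms K gr V 0 D sD g.
have r1 : form_rel (leibniz 0 D om).
  apply: form_eq_rel hxi.2; apply: leibniz_cong => //.
    exact: (der_stable (lie_der Hom vxi)).
  exact: (lie_unique flow_lie (lieP Hom vxi)).
rewrite op2_flow //; apply: closed_lim cR _ => G; pose N := bound (ga2 td) G.
exists (texp N (leibniz 0 D) om - om); last first.
  move=> j jG; rewrite !fE; congr (_ - _).
  exact: (gexp_agree LS leibniz_raise fo (leqnn _) jG).
rewrite /texp /N /bound big_ord_recl fact0 invr1 scale1r /= addrAC subrr add0r.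
apply: (closed_sum cR) => k _; apply: (closedQ cR); move: (nat_of_ord k) => {}k.
have h : form_rel (iter k.+1 (leibniz 0 D) om) by rewrite iterSr; elim: k => //= k; exact: leibniz_rel.
exact: h.
Qed.

(** The inverse is the inverse of phi composed with the exponential of -xi. A pullback along the
    composite exists, as the flow composed with the pullback along phi, so by uniqueness it may be
    used to compute the effect on om. *)
Lemma exp_sympl phi : symplectomorphism gr om phi -> symplectomorphism gr om (expv xi \o phi).
Proof.
move=> hs; have hP := pull_ex hs; have [[hphi [G hG [e1 e2]]] sphi] := hs.
have [cphi _ _] := hphi; have [cG _ _] := hG.
have lphi u : lcW u -> lcW (phi u) by apply: cont_car.
have [ce _ _] := expv_morphism.
split.
  split; first by apply: (mor_comp gW) => //; exact: expv_morphism.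
  have nxi : vfield 0 (- xi).
    by have := der_sg gW 1 vxi; rewrite /ksgn scaleN1r.
  have nraise k u : lcW u -> low sz k u -> low sz k.+1 ((- xi) u).
    by move=> lu lo t tk; rewrite eoppE foppE (field_raise lu lo tk) oppr0.
  have nmor : morphism gr (expv (- xi)) := gexp_morphism gW gS nxi nraise.
  have nS u (lu : lcW u) : lcW ((- xi) u) := cont_car (der_cont nxi) lu.
  have [cn _ _] := nmor.
  exists (G \o expv (- xi)); first exact: mor_comp.
  split=> u lu /=.
    have /= -> := e1 (expv (- xi) u) (cont_car cn lu).
    exact: (gexp_neg (closed_lcW (V := V)) xS (cont_clin cxi) field_raise lu).
  have -> : expv (- xi) (expv xi (phi u)) = phi u.
    have := gexp_neg (closed_lcW (V := V)) nS (cont_clin (der_cont nxi)) nraise (lphi _ lu).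
    by rewrite (_ : (fun v : X => - (- xi) v) = xi) //; apply: funext => v; rewrite eoppE opprK.
  exact: (e2 _ lu).
have hF := flow_pull hP lphi; have hQ : pull_spec (expv xi \o phi) (pull_op (expv xi \o phi)).
  by apply: (xgetPex (0 : endo Om)); exists (flow \o pull_op phi).
have fo := om_forms Hom; have sE := mor_stable flow_morphism; have sP := mor_stable hP.1.
apply: form_eq_trans (op2_cong (mor_stable hQ.1) (mor_stable hF.1) (pull_unique hQ hF) fo) _.
rewrite op2_comp //; apply: form_eq_trans flow_om.
have := op2_rel flow_morphism sphi.
by rewrite (clinB (@closed_forms K gr V) (clin_op2 sE sE)) //; apply: op2_forms.
Qed.
End Flow.
End Symplectic.
End SymplExp.

(** * Orders, Hamiltonian fields and extensions *)
Section Orders.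
Variables (K : comAlgType rat) (gr : even_grading K) (V : free_module).
Local Notation X := (seq (bas V) -> K).
Local Notation LW := (@LW K V).
Local Notation lcW := (lcar (l := LW)).
Local Notation sz := (@size (bas V)).
Local Notation vfield := (@vector_field K gr V).
Implicit Types (u v : X) (E G : endo LW) (xi eta : endo LW).
Let gW := good_LW gr V.
Let gS := graded_LW K V.

Definition raises k E := forall i u, lcW u -> low sz i u -> low sz (i + k) (E u).

Definition cong k E G := raises k (E - G).

Lemma contB E G : cont_endo E -> cont_endo G -> cont_endo (E - G).
Proof. by move=> cE cG; rewrite -[- G]scaleN1r; apply: (contD gW cE); exact: (contQ gW). Qed.

(** Orders are tested on elements of pure length, [raises] on the filtration by length; splitting
    into components identifies the two, order k + 1 being the raising of length by k. *)
Lemma order_geP k E : cont_endo E -> order_ge k.+1 E <-> raises k E.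
Proof.
move=> cE; split=> h i u lu.
  move=> lo; suff [] : [set v | lcW v /\ low sz (i + k) (E v)] u by [].
  apply: (closed_Pi (ga := sz)).
    have cl := @closed_low K _ sz (i + k).
    exact: (closed_preim (T := [set v | low sz (i + k) v]) (g_car gW) (cont_clin cE) cl).
  move=> n; have ln := gd_car gS n lu; split=> // t tk.
  have [e|/eqP Et] := eqVneq (E (Pi sz n u) t) 0; first exact: e.
  case: n ln Et => [n|n] ln Et; last first.
    have z : Pi sz (Negz n) u = 0 by apply: funext => r; rewrite /Pi.
    by rewrite z (clin0 (g_car gW) (cont_clin cE)).
  have [ni|ni] := ltnP n i.
    have z : Pi sz n u = 0.
      by apply: funext => r; rewrite /Pi; case: eqP => // -[e]; apply: lo; rewrite e.
    by rewrite z (clin0 (g_car gW) (cont_clin cE)).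
  have := h n _ ln _ t Et; rewrite addnS ltnS => H.
  have : (n + k <= size t)%N by apply: H => r hr; have [] := @supp_Pi K _ sz n u r hr.
  by rewrite leqNgt (leq_trans tk) // leq_add2r.
move=> su t Et; rewrite addnS ltnS; case: (leqP (i + k) (size t)) => // lt.
case: Et; apply: (h i u lu _ t lt) => r ri; have [//|/eqP/su e] := eqVneq (u r) 0; by move: ri; rewrite e ltnn.
Qed.

Lemma eq_modP k E G : cont_endo E -> cont_endo G -> eq_mod k.+1 E G <-> cong k E G.
Proof. by move=> cE cG; apply: order_geP; apply: contB. Qed.

Lemma has_order_raises k E : cont_endo E -> has_order k.+1 E -> raises k E.
Proof. by move=> cE h; apply/order_geP => // i u lu su t /(h i u lu su t) ->. Qed.

(** On an element of pure length the image has a single length, and that length is excluded by the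
    stronger filtration bound. Congruences between fields of the same order thus become
    equalities. *)
Lemma order_raises_eq0 k E : cont_endo E -> has_order k.+1 E -> raises k.+1 E -> eq_car E 0.
Proof.
move=> cE ho hr; apply: (@lcW_Pi_ind _ gr _ _ E [set 0]).
- exact: closed_eq0.
- exact: cont_clin.
case=> [i|i] u lu su; last first.
  rewrite (_ : u = 0) ?(clin0 (g_car gW) (cont_clin cE)) //.
  by apply: funext => r; have [//|/eqP/su] := eqVneq (u r) 0.
apply: funext => t; have [//|/eqP Et] := eqVneq (E u t) 0.
have st := has_order_supp ho lu su Et.
case: Et; apply: (hr i u lu) => [r ri|]; last by case: st; lia.
by have [//|/eqP/su[e]] := eqVneq (u r) 0; by move: ri; rewrite e ltnn.
Qed.

Lemma raises_eq k E G : eq_car E G -> raises k G -> raises k E.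
Proof. by move=> e h i u lu lo; rewrite e //; apply: h. Qed.

Lemma raises_le j k E : (j <= k)%N -> raises k E -> raises j E.
Proof. by move=> jk h i u lu lo; apply: low_le (h i u lu lo); rewrite leq_add2l. Qed.

Lemma raises0 k : raises k 0. Proof. by move=> i u lu lo t _. Qed.

Lemma raisesD k E G : raises k E -> raises k G -> raises k (E + G).
Proof. by move=> hE hG i u lu lo t tk; rewrite !eE !fE (hE i u) ?(hG i u) ?addr0. Qed.

Lemma raisesN k E : raises k E -> raises k (- E).
Proof. by move=> hE i u lu lo t tk; rewrite !eE !fE (hE i u) ?oppr0. Qed.

Lemma raisesB k E G : raises k E -> raises k G -> raises k (E - G).
Proof. by move=> hE hG; apply: raisesD => //; apply: raisesN. Qed.

Lemma raises_sum k (I : eqType) (r : seq I) (E : I -> endo LW) :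
  (forall i, i \in r -> raises k (E i)) -> raises k (\sum_(i <- r) E i).
Proof.
by move=> h; rewrite big_seq; apply: big_rec => [|i G /h hE hG]; [exact: raises0 | exact: raisesD].
Qed.

Lemma raises_comp j k E G : cont_endo G -> raises j E -> raises k G -> raises (j + k) (E \o G).
Proof.
move=> cG hE hG i u lu lo /=; rewrite (addnC j) addnA; apply: hE; first exact: (cont_car cG).
exact: hG.
Qed.

Lemma cong_refl k E : cong k E E. Proof. by rewrite /cong subrr; apply: raises0. Qed.

Lemma cong_sym k E G : cong k E G -> cong k G E.
Proof. by move=> /raisesN; rewrite /cong opprB. Qed.

Lemma cong_trans k E G H : cong k E G -> cong k G H -> cong k E H.
Proof. by move=> h /(raisesD h); rewrite addrA subrK. Qed.

Lemma congD k E E' G G' : cong k E G -> cong k E' G' -> cong k (E + E') (G + G').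
Proof. by move=> h /(raisesD h); rewrite /cong opprD addrACA. Qed.

Lemma congB k E E' G G' : cong k E G -> cong k E' G' -> cong k (E - E') (G - G').
Proof. by move=> h /raisesN h'; apply: congD => //; rewrite /cong -opprD. Qed.

Lemma cong_le j k E G : (j <= k)%N -> cong k E G -> cong j E G.
Proof. exact: raises_le. Qed.

Lemma cong_raises k E G : cong k E G -> raises k G -> raises k E.
Proof. by move=> h /(raisesD h); rewrite subrK. Qed.

Lemma cong_eq k E G : eq_car E G -> cong k E G.
Proof. by move=> e i u lu lo t tk; rewrite !eE !fE e ?subrr. Qed.

Lemma cong_compl j k E E' G : cont_endo G -> cong j E E' -> raises k G ->
  cong (j + k) (E \o G) (E' \o G).
Proof. exact: raises_comp. Qed.

Lemma cong_compr j k E G G' : cont_endo E -> cont_endo G -> cont_endo G' ->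
  raises j E -> cong k G G' -> cong (j + k) (E \o G) (E \o G').
Proof.
move=> cE cG cG' hE hG; apply: (@raises_eq _ _ (E \o (G - G'))).
  move=> u lu; have h := clinB (g_car gW) (cont_clin cE) (cont_car cG lu) (cont_car cG' lu).
  exact: esym h.
by apply: raises_comp => //; apply: contB.
Qed.

Lemma cong_comp_sum k E G G' : cont_endo E -> cont_endo G -> cont_endo G' ->
  cong k (E \o (G + G')) ((E \o G) + (E \o G')).
Proof.
move=> cE cG cG'; apply: cong_eq => u lu.
have h := clinD (cont_clin cE) (cont_car cG lu) (cont_car cG' lu); exact: h.
Qed.

Lemma raises_id : raises 0 id. Proof. by move=> i u lu lo; rewrite addn0. Qed.

Section Exp.
Variables (xi : endo LW) (s : nat).
Hypotheses (hxi : vfield 0 xi) (rxi : raises s.+1 xi).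
Let cxi := der_cont hxi.

Let raise k u : lcW u -> low sz k u -> low sz k.+1 (xi u).
Proof. by move=> lu lo; apply: low_le (rxi lu lo); rewrite addnS ltnS leq_addr. Qed.

Lemma expv_cont : cont_endo (expv xi).
Proof. exact: (gexp_cont gW hxi raise). Qed.

(** The k-th iterate raises the length by k(s + 1), and for k at least 2 this is at least s + 2. *)
Lemma expv_cong : cong s.+2 (expv xi) (id + xi).
Proof.
have xS u (lu : lcW u) : lcW (xi u) := cont_car cxi lu.
move=> i u lu lo t tk; rewrite !eE !fE.
have -> : expv xi u t = texp (size t).+2 xi u t.
  exact: (gexp_trunc xS raise lu (leqW (ltnSn _))).
rewrite /texp !big_ord_recl fact0 invr1 !fE /= !scale1r.
rewrite big1 => [|k _]; first by ring.
have h m : low sz (i + m * s.+1) (iter m xi u).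
  elim: m => [|m IH] /=; first by rewrite addn0.
  by rewrite mulSn addnCA addnC; apply: rxi => //; apply: (iter_closed xS).
rewrite fE; have /= -> := h k.+2 t; first by rewrite scaler0.
apply: leq_trans tk _.
by rewrite leq_add2l !mulSn; lia.
Qed.

End Exp.

Lemma has_order_comm e e' j k xi eta : vfield e xi -> vfield e' eta ->
  has_order j.+1 xi -> has_order k.+1 eta -> has_order (j + k).+1 (comm e e' xi eta).
Proof.
move=> vx ve ox oe; apply: supp_has_order => i u lu su.
have h1 := has_order_supp ox (cont_car (der_cont ve) lu) (has_order_supp oe lu su).
have h2 := has_order_supp oe (cont_car (der_cont vx) lu) (has_order_supp ox lu su).
move=> t; have [e1|/eqP/h1 -> _] := eqVneq (xi (eta u) t) 0; last by rewrite PoszD; ring.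
have [e2|/eqP/h2 -> _] := eqVneq (eta (xi u) t) 0; last by rewrite PoszD; ring.
by rewrite /comm !eE !fE /= e1 e2 scaler0 subr0.
Qed.

Lemma has_orderB k xi eta :
  has_order k.+1 xi -> has_order k.+1 eta -> has_order k.+1 (xi - eta).
Proof.
move=> ox oe i u lu su t; rewrite !eE !fE => h.
have [e1|/eqP/(ox i u lu su) //] := eqVneq (xi u t) 0.
have [e2|/eqP/(oe i u lu su) //] := eqVneq (eta u t) 0.
by case: h; rewrite e1 e2 subr0.
Qed.

Lemma cont_comm e e' xi eta : cont_endo xi -> cont_endo eta -> cont_endo (comm e e' xi eta).
Proof.
move=> cx ce; rewrite /comm -scaleNr; apply: (contD gW); first exact: cont_comp.
by apply: (contQ gW); apply: cont_comp.
Qed.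

Lemma cong_comm j k l e e' xi xi' eta : cont_endo xi -> cont_endo xi' -> cont_endo eta ->
  cong j xi xi' -> raises k eta -> (l <= j + k)%N ->
  cong l (comm e e' xi eta) (comm e e' xi' eta).
Proof.
move=> cx cx' ce h r jk; apply: congB; apply: (cong_le jk); first exact: cong_compl.
have hs : raises (j + k) ((eta \o xi) - (eta \o xi')).
  by rewrite addnC; apply: cong_compr.
rewrite /cong -scalerBr => i u lu lo t tk.
by rewrite escaleE fscaleE (hs i u lu lo t tk) scaler0.
Qed.
End Orders.

(** * Hamiltonians, cocycles and fields commuting with [m2] *)

Section Hamiltonians.
Variables (K : comAlgType rat) (gr : even_grading K) (V : free_module).
Local Notation X := (seq (bas V) -> K).
Local Notation LW := (@LW K V).
Local Notation F2 := (form2_ix V -> K).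
Local Notation Om := (@Omega K gr V).
Local Notation form_rel := (@form_rel K gr V).
Local Notation form_eq := (@form_eq K gr V).
Local Notation leibniz := (@leibniz K gr V).
Local Notation forms := (@forms K gr V).
Local Notation dDR := (@dDR K gr V).
Local Notation lieDR := (@lieDR K gr V).
Local Notation contr_op := (@contr_op K gr V).
Local Notation lie_op := (@lie_op K gr V).
Local Notation vfield := (@vector_field K gr V).
Local Notation contrDR := (@contrDR K gr V).
Local Notation Phi := (@Phi K gr V).
Local Notation sz := (@size (bas V)).
Local Notation td := (@tdeg V).
Local Notation fd := (@fdeg V).
Implicit Types (u v : X) (f h al be : F2) (D : endo Om) (xi eta : endo LW).
Let gO := good_Omega gr V.
Let gW := good_LW gr V.
Let gF := graded_fdeg gr V.
Let cR := @closed_form_rel K gr V.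
Let cF := @closed_forms K gr V.

Lemma lie_component_fd e xi D : vfield e xi -> lie_spec (gr := gr) e xi D ->
  lie_spec (gr := gr) e xi (component (L := Om) fd 0 D).
Proof.
move=> hxi [hD sD]; have cD := der_cont hD; split; first exact: (der_component gO gF).
move=> u lu; have [s1 s2] := sD u lu; split.
  rewrite (component_supp gO _ cD (@supp_of_g_fd _ _ u)).
  have /suppP <- := @supp_of_g_fd _ _ (xi u).
  exact: (eqr_Pi _ gF).
rewrite (component_supp gO _ cD (@supp_d_of_fd _ _ u)).
have lx := cont_car (der_cont hxi) lu; have h := dR_of_g gr lx.
apply: (eqr_trans (eqr_Pi _ gF s2)); rewrite !fsg (flZ (@flin_Pi K _ fd _)); apply: eqrZ.
apply: (eqr_trans (eqr_Pi _ gF h)); rewrite addr0.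
by have /suppP -> := @supp_d_of_fd _ _ (xi u); apply: eqr_sym.
Qed.

Lemma dDRZ c f : forms f -> dDR (c \*o f) = c \*o dDR f.
Proof. by move=> ff; apply: (clinZ cF (clin_leibniz 1 (der_stable (dR_der gr V)))). Qed.

Lemma dDRB f h : forms f -> forms h -> dDR (f - h) = dDR f - dDR h.
Proof. by move=> ff fh; apply: (clinB cF (clin_leibniz 1 (der_stable (dR_der gr V)))). Qed.

Lemma dDR0 : dDR 0 = 0.
Proof. exact: (clin0 cF (clin_leibniz 1 (der_stable (dR_der gr V)))). Qed.

Section Symplectic.
Variables (w : int) (om : F2) (Hom : @symplectic_form K gr V w om).
Hypothesis om2 : form_order 2 0 om.

Lemma lieDRZ e xi c f : vfield e xi -> forms f -> lieDR e xi (c \*o f) = c \*o lieDR e xi f.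
Proof. by move=> hxi ff; apply: (clinZ cF (clin_leibniz e (der_stable (lie_der Hom hxi)))). Qed.

Lemma lieDRB e xi f h : vfield e xi -> forms f -> forms h ->
  lieDR e xi (f - h) = lieDR e xi f - lieDR e xi h.
Proof. by move=> hxi ff fh; apply: (clinB cF (clin_leibniz e (der_stable (lie_der Hom hxi)))). Qed.

Lemma lieDR0 e xi : vfield e xi -> lieDR e xi 0 = 0.
Proof. by move=> hxi; apply: (clin0 cF (clin_leibniz e (der_stable (lie_der Hom hxi)))). Qed.

Lemma PhiB e xi eta : vfield e xi -> vfield e eta ->
  form_eq (Phi om e (xi - eta)) (Phi om e xi - Phi om e eta).
Proof.
move=> hx he; have [hD sD] := contrP Hom hx; have [hE sE] := contrP Hom he.
have hs : contr_spec (gr := gr) e (xi - eta) (contr_op e xi - contr_op e eta).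
  split; first exact: (derB gO).
  move=> u lu; have [a1 a2] := sD u lu; have [b1 b2] := sE u lu; rewrite !eE; split.
    exact: (closedB (g_rel gO)).
  by rewrite (flB (@flin_of_g K V)); apply: eqrB.
apply: form_eq_trans (Phi_eq Hom (derB gW hx he) hs) _.
suff -> : leibniz (e - 1) (contr_op e xi - contr_op e eta) om = Phi om e xi - Phi om e eta.
  exact: form_eq_refl.
apply: funext => j; rewrite /Defs.Phi /Defs.contrDR /Defs.leibniz !eE !fE !ksgnE; ring.
Qed.

Lemma symplB e xi eta : symplectic_field gr om e xi -> symplectic_field gr om e eta ->
  symplectic_field gr om e (xi - eta).
Proof.
move=> [hx sx] [he se]; have hB := derB gW hx he; split=> //.
apply/(sympl_closed Hom hB).
have fx := Phi_forms Hom hx; have fe := Phi_forms Hom he.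
apply: form_eq_rel (dDR_eq (Phi_forms Hom hB) (closedB cF fx fe) (PhiB hx he)) _.
by rewrite dDRB //; apply: (closedB cR); apply/(sympl_closed Hom).
Qed.

Lemma symplD e xi eta : symplectic_field gr om e xi -> symplectic_field gr om e eta ->
  symplectic_field gr om e (xi + eta).
Proof.
move=> hx he.
by have := symplB hx (symplB (symplB he he) he); rewrite subrr sub0r opprK.
Qed.

Lemma sympl0 e : symplectic_field gr om e 0.
Proof.
split; first exact: (der0 gW).
apply/(sympl_closed Hom (der0 gW e)).
apply: form_eq_rel (dDR_eq (Phi_forms Hom (der0 gW e)) (closed0 cF) _) _; last first.
  by rewrite dDR0; apply: (closed0 cR).
by rewrite -(@leibniz0 K gr V (e - 1) om); apply: (Phi_eq Hom (der0 gW e)); exact: contr_spec0.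
Qed.

Lemma Phi_eq0 e xi : vfield e xi -> form_rel (Phi om e xi) -> eq_car xi 0.
Proof.
move=> hx r; apply: (Phi_inj Hom hx (der0 gW e)).
have r0 : form_eq (Phi om e xi) 0 by apply/form_eq0.
apply: (form_eq_trans r0); apply: form_eq_sym.
by rewrite -(@leibniz0 K gr V (e - 1) om); apply: (Phi_eq Hom (der0 gW e)); exact: contr_spec0.
Qed.

Variables (m2 : endo LW) (hm2 : symplectic_field gr om 1 m2) (om22 : has_order 2 m2).
Let vm := hm2.1.

(** The Lie derivative of a cochain is known only modulo relations; taking the part of shift 1 in
    tensor degree and 0 in form degree gives a representative to which the Poincare lemma
    applies. *)
Lemma lie_nice k be : Defs.form 0 be -> form_order 0 k be ->
  exists f, [/\ Defs.form 0 f, form_order 0 k.+1 f & form_eq (lieDR 1 m2 be) f].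
Proof.
move=> fb ob; have ff := form_forms gr fb; have /(formP gr)[_ sb] := fb.
have hL := lieP Hom vm; have hF := lie_component_fd vm hL.
have [hT sT] := lie_component 1 vm hF; have E := order_component vm om22.
have hS : lie_spec (gr := gr) 1 m2 (component (L := Om) td 1 (component (L := Om) fd 0 (lie_op 1 m2))).
  by split=> // u lu; rewrite (E u lu); exact: sT.
move/form_orderP: ob => ob.
have cF0 := der_cont hF.1; have cL := der_cont hL.1.
exists (leibniz 1 (component (L := Om) td 1 (component (L := Om) fd 0 (lie_op 1 m2))) be); split.
- apply/(formP gr); split; first by apply: leibniz_forms => //; exact: (der_stable hT).
  rewrite (@leibniz_component K gr V td _ 1 _ _ _ cF0 ff ob).
  have := @supp_leibniz K gr V fd 1 0 _ _ _ cL ff sb => /= h j.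
  by rewrite /Pi; case: ifP => // _ /h.
- apply/form_orderP; have := @supp_leibniz K gr V td 1 1 _ _ _ cF0 ff ob.
  by rewrite (_ : (k + 0)%N%:Z + 1 = (k.+1 + 0)%N%:Z) //; lia.
apply: leibniz_cong => //; [exact: (der_stable hL.1) | exact: (der_stable hT) |].
exact: (lie_unique hL hS).
Qed.

(* The Poincare lemma makes [dDR] injective on 0-forms of positive order. *)
Lemma lie_exact k f be : Defs.form 0 f -> form_order 0 k.+1 f ->
  Defs.form 0 be -> form_order 0 k be ->
  form_eq (dDR f) (dDR (lieDR 1 m2 be)) -> form_eq f (lieDR 1 m2 be).
Proof.
move=> ff of_ fb ob h; have [N [fN oN eN]] := lie_nice fb ob.
have F1 := form_forms gr ff; have F2 := form_forms gr fN; have F3 := form_forms gr fb.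
apply: form_eq_trans (form_eq_sym eN); apply: (@poincare0 _ gr _ _ _ Hom k).
- apply/(formP gr); move/(formP gr): ff => [_ s1]; move/(formP gr): fN => [_ s2]; split.
    exact: (closedB cF).
  move=> j; rewrite !fE; have [e1|/eqP/s1 //] := eqVneq (f j) 0.
  by have [e2|/eqP/s2 //] := eqVneq (N j) 0; rewrite e1 e2 subr0.
- move=> j; rewrite !fE; have [e1|/eqP/of_ //] := eqVneq (f j) 0.
  by have [e2|/eqP/oN //] := eqVneq (N j) 0; rewrite e1 e2 subr0.
rewrite dDRB //; apply: form_eq_trans h _.
by apply: dDR_eq => //; apply: (lieDR_forms Hom).
Qed.

(** Contraction with [m2, eta] is the Lie derivative along m2 of d be, and this odd Lie derivative
    anticommutes with d. *)
Lemma Phi_bracket e eta be : vfield e eta -> forms be -> form_eq (dDR be) (Phi om e eta) ->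
  form_eq (Phi om (1 + e) (comm 1 e m2 eta)) (- dDR (lieDR 1 m2 be)).
Proof.
move=> he fb E; apply: form_eq_trans (Phi_comm Hom hm2 he) _.
have fd := dDR_forms fb.
apply: form_eq_trans (lieDR_eq Hom vm (Phi_forms Hom he) fd (form_eq_sym E)) _.
have := lie_d Hom vm fb; rewrite (_ : sg 1 \*o _ = - dDR (lieDR 1 m2 be)) //.
by apply: funext => j; rewrite !fE /sg /= mulN1r.
Qed.

(** The coboundaries on the side of fields. With n = p + 3, eta has order n - 2 as in the
    equivalence of extensions, and the bracket has order n - 1. *)
Definition field_exact p xi := exists eta, [/\ symplectic_field gr om (-1) eta,
  has_order p.+1 eta & eq_car xi (comm 1 (-1) m2 eta)].

Lemma field_exact_eq p xi xi' : eq_car xi xi' -> field_exact p xi' -> field_exact p xi.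
Proof. by move=> e [eta [h1 h2 h3]]; exists eta; split=> // u lu; rewrite e // h3. Qed.

Lemma comm_lin e e' eta eta' : vfield e' eta -> vfield e' eta' ->
  eq_car (comm e e' m2 (eta - eta')) (comm e e' m2 eta - comm e e' m2 eta').
Proof.
move=> h h' u lu; have e1 v : (eta - eta') v = eta v - eta' v by [].
rewrite /comm !eE /= !e1.
have k := clinB (g_car gW) (cont_clin (der_cont vm)) (cont_car (der_cont h) lu) (cont_car (der_cont h') lu).
rewrite [m2 (_ - _)]k !fsg; apply: funext => t; rewrite !fE; ring.
Qed.

Lemma field_exact0 p : field_exact p 0.
Proof.
exists 0; split; [exact: sympl0 | by move=> i u lu su t | move=> u lu].
rewrite /comm !eE /= (clin0 (g_car gW) (cont_clin (der_cont vm))) fsg.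
by apply: funext => t; rewrite !fE mulr0 subr0.
Qed.

Lemma field_exactB p xi xi' : field_exact p xi -> field_exact p xi' -> field_exact p (xi - xi').
Proof.
move=> [eta [s1 o1 e1]] [eta' [s2 o2 e2]]; exists (eta - eta'); split.
- exact: symplB.
- exact: has_orderB.
by move=> u lu; rewrite (comm_lin 1 s1.1 s2.1 lu) !eE e1 // e2.
Qed.

Lemma field_exactN p xi : field_exact p xi -> field_exact p (- xi).
Proof. by move=> h; rewrite -[- xi]sub0r; apply: field_exactB => //; exact: field_exact0. Qed.

Lemma field_exactD p xi xi' : field_exact p xi -> field_exact p xi' -> field_exact p (xi + xi').
Proof. by move=> h h'; rewrite -[xi']opprK; apply: field_exactB => //; exact: field_exactN. Qed.

Local Notation Ups := (Upsilon gr w om (w - 1)).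

(** The degree w - 1 is the one for which the associated field has degree (w - 1) + 1 - w = 0. *)
Lemma UpsP p al : cochain gr p.+3 (w - 1) al ->
  [/\ symplectic_field gr om 0 (Ups al), has_order p.+2 (Ups al) &
      form_eq (Phi om 0 (Ups al)) (sg (w - 1) \*o dDR al)].
Proof. by move=> h; have := UpsilonP Hom om2 h; rewrite subrK subrr => -[]. Qed.

Lemma cochainB i j al be : cochain gr i j al -> cochain gr i j be -> cochain gr i j (al - be).
Proof.
move=> [/(formP gr)[f1 s1] o1 d1] [/(formP gr)[f2 s2] o2 d2]; split.
- apply/(formP gr); split; first exact: (closedB cF).
  move=> t; rewrite !fE; have [e1|/eqP/s1 //] := eqVneq (al t) 0.
  by have [e2|/eqP/s2 //] := eqVneq (be t) 0; rewrite e1 e2 subr0.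
- move=> t; rewrite !fE; have [e1|/eqP/o1 //] := eqVneq (al t) 0.
  by have [e2|/eqP/o2 //] := eqVneq (be t) 0; rewrite e1 e2 subr0.
by move=> t; rewrite !fE; apply: hcompB.
Qed.

Lemma cochainZ i j k al : cochain gr i j al -> cochain gr i j (sg k \*o al).
Proof.
move=> [/(formP gr)[f1 s1] o1 d1]; split.
- apply/(formP gr); split; first exact: (closedZ cF).
  by move=> t ht; apply: s1 => e; apply: ht; rewrite fE e mulr0.
- by move=> t ht; apply: o1 => e; apply: ht; rewrite fE e mulr0.
exact: hom_sg.
Qed.

Lemma cochain0 i j : cochain gr i j (0 : F2).
Proof.
split; [apply/(formP gr); split; [exact: (closed0 cF) | by []] | by [] |].
by move=> t; apply: hcomp0.
Qed.

Lemma cocycle0 i j : cocycle gr m2 i j 0.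
Proof. by split; [exact: cochain0 | rewrite (lieDR0 vm); exact: (closed0 cR)]. Qed.

Lemma cocycleB i j al be : cocycle gr m2 i j al -> cocycle gr m2 i j be ->
  cocycle gr m2 i j (al - be).
Proof.
move=> [ca ra] [cb rb]; split; first exact: cochainB.
have [[fa _ _] [fb _ _]] := (ca, cb).
by rewrite (lieDRB vm (form_forms gr fa) (form_forms gr fb)); exact: (closedB cR).
Qed.

Lemma cocycleD i j al be : cocycle gr m2 i j al -> cocycle gr m2 i j be ->
  cocycle gr m2 i j (al + be).
Proof.
by move=> ha hb; have := cocycleB ha (cocycleB (cocycle0 i j) hb); rewrite sub0r opprK.
Qed.

(** The fields are separate choices, so additivity comes from injectivity of the contraction with
    om, and it holds on the carrier. *)
Lemma UpsB p al be : cochain gr p.+3 (w - 1) al -> cochain gr p.+3 (w - 1) be ->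
  eq_car (Ups (al - be)) (Ups al - Ups be).
Proof.
move=> ha hb; have [sa _ ea] := UpsP ha; have [sb _ eb] := UpsP hb.
have [sc _ ec] := UpsP (cochainB ha hb); apply: (Phi_inj Hom sc.1 (derB gW sa.1 sb.1)).
apply: form_eq_trans ec _; apply: form_eq_sym; apply: form_eq_trans (PhiB sa.1 sb.1) _.
apply: form_eq_trans (form_eqB ea eb) _.
have [[fa _ _] [fb _ _]] := (ha, hb); rewrite (dDRB (form_forms gr fa) (form_forms gr fb)).
suff -> : sg (w - 1) \*o dDR al - sg (w - 1) \*o dDR be = sg (w - 1) \*o (dDR al - dDR be).
  exact: form_eq_refl.
by apply: funext => j; rewrite !fE mulrBr.
Qed.

Lemma Ups_cocycle p al : cocycle gr m2 p.+3 (w - 1) al -> eq_car (comm 1 0 m2 (Ups al)) 0.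
Proof.
move=> [ca ra]; have [sa oa ea] := UpsP ca; have [fa _ _] := ca; have ff := form_forms gr fa.
have E : form_eq (dDR (sg (w - 1) \*o al)) (Phi om 0 (Ups al)) by rewrite dDRZ //; apply: form_eq_sym.
apply: (@Phi_eq0 (1 + 0)); first exact: (der_comm gW vm sa.1).
apply: form_eq_rel (Phi_bracket sa.1 (closedZ cF _ ff) E) _.
apply: (closedN cR); apply: (dDR_rel); rewrite (lieDRZ _ vm) //.
exact: (closedZ cR).
Qed.

(** The cocycle is the Hamiltonian of xi up to the sign built into Upsilon. Its Lie derivative along
    m2 has differential 0 because [m2, xi] = 0, and the Poincare lemma makes it vanish. *)
Lemma Ups_surj p xi : symplectic_field gr om 0 xi -> has_order p.+2 xi ->
  eq_car (comm 1 0 m2 xi) 0 ->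
  exists2 al, cocycle gr m2 p.+3 (w - 1) al & eq_car (Ups al) xi.
Proof.
move=> sx ox cx; have [be [fb ob db E]] := potential Hom om2 sx ox.
have ff := form_forms gr fb.
have cb : cochain gr p.+3 (w - 1) be by split=> //; rewrite subrK; rewrite addr0 in db.
have cz := cochainZ (w - 1) cb.
have rb : form_rel (lieDR 1 m2 be).
  apply/form_eq0; apply: form_eq_sym; apply: (lie_exact (k := p.+3)) => //.
  - by have [] := cochain0 p.+4 0.
  - rewrite dDR0; apply: form_eq_sym; apply/form_eq0.
    have h := Phi_bracket sx.1 ff E; rewrite -[dDR _]opprK; apply: (closedN cR).
    apply: form_eq_rel (form_eq_sym h) _.
    apply: form_eq_rel (Phi_eq_car Hom (der_comm gW vm sx.1) (der0 gW _) cx) _.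
    apply: form_eq_rel (Phi_eq Hom (der0 gW _) (contr_spec0 gr V (1 + 0))) _.
    by rewrite leibniz0; exact: (closed0 cR).
exists (sg (w - 1) \*o be).
  by split=> //; rewrite (lieDRZ _ vm) //; apply: (closedZ cR).
have [sz _ ez] := UpsP cz; apply: (Phi_inj Hom sz.1 sx.1).
apply: form_eq_trans ez _; apply: form_eq_trans E; rewrite dDRZ //.
suff -> : sg (w - 1) \*o (sg (w - 1) \*o dDR be) = dDR be by exact: form_eq_refl.
by rewrite fmulA sgsq fmul1.
Qed.

(** Primitives correspond through Upsilon in one direction and Hamiltonians in the other: a cochain
    of order p + 2 and degree w - 2 matches a symplectic field of order p + 1 and degree -1. *)
Lemma Ups_exact p al : cochain gr p.+3 (w - 1) al ->
  (exists2 be, cochain gr p.+2 (w - 1 - 1) be & form_eq al (lieDR 1 m2 be)) <->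
  field_exact p (Ups al).
Proof.
move=> ca; have [sa oa ea] := UpsP ca; have [fa o_a da] := ca; have ffa := form_forms gr fa.
split=> [[be cb E]|[eta [se oe ee]]].
  have [vb ob eb sb] := UpsilonP Hom om2 cb; rewrite subrK in vb ob eb sb.
  set B := Upsilon gr w om (w - 1 - 1) be in vb ob eb sb.
  have dB : w - 1 - w = -1 by ring.
  rewrite dB in vb eb sb; exists B; split => //.
  have [fb _ _] := cb; have ffb := form_forms gr fb.
  apply: (Phi_inj Hom sa.1 (der_comm gW vm vb)).
  apply: form_eq_trans ea _; apply: form_eq_sym.
  have E1 : form_eq (dDR (sg (w - 1 - 1) \*o be)) (Phi om (-1) B) by rewrite dDRZ //; apply: form_eq_sym.
  apply: form_eq_trans (Phi_bracket vb (closedZ cF _ ffb) E1) _.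
  have fL := lieDR_forms Hom vm ffb.
  rewrite (lieDRZ _ vm) // dDRZ // sgB1.
  suff -> : - (- sg (w - 1) \*o dDR (lieDR 1 m2 be)) = sg (w - 1) \*o dDR (lieDR 1 m2 be) :> F2.
    by apply: form_eqZ; apply: dDR_eq => //; exact: form_eq_sym.
  by apply: funext => j; rewrite !fE mulNr opprK.
have [be [fb ob db E]] := potential Hom om2 se oe; have ffb := form_forms gr fb.
have cb : cochain gr p.+2 (w - 1 - 1) be by split=> //; rewrite subrK.
(* The Hamiltonian is rescaled by (-1)^(w-2): together with the sign of [Phi_bracket] this cancels
   the sign (-1)^(w-1) in Upsilon. *)
have cz := cochainZ (w - 1 - 1) cb; exists (sg (w - 1 - 1) \*o be) => //.
have [fz oz dz] := cz; apply: (lie_exact (k := p.+2)) => //.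
have fL := lieDR_forms Hom vm ffb.
rewrite (lieDRZ _ vm) // dDRZ // sgB1.
have h := form_eq_trans (form_eq_sym ea) (form_eq_trans (Phi_eq_car Hom sa.1 (der_comm gW vm se.1) ee)
  (Phi_bracket se.1 ffb E)).
have := form_eqZ (sg (w - 1)) h; rewrite fmulA sgsq fmul1.
congr form_eq; apply: funext => j; rewrite !fE; ring.
Qed.

End Symplectic.
End Hamiltonians.

(** * Equality of classes *)

Section Quotients.
Variables (T : Type) (D : set T) (E : T -> T -> Prop).
Hypotheses (Er : forall x, D x -> E x x) (Es : forall x y, D x -> D y -> E x y -> E y x)
  (Et : forall x y z, D x -> D y -> D z -> E x y -> E y z -> E x z).

Lemma cls_eq x y (Dx : D x) (Dy : D y) : E x y -> cls (E := E) Dx = cls Dy.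
Proof.
move=> e; apply: eq_exist; apply: funext => z; apply: propext; split=> -[Dz h]; split=> //.
  by apply: (Et Dy Dx) => //; apply: Es.
exact: (Et Dx Dy).
Qed.

Lemma cls_inj x y (Dx : D x) (Dy : D y) : cls (E := E) Dx = cls Dy -> E x y.
Proof.
move=> e; have : sval (cls (E := E) Dx) y by rewrite e; split=> //; apply: Er.
by case.
Qed.
End Quotients.

Lemma clsP (T : Type) (D : set T) (E : T -> T -> Prop) (c : quotient D E) :
  exists x (Dx : D x), c = cls Dx.
Proof. by case: c => C [x Dx eC]; exists x, Dx; apply: eq_exist. Qed.

(** * Extensions of a morphism and their equivalence *)

Section Extensions.
Variables (K : comAlgType rat) (gr : even_grading K) (V : free_module).
Local Notation LW := (@LW K V).
Local Notation F2 := (form2_ix V -> K).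
Local Notation vfield := (@vector_field K gr V).
Implicit Types (xi eta ga : endo LW).
Let gW := good_LW gr V.

Variables (w : int) (om : F2) (Hom : @symplectic_form K gr V w om).
Variables (m2 : endo LW) (hm2 : symplectic_field gr om 1 m2) (om22 : has_order 2 m2).
Let cm2 := der_cont hm2.1.
Let rm2 : raises 1 m2 := has_order_raises gr cm2 om22.

Section Leading.
Variables (n : nat) (ms : nat -> endo LW).
Hypotheses (hms : C_structure gr om n.+3 ms) (e2 : eq_car (ms 2) m2).

Lemma mc_field : vfield 1 (mc_sum n.+3 ms). Proof. by case: hms => _ []. Qed.

(** The components m_i with i at least 3 raise the length by at least 2. *)
Lemma mc_leading : cong 2 (mc_sum n.+3 ms) m2.
Proof.
case: hms => h _ _; rewrite /mc_sum big_ltn //.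
apply: (@cong_trans _ _ _ _ (ms 2)); last exact: cong_eq.
rewrite /cong addrAC subrr add0r; apply: raises_sum => i.
rewrite mem_index_iota; case: i => // i /andP[i3 i4].
have [|vi oi] := h i.+1; first by rewrite i4 ltnW.
apply: (raises_le (k := i)); first by [].
exact: (has_order_raises gr (der_cont vi)).
Qed.

Lemma mc_raises : raises 1 (mc_sum n.+3 ms).
Proof. by apply: cong_raises rm2; apply: cong_le mc_leading. Qed.
End Leading.

Variables (p : nat) (ms ms' : nat -> endo LW).
Hypotheses (hms : C_structure gr om p.+4 ms) (hms' : C_structure gr om p.+4 ms').
Hypotheses (e2 : eq_car (ms 2) m2) (e2' : eq_car (ms' 2) m2).
Let m := mc_sum p.+4 ms.
Let m' := mc_sum p.+4 ms'.
Let cm : cont_endo m := der_cont (mc_field hms).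
Let cm' : cont_endo m' := der_cont (mc_field hms').
Let rm : raises 1 m := mc_raises hms e2.
Let rm' : raises 1 m' := mc_raises hms' e2'.
Let lm : cong 2 m m2 := mc_leading hms e2.
Let lm' : cong 2 m' m2 := mc_leading hms' e2'.

Variables (phi : endo LW) (sphi : symplectomorphism gr om phi) (pphi : pointed phi).
Let cphi : cont_endo phi. Proof. by case: sphi => -[[]]. Qed.
Let lphi : cong 1 phi id.
Proof. by apply/(eq_modP gr) => //; exact: cont_id. Qed.
Let rphi : raises 0 phi.
Proof. by apply: cong_raises (@raises_id K V); apply: cong_le lphi. Qed.

(* The obstruction to [expv ga \o phi] being a morphism from [m] to [m']. *)
Let defect ga : endo LW := ((expv ga \o phi) \o m) - (m' \o (expv ga \o phi)).

Section Field.
Variables (ga : endo LW) (hga : vfield 0 ga) (oga : has_order p.+2 ga).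

Lemma field_raises : raises p.+1 ga.
Proof. exact: (has_order_raises gr (der_cont hga)). Qed.

Lemma expv_cont' : cont_endo (expv ga).
Proof. exact: (expv_cont hga field_raises). Qed.

Lemma expv_cong' : cong p.+2 (expv ga) (id + ga).
Proof. exact: (expv_cong hga field_raises). Qed.

(** Both factors are expanded to first order: exp(ga) is id + ga, and ga composed with phi is ga up
    to higher order because phi is pointed. *)
Lemma expv_phi_cong : cong p.+2 (expv ga \o phi) (phi + ga).
Proof.
have h := cong_compl cphi expv_cong' rphi; rewrite addn0 in h; apply: (cong_trans h).
rewrite (_ : (id + ga) \o phi = phi + (ga \o phi)) //.
apply: congD; first exact: cong_refl.
have := cong_compr gr (der_cont hga) cphi (cont_id LW) field_raises lphi.
by rewrite addn1.
Qed.

Lemma expv_phi_raises : raises 0 (expv ga \o phi).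
Proof.
apply: (cong_raises (cong_le (leq0n p.+2) expv_phi_cong)).
by apply: raisesD => //; apply: raises_le field_raises.
Qed.

Lemma cont_expv_phi : cont_endo (expv ga \o phi).
Proof. by apply: cont_comp => //; exact: expv_cont'. Qed.
End Field.

(** The two composites with phi differ by ga - ga' up to terms raising the length by p + 2.
    Composition with m or m' gains one more, and there m and m' may be replaced by [m2], since ga -
    ga' already raises by p + 1. *)
Lemma defect_cong ga ga' : vfield 0 ga -> has_order p.+2 ga -> vfield 0 ga' -> has_order p.+2 ga' ->
  cong p.+3 (defect ga - defect ga') (- comm 1 0 m2 (ga - ga')).
Proof.
move=> hg og hg' og'; have hB := derB gW hg hg'; have oB := has_orderB og og'.
have cg := cont_expv_phi hg og; have cg' := cont_expv_phi hg' og'.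
have rB := field_raises hB oB; have cB := der_cont hB.
have h : cong p.+2 ((expv ga \o phi) - (expv ga' \o phi)) (ga - ga').
  have := congB (expv_phi_cong hg og) (expv_phi_cong hg' og').
  by rewrite opprD addrACA subrr add0r.
have cD := contB gr cg cg'.
have h1 : cong p.+3 (((expv ga \o phi) \o m) - ((expv ga' \o phi) \o m)) ((ga - ga') \o m2).
  apply: (@cong_trans _ _ _ _ ((ga - ga') \o m)).
    by have := cong_compl cm h rm; rewrite addn1.
  by have := cong_compr gr cB cm cm2 rB lm; rewrite addn2.
have h2 : cong p.+3 ((m' \o (expv ga \o phi)) - (m' \o (expv ga' \o phi))) (m2 \o (ga - ga')).
  apply: (@cong_trans _ _ _ _ (m' \o ((expv ga \o phi) - (expv ga' \o phi)))).
    apply: cong_eq => u lu.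
    by have k := clinB (g_car gW) (cont_clin cm') (cont_car cg lu) (cont_car cg' lu); exact: esym k.
  apply: (@cong_trans _ _ _ _ (m' \o (ga - ga'))).
    by have := cong_compr gr cm' cD cB rm' h; rewrite add1n.
  by have := cong_compl cB lm' rB; rewrite add2n.
have := congB h1 h2; congr cong.
  have sw (Z : zmodType) (a b c d : Z) : a - b - (c - d) = a - c - (b - d).
    by rewrite !opprB !addrA addrAC [RHS]addrAC [a - b - c]addrAC.
  exact: sw.
by rewrite /comm mulr0 /ksgn /= expr0 scale1r opprB.
Qed.

(** That the composite is a symplectomorphism is automatic by [exp_sympl], so only the congruence
    for m and m' is at stake. *)
Lemma extensionE ga : symplectic_field gr om 0 ga -> has_order p.+2 ga ->
  extension gr om p.+3 m m' phi ga <-> raises p.+3 (defect ga).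
Proof.
move=> sg og; have cg := cont_expv_phi sg.1 og.
have h := @eq_modP _ gr _ p.+3 _ _ (cont_comp cg cm) (cont_comp cm' cg).
split=> [[_ _ [_ /h]] //|r]; split=> //; split; last exact/h.
exact: (exp_sympl Hom sg og).
Qed.

(** The bracket has order exactly p + 3, so it vanishes once it is known modulo order p + 4. *)
Lemma comm_eq0 xi : vfield 0 xi -> has_order p.+2 xi ->
  raises p.+3 (comm 1 0 m2 xi) -> eq_car (comm 1 0 m2 xi) 0.
Proof.
move=> hx ox; have oc : has_order (1 + p.+1).+1 (comm 1 0 m2 xi) := has_order_comm hm2.1 hx om22 ox; move: oc; rewrite add1n => oc.
apply: (order_raises_eq0 gr) => //; apply: (cont_comm gr) => //; exact: (der_cont hx).
Qed.

Lemma extension_add ga xi : extension gr om p.+3 m m' phi ga ->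
  symplectic_field gr om 0 xi -> has_order p.+2 xi -> eq_car (comm 1 0 m2 xi) 0 ->
  extension gr om p.+3 m m' phi (ga + xi).
Proof.
move=> hga sx ox cx; have [sg og _] := hga; have rg := proj1 (extensionE sg og) hga.
have sD := symplD Hom sg sx.
have oD : has_order p.+2 (ga + xi).
  have h : has_order p.+2 (ga - (xi - xi - xi)) := has_orderB og (has_orderB (has_orderB ox ox) ox).
  by rewrite subrr sub0r opprK in h.
apply/(extensionE sD oD); apply: (cong_raises _ rg).
have h : cong p.+3 (defect (ga + xi) - defect ga) (- comm 1 0 m2 (ga + xi - ga)).
  exact: (defect_cong sD.1 oD sg.1 og).
rewrite (_ : ga + xi - ga = xi) in h; last by rewrite addrAC subrr add0r.
apply: (cong_raises h); apply: raisesN; apply: raises_eq cx (@raises0 _ _ _).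
Qed.

Lemma extension_sub ga ga' : extension gr om p.+3 m m' phi ga -> extension gr om p.+3 m m' phi ga' ->
  [/\ symplectic_field gr om 0 (ga - ga'), has_order p.+2 (ga - ga') &
      eq_car (comm 1 0 m2 (ga - ga')) 0].
Proof.
move=> h h'; have [[s o _] [s' o' _]] := (h, h').
have sB := symplB Hom s s'; have oB := has_orderB o o'; split=> //.
apply: comm_eq0 => //; first exact: sB.1.
have r := raisesB (proj1 (extensionE s o) h) (proj1 (extensionE s' o') h').
have := cong_raises (cong_sym (defect_cong s.1 o s'.1 o')) r.
by move=> /raisesN; rewrite opprK.
Qed.

(** For a given eta the right-hand composite is exp(ga') phi + [m2, eta] to first order. The
    difference of the two sides then has leading term ga - ga' - [m2, eta], of order exactly n - 1,
    so the congruence modulo n amounts to its vanishing. *)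
Lemma ext_equivE ga ga' : extension gr om p.+3 m m' phi ga -> extension gr om p.+3 m m' phi ga' ->
  ext_equiv gr om p.+3 m phi ga ga' <-> field_exact gr om m2 p (ga - ga').
Proof.
move=> [[vg sg] og _] [[vg' sg'] og' _].
have cg := cont_expv_phi vg og; have cg' := cont_expv_phi vg' og'.
suff h eta : vfield (-1) eta -> has_order p.+1 eta ->
    eq_mod p.+3 (expv ga \o phi) (expv ga' \o phi \o expv (comm 1 (-1) m eta)) <->
    eq_car (ga - ga') (comm 1 (-1) m2 eta).
  by split=> -[eta [s o e]]; exists eta; split=> //; apply/(h eta s.1 o).
move=> ve oe; have ce := der_cont ve; have re := has_order_raises gr ce oe.
have vc : vfield 0 (comm 1 (-1) m eta) := der_comm gW (mc_field hms) ve.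
have vc2 : vfield 0 (comm 1 (-1) m2 eta) := der_comm gW hm2.1 ve.
have oc2 : has_order p.+2 (comm 1 (-1) m2 eta).
  exact: (has_order_comm hm2.1 ve om22 oe).
have rc2 := field_raises vc2 oc2.
have lc : cong p.+2 (comm 1 (-1) m eta) (comm 1 (-1) m2 eta).
  exact: (cong_comm gr 1 (-1) cm cm2 ce lm re (leqnn p.+2)).
have rc : raises p.+1 (comm 1 (-1) m eta).
  by apply: cong_raises rc2; apply: cong_le lc.
have cE := expv_cont vc rc.
have lE : cong p.+2 (expv (comm 1 (-1) m eta)) (id + comm 1 (-1) m2 eta).
  apply: cong_trans (expv_cong vc rc) _; apply: congD lc; exact: cong_refl.
have ci := @cont_id K LW; have cc2 := der_cont vc2.
have lR : cong p.+2 (expv ga' \o phi \o expv (comm 1 (-1) m eta)) ((expv ga' \o phi) + comm 1 (-1) m2 eta).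
  have h0 := cong_compr gr cg' cE (contD gW ci cc2) (expv_phi_raises vg' og') lE.
  apply: (cong_trans h0); rewrite add0n.
  apply: (cong_trans (@cong_comp_sum _ _ p.+2 _ _ _ cg' ci cc2)); apply: congD; first exact: cong_refl.
  have l1 : cong 1 (expv ga' \o phi) id.
    apply: cong_trans (cong_le _ (expv_phi_cong vg' og')) _ => //.
    rewrite -[X in cong _ _ X]addr0; apply: congD => //; rewrite /cong subr0.
    by apply: raises_le (field_raises vg' og').
  by have := cong_compl cc2 l1 rc2; rewrite add1n.
have lD : cong p.+2 ((expv ga \o phi) - (expv ga' \o phi)) (ga - ga').
  have := congB (expv_phi_cong vg og) (expv_phi_cong vg' og').
  by rewrite opprD addrACA subrr add0r.
have cR : cont_endo (expv ga' \o phi \o expv (comm 1 (-1) m eta)) by exact: cont_comp.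
have h0 := @eq_modP _ gr _ p.+2 _ _ cg cR.
have eqv : cong p.+2 ((expv ga \o phi) - (expv ga' \o phi \o expv (comm 1 (-1) m eta)))
    (ga - ga' - comm 1 (-1) m2 eta).
  have := congB lD (@cong_refl K V p.+2 (comm 1 (-1) m2 eta)) => h1.
  apply: cong_trans h1; rewrite -addrA -opprD; apply: congB lR; exact: cong_refl.
have vB := derB gW vg vg'.
split=> [/h0 r|e].
  have := order_raises_eq0 gr (der_cont (derB gW vB vc2))
    (has_orderB (has_orderB og og') oc2) (cong_raises (cong_sym eqv) r).
  by move=> z u lu; apply/eqP; rewrite -subr_eq0; apply/eqP; exact: z.
apply/h0; apply: (cong_raises eqv); apply: raises_eq (@raises0 _ _ _).
by move=> u lu; rewrite eaddE eoppE e // subrr.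
Qed.
End Extensions.

Lemma cohomologousE (K : comAlgType rat) (gr : even_grading K) (V : free_module) (w : int)
    (om : form2_ix V -> K) (m2 : endo (LW (K := K) V)) p al be : frobenius gr w m2 om ->
  cocycle gr m2 p.+3 (w - 1) al -> cocycle gr m2 p.+3 (w - 1) be ->
  cohomologous gr m2 p.+3 (w - 1) al be <->
  field_exact gr om m2 p (Upsilon gr w om (w - 1) al - Upsilon gr w om (w - 1) be).
Proof.
move=> [Hom om2 hm2 om22 _] [ca _] [cb _].
have e := UpsB Hom om2 ca cb; have h := Ups_exact Hom om2 hm2 om22 (cochainB ca cb).
split=> [/h|r]; first by apply: field_exact_eq => u /e.
by apply/h; apply: field_exact_eq r.
Qed.

Theorem theorem12p15 (K : comAlgType rat) (gr : even_grading K)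
    (V : free_module) (w : int) (m2 : endo (LW (K := K) V))
    (om : form2_ix V -> K) (n : nat) (ms ms' : nat -> endo (LW (K := K) V)) :
  (3 <= n)%N ->
  frobenius gr w m2 om ->
  C_structure gr om n.+1 ms -> C_structure gr om n.+1 ms' ->
  eq_car (ms 2) m2 -> eq_car (ms' 2) m2 ->
  let m := mc_sum n.+1 ms in
  let m' := mc_sum n.+1 ms' in
  forall (c : SM gr om n (mc_sum n ms) (mc_sum n ms')) (phi : endo (LW (K := K) V)),
  sval c phi ->
  extendable gr om n m m' phi ->
  exists act : HC gr m2 n (w - 1) -> SEM gr om n m m' phi -> SEM gr om n m m' phi,
    [/\ forall al (hal : cocycle gr m2 n (w - 1) al)
               ga (hga : extension gr om n m m' phi ga),
          exists h : extension gr om n m m' phi (ga + Upsilon gr w om (w - 1) al),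
            act (cls hal) (cls hga) = cls h,
        forall al be (hal : cocycle gr m2 n (w - 1) al)
               (hbe : cocycle gr m2 n (w - 1) be),
          exists h : cocycle gr m2 n (w - 1) (al + be), forall s,
            act (cls h) s = act (cls hal) (act (cls hbe) s),
        exists h0 : cocycle gr m2 n (w - 1) 0,
          (forall s, act (cls h0) s = s) /\
          (forall a s, act a s = s -> a = cls h0)
      & forall s t, exists a, act a s = t].
Proof.
(* With n = p + 3 the truncated differences [n.-1] and [n.-2] compute to p + 2 and p + 1. *)
case: n => [|[|[|p]]] // _ frob hms hms' e2 e2' m m' c phi cphi _.
have [Hom om2 hm2 om22 _] := frob.
have [sphi pphi] : symplectomorphism gr om phi /\ pointed phi.
  by case: c cphi => C [x Dx eC] /=; rewrite eC => -[[[]]].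
pose U := Upsilon gr w om (w - 1).
pose D1 := cocycle gr m2 p.+3 (w - 1); pose E1 := cohomologous gr m2 p.+3 (w - 1).
pose D2 := extension gr om p.+3 m m' phi; pose E2 := ext_equiv gr om p.+3 m phi.
have exE ga ga' (h : D2 ga) (h' : D2 ga') : E2 ga ga' <-> field_exact gr om m2 p (ga - ga').
  exact: (ext_equivE hm2 om22 hms e2 sphi pphi h h').
have coE al be (h : D1 al) (h' : D1 be) : E1 al be <-> field_exact gr om m2 p (U al - U be).
  exact: cohomologousE.
have fx0 := field_exact0 Hom hm2 p; have fxN := field_exactN Hom hm2 (p := p).
have fxD := field_exactD Hom hm2 (p := p).
have E2r ga : D2 ga -> E2 ga ga by move=> h; apply/exE => //; rewrite subrr.
have E2s ga ga' : D2 ga -> D2 ga' -> E2 ga ga' -> E2 ga' ga.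
  by move=> h h' /(exE _ _ h h')/fxN; rewrite opprB => /exE; apply.
have E2t x y z : D2 x -> D2 y -> D2 z -> E2 x y -> E2 y z -> E2 x z.
  move=> hx hy hz /(exE _ _ hx hy) h1 /(exE _ _ hy hz) /(fxD _ _ h1).
  by rewrite addrA subrK => /exE; apply.
have E1r al : D1 al -> E1 al al by move=> h; apply/coE => //; rewrite subrr.
have E1s al be : D1 al -> D1 be -> E1 al be -> E1 be al.
  by move=> h h' /(coE _ _ h h')/fxN; rewrite opprB => /coE; apply.
have E1t x y z : D1 x -> D1 y -> D1 z -> E1 x y -> E1 y z -> E1 x z.
  move=> hx hy hz /(coE _ _ hx hy) h1 /(coE _ _ hy hz) /(fxD _ _ h1).
  by rewrite addrA subrK => /coE; apply.
have opD ga al : D2 ga -> D1 al -> D2 (ga + U al).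
  move=> hg ha; have [sU oU _] := UpsP Hom om2 ha.1.
  exact: (extension_add Hom hm2 om22 hms hms' e2 e2' sphi pphi hg sU oU (Ups_cocycle Hom om2 hm2 ha)).
have eq2 ga ga' (h : D2 ga) (h' : D2 ga') : eq_car ga ga' -> cls (E := E2) h = cls h'.
  move=> e; apply: (cls_eq E2s E2t); apply/exE => //; apply: field_exact_eq fx0 => u lu.
  by rewrite eaddE eoppE e // subrr.
have [act actP] : exists act : HC gr m2 p.+3 (w - 1) -> SEM gr om p.+3 m m' phi -> SEM gr om p.+3 m m' phi,
    forall al (hal : D1 al) ga (hga : D2 ga), act (cls hal) (cls hga) = cls (E := E2) (opD ga al hga hal).
  (* A class is a set without a distinguished representative, so the action is obtained by choice.
     Its value does not depend on representatives because both equivalences amount to exactness of a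
     difference of fields, and exact fields add up. *)
  have /choice[f fP] (q : HC gr m2 p.+3 (w - 1) * SEM gr om p.+3 m m' phi) : exists t : SEM gr om p.+3 m m' phi,
      forall al (hal : D1 al) ga (hga : D2 ga), q = (cls hal, cls hga) -> t = cls (E := E2) (opD ga al hga hal).
    case: q => a s; have [al [hal ->]] := clsP a; have [ga [hga ->]] := clsP s.
    exists (cls (opD ga al hga hal)) => be hbe de hde e.
    have h1 := cls_inj E1r (congr1 fst e : cls (E := E1) hal = cls hbe).
    have h2 := cls_inj E2r (congr1 snd e : cls (E := E2) hga = cls hde).
    apply: (cls_eq E2s E2t); apply/exE; [exact: opD | exact: opD |].
    have := fxD _ _ (proj1 (exE _ _ hga hde) h2) (proj1 (coE _ _ hal hbe) h1).
    by congr (field_exact _ _ _ _ _); rewrite opprD addrACA.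
  by exists (fun a s => f (a, s)) => al hal ga hga; apply: fP.
exists act; split.
- by move=> al hal ga hga; exists (opD ga al hga hal); apply: actP.
- move=> al be hal hbe; exists (cocycleD Hom hm2 hal hbe) => s; have [ga [hga ->]] := clsP s.
  rewrite !actP; apply: eq2 => u lu.
  (* Additivity of Upsilon, extracted from its compatibility with differences. *)
  have e : U (al + be - be) u = U (al + be) u - U be u := UpsB Hom om2 (cocycleD Hom hm2 hal hbe).1 hbe.1 lu.
  by rewrite !eE; rewrite addrK in e; rewrite e -!addrA; congr (_ + _); rewrite addrC subrK.
- have c0 : D1 0 := cocycle0 Hom hm2 _ _.
  have U0 u : lcar (l := LW V) u -> U 0 u = 0.
    move=> lu; have e : U (0 - 0) u = U 0 u - U 0 u := UpsB Hom om2 c0.1 c0.1 lu.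
    by rewrite !subrr in e.
  exists c0; split.
    move=> s; have [ga [hga ->]] := clsP s; rewrite actP; apply: eq2 => u lu.
    by rewrite eaddE U0 // addr0.
  move=> a s; have [al [hal ->]] := clsP a; have [ga [hga ->]] := clsP s.
  (* Freeness: if ga + Upsilon(al) is equivalent to ga, then Upsilon(al) is exact, so al is a
     coboundary. *)
  rewrite actP => /(cls_inj E2r)/exE h; apply: (cls_eq E1s E1t); apply/coE => //.
  have := h (opD _ _ hga hal) hga; rewrite addrAC subrr add0r.
  by apply: field_exact_eq => u lu; rewrite eaddE eoppE U0 // subr0.
move=> s t; have [ga [hga ->]] := clsP s; have [de [hde ->]] := clsP t.
(* Transitivity: the difference of two extensions is a symplectic field commuting with [m2], hence
   Upsilon of a cocycle. *)
have [sx ox cx] := extension_sub Hom hm2 om22 hms hms' e2 e2' sphi pphi hde hga.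
have [al hal eU] := Ups_surj Hom om2 hm2 om22 sx ox cx.
exists (cls hal); rewrite actP; apply: eq2 => u lu.
by rewrite eaddE [U al u]eU // !eE addrC subrK.
Qed.
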